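(* For every $f\in W^{-1}$ and every $g\in H$ there exists a unique $u\in W$ such that $$Lu=f\ \text{ in }\Omega,\qquad Tu=g\ \ \sigma\text{-a.e. on }\Gamma .$$ Moreover, there exists $C>0$ independent of $f$ and $g$ such that $$\|u\|_W\le C\big(\|g\|_H+\|f\|_{W^{-1}}\big),\qquad \|f\|_{W^{-1}}=\sup_{\varphi\in W_0,\ \|\varphi\|_W=1}\langle f,\varphi\rangle_{W^{-1},W_0}.$$
   Context: Let $n\ge2$ and let $0<d<n-1$ be a real number. $\Gamma\subset\mathbb R^n$ is a nonempty closed set which is Ahlfors regular of dimension $d$: there is $C_0\ge1$ with $C_0^{-1}r^d\le\mathcal H^d(\Gamma\cap B(x,r))\le C_0r^d$ for all $x\in\Gamma$, $r>0$. Set $\Omega=\mathbb R^n\setminus\Gamma$, $\sigma=\mathcal H^d|_\Gamma$, $\delta(z)=\operatorname{dist}(z,\Gamma)$ and $w(z)=\delta(z)^{d+1-n}$. $W=\{u\in L^1_{loc}(\Omega):\nabla u\in L^2(\Omega,w)\}$ (distributional gradient in $\Omega$; $L^2(\Omega,w)=L^2(\Omega,w\,dz)$), $\|u\|_W=\big(\int_\Omega|\nabla u|^2w\,dz\big)^{1/2}$; every $u\in W$ lies in $L^1_{loc}(\mathbb R^n)$. The trace of $u\in W$ is $Tu(x)=\lim_{r\to0}\frac1{|B(x,r)|}\int_{B(x,r)}u\,dz$, which exists for $\sigma$-a.e. $x\in\Gamma$. $W_0=\{u\in W:Tu=0\ \sigma\text{-a.e.}\}$ is a Hilbert space with norm $\|\cdot\|_W$,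 and $W^{-1}=(W_0)^*$ is its dual. $H$ is the space of measurable functions $g$ on $\Gamma$ with $\|g\|_H^2=\int_\Gamma\int_\Gamma\frac{|g(x)-g(y)|^2}{|x-y|^{d+1}}\,d\sigma(x)\,d\sigma(y)<\infty$. $A:\Omega\to M_n(\mathbb R)$ is measurable and satisfies, for some $C_1\ge1$, $|A(x)\xi\cdot\zeta|\le C_1w(x)|\xi||\zeta|$ and $A(x)\xi\cdot\xi\ge C_1^{-1}w(x)|\xi|^2$ for all $x\in\Omega$, $\xi,\zeta\in\mathbb R^n$; $L=-\operatorname{div}A\nabla$. For $u\in W$ and $f\in W^{-1}$, $Lu=f$ in $\Omega$ means $\int_\Omega A\nabla u\cdot\nabla v\,dz=\langle f,v\rangle_{W^{-1},W_0}$ for all $v\in W_0$. *)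

(* Defs.v *)
From HB Require Import structures.
From mathcomp Require Import all_boot all_order all_algebra.
From mathcomp Require Import all_classical all_reals all_analysis.

Set Implicit Arguments.
Unset Strict Implicit.
Unset Printing Implicit Defensive.
Import Order.TTheory GRing.Theory Num.Theory.
Import numFieldNormedType.Exports.

Local Open Scope classical_set_scope.
Local Open Scope ring_scope.

(* Method I construction of an outer measure: the pieces [E i], with [i] in
   [P], are available for coverings and the piece [E i] costs [c i]. *)

Definition cover_outer (R : realType) (X I : Type) (P : set I)
    (E : I -> set X) (c : I -> \bar R) (A : set X) : \bar R :=
  ereal_inf [set (\sum_(0 <= k <oo) c (s k))%E | s in
    [set s : nat -> I | (forall k, P (s k)) /\ A `<=` \bigcup_k E (s k)]].

Section cover_outer_lemmas.
Local Open Scope ereal_scope.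
Context (R : realType) (X I : Type) (P : set I) (E : I -> set X)
  (c : I -> \bar R).

Lemma cover_outer_le :
  {homo (cover_outer P E c) : A B / A `<=` B >-> A <= B}.
Proof.
move=> A B AB; apply: ereal_inf_le_tmp => x [s [Ps Bs]] <-.
by exists s => //; split => //; exact: subset_trans Bs.
Qed.

Hypothesis c_ge0 : forall i, 0 <= c i.

Lemma cover_outer_ge0 A : 0 <= cover_outer P E c A.
Proof. by apply: le_ereal_inf_tmp => x [s _ <-]; exact: nneseries_ge0. Qed.

Lemma cover_outer0 (i0 : I) : P i0 -> c i0 = 0 -> cover_outer P E c set0 = 0.
Proof.
move=> Pi0 ci0; apply/eqP; rewrite eq_le cover_outer_ge0 andbT.
apply: ereal_inf_lbound; exists (fun=> i0); first by split.
by apply: eseries0 => k _ _.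
Qed.

Lemma cover_outer_sigma_subadditive :
  sigma_subadditive (cover_outer P E c).
Proof.
move=> A.
have [[i ioo]|] := pselect (exists i, cover_outer P E c (A i) = +oo).
  rewrite (eseries_pinfty _ _ ioo) ?leey// => n _.
  by rewrite -ltNye (lt_le_trans _ (cover_outer_ge0 _)).
rewrite -forallNE => Aoo.
suff add2e (e : {posnum R}) : cover_outer P E c (\bigcup_n A n) <=
    \sum_(i <oo) cover_outer P E c (A i) + e%:num%:E.
  by apply/lee_addgt0Pr => _/posnumP[].
rewrite (le_trans _ (epsilon_trick _ _ _))//; last first.
  by move=> n; exact: cover_outer_ge0.
pose Q n (s : nat -> I) :=
  ((forall k, P (s k)) /\ A n `<=` \bigcup_k E (s k)) /\
  \sum_(k <oo) c (s k) <=
    cover_outer P E c (A n) + (e%:num / (2 ^ n.+1)%:R)%:E.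
have [G QG] : {G : nat -> nat -> I & forall n, Q n (G n)}.
  apply: (@choice _ _ Q) => n; rewrite /Q /cover_outer.
  set S := (X in ereal_inf X); move infS : (ereal_inf S) => iS.
  case: iS infS => [r Sr|Soo|Soo].
  - have en1 : (0 < e%:num / (2 ^ n.+1)%:R)%R by [].
    have /(lb_ereal_inf_adherent en1) : ereal_inf S \is a fin_num by rewrite Sr.
    move=> [x [s sP muBx] xS].
    by exists s; split => //; rewrite muBx -Sr; exact/ltW.
  - by have := Aoo n; rewrite /cover_outer Soo.
  - suff : lbound S 0 by move/le_ereal_inf_tmp; rewrite Soo.
    by move=> /= _ [s _ <-]; exact: nneseries_ge0.
have cG_ge0 x : 0 <= (c \o uncurry G) x by exact: c_ge0.
apply: (@le_trans _ _ (\esum_(i in setT) (c \o uncurry G) i)).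
  rewrite /cover_outer; apply: ereal_inf_lbound => /=.
  have /card_esym/ppcard_eqP[f] := card_nat2.
  exists (uncurry G \o f).
    split => [i|]; first by rewrite /=; case: (f i) => a b; exact: (QG a).1.1.
    apply: (@subset_trans _  (\bigcup_n \bigcup_k E (G n k))) => [t [i _]|].
      by move=> /(QG i).1.2 -[j _ ?]; exists i => //; exists j.
    move=> t [i _ [j _ Bijt]]; exists (f^-1%FUN (i, j)) => //=.
    by rewrite invK ?inE.
  rewrite -(esum_pred_image (c \o uncurry G) _ xpredT) ?[fun=> _]set_true//.
  by rewrite image_eq.
rewrite (_ : esum _ _ = \sum_(i <oo) \sum_(j <oo ) c (G i j)); last first.
  pose J : nat -> set (nat * nat) := fun i => [set (i, j) | j in setT].
  rewrite (_ : setT = \bigcup_k J k); last first.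
    by rewrite predeqE => -[a b]; split => // _; exists a => //; exists b.
  rewrite esum_bigcupT /=; last 2 first.
    - apply/trivIsetP => i j _ _ ij.
      rewrite predeqE => -[n m] /=; split => //= -[] [_] _ [<-{n} _].
      by move=> [m' _] [] /esym/eqP; rewrite (negbTE ij).
    - by move=> /= [n m]; exact: c_ge0.
  rewrite -(image_id [set: nat]) -fun_true esum_pred_image//; last first.
    by move=> n _; exact: esum_ge0.
  apply: eq_eseriesr => /= j _.
  rewrite -(esum_pred_image (c \o uncurry G) (pair j) predT)//=; last first.
    by move=> ? ? _ _; exact: (@can_inj _ _ _ snd).
  by congr esum; rewrite predeqE => -[a b]; split; move=> [i _ <-]; exists i.
apply: lee_lim.
- apply: is_cvg_nneseries => n *.
  by apply: nneseries_ge0 => m *; exact: (cG_ge0 (n, m)).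
- by apply: is_cvg_nneseries => n *; apply: adde_ge0 => //; exact: cover_outer_ge0.
- by near=> n; apply: lee_sum => i _; exact: (QG i).2.
Unshelve. all: by end_near. Qed.

End cover_outer_lemmas.

(* The norm [`|x|] of the library on ['rV[R]_n] is the sup norm, hence this
   separate Euclidean norm; both define the same topology. *)

Definition dotp (R : realType) (n : nat) (x y : 'rV[R]_n) : R :=
  \sum_(i < n) x 0 i * y 0 i.

Definition enorm (R : realType) (n : nat) (x : 'rV[R]_n) : R :=
  Num.sqrt (dotp x x).

Definition eball (R : realType) (n : nat) (x : 'rV[R]_n) (r : R) :
    set 'rV[R]_n :=
  [set y | enorm (y - x) < r].

Definition edist (R : realType) (n : nat) (G : set 'rV[R]_n) (z : 'rV[R]_n) :
    R :=
  inf [set enorm (z - y) | y in G].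

(* [ediam set0 = 0] because of the added 0. *)
Definition ediam (R : realType) (n : nat) (E : set 'rV[R]_n) : \bar R :=
  ereal_sup ([set 0%E] `|`
    [set (enorm (xy.1 - xy.2))%:E | xy in E `*` E]).

(* Coverings by closed boxes define Lebesgue outer measure. [None] is an
   empty piece of volume 0: it allows finite coverings. *)

Definition box (R : realType) (n : nat)
    (p : option ('rV[R]_n * 'rV[R]_n)) : set 'rV[R]_n :=
  if p is Some (a, b) then [set x | forall i, a 0 i <= x 0 i <= b 0 i]
  else set0.

Definition box_vol (R : realType) (n : nat)
    (p : option ('rV[R]_n * 'rV[R]_n)) : \bar R :=
  if p is Some (a, b) then (\prod_(i < n) Num.max 0 (b 0 i - a 0 i))%:E
  else 0%E.

Definition leb_outer (R : realType) (n : nat) : set 'rV[R]_n -> \bar R :=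
  cover_outer setT (@box R n) (@box_vol R n).

Section leb_outer_instance.
Context (R : realType) (n : nat).

Let box_vol_ge0 p : (0 <= @box_vol R n p)%E.
Proof.
case: p => [[a b]|]//=; rewrite lee_fin.
by apply: prodr_ge0 => i _; rewrite le_max lexx.
Qed.

HB.instance Definition _ := isOuterMeasure.Build R 'rV[R]_n (@leb_outer R n)
  (@cover_outer0 R 'rV[R]_n _ setT (@box R n) _ box_vol_ge0 None I erefl)
  (@cover_outer_ge0 R 'rV[R]_n _ setT (@box R n) _ box_vol_ge0)
  (@cover_outer_le R 'rV[R]_n _ setT (@box R n) (@box_vol R n))
  (@cover_outer_sigma_subadditive R 'rV[R]_n _ setT (@box R n) _ box_vol_ge0).

End leb_outer_instance.

(* R^n with the Caratheodory sigma-algebra of Lebesgue outer measure, that is,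
   the complete sigma-algebra of Lebesgue measurable sets. *)
Notation leb_space R n := (caratheodory_type (@leb_outer R n)).

Definition leb (R : realType) (n : nat) :
    {measure set (leb_space R n) -> \bar R} :=
  let mu : {outer_measure set 'rV[R]_n -> \bar R} := @leb_outer R n in
  (mu : set (caratheodory_type mu) -> \bar R).

(* [haus_cost] is [diam ^ d], with cost 0 for the empty set also if [d = 0].
   No normalizing constant is used. *)

Definition haus_cost (R : realType) (n : nat) (d : R) (E : set 'rV[R]_n) :
    \bar R :=
  if E == set0 then 0%E else (ediam E `^ d)%E.

Definition haus_pre (R : realType) (n : nat) (d e : R) :
    set 'rV[R]_n -> \bar R :=
  cover_outer [set E | (ediam E <= e%:E)%E] id (haus_cost d).

Definition haus_outer (R : realType) (n : nat) (d : R) (A : set 'rV[R]_n) :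
    \bar R :=
  ereal_sup [set haus_pre d e A | e in [set e : R | 0 < e]].

Section haus_outer_instance.
Context (R : realType) (n : nat) (d : R).
Local Open Scope ereal_scope.

Let haus_cost_ge0 (E : set 'rV[R]_n) : 0 <= haus_cost d E.
Proof. by rewrite /haus_cost; case: ifP => // _; exact: poweR_ge0. Qed.

Let haus_pre_le_outer (e : R) (A : set 'rV[R]_n) :
  (0 < e)%R -> haus_pre d e A <= haus_outer d A.
Proof. by move=> e0; apply: ereal_sup_ubound; exists e. Qed.

Let haus_outer_ge0 (A : set 'rV[R]_n) : 0 <= haus_outer d A.
Proof.
by apply: le_trans (haus_pre_le_outer A ltr01); exact: cover_outer_ge0.
Qed.

Let ediam0 : ediam (set0 : set 'rV[R]_n) = 0.
Proof.
rewrite /ediam setX0 image_set0 setU0; exact: ereal_sup1.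
Qed.

Let haus_outer0 : haus_outer d (set0 : set 'rV[R]_n) = 0.
Proof.
apply/eqP; rewrite eq_le haus_outer_ge0 andbT.
apply: ge_ereal_sup => _ [e /= e0 <-].
rewrite /haus_pre (@cover_outer0 _ _ _ _ _ _ _ set0)//=.
- by rewrite ediam0 lee_fin ltW.
- by rewrite /haus_cost eqxx.
Qed.

Let haus_outer_le :
  {homo (@haus_outer R n d) : A B / A `<=` B >-> A <= B}.
Proof.
move=> A B AB; apply: ge_ereal_sup => _ [e /= e0 <-].
by apply: le_trans (haus_pre_le_outer B e0); exact: cover_outer_le.
Qed.

Let haus_outer_sigma_subadditive : sigma_subadditive (@haus_outer R n d).
Proof.
move=> F; apply: ge_ereal_sup => _ [e /= e0 <-].
apply: le_trans (cover_outer_sigma_subadditive _ _ _ _) _ => //.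
apply: lee_nneseries => k *; first exact: cover_outer_ge0.
exact: haus_pre_le_outer.
Qed.

HB.instance Definition _ := isOuterMeasure.Build R 'rV[R]_n (@haus_outer R n d)
  haus_outer0 haus_outer_ge0 haus_outer_le haus_outer_sigma_subadditive.

End haus_outer_instance.

(* This sigma-algebra contains the Borel sets, so it contains the closed set
   Gamma; the restriction of [haus] to Gamma is expressed by restricting the
   domains of integrals and almost-everywhere statements to Gamma. *)
Notation haus_space R n d := (caratheodory_type (@haus_outer R n d)).

Definition haus (R : realType) (n : nat) (d : R) :
    {measure set (haus_space R n d) -> \bar R} :=
  let mu : {outer_measure set 'rV[R]_n -> \bar R} := @haus_outer R n d in
  (mu : set (caratheodory_type mu) -> \bar R).

Definition ahlfors_regular (R : realType) (n : nat) (d C0 : R)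
    (Gamma : set 'rV[R]_n) : Prop :=
  forall (x : 'rV[R]_n) (r : R), Gamma x -> 0 < r ->
    ((C0^-1 * r `^ d)%:E <= haus n d (Gamma `&` eball x r) <=
      (C0 * r `^ d)%:E)%E.

Definition partial (R : realType) (n : nat) (i : 'I_n) (f : 'rV[R]_n -> R) :
    'rV[R]_n -> R :=
  fun x => 'D_(delta_mx 0 i) f x.

Definition smooth (R : realType) (n : nat) (f : 'rV[R]_n -> R) : Prop :=
  forall s : seq 'I_n,
    let g := foldr (@partial R n) f s in
    continuous g /\ forall (x : 'rV[R]_n) (i : 'I_n),
      derivable g x (delta_mx 0 i).

Definition test_function (R : realType) (n : nat) (Omega : set 'rV[R]_n)
    (phi : 'rV[R]_n -> R) : Prop :=
  smooth phi /\ exists K : set 'rV[R]_n,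
    [/\ compact K, K `<=` Omega & forall x, ~ K x -> phi x = 0].

Definition loc_integrable (R : realType) (n : nat) (D : set 'rV[R]_n)
    (f : 'rV[R]_n -> R) : Prop :=
  measurable_fun (D : set (leb_space R n)) f /\
  forall K : set 'rV[R]_n, compact K -> K `<=` D ->
    (\int[leb R n]_(z in K) `|(f z)%:E| < +oo)%E.

Definition is_wgrad (R : realType) (n : nat) (Omega : set 'rV[R]_n)
    (u : 'rV[R]_n -> R) (G : 'rV[R]_n -> 'rV[R]_n) : Prop :=
  forall i : 'I_n, loc_integrable Omega (fun z => G z 0 i) /\
    forall phi : 'rV[R]_n -> R, test_function Omega phi ->
      (\int[leb R n]_(z in Omega) (u z * partial i phi z)%:E =
       - \int[leb R n]_(z in Omega) (G z 0 i * phi z)%:E)%E.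

(* A distributional gradient of [u], which is unique up to a.e. equality;
   the zero field if there is none. *)
Definition wgrad (R : realType) (n : nat) (Omega : set 'rV[R]_n)
    (u : 'rV[R]_n -> R) : 'rV[R]_n -> 'rV[R]_n :=
  xget (cst 0) [set G | is_wgrad Omega u G].

(* Elements of W are represented by functions on the whole of R^n; their values
   on Gamma, which is a Lebesgue null set if it is Ahlfors regular of dimension
   less than n, are irrelevant. Similarly only the values on Gamma of the
   elements of H matter. *)

Definition weight (R : realType) (n : nat) (d : R) (Gamma : set 'rV[R]_n)
    (z : 'rV[R]_n) : R :=
  edist Gamma z `^ (d + 1 - n%:R).

Definition W_energy (R : realType) (n : nat) (d : R) (Gamma : set 'rV[R]_n)
    (u : 'rV[R]_n -> R) : \bar R :=
  (\int[leb R n]_(z in ~` Gamma)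
     (enorm (wgrad (~` Gamma) u z) ^+ 2 * weight d Gamma z)%:E)%E.

Definition in_W (R : realType) (n : nat) (d : R) (Gamma : set 'rV[R]_n)
    (u : 'rV[R]_n -> R) : Prop :=
  [/\ loc_integrable (~` Gamma) u,
      is_wgrad (~` Gamma) u (wgrad (~` Gamma) u) &
      (W_energy d Gamma u < +oo)%E].

Definition W_norm (R : realType) (n : nat) (d : R) (Gamma : set 'rV[R]_n)
    (u : 'rV[R]_n -> R) : R :=
  Num.sqrt (fine (W_energy d Gamma u)).

Definition ball_mean (R : realType) (n : nat) (u : 'rV[R]_n -> R)
    (x : 'rV[R]_n) (r : R) : \bar R :=
  ((fine (leb R n (eball x r)))^-1%:E *
   \int[leb R n]_(z in eball x r) (u z)%:E)%E.

(* [Tu = g] sigma-a.e. on Gamma; the existence of the limit that defines [Tu]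
   is part of the assertion. *)
Definition has_trace (R : realType) (n : nat) (d : R) (Gamma : set 'rV[R]_n)
    (u g : 'rV[R]_n -> R) : Prop :=
  {ae haus n d, forall x : 'rV[R]_n, Gamma x ->
    ball_mean u x r @[r --> 0^'+] --> (g x)%:E}.

Definition in_W0 (R : realType) (n : nat) (d : R) (Gamma : set 'rV[R]_n)
    (u : 'rV[R]_n -> R) : Prop :=
  in_W d Gamma u /\ has_trace d Gamma u (cst 0).

(* Bounded linear functionals on W_0. Boundedness implies that [f] takes the
   same value on a.e. equal functions, as their difference has norm 0. *)
Definition in_Wdual (R : realType) (n : nat) (d : R) (Gamma : set 'rV[R]_n)
    (f : ('rV[R]_n -> R) -> R) : Prop :=
  (forall (a : R) (u v : 'rV[R]_n -> R),
     in_W0 d Gamma u -> in_W0 d Gamma v ->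
     f (fun z => a * u z + v z) = a * f u + f v) /\
  exists M : R, forall v : 'rV[R]_n -> R, in_W0 d Gamma v ->
    `|f v| <= M * W_norm d Gamma v.

Definition Wdual_norm (R : realType) (n : nat) (d : R) (Gamma : set 'rV[R]_n)
    (f : ('rV[R]_n -> R) -> R) : R :=
  sup [set f phi | phi in
    [set phi | in_W0 d Gamma phi /\ W_norm d Gamma phi = 1]].

Definition H_energy (R : realType) (n : nat) (d : R) (Gamma : set 'rV[R]_n)
    (g : 'rV[R]_n -> R) : \bar R :=
  (\int[haus n d]_(x in Gamma) \int[haus n d]_(y in Gamma)
     (`|g x - g y| ^+ 2 / enorm (x - y) `^ (d + 1))%:E)%E.

Definition in_H (R : realType) (n : nat) (d : R) (Gamma : set 'rV[R]_n)
    (g : 'rV[R]_n -> R) : Prop :=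
  measurable_fun (Gamma : set (haus_space R n d)) g /\
  (H_energy d Gamma g < +oo)%E.

Definition H_norm (R : realType) (n : nat) (d : R) (Gamma : set 'rV[R]_n)
    (g : 'rV[R]_n -> R) : R :=
  Num.sqrt (fine (H_energy d Gamma g)).

(* [M xi], as a row vector. *)
Definition mxact (R : realType) (n : nat) (M : 'M[R]_n) (xi : 'rV[R]_n) :
    'rV[R]_n :=
  xi *m M^T.

Definition elliptic (R : realType) (n : nat) (d C1 : R)
    (Gamma : set 'rV[R]_n) (A : 'rV[R]_n -> 'M[R]_n) : Prop :=
  forall x : 'rV[R]_n, (~` Gamma) x ->
    (forall xi zeta : 'rV[R]_n,
       `|dotp (mxact (A x) xi) zeta| <=
         C1 * weight d Gamma x * enorm xi * enorm zeta) /\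
    (forall xi : 'rV[R]_n,
       dotp (mxact (A x) xi) xi >=
         C1^-1 * weight d Gamma x * enorm xi ^+ 2).

Definition weak_solution (R : realType) (n : nat) (d : R)
    (Gamma : set 'rV[R]_n) (A : 'rV[R]_n -> 'M[R]_n)
    (u : 'rV[R]_n -> R) (f : ('rV[R]_n -> R) -> R) : Prop :=
  forall v : 'rV[R]_n -> R, in_W0 d Gamma v ->
    (\int[leb R n]_(z in ~` Gamma)
       (dotp (mxact (A z) (wgrad (~` Gamma) u z)) (wgrad (~` Gamma) v z))%:E
     = (f v)%:E)%E.

Definition is_solution (R : realType) (n : nat) (d : R)
    (Gamma : set 'rV[R]_n) (A : 'rV[R]_n -> 'M[R]_n)
    (f : ('rV[R]_n -> R) -> R) (g u : 'rV[R]_n -> R) : Prop :=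
  [/\ in_W d Gamma u, weak_solution d Gamma A u f & has_trace d Gamma u g].

(* Main.v *)
(* Functions in W are integrable across Gamma because Gamma, being Ahlfors regular of
   dimension d < n - 1, is missed by almost every line parallel to a coordinate axis; this
   yields a Poincare inequality on all boxes. For e in W_0, the mean of e over a ball
   centred at a point x of Gamma is controlled by a potential of |grad e| around x, and by
   Tonelli these potentials have an integral over Gamma at most C ||e||_W. Hence
   ||e||_W bounds the local L^1 norm of e, which gives uniqueness, and the
   completeness of W_0: along a fast Cauchy sequence the potentials of the differences
   are summable a.e. on Gamma, so that a vanishing trace passes to the limit.
   A right inverse of the trace is u(z) = N(z) / D(z), where N and D are the integrals of
   g(y) |z - y|^(-M) and |z - y|^(-M) over Gamma, with M = d + 1 + n; Jensen's inequality
   bounds |grad u|^2 by a double integral of |g(x) - g(y)|^2, and Tonelli bounds the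
   energy of u by ||g||_H^2. After subtraction of the extension, the Lax-Milgram theorem
   in W_0 applies. *)
From HB Require Import structures.
Require Import Defs.
From mathcomp Require Import all_boot all_order all_algebra.
From mathcomp Require Import all_classical all_reals all_analysis.
From mathcomp Require Import measurable_realfun ring lra.
Import Order.TTheory GRing.Theory Num.Theory.
Import numFieldNormedType.Exports.
Local Open Scope classical_set_scope.
Local Open Scope ring_scope.

Set Implicit Arguments.
Unset Strict Implicit.
Unset Printing Implicit Defensive.

(** * Lebesgue measure of boxes *)

(** No integrability of u near Gamma is given, and u is known only through tests. Smoothed tents
    compare the integrals of u over a box and over its translate. An L^1 norm is the supremum of
    sums of absolute integrals over dyadic boxes ([total_variation_le]), and the bounds obtained are
    superadditive under halving; this turns estimates for single boxes into L^1 estimates of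
    increments and into the Poincare inequality, without representatives that are absolutely
    continuous on lines. The weight enters through Young's inequality |grad u| <= a^-1 |grad u|^2 w
    + a w^-1, where w^-1 = dist^(n-1-d) is bounded near Gamma because d < n - 1. The free parameter
    a is tuned at each scale so that the integrated potentials form a geometric series. The exponent
    M = d + 1 + n fits twice: w dist^-2 D^-2 is at most a multiple of dist^M, and n - M = -(d + 1)
    is the exponent of the kernel of H. Elements of W_0 are functions rather than classes, so the
    Riesz and Lax-Milgram theorems are proved for semi-inner products on a predicate. *)

Lemma max_cut (R : realDomainType) (a b c : R) :
  Num.max 0 (Num.min b c - a) + Num.max 0 (b - Num.max a c) = Num.max 0 (b - a).
Proof.
have [bc|cb] := leP b c; have [ac|ca] := leP a c;
  have [] := leP 0 (b - a); have [] := leP 0 (b - c); have [] := leP 0 (c - a); lra.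
Qed.

Section caratheodory_of_boxes.
Context {R : realType} {n : nat}.
Implicit Types (a b : 'rV[R]_n) (i : 'I_n) (c : R).

Definition set_coord (x : 'rV[R]_n) (i : 'I_n) (c : R) : 'rV[R]_n :=
  \row_j (if j == i then c else x 0 j).

Lemma set_coordE x i c j : set_coord x i c 0 j = if j == i then c else x 0 j.
Proof. by rewrite mxE. Qed.

Definition cut_left i c (p : option ('rV[R]_n * 'rV[R]_n)) :=
  omap (fun ab => (ab.1, set_coord ab.2 i (Num.min (ab.2 0 i) c))) p.

Definition cut_right i c (p : option ('rV[R]_n * 'rV[R]_n)) :=
  omap (fun ab => (set_coord ab.1 i (Num.max (ab.1 0 i) c), ab.2)) p.

Lemma box_vol_ge0 p : (0 <= @box_vol R n p)%E.
Proof.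
case: p => [[a b]|]//=; rewrite lee_fin.
by apply: prodr_ge0 => i _; rewrite le_max lexx.
Qed.

(** The truncation of sides at 0 makes the identity hold for every level [c]: a hyperplane that
    misses the box leaves one part with an inverted side, hence with volume 0. *)
Lemma box_vol_cut i c p :
  (box_vol (cut_left i c p) + box_vol (cut_right i c p) = box_vol p)%E.
Proof.
case: p => [[a b]|]/=; last by rewrite adde0.
rewrite -EFinD; congr EFin.
rewrite (bigD1 i)//= [in X in _ + X](bigD1 i)//= [RHS](bigD1 i)//= !set_coordE eqxx.
under eq_bigr => j ji do rewrite set_coordE (negbTE ji).
under [in X in _ + X]eq_bigr => j ji do rewrite set_coordE (negbTE ji).
rewrite -mulrDl; congr (_ * _).
exact: max_cut.
Qed.

Lemma box_cut_left i c p :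
  box p `&` [set x | x 0 i <= c] `<=` box (cut_left i c p).
Proof.
case: p => [[a b]|]; last by rewrite set0I.
move=> x [/= abx xc] j; rewrite set_coordE; case: eqP => [->|_]; last exact: abx.
by have /andP[-> ?] := abx i; rewrite le_min xc andbT.
Qed.

Lemma box_cut_right i c p :
  box p `&` ~` [set x | x 0 i <= c] `<=` box (cut_right i c p).
Proof.
case: p => [[a b]|]; last by rewrite set0I.
move=> x [/= abx /negP]; rewrite -ltNge => xc j; rewrite set_coordE.
case: eqP => [->|_]; last exact: abx.
by have /andP[? ->] := abx i; rewrite ge_max (ltW xc) !andbT.
Qed.

(** Cutting every box of a cover of [X] along the hyperplane yields covers of both parts of [X], and
    by [box_vol_cut] their costs add up to the original cost. *)
Lemma measurable_leb_halfspace i c :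
  measurable ([set x | x 0 i <= c] : set (leb_space R n)).
Proof.
apply: le_caratheodory_measurable => X.
rewrite [leRHS]/= /leb_outer; apply: le_ereal_inf_tmp => _ [s [_ Xs] <-].
rewrite -(eq_eseriesr (fun k _ => box_vol_cut i c (s k))).
rewrite nneseriesD; try by move=> *; exact: box_vol_ge0.
apply: leeD; apply: ereal_inf_lbound.
- exists (cut_left i c \o s) => //; split => // x [/Xs[k _ skx] xi].
  by exists k => //; apply: box_cut_left.
- exists (cut_right i c \o s) => //; split => // x [/Xs[k _ skx] xi].
  by exists k => //; apply: box_cut_right.
Qed.

End caratheodory_of_boxes.

Lemma exists_invSn_lt (R : archiRealFieldType) (e : R) : 0 < e -> exists k : nat, k.+1%:R^-1 < e.
Proof.
move=> e0; exists (Num.trunc e^-1).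
by rewrite invf_plt ?posrE// truncnS_gt.
Qed.

Lemma exists_rat_near (R : realType) (x e : R) : 0 < e -> exists q : rat, `|x - ratr q| < e.
Proof.
move=> e0; have /rat_in_itvoo[q] : x - e < x + e by lra.
by rewrite in_itv/= => /andP[? ?]; exists q; rewrite ltr_norml; apply/andP; split; lra.
Qed.

(** * Borel sets through measurable coordinates *)

Section coordinates.
Context {d : measure_display} {T : measurableType d} {R : realType} {n : nat}.
Variable c : T -> 'rV[R]_n.
Hypothesis mc : forall i, measurable_fun setT (fun x => c x 0 i).

Lemma measurable_coord_rect (P : 'I_n -> set R) :
  (forall i, measurable (P i)) -> measurable [set x | forall i, P i (c x 0 i)].
Proof.
move=> mP.
rewrite (_ : [set x | _] = \bigcap_(i in [set: 'I_n]) ((fun x => c x 0 i) @^-1` P i)).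
  apply: fin_bigcap_measurable => //= i _.
  by rewrite -[X in measurable X]setTI; apply: mc.
by apply/seteqP; split => x /= h i; [move=> _|]; exact: h.
Qed.

(** An open set is the countable union of the sup-norm balls with rational centre and radius 1/(k+1)
    that it contains. The map [c] is the identity for Lebesgue and Hausdorff measure, and later also
    a gradient field. *)
Lemma measurable_coord_open (U : set 'rV[R]_n) :
  open U -> measurable (c @^-1` U).
Proof.
move=> oU.
pose B (pk : 'rV[rat]_n * nat) : set 'rV[R]_n :=
  [set y | forall i, `|y 0 i - ratr (pk.1 0 i)| < pk.2.+1%:R^-1].
have -> : c @^-1` U = \bigcup_pk (if `[< B pk `<=` U >] then c @^-1` B pk else set0).
  apply/seteqP; split => [x /= Ucx|x [pk _]]; last by case: asboolP => // + Bx; exact.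
  have /nbhs_ballP[e /= e0 eU] := open_nbhs_nbhs (conj oU Ucx).
  have [k ke] := exists_invSn_lt (divr_gt0 e0 (@ltr0Sn R 1)).
  have H i : exists q : rat, `|c x 0 i - ratr q| < k.+1%:R^-1 by exact: exists_rat_near.
  have [f fP] := choice H.
  exists (\row_i f i, k) => //; case: asboolP => /= [_ i|]; first by rewrite mxE.
  apply; move=> y By; apply: eU; split => // i j; rewrite (ord1 i) /ball/=.
  have {By} := By j; rewrite /= mxE => By.
  have : c x 0 j - y 0 j = (c x 0 j - ratr (f j)) - (y 0 j - ratr (f j)) by lra.
  move=> ->; apply: le_lt_trans (ler_normB _ _) _.
  by rewrite [e]splitr ltrD// (lt_trans _ ke).
apply: countable_bigcupT_measurable => [|pk]; first exact: countableP.
case: asboolP => // _; apply: (measurable_coord_rect (P := fun i => [set r | `|r - ratr (pk.1 0 i)| < pk.2.+1%:R^-1])) => i.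
rewrite (_ : [set r | _] = `]ratr (pk.1 0 i) - pk.2.+1%:R^-1, ratr (pk.1 0 i) + pk.2.+1%:R^-1[%classic)//.
by apply/seteqP; split => r /=; rewrite in_itv/= ltr_distl ?ltr_distl.
Qed.

Lemma measurable_coord_closed (F : set 'rV[R]_n) :
  closed F -> measurable (c @^-1` F).
Proof.
move=> cF; rewrite -[F]setCK preimage_setC; apply: measurableC.
by apply: (@measurable_coord_open (~` F)); exact: closed_openC.
Qed.

Lemma measurable_coord_continuous (f : 'rV[R]_n -> R) :
  continuous f -> measurable_fun setT (f \o c).
Proof.
move=> cf; apply: (measurability _ (RGenOpens.measurableE R)).
move=> _ [_ [a [b ->] <-]]; rewrite setTI comp_preimage.
apply: measurable_coord_open.
by apply: open_comp => [x _|]; [exact: cf|exact: interval_open].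
Qed.

End coordinates.

Section leb_borel.
Context {R : realType} {n : nat}.
Local Notation L := (leb_space R n).

Lemma measurable_leb_coord i : measurable_fun setT (fun x : L => (x : 'rV[R]_n) 0 i).
Proof.
apply: (measurability _ (RGenCInfty.measurableE R)).
move=> _ [_ [a ->] <-]; rewrite setTI.
rewrite (_ : _ @^-1` _ = ~` \bigcup_k ([set x | x 0 i <= a - k.+1%:R^-1] : set L)).
  by apply: measurableC; apply: bigcupT_measurable => k; exact: measurable_leb_halfspace.
apply/seteqP; split => x /=; rewrite in_itv/= andbT.
  by move=> ax [k _ /=]; apply/negP; rewrite -ltNge ltrBlDr (le_lt_trans ax)// ltrDl.
move=> H; rewrite leNgt; apply/negP => xa; apply: H.
have ax : 0 < a - x 0 i by lra.
have [k] := exists_invSn_lt ax.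
by exists k => //=; rewrite lerBrDr -lerBrDl ltW.
Qed.

Lemma measurable_leb_open (U : set 'rV[R]_n) : open U -> measurable (U : set L).
Proof. exact: (measurable_coord_open measurable_leb_coord). Qed.

Lemma measurable_leb_closed (U : set 'rV[R]_n) : closed U -> measurable (U : set L).
Proof. exact: (measurable_coord_closed measurable_leb_coord). Qed.

Lemma measurable_leb_continuous (f : 'rV[R]_n -> R) :
  continuous f -> measurable_fun (setT : set L) f.
Proof. exact: (measurable_coord_continuous measurable_leb_coord). Qed.

Lemma measurable_leb_box p : measurable (box p : set L).
Proof.
case: p => [[a b]|]; last exact: measurable0.
apply: (measurable_coord_rect measurable_leb_coord (P := fun i => [set r | a 0 i <= r <= b 0 i])) => i.
by rewrite (_ : [set r | _] = `[a 0 i, b 0 i]%classic).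
Qed.

(** Half-open boxes have disjoint halves, which makes halving an exact splitting of integrals. *)
Definition hbox (a b : 'rV[R]_n) : set 'rV[R]_n :=
  [set x | forall i, a 0 i < x 0 i <= b 0 i].

Lemma measurable_leb_hbox a b : measurable (hbox a b : set L).
Proof.
apply: (measurable_coord_rect measurable_leb_coord (P := fun i => [set r | a 0 i < r <= b 0 i])) => i.
by rewrite (_ : [set r | _] = `]a 0 i, b 0 i]%classic).
Qed.

Lemma leb_box_le p : (leb R n (box p) <= box_vol p)%E.
Proof.
apply: ereal_inf_lbound; exists (fun k : nat => if k == 0%N then p else None).
  by split => // x px; exists 0%N.
rewrite (@nneseriesD1 _ _ 0%N)//=; last by move=> k _; exact: box_vol_ge0.
rewrite eseries0 ?adde0// => -[|k] _ //.
Qed.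

End leb_borel.

Section box_volume_lower.
Context {R : realType} {n : nat}.
Implicit Types (p : option ('rV[R]_n * 'rV[R]_n)) (q : 'rV[R]_n * 'rV[R]_n).
Local Open Scope ereal_scope.

Let side q (i : 'I_n) : R := Num.max 0%R (q.2 0%R i - q.1 0%R i)%R.
Let ind q (i : 'I_n) (t : R) : R := \1_(`[q.1 0%R i, q.2 0%R i]%classic) t.
(* the first [m] coordinates are integrated out *)
Let part p (m : nat) (x : 'rV[R]_n) : R :=
  (if p is Some q then \prod_(i < n) (if (i < m)%N then side q i else ind q i (x 0 i))
   else 0)%R.

Let side_ge0 q i : (0 <= side q i)%R.
Proof. by rewrite /side le_max lexx. Qed.
Let ind_ge0 q i t : (0 <= ind q i t)%R.
Proof. by []. Qed.
Let part_ge0 p m x : (0 <= part p m x)%R.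
Proof. by case: p => [q|]//=; apply: prodr_ge0 => i _; case: ifP. Qed.

Let measurable_ind q i : measurable_fun setT (ind q i).
Proof. exact: measurable_indic. Qed.

Let integral_ind q i : \int[lebesgue_measure]_t (ind q i t)%:E = (side q i)%:E.
Proof.
transitivity (lebesgue_measure `[q.1 0%R i, q.2 0%R i]%classic).
  by rewrite /ind integral_indic// setIT.
rewrite lebesgue_measure_itv/= lte_fin /side.
case: ltP => ab; last by congr EFin; rewrite max_l// subr_le0.
by rewrite -EFinD max_r// subr_ge0 ltW.
Qed.

Let rest p (i : 'I_n) (x : 'rV[R]_n) : R :=
  (if p is Some q then
     \prod_(j < n | j != i) (if (j < i)%N then side q j else ind q j (x 0 j))
   else 0)%R.
Let rest_ge0 p i x : (0 <= rest p i x)%R.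
Proof. by case: p => [q|]//=; apply: prodr_ge0 => j _; case: ifP. Qed.

Let indo p i (t : R) : R := (if p is Some q then ind q i t else 0)%R.

Let part_set_coord p (i : 'I_n) x t :
  part p i (set_coord x i t) = (indo p i t * rest p i x)%R.
Proof.
case: p => [q|]/=; last by rewrite mul0r.
rewrite (bigD1 i)//= ltnn set_coordE eqxx; congr *%R.
by apply: eq_bigr => j ji; rewrite set_coordE (negbTE ji).
Qed.

Let measurable_part p (i : 'I_n) x :
  measurable_fun setT (fun t : R => (part p i (set_coord x i t))%:E).
Proof.
apply/measurable_EFinP.
rewrite (_ : (fun t => _) = (fun t => indo p i t * rest p i x)%R); last first.
  by apply/funext => t; exact: part_set_coord.
case: p => [q|] /=; apply: measurable_funM => //; exact: measurable_ind.
Qed.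

Let integral_part p (i : 'I_n) x :
  \int[lebesgue_measure]_t (part p i (set_coord x i t))%:E = (part p i.+1 x)%:E.
Proof.
under eq_integral do rewrite part_set_coord mulrC EFinM.
case: p => [q|]; last first.
  by rewrite integral0_eq// => x0 _; rewrite mule0.
rewrite ge0_integralZl_EFin //; try (by move=> t _; rewrite lee_fin); try exact: (@rest_ge0 (Some q)); try by apply/measurable_EFinP; exact: measurable_ind.
  rewrite integral_ind -EFinM mulrC /= [in RHS](bigD1 i)//= ltnS leqnn; congr EFin.
  congr *%R; apply: eq_bigr => j ji.
  by rewrite ltnS (leq_eqVlt j) (inj_eq val_inj) (negbTE ji).
Qed.

(** The indicator of [box p] is at most the sum of the indicators of the covering boxes. This
    inequality is integrated over one coordinate after another with one-dimensional Lebesgue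
    measure; series and integrals of nonnegative functions commute, so no reduction to finite covers
    by compactness takes place. *)
Lemma box_vol_le_series p (s : nat -> option ('rV[R]_n * 'rV[R]_n)) :
  box p `<=` \bigcup_k box (s k) ->
  box_vol p <= \sum_(k <oo) box_vol (s k).
Proof.
move=> ps.
have part0 (q : option ('rV[R]_n * 'rV[R]_n)) x : part q 0 x = \1_(box q) x.
  case: q => [[a b]|]/=; last by rewrite indic0.
  rewrite indicE; case: (boolP (_ \in _)) => [|].
    rewrite inE/= => H; rewrite big1// => i _; rewrite /ind indicE mem_set//=.
    by rewrite in_itv/= H.
  move/negP; rewrite inE/= => /existsNP[i H].
  by rewrite (bigD1 i)//= /ind indicE memNset ?mul0r//= in_itv.
(* Induction on the number [m] of coordinates already integrated: [part] is the indicator of the box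
   at [m = 0] and its volume at [m = n]. *)
have key m x : (m <= n)%N -> (part p m x)%:E <= \sum_(k <oo) (part (s k) m x)%:E.
  elim: m x => [x _|m IH x mn].
    rewrite part0 indicE; case: (boolP (_ \in _)) => [|_]; last first.
      by apply: nneseries_ge0 => k _ _; rewrite lee_fin.
    rewrite inE => /ps[k _ kx]; rewrite (@nneseriesD1 _ _ k)//=.
      rewrite part0 indicE mem_set//= leeDl//.
      by apply: nneseries_ge0 => j _ _; rewrite lee_fin.
    by move=> j _; rewrite lee_fin.
  rewrite -(integral_part p (Ordinal mn) x).
  under eq_eseriesr do rewrite -(integral_part _ (Ordinal mn) x).
  rewrite -integral_nneseries//.
  - apply: ge0_le_integral => //.
    + by move=> t _; rewrite lee_fin.
    + exact: measurable_part.
    + by apply: ge0_emeasurable_sum => [k t _ _|k _]; [rewrite lee_fin|exact: measurable_part].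
    + by move=> t _; apply: IH; exact: ltnW.
  - by move=> k; exact: measurable_part.
  - by move=> k t _; rewrite lee_fin.
have partn (q : option ('rV[R]_n * 'rV[R]_n)) : (part q n 0)%:E = box_vol q.
  case: q => [[a b]|]//=; congr EFin; apply: eq_bigr => i _.
  by rewrite ltn_ord.
rewrite -partn; apply: le_trans (key n 0%R (leqnn n)) _.
by under eq_eseriesr do rewrite partn.
Qed.

Lemma leb_box p : leb R n (box p) = box_vol p.
Proof.
apply/eqP; rewrite eq_le leb_box_le/=.
by apply: le_ereal_inf_tmp => _ [s [_ ps] <-]; exact: box_vol_le_series.
Qed.

End box_volume_lower.

Lemma open_obox (R : realType) (n : nat) (a b : 'rV[R]_n) :
  open [set x : 'rV[R]_n | forall i, a 0 i < x 0 i < b 0 i].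
Proof.
rewrite openE => x xab; rewrite /interior.
exists (fun _ i => `]a 0 i, b 0 i[%classic) => [i j|y H i]; last first.
  by have := H 0 i; rewrite /= in_itv.
by apply: open_nbhs_nbhs; split; [exact: interval_open|rewrite /= in_itv/= (ord1 i); exact: xab].
Qed.

Section hbox_volume.
Context {R : realType} {n : nat}.
Implicit Types (a b h : 'rV[R]_n).
Local Notation L := (leb_space R n).

Lemma leb_face (i : 'I_n) a b : (leb R n (box (Some (a, set_coord b i (a 0%R i)))) = 0)%E.
Proof.
by rewrite leb_box /= (bigD1 i)//= set_coordE eqxx subrr maxxx mul0r.
Qed.

Definition vol a b : R := \prod_(i < n) Num.max 0 (b 0 i - a 0 i).

(** The closed box exceeds the half-open one only by points of the lower faces, and each face is a
    closed box with one side of length 0. *)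
Lemma leb_hbox a b : leb R n (hbox a b) = (vol a b)%:E.
Proof.
have E : (vol a b)%:E = leb R n (box (Some (a, b))) by rewrite leb_box.
apply/eqP; rewrite E eq_le; apply/andP; split.
  apply: le_measure; rewrite ?inE.
  - exact: measurable_leb_hbox.
  - exact: measurable_leb_box.
  - by move=> x xab i; have /andP[/ltW -> ->] := xab i.
pose F := \big[setU/set0]_(i < n) (box (Some (a, set_coord b i (a 0%R i))) : set L).
have [mF F0] : measurable F /\ leb R n F = 0%E.
  rewrite /F; apply: (big_ind (fun F : set L => measurable F /\ leb R n F = 0%E)).
  - by split; [exact: measurable0|rewrite measure0].
  - move=> A B [mA A0] [mB B0]; split; first exact: measurableU.
    by rewrite measureU0.
  - by move=> i _; split; [exact: measurable_leb_box|exact: leb_face].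
rewrite -[leRHS](@measureU0 _ _ _ (leb R n) _ _ (measurable_leb_hbox a b) mF F0).
apply: le_measure; rewrite ?inE.
- exact: measurable_leb_box.
- by apply: measurableU => //; exact: measurable_leb_hbox.
move=> x xab; have [h|] := pselect (forall i, (a 0 i < x 0 i)%R).
  by left => i; have /andP[_ ->] := xab i; rewrite h.
move=> /existsNP[i /negP]; rewrite -leNgt => xa; right.
rewrite /F (bigD1 i)//=; left => j; rewrite set_coordE; have /= := xab j.
by case: eqP => [->|//] /andP[-> _].
Qed.

Lemma leb_fin_box p : (leb R n (box p) < +oo)%E.
Proof. by rewrite leb_box; case: p => [[a b]|]//=; rewrite ltry. Qed.

Lemma leb_sigma_finite : sigma_finite [set: L] (leb R n).
Proof.
exists (fun k : nat => box (Some (const_mx (- k%:R), const_mx k%:R))).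
  apply/esym/seteqP; split => // x _.
  exists (\sum_i (Num.trunc `|x 0%R i|).+1)%N => // i; rewrite !mxE -ler_norml.
  apply: le_trans (ltW (truncnS_gt _)) _; rewrite ler_nat.
  by rewrite (bigD1 i)//= leq_addr.
by move=> k; split; [exact: measurable_leb_box|exact: leb_fin_box].
Qed.

End hbox_volume.

Section leb_translation.
Context {R : realType} {n : nat}.
Implicit Types (a b h : 'rV[R]_n).
Local Notation L := (leb_space R n).

Definition shift_box h (p : option ('rV[R]_n * 'rV[R]_n)) :=
  omap (fun q => (q.1 + h, q.2 + h)) p.

Lemma box_shift h p x : box (shift_box h p) (x + h) <-> box p x.
Proof.
case: p => [[a b]|]//=; split => H i; have := H i; rewrite !mxE; first by rewrite !lerD2r.
by rewrite !lerD2r.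
Qed.

Lemma box_vol_shift h p : box_vol (shift_box h p) = box_vol p.
Proof.
case: p => [[a b]|]//=; congr EFin; apply: eq_bigr => i _; rewrite !mxE.
by congr Num.max; lra.
Qed.

Lemma leb_outer_shift h (A : set 'rV[R]_n) :
  leb_outer [set x | A (x + h)] = leb_outer A.
Proof.
have le (k : 'rV[R]_n) (B : set 'rV[R]_n) : (leb_outer [set x | B (x + k)%R] <= leb_outer B)%E.
  apply: le_ereal_inf_tmp => _ [s [_ Bs] <-]; apply: ereal_inf_lbound.
  exists (shift_box (- k) \o s) => /=; last first.
    by apply: eq_eseriesr => j _; rewrite box_vol_shift.
  split => // x /Bs[j _ sj]; exists j => //=.
  by rewrite -[x](addrK k); apply/box_shift.
apply/eqP; rewrite eq_le le/=; have := le (- h) [set x | A (x + h)].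
suff -> : [set x | [set x | A (x + h)] (x - h)] = A by [].
by rewrite predeqE => x /=; rewrite addrNK.
Qed.

Lemma measurable_leb_shift h : measurable_fun setT (fun x : L => (x : 'rV[R]_n) + h : L).
Proof.
move=> _ A mA; rewrite setTI; apply: le_caratheodory_measurable => X.
have -> : X = [set x | [set y | X (y - h)] (x + h)].
  by rewrite predeqE => x /=; rewrite addrK.
set Y : set 'rV[R]_n := [set y | X (y - h)].
rewrite (_ : _ `&` _ = [set x | (Y `&` A) (x + h)])//.
rewrite (_ : [set x | Y (x + h)] `&` ~` _ = [set x | (Y `&` ~` A) (x + h)])//.
change (leb_outer [set x : 'rV[R]_n | (Y `&` A) (x + h)%R] +
  leb_outer [set x : 'rV[R]_n | (Y `&` ~` A) (x + h)%R] <=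
  leb_outer [set x : 'rV[R]_n | Y (x + h)%R])%E.
by rewrite (leb_outer_shift h Y) (leb_outer_shift h (Y `&` A)) (leb_outer_shift h (Y `&` ~` A)); have /= -> := mA Y.
Qed.

Lemma leb_shift h (A : set L) : leb R n [set x | A (x + h)] = leb R n A.
Proof. exact: leb_outer_shift. Qed.

End leb_translation.

(* Outer regularity: the closed boxes of an almost optimal cover are enlarged. *)
Section leb_regularity.
Context {R : realType} {n : nat}.

(** The small excess comes from continuity of the measure from above along the closed boxes enlarged
    by 1/(k+1) on every side; the open version of such an enlargement is the required set. *)
Lemma box_enlarge (p : option ('rV[R]_n * 'rV[R]_n)) (e : R) : 0 < e ->
  exists U : set 'rV[R]_n,
    [/\ open U, box p `<=` U & (leb_outer U <= box_vol p + e%:E)%E].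
Proof.
case: p => [[a b]|] e0; last first.
  exists set0; split; [exact: open0|exact: sub0set|].
  by rewrite outer_measure0 add0e lee_fin ltW.
pose F (k : nat) := box (Some (a - const_mx k.+1%:R^-1, b + const_mx k.+1%:R^-1)) : set (leb_space R n).
have FE : \bigcap_k F k = box (Some (a, b)).
  apply/seteqP; split => [x xF i|x xab k _ i]; last first.
    rewrite !mxE; have /andP[xa xb] := xab i; apply/andP; split.
      by rewrite (le_trans _ xa)// gerBl.
    by rewrite (le_trans xb)// lerDl.
  apply/andP; split; rewrite leNgt; apply/negP; rewrite -subr_gt0 => h;
    have [k _ /(_ k (leqnn k)) /= ke] := near_infty_natSinv_lt (PosNum h);
    have := xF k I i; rewrite !mxE; move: (k.+1%:R^-1 : R) ke => t ke /andP[]; lra.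
have FS k : F k.+1 `<=` F k.
  move=> x xF i; have := xF i; rewrite !mxE => /andP[xa xb].
  have kk : (k.+2%:R^-1 : R) <= k.+1%:R^-1 by rewrite lef_pV2 ?posrE// ler_nat.
  by apply/andP; split; [apply: le_trans xa; rewrite lerD2l lerN2|apply: le_trans xb _; rewrite lerD2l].
have cF : (leb R n \o F) k @[k --> \oo] --> leb R n (\bigcap_k F k).
  apply: nonincreasing_cvg_mu; [exact: leb_fin_box|by move=> k; exact: measurable_leb_box| |].
    by apply: bigcapT_measurable => k; exact: measurable_leb_box.
  by apply/nonincreasing_seqP => k; apply/subsetPset; exact: FS.
rewrite FE leb_box in cF.
have : \forall k \near \oo, ((leb R n \o F) k < box_vol (Some (a, b)) + e%:E)%E.
  apply: (cF [set y | (y < _)%E]); apply: open_nbhs_nbhs; split.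
    exact: open_ereal_lt_ereal.
  by rewrite /= lteDl// lte_fin.
case=> k _ /(_ k (leqnn k)) /= kF.
exists [set x | forall i, (a - const_mx k.+1%:R^-1) 0 i < x 0 i < (b + const_mx k.+1%:R^-1) 0 i].
split; first exact: open_obox.
  move=> x xab i; rewrite !mxE; have /andP[xa xb] := xab i; apply/andP; split.
    by rewrite (lt_le_trans _ xa)// gtrBl.
  by rewrite (le_lt_trans xb)// ltrDl.
apply: le_trans (ltW kF); apply: le_outer_measure => x xU i.
by have /andP[/ltW -> /ltW ->] := xU i.
Qed.

Lemma leb_outer_regular (A : set 'rV[R]_n) (e : R) : 0 < e -> (leb_outer A < +oo)%E ->
  exists U, [/\ open U, A `<=` U & (leb_outer U <= leb_outer A + e%:E)%E].
Proof.
move=> e0 Afin.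
have Afn : leb_outer A \is a fin_num by rewrite ge0_fin_numE// outer_measure_ge0.
have e2 : 0 < e / 2 by rewrite divr_gt0.
have [_ [s [_ As] <-] sA] := lb_ereal_inf_adherent e2 Afn.
have H k : exists U : set 'rV[R]_n,
    [/\ open U, box (s k) `<=` U & (leb_outer U <= box_vol (s k) + (e / 2 / (2 ^ k.+1)%:R)%:E)%E].
  by apply: box_enlarge; rewrite divr_gt0// ltr0n expn_gt0.
have [U UP] := choice H; exists (\bigcup_k U k); split.
- by apply: bigcup_open => k _; have [] := UP k.
- by move=> x /As[k _ kx]; exists k => //; have [_ + _] := UP k; exact.
apply: le_trans (outer_measure_sigma_subadditive _ _) _.
apply: (@le_trans _ _ (\sum_(k <oo) (box_vol (s k) + (e / 2 / (2 ^ k.+1)%:R)%:E))%E).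
  by apply: lee_nneseries => k *; [exact: (outer_measure_ge0 (@leb_outer R n))|have [] := UP k].
apply: le_trans (epsilon_trick _ _ (ltW e2)) _; first by move=> k; exact: box_vol_ge0.
by rewrite [e in leRHS]splitr EFinD addeA leeD2r// ltW.
Qed.

End leb_regularity.

(** * Smooth cut-off functions *)

Section one_variable.
Context {R : realType}.
Implicit Types (f g : R -> R) (k : nat).

(** Only the existence of derivatives is recorded; continuity of each derivative follows from the
    existence of the next one as soon as all orders are available. *)
Fixpoint cdiff k f : Prop :=
  if k is k'.+1 then (forall x, derivable f x 1) /\ cdiff k' (derive1 f) else True.

Definition csmooth f := forall k, cdiff k f.

Lemma csmooth_derivable f x : csmooth f -> derivable f x 1.
Proof. by move=> /(_ 1%N)[]. Qed.

Lemma csmooth_derive1 f : csmooth f -> csmooth (derive1 f).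
Proof. by move=> sf k; have [] := sf k.+1. Qed.

Lemma csmooth_continuous f : csmooth f -> continuous f.
Proof.
move=> sf x; apply: differentiable_continuous; apply/derivable1_diffP.
exact: csmooth_derivable.
Qed.

Lemma cdiffW k f : cdiff k.+1 f -> cdiff k f.
Proof. by elim: k f => // k IH f [df] /IH. Qed.

Lemma cdiff_cst k (c : R) : cdiff k (cst c).
Proof.
elim: k c => //= k IH c; split; first by move=> x; exact: derivable_cst.
rewrite (_ : (derive1 (cst c)) = cst 0)//.
by apply/funext => x; rewrite derive1E derive_cst.
Qed.

Lemma cdiff_id k : cdiff k id.
Proof.
case: k => //= k; split; first by move=> x; exact: derivable_id.
rewrite (_ : (derive1 id) = cst 1); first exact: cdiff_cst.
by apply/funext => x; rewrite derive1E derive_id.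
Qed.

Lemma cdiffD k f g : cdiff k f -> cdiff k g -> cdiff k (fun x => f x + g x).
Proof.
elim: k f g => //= k IH f g [df cf] [dg cg]; split; first by move=> x; exact: derivableD.
rewrite (_ : (derive1 (fun x => f x + g x)) = (fun x => (derive1 f) x + (derive1 g) x)); first exact: IH.
by apply/funext => x; rewrite !derive1E deriveD.
Qed.

Lemma cdiffM k f g : cdiff k f -> cdiff k g -> cdiff k (fun x => f x * g x).
Proof.
elim: k f g => //= k IH f g [df cf] [dg cg]; split; first by move=> x; exact: derivableM.
rewrite (_ : (derive1 (fun x => f x * g x)) = (fun x => f x * (derive1 g) x + g x * (derive1 f) x)).
  by apply: cdiffD; apply: IH => //; apply: cdiffW.
by apply/funext => x; rewrite !derive1E deriveM.
Qed.

Lemma cdiffV k f : (forall x, f x != 0) -> cdiff k f -> cdiff k (fun x => (f x)^-1).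
Proof.
move=> f0; elim: k => //= k IH [df cf].
have df' (x : R) : is_derive x (1 : R) (fun x => (f x)^-1) (- (f x) ^- 2 *: (derive1 f) x).
  by rewrite derive1E; apply: is_deriveV => //; exact: derivableP.
split; first by move=> x; exact: ex_derive.
rewrite (_ : (derive1 (fun x => (f x)^-1)) = (fun x => (-1 * ((f x)^-1 * (f x)^-1)) * (derive1 f) x)).
  have cf' : cdiff k f by apply: cdiffW.
  by do 3 (apply: cdiffM => //; try exact: cdiff_cst); exact: IH.
apply/funext => x; rewrite derive1E derive_val.
by rewrite -exprVn expr2 mulN1r.
Qed.

Lemma is_derive_affine f (a b x : R) : (forall x, derivable f x 1) ->
  is_derive x 1 (fun t => f (a * t + b)) (a * (derive1 f) (a * x + b)).
Proof.
move=> df; have da : is_derive x 1 (fun t => a * t + b) a.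
  by apply: is_derive_eq; rewrite addr0 /GRing.scale/= mulr1.
have dfx : is_derive (a * x + b) 1 f ((derive1 f) (a * x + b)).
  by rewrite derive1E; exact: derivableP.
by have := @is_derive1_comp _ f (fun t => a * t + b) x _ _ dfx da; rewrite mulrC.
Qed.

Lemma cdiff_affine k f (a b : R) : cdiff k f -> cdiff k (fun x => f (a * x + b)).
Proof.
elim: k f => //= k IH f [df cf].
have H x := @is_derive_affine f a b x df.
split; first by move=> x; exact: ex_derive.
rewrite (_ : (derive1 (fun x => f (a * x + b))) = (fun x => (cst a x) * (derive1 f) (a * x + b))).
  by apply: cdiffM; [exact: cdiff_cst|exact: IH].
by apply/funext => x; rewrite derive1E derive_val.
Qed.

(* [x^-m e^(-1/x)] for [x > 0] *)
Definition flat (m : nat) (x : R) : R :=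
  if 0 < x then x^-1 ^+ m * expR (- x^-1) else 0.

Lemma flat_ge0 m x : 0 <= flat m x.
Proof.
rewrite /flat; case: ifP => // x0.
by rewrite mulr_ge0// ?expR_ge0// exprn_ge0// invr_ge0 ltW.
Qed.

Lemma flat0_gt0 x : 0 < x -> 0 < flat 0 x.
Proof. by rewrite /flat => ->; rewrite mul1r expR_gt0. Qed.

Lemma flat_npos m x : x <= 0 -> flat m x = 0.
Proof. by rewrite /flat ltNge => ->. Qed.

(** A quadratic bound at 0 is what [is_derive0_sqr] uses to differentiate the function across the
    gluing point. *)
Lemma flat_le_sqr m : exists C, forall x, `|flat m x| <= C * x ^+ 2.
Proof.
exists (m.+2%:R ^+ m.+2) => x; rewrite ger0_norm ?flat_ge0// /flat.
case: ifP => x0; last by rewrite mulr_ge0// ?sqr_ge0// exprn_ge0.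
have y0 : 0 < x^-1 by rewrite invr_gt0.
(* The inequality 1 + t <= exp t at t = x^-1 / (m + 2), raised to the power m + 2. Two powers more
   than needed to absorb x^-m leave the factor x^2. *)
have e_ge : (x^-1 / m.+2%:R) ^+ m.+2 <= expR x^-1.
  have -> : expR x^-1 = expR (x^-1 / m.+2%:R) ^+ m.+2 by rewrite -expRM_natr divfK.
  apply: lerXn2r; rewrite ?nnegrE ?expR_ge0//.
    by rewrite divr_ge0// ltW.
  by apply: le_trans (expR_ge1Dx _); rewrite lerDr.
rewrite expRN ler_pdivrMr ?expR_gt0//.
have -> : x^-1 ^+ m = m.+2%:R ^+ m.+2 * x ^+ 2 * (x^-1 / m.+2%:R) ^+ m.+2.
  rewrite expr_div_n.
  have -> : x^-1 ^+ m.+2 = x^-1 ^+ m * x^-1 ^+ 2 by rewrite -exprD addn2.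
  have : (m.+2%:R : R) ^+ m.+2 != 0 by rewrite expf_neq0// pnatr_eq0.
  move: (x^-1 ^+ m) ((m.+2%:R : R) ^+ m.+2) => u w w0; field.
  by rewrite w0 gt_eqF.
by apply: ler_wpM2l => //; apply: mulr_ge0; [exact: exprn_ge0|exact: sqr_ge0].
Qed.

Lemma is_derive0_sqr f C : f 0 = 0 -> (forall x, `|f x| <= C * x ^+ 2) -> is_derive (0 : R) (1 : R) f 0.
Proof.
move=> f00 fC.
have H : (fun h : R => h^-1 *: (f (h *: 1 + 0) - f 0)) @ 0^' --> (0 : R).
  apply/cvgr0Pnorm_le => e e0.
  near=> h.
  rewrite /GRing.scale/= mulr1 addr0 f00 subr0 normrM normfV.
  have h0 : 0 < `|h| by rewrite normr_gt0; near: h; exact: nbhs_dnbhs_neq.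
  rewrite mulrC ler_pdivrMr//; apply: le_trans (fC h) _.
  rewrite -(real_normK (num_real h)) expr2 mulrA.
  rewrite ler_wpM2r//.
  apply: (@le_trans _ _ ((`|C| + 1) * `|h|)).
    by rewrite ler_wpM2r//; have := ler_norm C; lra.
  rewrite -ler_pdivlMl ?ltr_wpDl//.
  near: h; apply: dnbhs0_le; rewrite mulr_gt0// invr_gt0 ltr_wpDl//.
by apply: DeriveDef; [apply/cvg_ex; exists 0|apply/cvg_lim].
Unshelve. all: by end_near. Qed.

(** The index [m] makes the family stable under differentiation up to linear combinations, so that
    all its members are smooth by one induction on the order. *)
Lemma is_derive_flat m (x : R) :
  is_derive x (1 : R) (flat m) (flat m.+2 x + (- m%:R) * flat m.+1 x).
Proof.
have [x0|x0|x0] := ltgtP x 0; last first.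
- rewrite x0 !flat_npos// mulr0 addr0.
  by have [C hC] := flat_le_sqr m; apply: is_derive0_sqr hC; rewrite flat_npos.
- have H : is_derive x 1 (fun t => t^-1 ^+ m * expR (- t^-1))
      (flat m.+2 x + (- m%:R) * flat m.+1 x).
    have xn0 : x != 0 by rewrite gt_eqF.
    have dV : is_derive x 1 (fun t : R => t^-1) (- x ^- 2).
      have := @is_deriveV _ (fun t : R => t) x 1 1 xn0 (is_derive_id x 1).
      by rewrite /GRing.scale/= mulr1.
    have dX := is_deriveX m dV.
    have dE : is_derive x 1 (fun t : R => expR (- t^-1)) (x ^- 2 * expR (- x^-1)).
      have dN : is_derive x 1 (fun t : R => - t^-1) (x ^- 2).
        by have := is_deriveN dV; rewrite opprK.
      by have := @is_derive1_comp _ expR (fun t : R => - t^-1) x _ _ (is_derive_expR (- x^-1)) dN; rewrite mulrC.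
    rewrite /flat x0; case: m dX => [_|m dX].
      rewrite (_ : (fun t => _) = (fun t : R => expR (- t^-1))); last first.
        by apply/funext => t; rewrite mul1r.
      by rewrite oppr0 mul0r addr0 exprVn.
    rewrite (_ : (fun t => _) = (fun t : R => t^-1) ^+ m.+1 * (fun t : R => expR (- t^-1))); last first.
      by apply/funext => t; rewrite mulrfctE exprfctE.
    refine (@is_derive_eq _ _ _ _ _ _ _ _ (is_deriveM dX dE) _).
    rewrite exprfctE.
    rewrite /GRing.scale/= !exprVn !exprS; field.
    by rewrite expf_eq0 (negbTE xn0) andbF.
  apply: (near_eq_is_derive _ H).
  near=> t; rewrite /flat ifT//; near: t.
  by apply: (@lt_nbhsr _ 0 x).
- rewrite !flat_npos ?ltW// mulr0 addr0.
  apply: (near_eq_is_derive _ (is_derive_cst 0 x 1)).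
  near=> t; rewrite flat_npos//; apply/ltW; near: t.
  by apply: (@lt_nbhsl _ x 0).
Unshelve. all: by end_near. Qed.

Lemma csmooth_flat m : csmooth (flat m).
Proof.
move=> k; elim: k m => //= k IH m.
have H x := is_derive_flat m x.
split; first by move=> x; exact: ex_derive.
rewrite (_ : (derive1 (flat m)) = (fun x => flat m.+2 x + (cst (- m%:R) x) * flat m.+1 x)).
  by apply: cdiffD => //; apply: cdiffM => //; exact: cdiff_cst.
by apply/funext => x; rewrite derive1E derive_val.
Qed.

Definition step (t : R) : R := flat 0 t / (flat 0 t + flat 0 (1 - t)).

Lemma step_den_gt0 t : 0 < flat 0 t + flat 0 (1 - t).
Proof.
have [t0|t0] := ltP 0 t; first by rewrite ltr_wpDr ?flat_ge0// flat0_gt0.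
by rewrite ltr_wpDl ?flat_ge0// flat0_gt0// subr_gt0 (le_lt_trans t0).
Qed.

Lemma step0 t : t <= 0 -> step t = 0.
Proof. by move=> t0; rewrite /step flat_npos// mul0r. Qed.

Lemma step1 t : 1 <= t -> step t = 1.
Proof.
move=> t1; rewrite /step (@flat_npos _ (1 - t)) ?subr_le0// addr0 divff//.
by rewrite gt_eqF// flat0_gt0// (lt_le_trans _ t1).
Qed.

Lemma step_ge0 t : 0 <= step t.
Proof. by rewrite divr_ge0 ?flat_ge0// ltW// step_den_gt0. Qed.

Lemma step_le1 t : step t <= 1.
Proof. by rewrite ler_pdivrMr ?step_den_gt0// mul1r lerDl flat_ge0. Qed.

Lemma csmooth_step : csmooth step.
Proof.
move=> k; apply: cdiffM; first exact: csmooth_flat.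
apply: cdiffV; first by move=> x; rewrite gt_eqF// step_den_gt0.
apply: cdiffD; first exact: csmooth_flat.
have := @cdiff_affine k (flat 0) (-1) 1 (csmooth_flat 0 k).
by under eq_fun do rewrite mulN1r addrC.
Qed.

(* A smooth substitute for the positive part; its derivative [dramp] is a
   smooth substitute for the Heaviside function. *)
Definition ramp (t : R) : R := t * step t.
Definition dramp : R -> R := (derive1 ramp).

Lemma csmooth_ramp : csmooth ramp.
Proof. by move=> k; apply: cdiffM; [exact: cdiff_id|exact: csmooth_step]. Qed.

Lemma ramp_npos t : t <= 0 -> ramp t = 0.
Proof. by move=> t0; rewrite /ramp step0// mulr0. Qed.

Lemma ramp_ge1 t : 1 <= t -> ramp t = t.
Proof. by move=> t0; rewrite /ramp step1// mulr1. Qed.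

Lemma continuous_dramp : continuous dramp.
Proof. exact: csmooth_continuous (csmooth_derive1 csmooth_ramp). Qed.

Lemma dramp_neg t : t < 0 -> dramp t = 0.
Proof.
move=> t0; rewrite /dramp derive1E.
have : is_derive t 1 ramp 0.
  apply: (near_eq_is_derive _ (is_derive_cst 0 t 1)).
  near=> s; rewrite ramp_npos//; apply/ltW; near: s.
  by apply: (@lt_nbhsl _ t 0).
by move=> ?; rewrite derive_val.
Unshelve. all: by end_near. Qed.

Lemma dramp_gt1 t : 1 < t -> dramp t = 1.
Proof.
move=> t0; rewrite /dramp derive1E.
have : is_derive t 1 ramp 1.
  apply: (near_eq_is_derive _ (is_derive_id t 1)).
  near=> s; rewrite ramp_ge1//; apply/ltW; near: s.
  by apply: (@lt_nbhsr _ 1 t).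
by move=> ?; rewrite derive_val.
Unshelve. all: by end_near. Qed.

(** Continuity from the left. The value at 0 decides the end points: with it, the limits of [dtente]
    are indicators of intervals that are open on the left and closed on the right. *)
Lemma dramp0 : dramp 0 = 0.
Proof.
apply/eqP; apply/negPn/negP; rewrite -normr_gt0 => c0.
have /cvgr_dist_lt/(_ _ c0)/nbhs_ballP[e /= e0 H] : dramp x @[x --> (0 : R)] --> dramp 0.
  exact: continuous_dramp.
have /H : ball (0 : R) e (- (e / 2)).
  by rewrite /ball/= sub0r opprK ger0_norm ?divr_ge0 ?ltW//; lra.
by rewrite /= (@dramp_neg (- (e / 2))) ?subr0 ?ltxx// oppr_lt0 divr_gt0.
Qed.

Lemma dramp_bounded : exists2 C : R, 0 < C & forall t, `|dramp t| <= C.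
Proof.
have /compact_bounded[M [_ HM]] : compact (dramp @` `[0, 1]%classic).
  apply: continuous_compact; last exact: segment_compact.
  by apply: continuous_subspaceT; exact: continuous_dramp.
exists (`|M| + 2) => [|t]; first by rewrite ltr_wpDl.
have [t0|t0] := ltP t 0; first by rewrite dramp_neg// normr0 addr_ge0.
have [t1|t1] := ltP 1 t; first by rewrite dramp_gt1// normr1; have := normr_ge0 M; lra.
apply: HM; first by have := ler_norm M; lra.
by exists t => //=; rewrite in_itv/= t0.
Qed.

End one_variable.

(** * Integrals of real-valued functions *)

Section integration.
Context {d : measure_display} {T : measurableType d} {R : realType}.
Variable mu : {measure set T -> \bar R}.
Implicit Types (D E K : set T) (f g : T -> R).

Lemma integral_support D K (f : T -> \bar R) : K `<=` D ->
  (forall x, D x -> ~ K x -> f x = 0%E) ->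
  (\int[mu]_(x in D) f x = \int[mu]_(x in K) f x)%E.
Proof.
move=> KD f0; rewrite integral_mkcond [RHS]integral_mkcond; apply: eq_integral => x _.
rewrite /patch; case: ifPn => [|/negP]; case: ifPn => //.
- by move=> /negP; rewrite !inE => nK Dx; rewrite f0.
- by rewrite !inE => /KD ? /(_ _).
Qed.

Lemma dct_eventually D (f_ : nat -> T -> R) f g : measurable D ->
  (forall k, measurable_fun D (f_ k)) -> mu.-integrable D (EFin \o g) ->
  (forall k x, D x -> `|f_ k x| <= g x) ->
  (forall x, D x -> f_ k x @[k --> \oo] --> f x) ->
  mu.-integrable D (EFin \o f) /\
  \int[mu]_(x in D) f_ k x @[k --> \oo] --> \int[mu]_(x in D) f x.
Proof.
move=> mD mf ig fg ff.
have mlim : measurable_fun D f by apply: measurable_fun_cvg ff => // k; exact: mf.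
have [] := @dominated_convergence _ _ _ mu D mD (fun k => EFin \o f_ k) (EFin \o f) (EFin \o g).
- by move=> k; apply/measurable_EFinP.
- exact/measurable_EFinP.
- by apply: aeW => x Dx; apply: cvg_EFin; [exact: nearW|exact: ff].
- exact: ig.
- by apply: aeW => x k Dx; rewrite lee_fin; exact: fg.
move=> if_ _ cf; split => //; apply: fine_cvg.
by rewrite fineK//; apply: integrable_fin_num.
Qed.

Lemma integrable_le D f g : measurable D -> measurable_fun D f ->
  mu.-integrable D (EFin \o g) -> (forall x, D x -> `|f x| <= g x) ->
  mu.-integrable D (EFin \o f).
Proof.
move=> mD mf ig fg; apply: le_integrable ig => //; first exact/measurable_EFinP.
by move=> x Dx; rewrite /= lee_fin (le_trans (fg x Dx))// ler_norm.
Qed.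

Lemma integrableRD D f g : measurable D -> mu.-integrable D (EFin \o f) ->
  mu.-integrable D (EFin \o g) -> mu.-integrable D (EFin \o (fun x => f x + g x)).
Proof. by move=> mD iF iG; have := integrableD mD iF iG. Qed.

Lemma integrableRB D f g : measurable D -> mu.-integrable D (EFin \o f) ->
  mu.-integrable D (EFin \o g) -> mu.-integrable D (EFin \o (fun x => f x - g x)).
Proof. by move=> mD iF iG; have := integrableB mD iF iG. Qed.

Lemma integrableRZ D (c : R) f : measurable D -> mu.-integrable D (EFin \o f) ->
  mu.-integrable D (EFin \o (fun x => c * f x)).
Proof. by move=> mD iF; have := integrableZl mD c iF. Qed.

Lemma integrableR_measurable D f : mu.-integrable D (EFin \o f) -> measurable_fun D f.
Proof. by move=> /measurable_int/measurable_EFinP. Qed.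

Lemma integrableR_mul D (C : R) f (h : T -> R) : measurable D -> mu.-integrable D (EFin \o f) ->
  measurable_fun D h -> (forall x, D x -> `|h x| <= C) ->
  mu.-integrable D (EFin \o (fun x => f x * h x)).
Proof.
move=> mD iF mh hC; apply: (@integrable_le D _ (fun x => C * `|f x|)) => //.
- by apply: measurable_funM => //; exact: integrableR_measurable.
- by apply: integrableRZ => //; exact: integrable_norm.
- by move=> x Dx; rewrite normrM mulrC ler_wpM2r// hC.
Qed.

Lemma measurable_fun_if_le (f g h : T -> R) (c : R) : measurable_fun setT f ->
  measurable_fun setT g -> measurable_fun setT h ->
  measurable_fun setT (fun x => if h x <= c then f x else g x).
Proof. by move=> mf mg mh; apply: measurable_fun_ifT => //; exact: measurable_fun_ler. Qed.

Lemma Rint_ae_eq D (N : set T) f g : measurable D -> measurable N -> mu N = 0%E ->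
  measurable_fun D f -> measurable_fun D g -> (forall x, D x -> ~ N x -> f x = g x) ->
  \int[mu]_(x in D) f x = \int[mu]_(x in D) g x.
Proof.
move=> mD mN N0 mf mg fg; rewrite /Rintegral; congr fine.
apply: ae_eq_integral; [exact: mD|exact/measurable_EFinP|exact/measurable_EFinP|].
exists N; split => // x /= H; apply: contrapT => nN; apply: H => Dx.
by rewrite fg.
Qed.

Lemma measurable_sign D K : measurable K -> measurable_fun D (fun x => 2 * \1_K x - 1 : R).
Proof.
move=> mK; apply: measurable_funB; last exact: measurable_cst.
apply: measurable_funM; first exact: measurable_cst.
by apply: measurable_funTS; exact: measurable_indic.
Qed.

Lemma integrableR_indic D K f : measurable D -> measurable K -> mu.-integrable D (EFin \o f) ->
  mu.-integrable D (EFin \o (fun x => f x * \1_K x)).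
Proof.
move=> mD mK iF; apply: (@integrableR_mul _ 1) => //.
by move=> x _; rewrite indicE; case: (_ \in _); rewrite ?normr1 ?normr0.
Qed.

Lemma Rint_indic D K f : measurable D -> measurable K -> K `<=` D ->
  \int[mu]_(x in D) (f x * \1_K x) = \int[mu]_(x in K) f x.
Proof.
move=> mD mK KD; rewrite -[in RHS](setIidr KD) Rintegral_mkcondr.
apply: eq_Rintegral => x _; rewrite /patch indicE.
by case: (x \in K); rewrite ?mulr1 ?mulr0.
Qed.

Lemma Rint_le_subset D K f : measurable D -> measurable K -> K `<=` D ->
  mu.-integrable D (EFin \o f) -> (forall x, D x -> 0 <= f x) ->
  \int[mu]_(x in K) f x <= \int[mu]_(x in D) f x.
Proof.
move=> mD mK KD iF f0; apply: fine_le.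
- by apply: integrable_fin_num => //; apply: integrableS iF.
- exact: integrable_fin_num.
- apply: ge0_subset_integral => //.
  by have := measurable_int _ iF.
Qed.

Lemma Rint_ae0 D f : measurable D -> mu.-integrable D (EFin \o f) ->
  \int[mu]_(x in D) `|f x| <= 0 -> {ae mu, forall x, D x -> f x = 0}.
Proof.
move=> mD iF f0.
have E : \int[mu]_(x in D) `|f x| = 0 by apply/eqP; rewrite eq_le f0 Rintegral_ge0.
have H : (\int[mu]_(x in D) `|(f x)%:E| = 0)%E.
  have := fineK (integrable_fin_num mD (integrable_norm iF)).
  by rewrite -[fine _]/(\int[mu]_(x in D) `|f x|) E => <-.
have /ae_eq_integral_abs := mD.
move=> /(_ _ mu _ (measurable_int _ iF)) [+ _] => /(_ H).
by apply: filterS => x + Dx => /(_ Dx) [].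
Qed.

Lemma ge0_integral_preserving (phi : T -> T) : measurable_fun setT phi ->
  (forall A, measurable A -> mu (phi @^-1` A) = mu A) ->
  forall (D : set T) (f : T -> \bar R), measurable D -> measurable_fun D f ->
  (forall x, (0 <= f x)%E) ->
  (\int[mu]_(x in D) f x = \int[mu]_(x in phi @^-1` D) f (phi x))%E.
Proof.
move=> mphi inv D f mD mf f0.
rewrite -[RHS]/(\int[mu]_(x in phi @^-1` D) (f \o phi) x)%E.
rewrite -(ge0_integral_pushforward mphi mu mD mf)//.
by apply: eq_measure_integral => A mA _; rewrite -(inv _ mA).
Qed.

Lemma integral_preserving (phi : T -> T) : measurable_fun setT phi ->
  (forall A, measurable A -> mu (phi @^-1` A) = mu A) ->
  forall (D : set T) (f : T -> \bar R), measurable D -> measurable_fun D f ->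
  (\int[mu]_(x in D) f x = \int[mu]_(x in phi @^-1` D) f (phi x))%E.
Proof.
move=> mphi inv D f mD mf; rewrite integralE [RHS]integralE; congr (_ - _)%E.
- rewrite (ge0_integral_preserving mphi inv mD (measurable_funepos mf)); last by [].
  by apply: eq_integral => x _; rewrite !funeposE.
- rewrite (ge0_integral_preserving mphi inv mD (measurable_funeneg mf)); last by [].
  by apply: eq_integral => x _; rewrite !funenegE.
Qed.

End integration.

(** * Smooth products of functions of one variable *)

Section product_functions.
Context {R : realType} {n : nat}.
Implicit Types (p : 'I_n -> R -> R) (z : 'rV[R]_n).

Definition prodf p z : R := \prod_i p i (z 0 i).

Definition upd_derive (i : 'I_n) p : 'I_n -> R -> R :=
  fun j => if j == i then derive1 (p j) else p j.

Lemma is_derive_prodf p z i : (forall j, csmooth (p j)) ->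
  is_derive z (delta_mx 0 i) (prodf p) (prodf (upd_derive i p) z).
Proof.
move=> sp; set rest := \prod_(j | j != i) p j (z 0 j).
have E h : h^-1 *: ((prodf p \o shift z) (h *: delta_mx 0 i) - prodf p z) =
    rest * (h^-1 *: ((p i \o shift (z 0 i)) (h *: 1) - p i (z 0 i))).
  rewrite /prodf /= (bigD1 i)//= [X in _ - X](bigD1 i)//= !mxE !eqxx mulr1.
  rewrite (_ : \prod_(j | j != i) p j _ = rest); last first.
    by apply: eq_bigr => j ji; rewrite !mxE (negbTE ji) mulr0 add0r.
  by rewrite -mulrBl /GRing.scale/= mulr1; ring.
have H : (fun h => h^-1 *: ((prodf p \o shift z) (h *: delta_mx 0 i) - prodf p z)) @ 0^'
    --> prodf (upd_derive i p) z.
  under eq_fun do rewrite E.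
  have -> : prodf (upd_derive i p) z = rest * 'D_1 (p i) (z 0 i).
    rewrite /prodf (bigD1 i)//= /upd_derive eqxx derive1E mulrC; congr (_ * _).
    by apply: eq_bigr => j ji; rewrite (negbTE ji).
  apply: cvgM; first exact: cvg_cst.
  have : derivable (p i) (z 0 i) 1 by exact: csmooth_derivable.
  exact.
by apply: DeriveDef; [apply/cvg_ex; exists (prodf (upd_derive i p) z)|apply/cvg_lim].
Qed.

Lemma partial_prodf p i : (forall j, csmooth (p j)) ->
  partial i (prodf p) = prodf (upd_derive i p).
Proof.
move=> sp; apply/funext => z; rewrite /partial.
by have ? := is_derive_prodf z i sp; rewrite derive_val.
Qed.

Lemma continuous_prodf p : (forall j, continuous (p j)) -> continuous (prodf p).
Proof.
move=> cp.
suff H (r : seq 'I_n) : continuous (fun z => \prod_(i <- r) p i (z 0 i)) by exact: H.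
elim: r => [|i r IH].
  rewrite (_ : (fun z => _) = cst (1 : R)); first exact: cst_continuous.
  by apply/funext => z; rewrite big_nil.
rewrite (_ : (fun z => _) = (fun z => p i (z 0 i) * \prod_(i <- r) p i (z 0 i))); last first.
  by apply/funext => z; rewrite big_cons.
move=> z.
have c1 : {for z, continuous (fun z : 'rV[R]_n => p i (z 0 i))}.
  by apply: (@continuous_comp _ _ _ (fun z : 'rV[R]_n => z 0 i) (p i)); [exact: coord_continuous|exact: cp].
exact: (continuousM c1 (IH z)).
Qed.

Lemma csmooth_upd_derive i p : (forall j, csmooth (p j)) -> forall j, csmooth (upd_derive i p j).
Proof. by move=> sp j; rewrite /upd_derive; case: ifP => // _; exact: csmooth_derive1. Qed.

(** A partial derivative of a product is again a product, with one factor differentiated, so every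
    iterated partial derivative stays in the class. *)
Lemma smooth_prodf p : (forall j, csmooth (p j)) -> smooth (prodf p).
Proof.
move=> sp s /=.
suff [q sq ->] : exists2 q, (forall j, csmooth (q j)) & foldr (@partial R n) (prodf p) s = prodf q.
  split; first by apply: continuous_prodf => j; exact: csmooth_continuous.
  by move=> z i; have ? := is_derive_prodf z i sq; exact: ex_derive.
elim: s => [|i s [q sq IH]]/=; first by exists p.
by rewrite IH partial_prodf//; exists (upd_derive i q) => //; exact: csmooth_upd_derive.
Qed.

Lemma compact_box (p : option ('rV[R]_n * 'rV[R]_n)) : compact (@box R n p).
Proof.
case: p => [[a b]|]; last exact: compact0.
have := @rV_compact R n (fun i => `[a 0 i, b 0 i]%classic) (fun i => @segment_compact R _ _).
congr compact; apply/seteqP; split => x /= H i; have := H i; rewrite in_itv //=.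
Qed.

Lemma test_function_prodf (Omega : set 'rV[R]_n) p a b : (forall j, csmooth (p j)) ->
  box (Some (a, b)) `<=` Omega ->
  (forall j t, ~~ (a 0 j <= t <= b 0 j) -> p j t = 0) -> test_function Omega (prodf p).
Proof.
move=> sp abO p0; split; first exact: smooth_prodf.
exists (box (Some (a, b))); split => //; first exact: compact_box.
move=> x /= /existsNP[i /negP xi]; rewrite /prodf (bigD1 i)//= p0 ?mul0r//.
Qed.

End product_functions.

(** * Smoothed indicators and tents *)

Section approximation.
Context {R : realType}.
Implicit Types (a b h t e : R).

Let eps (k : nat) : R := k.+1%:R^-1.

(* smooth approximations of the indicator of ]a, b] and of the tent function
   whose derivative is the indicator of ]a + h, b + h] minus that of ]a, b] *)
Definition bump e a b t : R := step ((t - a) / e) - step ((t - b) / e).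
Definition rampe e s : R := e * ramp (s / e).
Definition tente e a b h t : R :=
  rampe e (t - a - h) - rampe e (t - b - h) - rampe e (t - a) + rampe e (t - b).
Definition tent a b h t : R :=
  Num.max 0 (t - a - h) - Num.max 0 (t - b - h) - Num.max 0 (t - a) + Num.max 0 (t - b).
Definition dtente e a b h t : R :=
  dramp ((t - a - h) / e) - dramp ((t - b - h) / e) - dramp ((t - a) / e) + dramp ((t - b) / e).

Lemma csmooth_comp_affine (f : R -> R) e a : csmooth f -> csmooth (fun t => f ((t - a) / e)).
Proof.
move=> sf k; have := @cdiff_affine R k f e^-1 (- a / e) (sf k).
by under eq_fun do rewrite mulrC -mulrDl.
Qed.

Lemma csmoothB (f g : R -> R) : csmooth f -> csmooth g -> csmooth (fun t => f t - g t).
Proof.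
move=> sf sg k; apply: cdiffD => //.
have := cdiffM (cdiff_cst k (-1)) (sg k).
by under eq_fun do rewrite mulN1r.
Qed.

Lemma csmoothD (f g : R -> R) : csmooth f -> csmooth g -> csmooth (fun t => f t + g t).
Proof. by move=> sf sg k; apply: cdiffD. Qed.

Lemma csmooth_bump e a b : csmooth (bump e a b).
Proof. by apply: csmoothB; apply: csmooth_comp_affine; exact: csmooth_step. Qed.

Lemma csmooth_rampe e a : csmooth (fun t => rampe e (t - a)).
Proof.
move=> k; apply: cdiffM; first exact: cdiff_cst.
exact: csmooth_comp_affine csmooth_ramp k.
Qed.

Lemma csmooth_rampe2 e a h : csmooth (fun t => rampe e (t - a - h)).
Proof. by under eq_fun do rewrite -addrA -opprD; exact: csmooth_rampe. Qed.

Lemma csmooth_tente e a b h : csmooth (tente e a b h).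
Proof.
apply: csmoothD; last exact: csmooth_rampe.
apply: csmoothB; last exact: csmooth_rampe.
by apply: csmoothB; exact: csmooth_rampe2.
Qed.

Lemma is_derive_rampe e a t : e != 0 ->
  is_derive t (1 : R) (fun t => rampe e (t - a)) (dramp ((t - a) / e)).
Proof.
move=> e0.
have H : is_derive t (1 : R) (fun t => ramp (e^-1 * t + (- a / e))) (e^-1 * dramp (e^-1 * t + (- a / e))).
  by apply: is_derive_affine => x; apply: csmooth_derivable csmooth_ramp.
have Z := is_deriveZ e H.
have tE x : (x - a) / e = e^-1 * x + - a / e by rewrite mulrDl [x / e]mulrC.
rewrite (_ : (fun t => rampe e (t - a)) = e \*: (fun x : R => ramp (e^-1 * x + - a / e))); last first.
  by apply/funext => x; rewrite /rampe tE.
rewrite (_ : dramp _ = e *: (e^-1 * dramp (e^-1 * t + - a / e))); first exact: Z.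
by rewrite tE /GRing.scale /= mulVKf.
Qed.

Lemma derive1_tente e a b h : e != 0 -> derive1 (tente e a b h) = dtente e a b h.
Proof.
move=> e0; apply/funext => t; rewrite derive1E.
have D c := is_derive_rampe c t e0.
have D2 c : is_derive t (1 : R) (fun t => rampe e (t - c - h)) (dramp ((t - c - h) / e)).
  have := D (c + h).
  rewrite (_ : (fun t => rampe e (t - (c + h))) = (fun t => rampe e (t - c - h))).
    by rewrite opprD addrA.
  by apply/funext => x; rewrite opprD addrA.
have := is_deriveD (is_deriveB (is_deriveB (D2 a) (D2 b)) (D a)) (D b).
by move=> H; exact: (@derive_val _ _ _ _ _ _ _ H).
Qed.

Lemma rampe_npos e s : 0 < e -> s <= 0 -> rampe e s = 0.
Proof. by move=> e0 s0; rewrite /rampe ramp_npos ?mulr0// pmulr_lle0 ?invr_gt0. Qed.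

Lemma rampe_ge e s : 0 < e -> e <= s -> rampe e s = s.
Proof. by move=> e0 s0; rewrite /rampe ramp_ge1 ?ler_pdivlMr ?mul1r// mulrC divfK// gt_eqF. Qed.

Lemma rampe_bound e s : 0 < e -> 0 <= rampe e s <= Num.max 0 s.
Proof.
move=> e0; have [s0|s0] := leP s 0; first by rewrite rampe_npos// !lexx.
have -> : rampe e s = s * step (s / e) by rewrite /rampe /ramp mulrA [e * _]mulrC divfK ?gt_eqF.
by rewrite mulr_ge0 ?step_ge0 ?(ltW s0)//= ler_piMr ?step_le1// ltW.
Qed.

Lemma near_eps_le (s : R) : 0 < s -> \forall k \near \oo, eps k < s.
Proof. by move=> s0; exact: near_infty_natSinv_lt (PosNum s0). Qed.

(** At each point the rescaled profile is equal to its limit for all large [k], so that pointwise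
    convergence of the approximations below is eventual equality. *)
Lemma near_scaled (f : R -> R) (c s e0 : R) : 0 < e0 -> (forall s, s <= 0 -> f s = 0) ->
  (forall s, 1 < s -> f s = c) -> \forall k \near \oo, f (s / (e0 * eps k)) = if 0 < s then c else 0.
Proof.
move=> e00 f0 f1; case: ltP => s0.
  near=> k; rewrite f1// ltr_pdivlMr ?mulr_gt0 ?invr_gt0// mul1r mulrC -ltr_pdivlMr//.
  by near: k; apply: near_eps_le; rewrite divr_gt0.
apply: nearW => k; rewrite f0// pmulr_lle0// invr_gt0 mulr_gt0// invr_gt0//.
Unshelve. all: by end_near. Qed.

Lemma near_rampe (s e0 : R) : 0 < e0 ->
  \forall k \near \oo, rampe (e0 * eps k) s = Num.max 0 s.
Proof.
move=> e00; have [s0|s0] := leP s 0.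
  by apply: nearW => k; rewrite rampe_npos// mulr_gt0// invr_gt0.
near=> k; rewrite rampe_ge ?mulr_gt0 ?invr_gt0//.
rewrite mulrC -ler_pdivlMr//; apply/ltW; near: k; apply: near_eps_le.
by rewrite divr_gt0.
Unshelve. all: by end_near. Qed.

Lemma near_bump e0 a b t : 0 < e0 -> a <= b ->
  \forall k \near \oo, bump (e0 * eps k) a b t = (a < t <= b)%R%:R.
Proof.
move=> e00 ab; near=> k.
rewrite /bump (near (near_scaled (t - a) e00 step0 (fun s s1 => step1 (ltW s1))) k)//.
rewrite (near (near_scaled (t - b) e00 step0 (fun s s1 => step1 (ltW s1))) k)//.
rewrite !subr_gt0; case: (ltP a t) => at_; case: (ltP b t) => bt //=; try lra.
Unshelve. all: by end_near. Qed.

Lemma near_dtente e0 a b h t : 0 < e0 -> a <= b ->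
  \forall k \near \oo, dtente (e0 * eps k) a b h t = (a + h < t <= b + h)%R%:R - (a < t <= b)%R%:R.
Proof.
move=> e00 ab.
have d0 s : s <= 0 -> dramp s = 0 :> R.
  by rewrite le_eqVlt => /predU1P[->|]; [exact: dramp0|exact: dramp_neg].
have H s := near_scaled s e00 d0 (@dramp_gt1 R).
near=> k.
rewrite /dtente (near (H (t - a - h)) k)// (near (H (t - b - h)) k)//.
rewrite (near (H (t - a)) k)// (near (H (t - b)) k)//.
rewrite -2!(addrA t) -2!opprD !subr_gt0.
case: (ltP a t) => a1; case: (ltP b t) => b1; case: (ltP (a + h) t) => a2;
  case: (ltP (b + h) t) => b2 //=; try lra.
Unshelve. all: by end_near. Qed.

Lemma near_tente e0 a b h t : 0 < e0 ->
  \forall k \near \oo, tente (e0 * eps k) a b h t = tent a b h t.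
Proof.
move=> e00; near=> k; rewrite /tente /tent.
by congr (_ - _ - _ + _); near: k; exact: near_rampe.
Unshelve. all: by end_near. Qed.

Lemma bump_supp e a b t : 0 < e -> a <= b -> ~~ (a <= t <= b + e) -> bump e a b t = 0.
Proof.
move=> e0 ab; rewrite negb_and -!ltNge /bump => /orP[ta|bt].
  by rewrite !step0 ?subrr// pmulr_lle0 ?invr_gt0//; lra.
by rewrite !step1 ?subrr// ler_pdivlMr ?mul1r//; lra.
Qed.

Lemma tente_supp e a b h t : 0 < e -> a <= b -> 0 <= h ->
  ~~ (a <= t <= b + h + e) -> tente e a b h t = 0.
Proof.
move=> e0 ab h0; rewrite negb_and -!ltNge /tente => /orP[ta|bt].
  by rewrite !rampe_npos//; lra.
by rewrite !rampe_ge//; lra.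
Qed.

Lemma dtente_supp e a b h t : 0 < e -> a <= b -> 0 <= h ->
  ~~ (a <= t <= b + h + e) -> dtente e a b h t = 0.
Proof.
move=> e0 ab h0; rewrite negb_and -!ltNge /dtente => /orP[ta|bt].
  by rewrite !dramp_neg ?subrr ?addr0// pmulr_llt0 ?invr_gt0//; lra.
have H s : e < s -> dramp (s / e) = 1 by move=> es; rewrite dramp_gt1// ltr_pdivlMr// mul1r.
by rewrite !H; lra.
Qed.

Lemma bump_bound e a b t : `|bump e a b t| <= 1.
Proof.
rewrite /bump ler_norml; move: (step_ge0 ((t - a) / e)) (step_le1 ((t - a) / e)).
by move: (step_ge0 ((t - b) / e)) (step_le1 ((t - b) / e)); lra.
Qed.

Lemma tente_bound e a b h t M : 0 < e -> a <= b -> 0 <= h -> 0 <= M -> t - a <= M ->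
  `|tente e a b h t| <= 2 * M.
Proof.
move=> e0 ab h0 M0 tM.
have H s : s <= M -> 0 <= rampe e s <= M.
  move=> sM; have /andP[-> /= /le_trans ->//] := rampe_bound s e0.
  by rewrite ge_max M0.
have := H (t - a) tM; have := H (t - b) _; have := H (t - a - h) _; have := H (t - b - h) _.
rewrite ler_norml /tente.
by move=> /(_ ltac:(lra))/andP[? ?] /(_ ltac:(lra))/andP[? ?] /(_ ltac:(lra))/andP[? ?] /andP[? ?]; lra.
Qed.

(** Differentiation cancels the prefactor of [rampe], hence the bound is uniform in the scale [e],
    as dominated convergence requires. *)
Lemma dtente_bound : exists2 C : R, 0 < C & forall e a b h t, `|dtente e a b h t| <= C.
Proof.
have [C C0 HC] := @dramp_bounded R; exists (4 * C) => [|e a b h t]; first by rewrite mulr_gt0.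
have H (x y z w : R) : `|x| <= C -> `|y| <= C -> `|z| <= C -> `|w| <= C -> `|x - y - z + w| <= 4 * C.
  rewrite !ler_norml => /andP[? ?] /andP[? ?] /andP[? ?] /andP[? ?].
  by apply/andP; split; lra.
by apply: H; exact: HC.
Qed.

(** The tent falls with slope 1 on ]a, b] and rises with slope 1 on ]a + h, b + h], so its height is
    at most the side [b - a] as well as [h]. The bound by the side is the one compatible with
    halving in [hull_split_le]. *)
Lemma tent_bound a b h t : a <= b -> 0 <= h -> `|tent a b h t| <= (b - a) * (a < t <= b + h)%R%:R.
Proof.
move=> ab h0; rewrite /tent.
have [? | ?] := leP (t - a - h) 0; have [? | ?] := leP (t - b - h) 0;
  have [? | ?] := leP (t - a) 0; have [? | ?] := leP (t - b) 0;
  case: (ltP a t) => ? /=; case: (leP t (b + h)) => ? /=; rewrite ler_norml; lra.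
Qed.

End approximation.

Section leb_compact.
Context {R : realType} {n : nat}.
Local Notation L := (leb_space R n).

Lemma measurable_leb_compact (K : set 'rV[R]_n) : compact K -> measurable (K : set L).
Proof. by move=> cK; apply: measurable_leb_closed; apply: compact_closed. Qed.

Lemma loc_integrable_compact (D K : set 'rV[R]_n) f : open D ->
  loc_integrable D f -> compact K -> K `<=` D -> (leb R n).-integrable K (EFin \o f).
Proof.
move=> oD [mf fK] cK KD; apply/integrableP; split; last exact: fK.
apply/measurable_EFinP; apply: measurable_funS mf => //.
exact: measurable_leb_open.
Qed.

Lemma compact_sub_open_ball (K U : set 'rV[R]_n) : compact K -> open U -> K `<=` U ->
  exists2 e : R, 0 < e & forall x, K x -> ball x e `<=` U.
Proof.
move=> /compact_near_coveringP cK oU KU.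
have H : \forall e \near 0^'+, K `<=` (fun x => ball x (e : R) `<=` U).
  apply: (cK _ (0 : R)^'+ (fun e x => ball x (e : R) `<=` U)) => x Kx.
  have /nbhs_ballP[d /= d0 dU] := open_nbhs_nbhs (conj oU (KU _ Kx)).
  exists (ball x (d / 2), [set e | 0 < e < d / 2]); first split => /=.
  - by apply: nbhsx_ballx; rewrite divr_gt0.
  - near=> e; apply/andP; split => //; near: e; apply: nbhs_right_lt; rewrite divr_gt0//.
  case=> y e /= [xy /andP[e0 ed]] z yz; apply: dU.
  by rewrite [d]splitr; apply: ball_triangle xy _; apply: le_ball yz; exact: ltW.
have [e [e0 He]] : exists e : R, 0 < e /\ K `<=` (fun x => ball x e `<=` U).
  near (0 : R)^'+ => e; exists e; split => //.
  by near: e.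
by exists e.
Unshelve. all: by end_near. Qed.

Lemma box_sub_open_enlarge (U : set 'rV[R]_n) a b : open U -> box (Some (a, b)) `<=` U ->
  (forall i, a 0 i <= b 0 i) ->
  exists2 e : R, 0 < e & box (Some (a, b + const_mx e)) `<=` U.
Proof.
move=> oU abU ab; have [e e0 H] := compact_sub_open_ball (@compact_box R n (Some (a, b))) oU abU.
exists (e / 2); first by rewrite divr_gt0.
move=> y yab; apply: (H (\row_i Num.min (y 0 i) (b 0 i))).
  move=> i; rewrite mxE; have := yab i; rewrite !mxE => /andP[ay _].
  by rewrite le_min ay ab ge_min lexx orbT.
split => // i j; rewrite (ord1 i) /ball/= mxE; have := yab j; rewrite !mxE => /andP[ay yb].
have [yb'|by'] := leP (y 0 j) (b 0 j); first by rewrite subrr normr0.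
rewrite distrC ger0_norm; lra.
Qed.

Lemma indic_hbox (a b z : 'rV[R]_n) : \1_(hbox a b) z = \prod_j (a 0 j < z 0 j <= b 0 j)%R%:R :> R.
Proof.
rewrite indicE; case: (boolP (_ \in _)) => [|/negP]; rewrite inE.
  by move=> H; rewrite big1// => j _; rewrite H.
by move=> /existsNP[j /negP/negbTE jab]; rewrite (bigD1 j)//= jab mul0r.
Qed.

End leb_compact.

(** Products of smoothed indicators are test functions that converge boundedly to the indicator of
    the half-open box, with supports in one slightly enlarged closed box inside [Omega]. *)
Lemma hbox_integral_eq0 (R : realType) (n : nat) (Omega : set 'rV[R]_n) (f : 'rV[R]_n -> R) (a b : 'rV[R]_n) :
  open Omega -> loc_integrable Omega f ->
  (forall phi, test_function Omega phi -> (\int[leb R n]_(z in Omega) (f z * phi z)%:E = 0)%E) ->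
  (forall j, a 0 j <= b 0 j) -> box (Some (a, b)) `<=` Omega ->
  \int[leb R n]_(z in hbox a b) f z = 0.
Proof.
move=> oO lf f0 ab abO.
have [e e0 eO] := box_sub_open_enlarge oO abO ab.
set K := box (Some (a, b + const_mx e)) in eO.
have cK : compact K by exact: compact_box.
have mK : measurable (K : set (leb_space R n)) by exact: measurable_leb_compact.
have ifK : (leb R n).-integrable K (EFin \o f) by exact: (loc_integrable_compact oO lf cK eO).
pose ek (k : nat) := e * k.+1%:R^-1.
have ek0 k : 0 < ek k by rewrite mulr_gt0// invr_gt0.
have eke k : ek k <= e by rewrite ler_piMr ?(ltW e0)// invf_le1 ?ltr0n// ler1n.
pose p k j := bump (ek k) (a 0 j) (b 0 j).
have sp k j : csmooth (p k j) by exact: csmooth_bump.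
have pK k j t : ~~ (a 0 j <= t <= (b + const_mx e) 0 j) -> p k j t = 0.
  rewrite !mxE => H; apply: bump_supp => //; apply: contra H => /andP[-> /= /le_trans]; apply.
  by rewrite lerD2l.
have tp k : test_function Omega (prodf (p k)) by exact: (test_function_prodf (sp k) eO (pK k)).
have prodfK k (z : 'rV[R]_n) : ~ K z -> prodf (p k) z = 0.
  by move=> /existsNP[j /negP zj]; rewrite /prodf (bigD1 j)//= pK ?mul0r.
have [] := @dct_eventually _ (leb_space R n) R (leb R n) K (fun k z => f z * prodf (p k) z)
  (fun z => f z * \1_(hbox a b) z) (fun z => `|f z|) mK.
- move=> k; apply: measurable_funM; first exact: integrableR_measurable ifK.
  apply: measurable_funS (measurable_leb_continuous _) => //.
  by apply: continuous_prodf => j; exact: csmooth_continuous.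
- exact: integrable_norm.
- move=> k z Kz; rewrite normrM ler_piMr// normr_prod.
  by apply: prodr_ile1 => j _; rewrite normr_ge0 bump_bound.
- move=> z Kz; apply: cvg_near_cst.
  have : \forall k \near \oo, forall j, bump (ek k) (a 0 j) (b 0 j) (z 0 j) = (a 0 j < z 0 j <= b 0 j)%R%:R.
    by apply: filter_forall => j; exact: near_bump.
  by apply: filterS => k H; rewrite indic_hbox; congr (_ * _); apply: eq_bigr => j _; exact: H.
move=> _; rewrite Rint_indic//; [|exact: measurable_leb_hbox|]; last first.
  move=> z zab j; have /andP[z1 z2] := zab j; rewrite !mxE (ltW z1)/=.
  by apply: le_trans z2 _; rewrite lerDl ltW.
rewrite (_ : (fun k => _) = cst 0) => [c0|].
  by apply: cvg_unique c0 _ => //; exact: cvg_cst.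
apply/funext => k; rewrite /Rintegral.
have := f0 _ (tp k); rewrite (@integral_support _ (leb_space R n) R (leb R n) Omega K _ eO).
  by move=> ->.
by move=> z _ /(prodfK k) E; rewrite E mulr0.
Qed.

(** * Integrals over a box and over its translate *)

Section wgrad_shift.
Context {R : realType} {n : nat}.
Variables (Omega : set 'rV[R]_n) (u : 'rV[R]_n -> R) (G : 'rV[R]_n -> 'rV[R]_n).
Hypothesis oO : open Omega.
Hypothesis iu : loc_integrable Omega u.
Hypothesis wg : is_wgrad Omega u G.
Local Notation L := (leb_space R n).
Local Notation mu := (leb R n).

(** The test function is a smoothed tent in the direction [i] times smoothed indicators in the other
    directions. Its derivative tends to the indicator of the translated box minus that of the box,
    and its own limit is bounded by the side of the box on the hull of both boxes and vanishes
    elsewhere. *)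
Lemma wgrad_shift_le (i : 'I_n) (a b : 'rV[R]_n) (h : R) : (forall j, a 0 j <= b 0 j) -> 0 <= h ->
  box (Some (a, b + h *: delta_mx 0 i)) `<=` Omega ->
  `| \int[mu]_(z in hbox (a + h *: delta_mx 0 i) (b + h *: delta_mx 0 i)) u z -
     \int[mu]_(z in hbox a b) u z | <=
  (b 0 i - a 0 i) * \int[mu]_(z in hbox a (b + h *: delta_mx 0 i)) `|G z 0 i|.
Proof.
move=> ab h0; set hi := h *: delta_mx 0 i => abO.
have hi_i : hi 0 i = h by rewrite !mxE !eqxx mulr1.
have hi_j j : j != i -> hi 0 j = 0 by move=> ji; rewrite !mxE (negbTE ji) mulr0.
have ab' j : a 0 j <= (b + hi) 0 j.
  by rewrite mxE; have [->|/hi_j->] := eqVneq j i; rewrite ?hi_i ?addr0//; have := ab i; lra.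
have [e e0 eO] := box_sub_open_enlarge oO abO ab'.
set K := box (Some (a, b + hi + const_mx e)) in eO.
have cK : compact K by exact: compact_box.
have mK : measurable (K : set L) by exact: measurable_leb_compact.
have iuK : mu.-integrable K (EFin \o u) by exact: (loc_integrable_compact oO iu cK eO).
have iGK : mu.-integrable K (EFin \o (fun z => G z 0 i)).
  by exact: (loc_integrable_compact oO (wg i).1 cK eO).
pose ek (k : nat) := e * k.+1%:R^-1.
have ek0 k : 0 < ek k by rewrite mulr_gt0// invr_gt0.
have eke k : ek k <= e by rewrite ler_piMr ?(ltW e0)// invf_le1 ?ltr0n// ler1n.
pose p k j := if j == i then tente (ek k) (a 0 i) (b 0 i) h else bump (ek k) (a 0 j) (b 0 j).
have sp k j : csmooth (p k j).
  by rewrite /p; case: ifP => _; [exact: csmooth_tente|exact: csmooth_bump].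
have pK k j t : ~~ (a 0 j <= t <= (b + hi + const_mx e) 0 j) -> p k j t = 0.
  rewrite !mxE /p; case: (eqVneq j i) => [-> H|ji H].
    apply: tente_supp => //; apply: contra H; rewrite !eqxx mulr1 => /andP[-> /= /le_trans]; apply.
    by rewrite lerD2l.
  apply: bump_supp => //; apply: contra H; rewrite andbF mulr0 addr0 => /andP[-> /= /le_trans]; apply.
  by rewrite lerD2l.
have tp k : test_function Omega (prodf (p k)).
  exact: (test_function_prodf (sp k) eO (pK k)).
pose q k := upd_derive i (p k).
have qE k (z : 'rV[R]_n) : prodf (q k) z = dtente (ek k) (a 0 i) (b 0 i) h (z 0 i) *
    \prod_(j | j != i) bump (ek k) (a 0 j) (b 0 j) (z 0 j).
  rewrite /prodf (bigD1 i)//= /q /upd_derive eqxx /p eqxx derive1_tente ?gt_eqF//.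
  by congr *%R; apply: eq_bigr => j /negbTE ->.
have pE k (z : 'rV[R]_n) : prodf (p k) z = tente (ek k) (a 0 i) (b 0 i) h (z 0 i) *
    \prod_(j | j != i) bump (ek k) (a 0 j) (b 0 j) (z 0 j).
  rewrite /prodf (bigD1 i)//= /p eqxx.
  by congr *%R; apply: eq_bigr => j /negbTE ->.
have rest_le k (z : 'rV[R]_n) : `|\prod_(j | j != i) bump (ek k) (a 0 j) (b 0 j) (z 0 j)| <= 1.
  by rewrite normr_prod; apply: prodr_ile1 => j _; rewrite normr_ge0 bump_bound.
have mprodf r : (forall j, csmooth (r j)) -> measurable_fun (K : set L) (prodf r).
  move=> sr; apply: measurable_funS (measurable_leb_continuous _) => //.
  by apply: continuous_prodf => j; exact: csmooth_continuous.
have near_rest (z : 'rV[R]_n) : \forall k \near \oo,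
    \prod_(j | j != i) bump (ek k) (a 0 j) (b 0 j) (z 0 j) =
    \prod_(j | j != i) (a 0 j < z 0 j <= b 0 j)%R%:R.
  have : \forall k \near \oo, forall j, bump (ek k) (a 0 j) (b 0 j) (z 0 j) = (a 0 j < z 0 j <= b 0 j)%R%:R.
    by apply: filter_forall => j; exact: near_bump.
  by apply: filterS => k H; apply: eq_bigr => j _.
have [C C0 HC] := @dtente_bound R.
pose M := b 0 i + h + e - a 0 i.
have M0 : 0 <= M by rewrite /M; have := ab i; lra.
pose phi (z : 'rV[R]_n) := tent (a 0 i) (b 0 i) h (z 0 i) * \prod_(j | j != i) (a 0 j < z 0 j <= b 0 j)%R%:R.
have [] := @dct_eventually _ L R mu K (fun k z => G z 0 i * prodf (p k) z)
  (fun z => G z 0 i * phi z) (fun z => 2 * M * `|G z 0 i|) mK.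
- by move=> k; apply: measurable_funM; [exact: integrableR_measurable iGK|exact: mprodf].
- by apply: integrableRZ => //; exact: integrable_norm.
- move=> k z Kz; rewrite normrM mulrC ler_wpM2r// pE normrM.
  apply: le_trans (_ : 2 * M * 1 <= _); last by rewrite mulr1.
  apply: ler_pM => //; apply: tente_bound => //.
  by have := Kz i; rewrite !mxE !eqxx mulr1 /M => /andP[_]; lra.
- move=> z Kz; apply: cvg_near_cst.
  have := near_rest z; have := near_tente (a 0 i) (b 0 i) h (z 0 i) e0.
  by apply: filterS2 => k H1 H2; rewrite pE /phi H1 H2.
move=> iphi cphi.
pose psi (z : 'rV[R]_n) : R := \1_(hbox (a + hi) (b + hi)) z - \1_(hbox a b) z.
have psiE (z : 'rV[R]_n) : psi z = ((a 0 i + h < z 0 i <= b 0 i + h)%R%:R - (a 0 i < z 0 i <= b 0 i)%R%:R) *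
    \prod_(j | j != i) (a 0 j < z 0 j <= b 0 j)%R%:R.
  rewrite /psi !indic_hbox (bigD1 i)//= [X in _ - X](bigD1 i)//= mulrBl !mxE !eqxx mulr1.
  congr (_ * _ - _); apply: eq_bigr => j ji.
  by rewrite !mxE (negbTE ji) mulr0 !addr0.
have [] := @dct_eventually _ L R mu K (fun k z => u z * prodf (q k) z)
  (fun z => u z * psi z) (fun z => C * `|u z|) mK.
- move=> k; apply: measurable_funM; [exact: integrableR_measurable iuK|apply: mprodf].
  exact: csmooth_upd_derive.
- by apply: integrableRZ => //; exact: integrable_norm.
- move=> k z Kz; rewrite normrM mulrC ler_wpM2r// qE normrM.
  by rewrite -[leRHS]mulr1; apply: ler_pM.
- move=> z Kz; apply: cvg_near_cst.
  have := near_rest z; have := near_dtente h (z 0 i) e0 (ab i).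
  by apply: filterS2 => k H1 H2; rewrite qE psiE H1 H2.
move=> ipsi cpsi.
have prodfK r (z : 'rV[R]_n) : (forall j t, ~~ (a 0 j <= t <= (b + hi + const_mx e) 0 j) -> r j t = 0) ->
    ~ K z -> prodf r z = 0.
  move=> r0 /existsNP[j /negP zj].
  by rewrite /prodf (bigD1 j)//= r0 ?mul0r.
have E k : \int[mu]_(z in K) (u z * prodf (q k) z) = - \int[mu]_(z in K) (G z 0 i * prodf (p k) z).
  have qK j t : ~~ (a 0 j <= t <= (b + hi + const_mx e) 0 j) -> q k j t = 0.
    move=> H; rewrite /q /upd_derive; case: (eqVneq j i) => [ji|ji]; last exact: pK.
    rewrite /p ji eqxx derive1_tente ?gt_eqF//; apply: dtente_supp => //.
    apply: contra H; rewrite !mxE ji !eqxx mulr1 => /andP[-> /= /le_trans]; apply.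
    by rewrite lerD2l.
  have := (wg i).2 _ (tp k); rewrite partial_prodf//.
  rewrite (@integral_support _ L R mu Omega K _ eO); last first.
    by move=> z _ /(prodfK _ _ qK) E; rewrite E mulr0.
  rewrite [X in (_ = - X)%E -> _](@integral_support _ L R mu Omega K _ eO); last first.
    by move=> z _ /(prodfK _ _ (pK k)) E; rewrite E mulr0.
  by move=> H; rewrite /Rintegral H fineN.
have cphi' : (fun k => \int[mu]_(z in K) (u z * prodf (q k) z)) @ \oo -->
    - \int[mu]_(z in K) (G z 0 i * phi z).
  rewrite (_ : (fun k => _) = (fun k => - \int[mu]_(z in K) (G z 0 i * prodf (p k) z))).
    exact: cvgN.
  exact/funext.
have EE : \int[mu]_(z in K) (u z * psi z) = - \int[mu]_(z in K) (G z 0 i * phi z).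
  exact: cvg_unique cpsi cphi'.
have sub1 : hbox (a + hi) (b + hi) `<=` K.
  move=> z zab j; have /andP[z1 z2] := zab j; rewrite !mxE in z1 z2 *.
  have : 0 <= hi 0 j by have [->|/hi_j->] := eqVneq j i; rewrite ?hi_i.
  by rewrite !mxE => ?; apply/andP; split; lra.
have sub2 : hbox a b `<=` K.
  move=> z zab j; have /andP[z1 z2] := zab j; rewrite !mxE in z1 z2 *.
  have : 0 <= hi 0 j by have [->|/hi_j->] := eqVneq j i; rewrite ?hi_i.
  by rewrite !mxE => ?; apply/andP; split; lra.
have sub3 : hbox a (b + hi) `<=` K.
  move=> z zab j; have /andP[z1 z2] := zab j; rewrite !mxE in z1 z2 *.
  by apply/andP; split; lra.
have <- : \int[mu]_(z in K) (u z * psi z) = \int[mu]_(z in hbox (a + hi) (b + hi)) u z -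
     \int[mu]_(z in hbox a b) u z.
  under eq_Rintegral do rewrite mulrBr.
  rewrite (RintegralB mK (integrableR_indic mK _ iuK) (integrableR_indic mK _ iuK));
    try exact: measurable_leb_hbox.
  by rewrite !Rint_indic//; exact: measurable_leb_hbox.
rewrite EE normrN; apply: le_trans (le_normr_Rintegral mK iphi) _.
have mh := measurable_leb_hbox a (b + hi).
have iGn := integrable_norm iGK.
rewrite -(Rint_indic _ _ mK mh sub3) -(RintegralZl _ mK (integrableR_indic mK mh iGn)).
apply: (le_Rintegral mK (integrable_norm iphi) (integrableRZ _ mK (integrableR_indic mK mh iGn))).
move=> z Kz; rewrite /= normrM mulrCA ler_wpM2l//.
rewrite indic_hbox (bigD1 i)//= mulrA /phi normrM.
have -> : \prod_(j | j != i) (a 0 j < z 0 j <= (b + hi) 0 j)%R%:R =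
    \prod_(j | j != i) (a 0 j < z 0 j <= b 0 j)%R%:R :> R.
  by apply: eq_bigr => j ji; rewrite mxE hi_j// addr0.
rewrite [X in _ * X <= _]ger0_norm; last by apply: prodr_ge0.
by rewrite ler_wpM2r ?prodr_ge0// mxE hi_i; apply: tent_bound.
Qed.

End wgrad_shift.

(** * Total variation of integrals over dyadic boxes *)

Section dyadic_leaves.
Context {R : realType} {n : nat}.
Implicit Types (a b z : 'rV[R]_n) (i j : 'I_n) (s : seq 'I_n).
Local Notation L := (leb_space R n).
Local Notation mu := (leb R n).

Definition mid a b i : R := (a 0 i + b 0 i) / 2.
Definition lower_b a b i := set_coord b i (mid a b i).
Definition upper_a a b i := set_coord a i (mid a b i).

(** [s] lists the directions of the successive halvings, and a repeated direction is refined again.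
    Bounds on sums over the leaves are proved for every list by induction on it. *)
Fixpoint leaves s a b : seq ('rV[R]_n * 'rV[R]_n) :=
  if s is i :: s' then leaves s' a (lower_b a b i) ++ leaves s' (upper_a a b i) b
  else [:: (a, b)].

Fixpoint leaf s a b z : 'rV[R]_n * 'rV[R]_n :=
  if s is i :: s' then
    if z 0 i <= mid a b i then leaf s' a (lower_b a b i) z else leaf s' (upper_a a b i) b z
  else (a, b).

Lemma mid_bounds a b i : a 0 i <= b 0 i -> a 0 i <= mid a b i <= b 0 i.
Proof. by rewrite /mid => ab; apply/andP; split; lra. Qed.

Lemma hbox_lower a b i z : (forall j, a 0 j <= b 0 j) ->
  hbox a (lower_b a b i) z <-> hbox a b z /\ z 0 i <= mid a b i.
Proof.
move=> ab; have /andP[am mb] := mid_bounds (ab i); split.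
  move=> H; have := H i; rewrite set_coordE eqxx => /andP[az zm]; split => // j.
  have := H j; rewrite set_coordE; case: eqP => [->|_]// /andP[-> zm']/=.
  exact: le_trans zm' mb.
move=> [H zm] j; rewrite set_coordE; case: eqP => [->|_]; last exact: H.
by have /andP[-> _] := H i.
Qed.

Lemma hbox_upper a b i z : (forall j, a 0 j <= b 0 j) ->
  hbox (upper_a a b i) b z <-> hbox a b z /\ mid a b i < z 0 i.
Proof.
move=> ab; have /andP[am mb] := mid_bounds (ab i); split.
  move=> H; have := H i; rewrite set_coordE eqxx => /andP[az zm]; split => // j.
  have := H j; rewrite set_coordE; case: eqP => [->|_]// /andP[zm' ->]; rewrite andbT.
  exact: le_lt_trans am zm'.
move=> [H zm] j; rewrite set_coordE; case: eqP => [->|_]; last exact: H.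
by have /andP[_ ->] := H i; rewrite zm.
Qed.

Lemma lower_le a b i : (forall j, a 0 j <= b 0 j) -> forall j, a 0 j <= lower_b a b i 0 j.
Proof.
move=> ab j; rewrite set_coordE; case: eqP => [->|_]//.
by have /andP[] := mid_bounds (ab i).
Qed.

Lemma upper_le a b i : (forall j, a 0 j <= b 0 j) -> forall j, upper_a a b i 0 j <= b 0 j.
Proof.
move=> ab j; rewrite set_coordE; case: eqP => [->|_]//.
by have /andP[] := mid_bounds (ab i).
Qed.

Lemma hbox_halves a b i : (forall j, a 0 j <= b 0 j) ->
  hbox a b = hbox a (lower_b a b i) `|` hbox (upper_a a b i) b.
Proof.
move=> ab; apply/seteqP; split => z.
  by move=> H; have [zm|zm] := leP (z 0 i) (mid a b i); [left; apply/hbox_lower|right; apply/hbox_upper].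
by case=> [/hbox_lower|/hbox_upper] => /(_ ab) [].
Qed.

Lemma halves_disjoint a b i : (forall j, a 0 j <= b 0 j) ->
  [disjoint hbox a (lower_b a b i) & hbox (upper_a a b i) b].
Proof.
move=> ab; apply/eqP/seteqP; split => // z [/(hbox_lower i z ab)[_ zm] /(hbox_upper i z ab)[_]].
by rewrite ltNge zm.
Qed.

Lemma Rint_halves f a b i : (forall j, a 0 j <= b 0 j) ->
  mu.-integrable (hbox a b) (EFin \o f) ->
  \int[mu]_(z in hbox a b) f z =
  \int[mu]_(z in hbox a (lower_b a b i)) f z + \int[mu]_(z in hbox (upper_a a b i) b) f z.
Proof.
move=> ab iF; rewrite {1}(hbox_halves i ab).
apply: Rintegral_setU; [exact: measurable_leb_hbox|exact: measurable_leb_hbox| |exact: halves_disjoint].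
by rewrite -(hbox_halves i ab).
Qed.

Lemma integrable_lower (f : 'rV[R]_n -> R) a b i : (forall j, a 0 j <= b 0 j) ->
  mu.-integrable (hbox a b) (EFin \o f) ->
  mu.-integrable (hbox a (lower_b a b i)) (EFin \o f).
Proof.
move=> ab; apply: integrableS; [exact: measurable_leb_hbox|exact: measurable_leb_hbox|].
by move=> z /(hbox_lower i z ab)[].
Qed.

Lemma integrable_upper (f : 'rV[R]_n -> R) a b i : (forall j, a 0 j <= b 0 j) ->
  mu.-integrable (hbox a b) (EFin \o f) ->
  mu.-integrable (hbox (upper_a a b i) b) (EFin \o f).
Proof.
move=> ab; apply: integrableS; [exact: measurable_leb_hbox|exact: measurable_leb_hbox|].
by move=> z /(hbox_upper i z ab)[].
Qed.

Lemma leaf_mem s a b z : (forall j, a 0 j <= b 0 j) -> hbox a b z ->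
  hbox (leaf s a b z).1 (leaf s a b z).2 z.
Proof.
elim: s a b => //= i s IH a b ab zab; case: leP => zm; apply: IH.
- exact: lower_le.
- exact/hbox_lower.
- exact: upper_le.
- exact/hbox_upper.
Qed.

Lemma leaf_side s a b z j :
  (leaf s a b z).2 0 j - (leaf s a b z).1 0 j = (b 0 j - a 0 j) / 2 ^+ count_mem j s.
Proof.
elim: s a b => [|i s IH] a b /=; first by rewrite divr1.
rewrite exprD invfM mulrA; case: leP => _; rewrite IH; congr (_ / _).
  rewrite set_coordE eq_sym; case: eqP => [->|_]; rewrite /mid ?expr1 ?expr0 ?divr1//; lra.
rewrite set_coordE eq_sym; case: eqP => [->|_]; rewrite /mid ?expr1 ?expr0 ?divr1//; lra.
Qed.

Section variation.
Variable U : set 'rV[R]_n.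

(** A function that is constant on each leaf and approximates the sign 2 1_U - 1 from inside [U];
    pairing with it costs at most the sum of the absolute integrals over the leaves. *)
Definition leaf_sign s a b z : R :=
  if `[< hbox (leaf s a b z).1 (leaf s a b z).2 `<=` U >] then 1 else -1.

Lemma leaf_sign_norm s a b z : `|leaf_sign s a b z| = 1.
Proof. by rewrite /leaf_sign; case: ifP => _; rewrite ?normrN normr1. Qed.

Lemma measurable_leaf_sign s a b : measurable_fun setT (leaf_sign s a b : L -> R).
Proof.
elim: s a b => [|i s IH] a b.
  by rewrite /leaf_sign /=; exact: measurable_cst.
rewrite (_ : leaf_sign _ a b = fun z => if z 0 i <= mid a b i then
   leaf_sign s a (lower_b a b i) z else leaf_sign s (upper_a a b i) b z); last first.
  by apply/funext => z; rewrite /leaf_sign /=; case: (z 0 i <= mid a b i).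
exact: (measurable_fun_if_le _ (IH _ _) (IH _ _) (measurable_leb_coord i)).
Qed.

Lemma leaf_sign_le s a b v : (forall j, a 0 j <= b 0 j) ->
  mu.-integrable (hbox a b) (EFin \o v) ->
  \int[mu]_(z in hbox a b) (v z * leaf_sign s a b z) <=
  \sum_(q <- leaves s a b) `|\int[mu]_(z in hbox q.1 q.2) v z|.
Proof.
elim: s a b => [|i s IH] a b ab iv.
  have mh := measurable_leb_hbox a b.
  rewrite /= big_seq1 /leaf_sign /=; case: ifP => _; rewrite (RintegralZr _ mh iv).
    by rewrite mulr1 ler_norm.
  by rewrite mulrN1 -normrN ler_norm.
rewrite /= big_cat/=.
have ivs : mu.-integrable (hbox a b) (EFin \o (fun z => v z * leaf_sign (i :: s) a b z)).
  apply: (@integrableR_mul _ _ _ _ _ 1) => //; first exact: measurable_leb_hbox.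
    exact: measurable_funTS (measurable_leaf_sign _ _ _).
  by move=> z _; rewrite leaf_sign_norm.
rewrite (Rint_halves i ab ivs); apply: lerD.
  apply: le_trans (IH _ _ (lower_le i ab) (integrable_lower i ab iv)).
  rewrite le_eqVlt; apply/orP; left; apply/eqP; apply: eq_Rintegral => z.
  by rewrite inE => /(hbox_lower i z ab)[_ zm]; rewrite /leaf_sign/= zm.
apply: le_trans (IH _ _ (upper_le i ab) (integrable_upper i ab iv)).
rewrite le_eqVlt; apply/orP; left; apply/eqP; apply: eq_Rintegral => z.
by rewrite inE => /(hbox_upper i z ab)[_ zm]; rewrite /leaf_sign/= leNgt zm.
Qed.

Definition all_dirs (k : nat) : seq 'I_n := flatten (nseq k (enum 'I_n)).

Lemma count_all_dirs k j : count_mem j (all_dirs k) = k.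
Proof.
elim: k => //= k IH; rewrite /all_dirs/= count_cat -/(all_dirs k) IH.
by rewrite count_uniq_mem ?enum_uniq// mem_enum.
Qed.

Lemma leaf_sign_cvg a b z : open U -> (forall j, a 0 j <= b 0 j) -> hbox a b z ->
  leaf_sign (all_dirs k) a b z @[k --> \oo] --> (2 * \1_U z - 1 : R).
Proof.
move=> oU ab zab; apply: cvg_near_cst.
rewrite indicE; have [Uz|Uz] := pselect (U z); [rewrite mem_set//|rewrite memNset//].
  have /nbhs_ballP[e /= e0 eU] := open_nbhs_nbhs (conj oU Uz).
  have H j : \forall k \near \oo, (b 0 j - a 0 j) / 2 ^+ k < e.
    have : (b 0 j - a 0 j) / 2 ^+ k @[k --> \oo] --> (b 0 j - a 0 j) * 0.
      by apply: cvgMr; under eq_fun do rewrite -exprVn; apply: cvg_expr; rewrite ger0_norm ?invr_ge0// invf_lt1 ?ltr1n.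
    by rewrite mulr0 => /cvgr_lt; apply.
  have : \forall k \near \oo, forall j, (b 0 j - a 0 j) / 2 ^+ k < e by exact: filter_forall.
  apply: filterS => k Hk; rewrite /leaf_sign asboolT; first by rewrite /= mulr1n; lra.
  move=> y yq; apply: eU; split => // i j; rewrite (ord1 i).
  have := leaf_side (all_dirs k) a b z j; rewrite count_all_dirs => sE.
  have /andP[y1 y2] := yq j; have /andP[z1 z2] := leaf_mem (all_dirs k) ab zab j.
  by rewrite /ball/= ltr_norml; apply/andP; have := Hk j; rewrite -sE; split; lra.
apply: nearW => k; rewrite /leaf_sign asboolF; first by rewrite /= mulr0n; lra.
by move=> H; apply: Uz; apply: H; exact: leaf_mem.
Qed.

End variation.

Variables (v : 'rV[R]_n -> R) (a b : 'rV[R]_n) (M : R).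
Hypothesis ab : forall j, a 0 j <= b 0 j.
Hypothesis iv : mu.-integrable (hbox a b) (EFin \o v).
Hypothesis vM : forall s, \sum_(q <- leaves s a b) `|\int[mu]_(z in hbox q.1 q.2) v z| <= M.
Let mh := measurable_leb_hbox a b.

Let open_le U : open U -> \int[mu]_(z in hbox a b) (v z * (2 * \1_U z - 1)) <= M.
Proof.
move=> oU.
have [] := @dct_eventually _ L R mu (hbox a b) (fun k z => v z * leaf_sign U (all_dirs k) a b z)
  (fun z => v z * (2 * \1_U z - 1)) (fun z => `|v z|) mh.
- move=> k; apply: measurable_funM; first exact: integrableR_measurable iv.
  exact: measurable_funTS (measurable_leaf_sign _ _ _ _).
- exact: integrable_norm.
- by move=> k z _; rewrite normrM leaf_sign_norm mulr1.
- by move=> z zab; apply: cvgMr; exact: leaf_sign_cvg.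
move=> _ cv; apply: (cvgr_to_le cv).
by apply: nearW => k; apply: le_trans (leaf_sign_le _ _ ab iv) _.
Qed.

(** The open sets of outer regularity are intersected successively to make them decrease, so that
    their indicators converge at every point. *)
Lemma leb_Gdelta (E : set L) : measurable E -> (mu E < +oo)%E ->
  exists U : nat -> set 'rV[R]_n, [/\ forall k, open (U k), forall k, U k.+1 `<=` U k,
    forall k, E `<=` U k & mu ((\bigcap_k U k) `\` E) = 0%E].
Proof.
move=> mE Efin.
have H k : exists U : set 'rV[R]_n, [/\ open U, E `<=` U & (mu (U : set L) <= mu E + (k.+1%:R^-1)%:E)%E].
  by apply: leb_outer_regular => //; rewrite invr_gt0.
have [U UP] := choice H.
pose V := fix V k := if k is k'.+1 then V k' `&` U k else U 0%N.
have VU k : V k `<=` U k by case: k => [|k] z //= [].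
exists V; split.
- elim=> [|k IH] /=; first by have [] := UP 0%N.
  by apply: openI => //; have [] := UP k.+1.
- by move=> k z [].
- elim=> [|k IH] z Ez /=; first by have [_ + _] := UP 0%N; exact.
  by split; [exact: IH|have [_ + _] := UP k.+1; exact].
have mV k : measurable (V k : set L).
  elim: k => [|k IH] /=; first by apply: measurable_leb_open; have [] := UP 0%N.
  by apply: measurableI => //; apply: measurable_leb_open; have [] := UP k.+1.
have Efn : mu E \is a fin_num by rewrite ge0_fin_numE// measure_ge0.
have mU k : measurable (U k : set L) by apply: measurable_leb_open; have [] := UP k.
apply/eqP; rewrite eq_le measure_ge0 andbT; apply/lee_addgt0Pr => e e0; rewrite add0e.
have [k ke] := exists_invSn_lt e0.
apply: (@le_trans _ _ (mu (U k `\` E))).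
  apply: le_measure; rewrite ?inE.
  - by apply: measurableD => //; exact: bigcapT_measurable.
  - exact: measurableD.
  - by move=> z [Vz nE]; split => //; apply: VU; exact: Vz.
have [oU EU Uk] := UP k.
have UE : (U k : set L) = E `|` (U k `\` E) by rewrite setDUK.
rewrite UE measureU//= in Uk; [|exact: measurableD|by rewrite setDIK].
rewrite leeD2lE// in Uk; apply: le_trans Uk _.
by rewrite lee_fin ltW.
Qed.

(** The sign of [v] is 2 1_E - 1 with E = {v > 0}, apart from the zeros of [v]. Dyadic signs reach
    open sets by dominated convergence, decreasing open sets reach a G_delta hull of [E], and the
    hull differs from [E] by a null set. *)
Lemma total_variation_le : \int[mu]_(z in hbox a b) `|v z| <= M.
Proof.
have mv : measurable_fun (hbox a b : set L) v by exact: integrableR_measurable iv.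
pose E : set L := hbox a b `&` (v @^-1` `]0, +oo[%classic).
have mE : measurable E by exact: mv.
have Efin : (mu E < +oo)%E.
  apply: le_lt_trans (_ : _ <= mu (hbox a b))%E _; last by rewrite leb_hbox ltry.
  by apply: le_measure; rewrite ?inE// => z [].
have [U [oU dU EU F0]] := leb_Gdelta mE Efin.
set F := \bigcap_k U k in F0.
have mU k : measurable (U k : set L) by exact: measurable_leb_open.
have mF : measurable (F : set L) by exact: bigcapT_measurable.
have [] := @dct_eventually _ L R mu (hbox a b) (fun k z => v z * (2 * \1_(U k) z - 1))
  (fun z => v z * (2 * \1_F z - 1)) (fun z => `|v z|) mh.
- move=> k; apply: measurable_funM; first exact: mv.
  exact: measurable_sign.
- exact: integrable_norm.
- move=> k z _; rewrite normrM ler_piMr// indicE.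
  by case: (_ \in _); rewrite ?mulr1 ?mulr0 ler_norml; lra.
- move=> z zab; apply: cvg_near_cst.
  have [Fz|] := pselect (F z).
    by apply: nearW => k; rewrite !indicE !mem_set//; exact: Fz.
  move=> nF; have /existsNP[k0 /not_implyP[_ Uz]] := nF.
  exists k0 => // k /= k0k; rewrite !indicE !memNset//.
  elim: k k0k => [|k IH]; first by rewrite leqn0 => /eqP <-.
  by rewrite leq_eqVlt => /predU1P[<-//|]; rewrite ltnS => /IH + /dU.
move=> iF cF.
apply: (@le_trans _ _ (\int[mu]_(z in hbox a b) (v z * (2 * \1_F z - 1)))); last first.
  apply: (cvgr_to_le cF).
  by apply: nearW => k; exact: open_le.
rewrite le_eqVlt; apply/orP; left; apply/eqP.
apply: (Rint_ae_eq mh (measurableD mF mE) F0).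
- by apply: measurableT_comp.
- exact: integrableR_measurable iF.
move=> z zab nFE; have [Ez|nE] := pselect (E z).
  rewrite indicE mem_set; last by move=> k _; exact: EU.
  have [_ /=] := Ez; rewrite in_itv/= andbT => v0.
  by rewrite gtr0_norm//= mulr1n; lra.
have nF : ~ F z by move=> Fz; apply: nFE.
rewrite indicE memNset//= mulr0n ler0_norm; first by lra.
by rewrite leNgt; apply/negP => v0; apply: nE; split => //=; rewrite in_itv/= v0.
Qed.

End dyadic_leaves.

(** * Lines that meet Gamma *)

Section leb_null.
Context {R : realType} {n : nat}.
Local Notation L := (leb_space R n).
Local Notation mu := (leb R n).

Lemma leb_null_measurable (N : set 'rV[R]_n) : leb_outer N = 0%E -> measurable (N : set L).
Proof.
move=> N0; apply: le_caratheodory_measurable => X.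
have -> : (@leb_outer R n : {outer_measure set 'rV[R]_n -> \bar R}) (X `&` N) = 0%E.
  apply/eqP; rewrite eq_le outer_measure_ge0 andbT -N0.
  by apply: le_outer_measure; exact: subIsetr.
by rewrite add0e; apply: le_outer_measure; exact: subIsetl.
Qed.

Lemma leb_null_sub (N M : set 'rV[R]_n) : leb_outer M = 0%E -> N `<=` M -> leb_outer N = 0%E.
Proof.
move=> M0 NM; apply/eqP; rewrite eq_le outer_measure_ge0 andbT -M0.
exact: le_outer_measure.
Qed.

Lemma measurable_fun_null_setC (D : set 'rV[R]_n) (f : 'rV[R]_n -> R) :
  measurable (D : set L) -> leb_outer (~` D) = 0%E ->
  measurable_fun (D : set L) f -> measurable_fun (setT : set L) f.
Proof.
move=> mD D0 mf _ Y mY; rewrite setTI.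
rewrite (_ : f @^-1` Y = (D `&` f @^-1` Y) `|` (~` D `&` f @^-1` Y)); last first.
  by rewrite -setIUl setUCr setTI.
apply: measurableU; first exact: mf.
by apply: leb_null_measurable; apply: leb_null_sub D0 _; exact: subIsetl.
Qed.

Lemma leb_integral_shift (h : 'rV[R]_n) (D : set L) (f : 'rV[R]_n -> \bar R) :
  measurable D -> measurable_fun D f ->
  (\int[mu]_(z in D) f z = \int[mu]_(z in [set z | D (z + h)%R]) f (z + h)%R)%E.
Proof.
move=> mD mf.
exact: (integral_preserving (measurable_leb_shift h) (fun A _ => leb_shift h A) mD mf).
Qed.

Lemma hbox_shift (h a b : 'rV[R]_n) :
  [set z | hbox (a + h) (b + h) (z + h)] = hbox a b.
Proof.
by apply/seteqP; split => z /= H i; have := H i; rewrite !mxE ltrD2r lerD2r.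
Qed.

Lemma Rint_hbox_shift (h a b : 'rV[R]_n) (f : 'rV[R]_n -> R) :
  measurable_fun (hbox (a + h) (b + h) : set L) f ->
  \int[mu]_(z in hbox (a + h) (b + h)) f z = \int[mu]_(z in hbox a b) f (z + h).
Proof.
move=> mf; rewrite /Rintegral (leb_integral_shift h) ?hbox_shift//.
  exact: measurable_leb_hbox.
exact/measurable_EFinP.
Qed.

Lemma measurable_fun_hbox_shift (h a b : 'rV[R]_n) (f : 'rV[R]_n -> R) :
  measurable_fun (hbox (a + h) (b + h) : set L) f ->
  measurable_fun (hbox a b : set L) (fun z => f (z + h)).
Proof.
move=> mf mD Y mY.
have := measurable_leb_shift h measurableT (mf (measurable_leb_hbox _ _) _ mY).
by rewrite setTI preimage_setI -[in X in _ -> measurable (X `&` _)](hbox_shift h a b).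
Qed.

Lemma integrable_hbox_shift (h a b : 'rV[R]_n) (f : 'rV[R]_n -> R) :
  mu.-integrable (hbox (a + h) (b + h)) (EFin \o f) ->
  mu.-integrable (hbox a b) (EFin \o (fun z => f (z + h))).
Proof.
move=> /integrableP[/measurable_EFinP mf fi]; apply/integrableP; split.
  by apply/measurable_EFinP; exact: measurable_fun_hbox_shift.
move: fi; rewrite (leb_integral_shift h) ?hbox_shift//.
  exact: measurable_leb_hbox.
by apply/measurable_EFinP; exact: measurableT_comp.
Qed.

End leb_null.

Section bad_lines.
Context {R : realType} {n : nat} (d C0 : R) (Gamma : set 'rV[R]_n).
Hypothesis d_bounds : 0 < d < n%:R - 1.
Hypothesis Gamma_AR : ahlfors_regular d C0 Gamma.
Local Notation L := (leb_space R n).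
Local Notation mu := (leb R n).

Lemma dotp_ge0 (x : 'rV[R]_n) : 0 <= dotp x x.
Proof. by apply: sumr_ge0 => i _; rewrite -expr2 sqr_ge0. Qed.

Lemma enorm_ge0 (x : 'rV[R]_n) : 0 <= enorm x.
Proof. exact: sqrtr_ge0. Qed.

Lemma coord_le_enorm (x : 'rV[R]_n) i : `|x 0 i| <= enorm x.
Proof.
rewrite -sqrtr_sqr ler_wsqrtr// /dotp (bigD1 i)//= -expr2 lerDl.
by apply: sumr_ge0 => j _; rewrite -expr2 sqr_ge0.
Qed.

Lemma enormN (x : 'rV[R]_n) : enorm (- x) = enorm x.
Proof. by congr Num.sqrt; apply: eq_bigr => i _; rewrite !mxE mulrNN. Qed.

Lemma enorm_le_sum (x : 'rV[R]_n) : enorm x <= \sum_i `|x 0 i|.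
Proof.
have s0 : 0 <= \sum_i `|x 0 i| by exact: sumr_ge0.
rewrite -[leRHS]ger0_norm// -sqrtr_sqr ler_wsqrtr// expr2 mulr_suml ler_sum// => i _.
rewrite -[leLHS]ger0_norm ?normrM; last by rewrite -expr2 sqr_ge0.
by rewrite ler_wpM2l// (bigD1 i)//= lerDl sumr_ge0.
Qed.

Lemma enorm_le_const (x : 'rV[R]_n) r : (forall i, `|x 0 i| <= r) -> enorm x <= n%:R * r.
Proof.
move=> xr; apply: le_trans (enorm_le_sum x) _.
apply: le_trans (ler_sum _ (fun i _ => xr i)) _.
by rewrite sumr_const card_ord mulr_natl.
Qed.

Lemma ediam_ge (E : set 'rV[R]_n) x y : E x -> E y -> ((enorm (x - y))%:E <= ediam E)%E.
Proof. by move=> Ex Ey; apply: ereal_sup_ubound; right; exists (x, y). Qed.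

(** The part of the tube over a set of diameter D lies in a box with one side 2 N and n - 1 sides 2
    D. As D <= e, D^(n-1) = D^(n-1-d) D^d is at most e^(n-1-d) times the Hausdorff cost. *)
Lemma tube_vol_le (i : 'I_n) (E : set 'rV[R]_n) (e N : R) (Z : set 'rV[R]_n) : 0 < N -> 0 < e ->
  (ediam E <= e%:E)%E ->
  (forall z, Z z -> `|z 0 i| <= N) ->
  (forall z, Z z -> exists t, E (z + t *: delta_mx 0 i)) ->
  (leb_outer Z <= (2 * N * 2 ^+ n.-1 * e `^ (n%:R - 1 - d))%:E * haus_cost d E)%E.
Proof.
move=> N0 e0 Ee ZN ZE; have /andP[d0 dn] := d_bounds.
have c0 : 0 <= 2 * N * 2 ^+ n.-1 * e `^ (n%:R - 1 - d).
  by rewrite !mulr_ge0 ?powR_ge0 ?exprn_ge0// ltW.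
rewrite /haus_cost; case: eqVneq => [E0|/set0P[p Ep]].
  rewrite mule0 (_ : Z = set0) ?outer_measure0//.
  by apply/seteqP; split => // z /ZE[t]; rewrite E0.
have diam0 : (0 <= ediam E)%E by apply: le_trans (ediam_ge Ep Ep); rewrite lee_fin enorm_ge0.
have diamfin : ediam E \is a fin_num by rewrite ge0_fin_numE// (le_lt_trans Ee) ?ltry.
pose D := fine (ediam E).
have DE : ediam E = D%:E by rewrite fineK.
have D0 : 0 <= D by rewrite -lee_fin -DE.
have De : D <= e by rewrite -lee_fin -DE.
pose a : 'rV[R]_n := \row_j (if j == i then - N else p 0 j - D).
pose b : 'rV[R]_n := \row_j (if j == i then N else p 0 j + D).
apply: (@le_trans _ _ (leb_outer (box (Some (a, b))))).
  apply: le_outer_measure => z Zz j; rewrite !mxE; case: eqP => [->|/eqP ji].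
    by rewrite -ler_norml ZN.
  have [t Et] := ZE z Zz.
  have := ediam_ge Et Ep; rewrite DE lee_fin => H.
  have : `|z 0 j - p 0 j| <= D.
    apply: le_trans H; apply: le_trans (coord_le_enorm _ j).
    by rewrite !mxE (negbTE ji) andbF mulr0 addr0.
  by rewrite ler_distl => /andP[? ?]; apply/andP; split; lra.
apply: le_trans (leb_box_le (Some (a, b))) _; rewrite /= DE poweR_EFin -EFinM lee_fin.
(* A piece of diameter 0 requires 0^(n-1) = 0, hence n >= 2, which follows from 0 < d < n - 1. *)
have n0 : (0 < n.-1)%N.
  have : (1 : R) < n%:R by have := d0; move: dn; lra.
  by rewrite ltr1n; case: (n) => [|[]].
rewrite (bigD1 i)//= !mxE eqxx opprK (_ : N + N = 2 * N); last by lra.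
rewrite max_r ?mulr_ge0// ?(ltW N0)//.
have -> : \prod_(j | j != i) Num.max 0 (b 0 j - a 0 j) = (2 * D) ^+ n.-1.
  rewrite (eq_bigr (fun=> 2 * D)) => [|j ji].
    by rewrite prodr_const cardC1 card_ord.
  by rewrite !mxE (negbTE ji) max_r; lra.
rewrite exprMn -!mulrA ler_wpM2l// ler_wpM2l ?(ltW N0)// ler_wpM2l ?exprn_ge0//.
move: D0; rewrite le_eqVlt => /predU1P[<-|D0].
  by rewrite expr0n gtn_eqF//= mulr_ge0 ?powR_ge0.
have -> : D ^+ n.-1 = D `^ (n%:R - 1 - d) * D `^ d.
  rewrite -powRD ?(gt_eqF D0) ?implybT// subrK -powR_mulrn ?(ltW D0)//.
  by congr (_ `^ _); move: n0; case: (n) => // m _; rewrite -natr1 addrK.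
by rewrite ler_wpM2r ?powR_ge0// ge0_ler_powR ?nnegrE ?(ltW D0) ?(ltW e0)//; lra.
Qed.

Variable x0 : 'rV[R]_n.
Hypothesis Gx0 : Gamma x0.

Definition bad_lines (i : 'I_n) : set 'rV[R]_n :=
  [set z | exists t : R, Gamma (z + t *: delta_mx 0 i)].

(** A bounded part of Gamma has finite Hausdorff measure and is covered by pieces of diameter at
    most [e] with bounded total cost. By [tube_vol_le] the tubes over the pieces have total volume
    O(e^(n-1-d)), which tends to 0 because d < n - 1. *)
Lemma leb_bad_lines i : leb_outer (bad_lines i) = 0%E.
Proof.
have /andP[d0 dn] := d_bounds.
pose Z (N : nat) : set 'rV[R]_n := [set z : 'rV[R]_n | `|z 0 i| <= N.+1%:R /\
  exists t : R, (Gamma `&` eball x0 N.+1%:R) (z + t *: delta_mx 0 i)].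
suff Z0 N : leb_outer (Z N) = 0%E.
  apply: (@leb_null_sub _ _ _ (\bigcup_N Z N)).
    apply/eqP; rewrite eq_le outer_measure_ge0 andbT.
    apply: le_trans (outer_measure_sigma_subadditive _ _) _.
    by rewrite eseries0// => N _ _; exact: Z0.
  move=> z [t Gt].
  pose N := maxn (Num.trunc `|z 0 i|) (Num.trunc (enorm (z + t *: delta_mx 0 i - x0))).
  exists N => //; split.
    by apply: le_trans (ltW (truncnS_gt _)) _; rewrite ler_nat ltnS leq_maxl.
  exists t; split => //; rewrite /eball/=.
  by apply: lt_le_trans (truncnS_gt _) _; rewrite ler_nat ltnS leq_maxr.
apply/eqP; rewrite eq_le outer_measure_ge0 andbT; apply/lee_addgt0Pr => eta eta0; rewrite add0e.
have NN : (0 : R) < N.+1%:R by [].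
have /andP[_ Hup] := Gamma_AR Gx0 NN.
have C0N : 0 <= C0 * N.+1%:R `^ d by rewrite -lee_fin (le_trans _ Hup)// measure_ge0.
pose K := 2 * N.+1%:R * 2 ^+ n.-1 * (C0 * N.+1%:R `^ d + 1).
have K0 : 0 < K by rewrite !mulr_gt0 ?exprn_gt0//; lra.
have al0 : 0 < n%:R - 1 - d by lra.
(* With this [e] the bound on the total volume of the tubes equals [eta]; the summand 1 in [K] is
   the slack in the choice of the cover. *)
pose e := (eta / K) `^ (n%:R - 1 - d)^-1.
have e0 : 0 < e by rewrite powR_gt0// divr_gt0.
have eE : e `^ (n%:R - 1 - d) = eta / K.
  by rewrite /e -powRrM mulVf ?gt_eqF// powRr1// divr_ge0 ?ltW.
have preN : (haus_pre d e (Gamma `&` eball x0 N.+1%:R) <= (C0 * N.+1%:R `^ d)%:E)%E.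
  by apply: le_trans Hup; apply: ereal_sup_ubound; exists e.
have prefin : haus_pre d e (Gamma `&` eball x0 N.+1%:R) \is a fin_num.
  rewrite ge0_fin_numE ?(le_lt_trans preN) ?ltry//.
  by apply: cover_outer_ge0 => E; rewrite /haus_cost; case: ifP => // _; exact: poweR_ge0.
have [_ [s [Ps Gs] <-] sN] := lb_ereal_inf_adherent (@ltr01 R) prefin.
pose Zk k : set 'rV[R]_n := [set z : 'rV[R]_n | `|z 0 i| <= N.+1%:R /\ exists t : R, s k (z + t *: delta_mx 0 i)].
apply: (@le_trans _ _ (leb_outer (\bigcup_k Zk k))).
  apply: le_outer_measure => z [zN [t Gt]].
  by have [k _ sk] := Gs _ Gt; exists k => //; split => //; exists t.
apply: le_trans (outer_measure_sigma_subadditive _ _) _.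
pose c := 2 * N.+1%:R * 2 ^+ n.-1 * (eta / K).
have c0 : 0 <= c by rewrite !mulr_ge0 ?exprn_ge0 ?invr_ge0 ?ltW.
have hc0 (E : set 'rV[R]_n) : (0 <= haus_cost d E)%E by rewrite /haus_cost; case: ifP => // _; exact: poweR_ge0.
apply: (@le_trans _ _ (\sum_(k <oo) (c%:E * haus_cost d (s k)))%E).
  apply: lee_nneseries => k *; first exact: outer_measure_ge0.
  rewrite /c -eE; apply: (@tube_vol_le i) => //; first exact: Ps.
  - by move=> z [].
  - by move=> z [].
rewrite nneseriesZl//.
apply: (@le_trans _ _ (c%:E * (C0 * N.+1%:R `^ d + 1)%:E)%E).
  rewrite lee_wpmul2l ?lee_fin//; apply: le_trans (ltW sN) _.
  by rewrite EFinD leeD2r.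
rewrite -EFinM lee_fin /c le_eqVlt; apply/orP; left; apply/eqP.
rewrite /K; field.
apply/and3P; split; apply: lt0r_neq0; [exact: ltr_wpDl|exact: exprn_gt0|by rewrite ltr_pwDl].
Qed.

Lemma Gamma_sub_bad i : Gamma `<=` bad_lines i.
Proof. by move=> z Gz; exists 0; rewrite scale0r addr0. Qed.

Lemma leb_Gamma : leb_outer Gamma = 0%E.
Proof.
have n0 : (0 < n)%N.
  have /andP[d0 dn] := d_bounds; have : (0 : R) < n%:R by lra.
  by rewrite ltr0n.
exact: leb_null_sub (leb_bad_lines (Ordinal n0)) (@Gamma_sub_bad _).
Qed.

End bad_lines.

Section integration_more.
Context {d : measure_display} {T : measurableType d} {R : realType}.
Variable mu : {measure set T -> \bar R}.

Lemma fatou_le (D N : set T) (f : nat -> T -> R) (g : T -> R) (M : \bar R) :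
  measurable D -> measurable N -> mu N = 0%E -> (forall k, measurable_fun D (f k)) ->
  measurable_fun D g -> (forall k x, 0 <= f k x) -> (forall x, 0 <= g x) ->
  (forall k, (\int[mu]_(x in D) (f k x)%:E <= M)%E) ->
  (forall x, D x -> ~ N x -> f k x @[k --> \oo] --> g x) ->
  (\int[mu]_(x in D) (g x)%:E <= M)%E.
Proof.
move=> mD mN N0 mf mg f0 g0 fM fg.
have mDN : measurable (D `\` N) by exact: measurableD.
have sub : (D `\` N) `<=` D by move=> x [].
have gE x : (D `\` N) x -> limn_einf (fun k => (f k x)%:E) = (g x)%:E.
  move=> [Dx nN].
  have cf : (f k x)%:E @[k --> \oo] --> (g x)%:E by apply: cvg_EFin; [exact: nearW|exact: fg].
  by have [-> _] := cvg_limn_einf_sup cf.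
rewrite (ge0_negligible_integral mN mD)//; last 2 first.
- exact/measurable_EFinP.
- by move=> x _; rewrite lee_fin.
rewrite (eq_integral (fun x => limn_einf (fun k => (f k x)%:E))); last first.
  by move=> x; rewrite inE => /gE ->.
apply: le_trans (fatou mu mDN _ _) _.
- by move=> k; apply/measurable_EFinP; apply: measurable_funS (mf k).
- by move=> k x _; rewrite lee_fin.
rewrite limn_einf_lim; apply: lime_le; first exact: is_cvg_einfs.
apply: nearW => k; apply: (@le_trans _ _ (\int[mu]_(x in D `\` N) (f k x)%:E)%E).
  by apply: ereal_inf_lbound; exists k => /=.
apply: le_trans (fM k); apply: ge0_subset_integral => //.
  by apply/measurable_EFinP; exact: mf.
by move=> x _; rewrite lee_fin.
Qed.

End integration_more.

Lemma rowDE (R : realType) (n : nat) (x y : 'rV[R]_n) k : (x + y) 0 k = x 0 k + y 0 k.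
Proof. by rewrite mxE. Qed.

Definition hv {R : realType} {n : nat} (i : 'I_n) (h : R) : 'rV[R]_n := h *: delta_mx 0 i.

Lemma hv_i (R : realType) (n : nat) (i : 'I_n) (h : R) : hv i h 0 i = h.
Proof. by rewrite !mxE !eqxx mulr1. Qed.

Lemma hv_j (R : realType) (n : nat) (i : 'I_n) (h : R) j : j != i -> hv i h 0 j = 0.
Proof. by move=> ji; rewrite !mxE (negbTE ji) andbF mulr0. Qed.

Lemma hv_ge0 (R : realType) (n : nat) (i : 'I_n) (h : R) k : 0 <= h -> 0 <= hv i h 0 k.
Proof. by have [->|ki] := eqVneq k i; rewrite ?hv_i ?hv_j. Qed.

Lemma hbox_sub_box (R : realType) (n : nat) (a b : 'rV[R]_n) : hbox a b `<=` box (Some (a, b)).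
Proof. by move=> z H k; have /andP[/ltW -> ->] := H k. Qed.

(** * Increments across Gamma *)

Section across.
Context {R : realType} {n : nat}.
Variables (Gamma : set 'rV[R]_n) (u : 'rV[R]_n -> R) (G : 'rV[R]_n -> 'rV[R]_n).
Local Notation L := (leb_space R n).
Local Notation mu := (leb R n).
Local Notation Omega := (~` Gamma).
Hypothesis Gamma_closed : closed Gamma.
Hypothesis Gamma0 : leb_outer Gamma = 0%E.
Hypothesis bad0 : forall i, leb_outer (bad_lines Gamma i) = 0%E.
Hypothesis lu : loc_integrable Omega u.
Hypothesis wg : is_wgrad Omega u G.
Hypothesis iG : forall a b i, mu.-integrable (hbox a b) (EFin \o (fun z => G z 0 i)).

Implicit Types (a b c e z : 'rV[R]_n) (i j : 'I_n) (h : R) (s : seq 'I_n).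

Let oO : open Omega.
Proof. exact: closed_openC. Qed.

Lemma measurable_across (f : 'rV[R]_n -> R) : loc_integrable Omega f -> measurable_fun (setT : set L) f.
Proof.
case=> mf _; apply: measurable_fun_null_setC mf; first exact: measurable_leb_open.
by rewrite setCK.
Qed.

Let mu_u : measurable_fun (setT : set L) u.
Proof. exact: measurable_across. Qed.

Lemma measurable_increment i h : measurable_fun (setT : set L) (fun z => u (z + hv i h) - u z).
Proof.
apply: measurable_funB; last exact: mu_u.
have H := measurableT_comp mu_u (measurable_leb_shift (hv i h)).
exact: H.
Qed.

Lemma hull_lower i h a b j : (forall k, a 0 k <= b 0 k) -> 0 <= h ->
  hbox a (lower_b a b j + hv i h) `<=` hbox a (b + hv i h).
Proof.
move=> ab h0 z H k; have /andP[-> /= zb] := H k; apply: le_trans zb _.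
rewrite rowDE [leRHS]rowDE lerD2r set_coordE; case: eqP => [->|_]//.
by have /andP[] := mid_bounds (ab j).
Qed.

Lemma hull_upper i h a b j : (forall k, a 0 k <= b 0 k) ->
  hbox (upper_a a b j) (b + hv i h) `<=` hbox a (b + hv i h).
Proof.
move=> ab z H k; have /andP[za ->] := H k; rewrite andbT; apply: le_lt_trans za.
rewrite set_coordE; case: eqP => [->|_]//.
by have /andP[] := mid_bounds (ab j).
Qed.

Lemma lower_hull i h a b j : j != i -> lower_b a b j + hv i h = lower_b a (b + hv i h) j.
Proof.
move=> ji; apply/rowP => k; rewrite rowDE !set_coordE; case: (eqVneq k j) => [->|_].
  by rewrite /mid rowDE hv_j// !addr0.
by rewrite rowDE.
Qed.

Lemma upper_hull i h a b j : j != i -> upper_a a b j = upper_a a (b + hv i h) j.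
Proof. by move=> ji; rewrite /upper_a /mid rowDE hv_j// addr0. Qed.

Lemma ab_hull i h a b : (forall k, a 0 k <= b 0 k) -> 0 <= h -> forall k, a 0 k <= (b + hv i h) 0 k.
Proof.
move=> ab h0 k; rewrite rowDE; have [->|ki] := eqVneq k i; rewrite ?hv_i ?hv_j ?addr0//.
by have := ab i; lra.
Qed.

Let iGn a b i : mu.-integrable (hbox a b) (EFin \o (fun z => `|G z 0 i|)).
Proof. exact: integrable_norm (iG a b i). Qed.

Lemma gradient_halves i a b j : (forall k, a 0 k <= b 0 k) ->
  \int[mu]_(z in hbox a b) `|G z 0 i| =
  \int[mu]_(z in hbox a (lower_b a b j)) `|G z 0 i| + \int[mu]_(z in hbox (upper_a a b j) b) `|G z 0 i|.
Proof. by move=> ab; rewrite -(Rint_halves j ab). Qed.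

Lemma gradient_le_sub i a b c e : hbox a b `<=` hbox c e ->
  \int[mu]_(z in hbox a b) `|G z 0 i| <= \int[mu]_(z in hbox c e) `|G z 0 i|.
Proof.
move=> sub; apply: Rint_le_subset => //; [exact: measurable_leb_hbox|exact: measurable_leb_hbox].
Qed.

Let gint i a b := \int[mu]_(z in hbox a b) `|G z 0 i|.
Let gint_ge0 i a b : 0 <= gint i a b.
Proof. by apply: Rintegral_ge0. Qed.

(* splitting a box halves either the hull or the side in direction [i] *)
Lemma hull_split_le i h a b j : (forall k, a 0 k <= b 0 k) -> 0 <= h ->
  (lower_b a b j 0 i - a 0 i) * gint i a (lower_b a b j + hv i h) +
  (b 0 i - upper_a a b j 0 i) * gint i (upper_a a b j) (b + hv i h) <=
  (b 0 i - a 0 i) * gint i a (b + hv i h).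
Proof.
move=> ab h0; rewrite !set_coordE; have [ij|ij] := eqVneq i j.
  have := @gradient_le_sub i _ _ _ _ (@hull_lower i h a b j ab h0).
  have := @gradient_le_sub i _ _ _ _ (@hull_upper i h a b j ab).
  rewrite -!/(gint _ _ _) /mid -ij; have := ab i.
  set x := gint i a _; set y := gint i _ _; set z := gint i a _ => abi xz yz.
  have -> : (a 0 i + b 0 i) / 2 - a 0 i = (b 0 i - a 0 i) / 2 by lra.
  have -> : b 0 i - (a 0 i + b 0 i) / 2 = (b 0 i - a 0 i) / 2 by lra.
  rewrite -mulrDr -mulrA ler_wpM2l ?subr_ge0//; lra.
rewrite lower_hull 1?eq_sym// (upper_hull h _ _ (_ : j != i)) 1?eq_sym//.
by rewrite /gint (gradient_halves i j (ab_hull i ab h0)) mulrDr.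
Qed.

Lemma hull_box_lower i h a b j : (forall k, a 0 k <= b 0 k) ->
  box (Some (a, b + hv i h)) `<=` Omega -> box (Some (a, lower_b a b j + hv i h)) `<=` Omega.
Proof.
move=> ab abO z H; apply: abO => k; have /andP[-> /= zb] := H k; apply: le_trans zb _.
rewrite rowDE [leRHS]rowDE lerD2r set_coordE; case: eqP => [->|_]//.
by have /andP[] := mid_bounds (ab j).
Qed.

Lemma hull_box_upper i h a b j : (forall k, a 0 k <= b 0 k) ->
  box (Some (a, b + hv i h)) `<=` Omega -> box (Some (upper_a a b j, b + hv i h)) `<=` Omega.
Proof.
move=> ab abO z H; apply: abO => k; have /andP[za ->] := H k; rewrite andbT; apply: le_trans za.
rewrite set_coordE; case: eqP => [->|_]//.
by have /andP[] := mid_bounds (ab j).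
Qed.

Lemma integrable_hbox_in (f : 'rV[R]_n -> R) a b : loc_integrable Omega f ->
  box (Some (a, b)) `<=` Omega -> mu.-integrable (hbox a b) (EFin \o f).
Proof.
move=> lf abO; apply: (@integrableS _ _ _ mu (box (Some (a, b)))); last first.
- exact: (loc_integrable_compact oO lf (@compact_box R n _) abO).
- exact: hbox_sub_box.
- exact: measurable_leb_hbox.
- exact: measurable_leb_box.
Qed.

(** For a single box this is [wgrad_shift_le]. By [hull_split_le] the right-hand side is
    superadditive under halving, so the bound survives any number of halvings. *)
Lemma shift_leaves_le i h s a b : (forall k, a 0 k <= b 0 k) -> 0 <= h ->
  box (Some (a, b + hv i h)) `<=` Omega ->
  \sum_(q <- leaves s a b) `|\int[mu]_(z in hbox q.1 q.2) (u (z + hv i h) - u z)| <=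
  (b 0 i - a 0 i) * gint i a (b + hv i h).
Proof.
elim: s a b => [|j s IH] a b ab h0 abO /=.
  rewrite big_seq1 /=.
  have hk k : 0 <= hv i h 0 k by exact: hv_ge0.
  have i1 : mu.-integrable (hbox (a + hv i h) (b + hv i h)) (EFin \o u).
    apply: integrable_hbox_in => // z H; apply: abO => k; have /andP[za ->] := H k.
    by rewrite andbT (le_trans _ za)// rowDE lerDl.
  have i2 : mu.-integrable (hbox a b) (EFin \o u).
    apply: integrable_hbox_in => // z H; apply: abO => k; have /andP[-> zb] := H k.
    by rewrite (le_trans zb)// rowDE lerDl.
  rewrite RintegralB//; [|exact: measurable_leb_hbox|exact: integrable_hbox_shift].
  rewrite -(Rint_hbox_shift (integrableR_measurable i1)).
  exact: (wgrad_shift_le oO lu wg ab h0 abO).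
rewrite big_cat/=; apply: le_trans (hull_split_le i j ab h0); apply: lerD.
  by apply: IH => //; [exact: lower_le|exact: hull_box_lower].
by apply: IH => //; [exact: upper_le|exact: (@hull_box_upper i h a b j ab)].
Qed.

Lemma shift_inside_le i h a b : (forall k, a 0 k <= b 0 k) -> 0 <= h ->
  box (Some (a, b + hv i h)) `<=` Omega ->
  \int[mu]_(z in hbox a b) `|u (z + hv i h) - u z| <= (b 0 i - a 0 i) * gint i a (b + hv i h) /\
  mu.-integrable (hbox a b) (EFin \o (fun z => u (z + hv i h) - u z)).
Proof.
move=> ab h0 abO.
have hk k : 0 <= hv i h 0 k by exact: hv_ge0.
have i1 : mu.-integrable (hbox (a + hv i h) (b + hv i h)) (EFin \o u).
  apply: integrable_hbox_in => // z H; apply: abO => k; have /andP[za ->] := H k.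
  by rewrite andbT (le_trans _ za)// rowDE lerDl.
have i2 : mu.-integrable (hbox a b) (EFin \o u).
  apply: integrable_hbox_in => // z H; apply: abO => k; have /andP[-> zb] := H k.
  by rewrite (le_trans zb)// rowDE lerDl.
have i3 := integrableRB (measurable_leb_hbox a b) (integrable_hbox_shift i1) i2.
split; last exact: i3.
by apply: (total_variation_le ab i3) => s; exact: shift_leaves_le.
Qed.

(** Selects the leaves whose hull with their translate by [h] misses Gamma; on these the increment
    is estimated inside the complement of Gamma. *)
Definition good_column i h s a b (z : 'rV[R]_n) : R :=
  if `[< box (Some ((leaf s a b z).1, (leaf s a b z).2 + hv i h)) `<=` Omega >] then 1 else 0.

Lemma good_column_ge0 i h s a b z : 0 <= good_column i h s a b z.
Proof. by rewrite /good_column; case: ifP. Qed.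

Lemma measurable_good_column i h s a b : measurable_fun (setT : set L) (good_column i h s a b).
Proof.
elim: s a b => [|j s IH] a b; first by rewrite /good_column /=; exact: measurable_cst.
rewrite (_ : good_column i h _ a b = fun z => if z 0 j <= mid a b j then
   good_column i h s a (lower_b a b j) z else good_column i h s (upper_a a b j) b z); last first.
  by apply/funext => z; rewrite /good_column /=; case: (z 0 j <= mid a b j).
exact: (measurable_fun_if_le _ (IH _ _) (IH _ _) (measurable_leb_coord j)).
Qed.

Let incr i h (z : 'rV[R]_n) := `|u (z + hv i h) - u z|.

Lemma measurable_incr i h : measurable_fun (setT : set L) (incr i h).
Proof. exact: measurableT_comp (measurable_increment i h). Qed.

Lemma shift_columns_le i h s a b : i \notin s -> (forall k, a 0 k <= b 0 k) -> 0 <= h ->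
  (\int[mu]_(z in hbox a b) (incr i h z * good_column i h s a b z)%:E <=
   ((b 0 i - a 0 i) * gint i a (b + hv i h))%:E)%E.
Proof.
elim: s a b => [|j s IH] a b; last first.
  rewrite inE negb_or => /andP[ij js] ab h0.
  rewrite (hbox_halves j ab) ge0_integral_setU; last 5 first.
  - exact: measurable_leb_hbox.
  - exact: measurable_leb_hbox.
  - apply/measurable_EFinP; apply: measurable_funTS; apply: measurable_funM.
      exact: measurable_incr.
    exact: measurable_good_column.
  - by move=> z _; rewrite lee_fin; apply: mulr_ge0; [exact: normr_ge0|exact: good_column_ge0].
  - exact: halves_disjoint.
  have := hull_split_le i j ab h0; rewrite -lee_fin EFinD; apply: le_trans.
  apply: leeD.
    apply: le_trans (IH a (lower_b a b j) js (lower_le j ab) h0).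
    rewrite le_eqVlt; apply/orP; left; apply/eqP; apply: eq_integral => z.
    by rewrite inE => /(hbox_lower j z ab)[_ zm]; rewrite /good_column/= zm.
  apply: le_trans (IH (upper_a a b j) b js (upper_le j ab) h0).
  rewrite le_eqVlt; apply/orP; left; apply/eqP; apply: eq_integral => z.
  by rewrite inE => /(hbox_upper j z ab)[_ zm]; rewrite /good_column/= leNgt zm.
move=> _ ab h0; have [abO|abO] := pselect (box (Some (a, b + hv i h)) `<=` Omega); last first.
  have gE z : good_column i h [::] a b z = 0 by rewrite /good_column asboolF.
  under eq_integral do rewrite gE mulr0.
  by rewrite integral0 lee_fin mulr_ge0 ?subr_ge0.
have gE z : good_column i h [::] a b z = 1 by rewrite /good_column asboolT.
under eq_integral do rewrite gE mulr1.
have [le1 i1] := shift_inside_le ab h0 abO.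
have := fineK (integrable_fin_num (measurable_leb_hbox a b) (integrable_norm i1)).
by move=> <-; rewrite lee_fin.
Qed.

Definition other_dirs i (k : nat) : seq 'I_n := flatten (nseq k [seq j <- enum 'I_n | j != i]).

Lemma other_dirs_notin i k : i \notin other_dirs i k.
Proof.
apply/negP => /flattenP[s /nseqP[-> _]].
by rewrite mem_filter eqxx.
Qed.

Lemma count_other_dirs i k j : j != i -> count_mem j (other_dirs i k) = k.
Proof.
move=> ji; elim: k => //= k IH; rewrite /other_dirs/= count_cat -/(other_dirs i k) IH.
rewrite count_uniq_mem; last by rewrite filter_uniq// enum_uniq.
by rewrite mem_filter ji mem_enum.
Qed.

(** A segment of a line that misses Gamma is compact and has a neighbourhood that misses Gamma.
    Columns that are cut only in the other directions become thin and end up in this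
    neighbourhood. *)
Lemma near_good_column i h a b z : (forall k, a 0 k <= b 0 k) -> 0 <= h -> hbox a b z ->
  ~ bad_lines Gamma i z ->
  \forall k \near \oo, good_column i h (other_dirs i k) a b z = 1.
Proof.
move=> ab h0 zab nbad.
(* The segment spans the whole height from a_i to b_i + h, since the leaves are never cut in the
   direction [i]. *)
pose K := box (Some (set_coord z i (a 0 i), set_coord z i (b 0 i + h))).
have KO : K `<=` Omega.
  move=> x Kx Gx; apply: nbad; exists (x 0 i - z 0 i).
  suff -> : z + (x 0 i - z 0 i) *: delta_mx 0 i = x by [].
  apply/rowP => j; rewrite !mxE eqxx/=; have := Kx j; rewrite !set_coordE.
  case: (eqVneq j i) => [-> _|_]; first by rewrite mulr1 addrC subrK.
  by rewrite mulr0n mulr0 addr0 => /andP[zx xz]; apply/eqP; rewrite eq_le zx xz.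
have [e e0 H] := compact_sub_open_ball (@compact_box R n _) oO KO.
have Hj j : \forall k \near \oo, (b 0 j - a 0 j) / 2 ^+ k < e.
  have : (b 0 j - a 0 j) / 2 ^+ k @[k --> \oo] --> (b 0 j - a 0 j) * 0.
    by apply: cvgMr; under eq_fun do rewrite -exprVn; apply: cvg_expr; rewrite ger0_norm ?invr_ge0// invf_lt1 ?ltr1n.
  by rewrite mulr0 => /cvgr_lt; apply.
have : \forall k \near \oo, forall j, (b 0 j - a 0 j) / 2 ^+ k < e by exact: filter_forall.
apply: filterS => k Hk; rewrite /good_column asboolT// => y yq.
have side j := leaf_side (other_dirs i k) a b z j.
have zl := leaf_mem (other_dirs i k) ab zab.
have lab : (leaf (other_dirs i k) a b z).1 0 i = a 0 i /\ (leaf (other_dirs i k) a b z).2 0 i = b 0 i.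
  have : i \notin other_dirs i k by exact: other_dirs_notin.
  elim: (other_dirs i k) (a) (b) => [|j s IH] a' b' //=; rewrite inE negb_or => /andP[ij js].
  by case: leP => _; split; have [E1 E2] := IH a' (lower_b a' b' j) js;
    have [E3 E4] := IH (upper_a a' b' j) b' js; rewrite ?E1 ?E2 ?E3 ?E4 ?set_coordE ?(negbTE ij).
apply: (H (set_coord z i (y 0 i))).
  move=> j; rewrite !set_coordE; case: eqP => _; last by rewrite lexx.
  by have := yq i; rewrite rowDE hv_i; case: lab => -> ->.
split => // i' j; rewrite (ord1 i') /ball/= set_coordE; case: (eqVneq j i) => [->|ji].
  by rewrite subrr normr0.
have /andP[] := yq j; rewrite rowDE hv_j// addr0 => y1 y2.
have := side j; rewrite count_other_dirs// => sj.
have /andP[z1 z2] := zl j; have := Hk j; rewrite -sj => sj'.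
by rewrite ltr_norml; apply/andP; split; lra.
Qed.

(** The good columns exhaust the box up to the null set [bad_lines], and Fatou's lemma removes the
    restriction to them. Only nonnegative integrals occur, because integrability of [u] near Gamma
    is a consequence of this estimate and not yet available. *)
Lemma shift_variation_le i h a b : (forall k, a 0 k <= b 0 k) -> 0 <= h ->
  (\int[mu]_(z in hbox a b) `|u (z + hv i h) - u z|%:E <=
   ((b 0 i - a 0 i) * \int[mu]_(z in hbox a (b + hv i h)) `|G z 0 i|)%:E)%E.
Proof.
move=> ab h0; have mh := measurable_leb_hbox a b.
have mB : measurable (bad_lines Gamma i : set L) by exact: leb_null_measurable.
pose f k z := incr i h z * good_column i h (other_dirs i k) a b z.
have mf k : measurable_fun (hbox a b : set L) (f k).
  apply: measurable_funTS; apply: measurable_funM; first exact: measurable_incr.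
  exact: measurable_good_column.
apply: (@fatou_le _ L R mu (hbox a b) (bad_lines Gamma i : set L) f (incr i h) _ mh mB (bad0 i) mf).
- by apply: measurable_funTS; exact: measurable_incr.
- by move=> k z; apply: mulr_ge0; [exact: normr_ge0|exact: good_column_ge0].
- by move=> z; exact: normr_ge0.
- by move=> k; apply: shift_columns_le => //; exact: other_dirs_notin.
- move=> z zab nb; apply: cvg_near_cst; have := near_good_column ab h0 zab nb.
  by apply: filterS => k; rewrite /f => ->; rewrite mulr1.
Qed.

End across.

(** * Poincare inequality on boxes *)

Lemma integrable_setU d (T : measurableType d) (R : realType) (mu : {measure set T -> \bar R})
    (A B : set T) (f : T -> \bar R) : measurable A -> measurable B ->
  mu.-integrable A f -> mu.-integrable B f -> mu.-integrable (A `|` B) f.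
Proof.
move=> mA mB iA iB.
have mf : measurable_fun (A `|` B) f.
  by apply/measurable_funU => //; split; [move/measurable_int: iA|move/measurable_int: iB].
apply/integrableP; split => //.
have -> : A `|` B = A `|` (B `\` A).
  by apply/seteqP; split => x [?|]; [left|case: (pselect (A x)); [left|right]|left|case; right].
have mBA : measurable (B `\` A) by exact: measurableD.
have sub : A `|` (B `\` A) `<=` A `|` B by move=> x [|[]]; [left|right].
rewrite ge0_integral_setU//; last 2 first.
- by apply: measurable_funS (measurableT_comp _ mf) => //; exact: measurableU.
- by apply/eqP/seteqP; split => // x [? []].
apply: lte_add_pinfty; first by have /integrableP[] := iA.
apply: le_lt_trans (_ : (\int[mu]_(x in B) `|f x| < +oo)%E); last by have /integrableP[] := iB.
apply: ge0_subset_integral => //.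
by apply: measurableT_comp => //; move/measurable_int: iB.
Qed.

Lemma norm_add_le (R : realDomainType) (x y : R) : `|x| + `|y| <= `|x + y| + `|x - y|.
Proof.
have := ler_norm (x + y); have := ler_norm (x - y).
have := ler_norm (- (x + y)); have := ler_norm (- (x - y)); rewrite !normrN.
by case: (ler0P x) => ?; case: (ler0P y) => ?; move: `|x + y| `|x - y| => p q; lra.
Qed.

Section poincare.
Context {R : realType} {n : nat}.
Variables (Gamma : set 'rV[R]_n) (u : 'rV[R]_n -> R) (G : 'rV[R]_n -> 'rV[R]_n).
Local Notation L := (leb_space R n).
Local Notation mu := (leb R n).
Local Notation Omega := (~` Gamma).
Hypothesis Gamma_closed : closed Gamma.
Hypothesis Gamma0 : leb_outer Gamma = 0%E.
Hypothesis bad0 : forall i, leb_outer (bad_lines Gamma i) = 0%E.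
Hypothesis lu : loc_integrable Omega u.
Hypothesis wg : is_wgrad Omega u G.
Hypothesis iG : forall a b i, mu.-integrable (hbox a b) (EFin \o (fun z => G z 0 i)).

Implicit Types (a b c e z t : 'rV[R]_n) (i j : 'I_n) (h : R) (s : seq 'I_n).

Let integrable_incr i h a b : (forall k, a 0 k <= b 0 k) -> 0 <= h ->
  mu.-integrable (hbox a b) (EFin \o (fun z => u (z + hv i h) - u z)).
Proof.
move=> ab h0; apply/integrableP; split.
  apply/measurable_EFinP; apply: measurable_funTS.
  exact: (measurable_increment Gamma_closed Gamma0 lu i h).
exact: le_lt_trans (shift_variation_le Gamma_closed Gamma0 bad0 lu wg iG i ab h0) (ltry _).
Qed.

Lemma integrable_hbox_unshift (f : 'rV[R]_n -> R) t a b :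
  mu.-integrable (hbox a b) (EFin \o (fun z => f (z + t))) ->
  mu.-integrable (hbox (a + t) (b + t)) (EFin \o f).
Proof.
move=> H; have := @integrable_hbox_shift R n (- t) (a + t) (b + t) (fun z => f (z + t)).
rewrite !addrK => /(_ H); congr (mu.-integrable _ (EFin \o _)).
by apply/funext => z; rewrite addrNK.
Qed.

Lemma integrable_hbox_up i h a b : (forall k, a 0 k <= b 0 k) -> 0 <= h ->
  mu.-integrable (hbox a b) (EFin \o u) ->
  mu.-integrable (hbox (a + hv i h) (b + hv i h)) (EFin \o u).
Proof.
move=> ab h0 iu; apply: integrable_hbox_unshift.
have := integrableRD (measurable_leb_hbox a b) (integrable_incr i ab h0) iu.
by congr (mu.-integrable _ (EFin \o _)); apply/funext => z; rewrite subrK.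
Qed.

Lemma integrable_hbox_down i h a b : (forall k, a 0 k <= b 0 k) -> 0 <= h ->
  mu.-integrable (hbox (a + hv i h) (b + hv i h)) (EFin \o u) ->
  mu.-integrable (hbox a b) (EFin \o u).
Proof.
move=> ab h0 iu.
have := integrableRB (measurable_leb_hbox a b) (integrable_hbox_shift iu) (integrable_incr i ab h0).
by congr (mu.-integrable _ (EFin \o _)); apply/funext => z; rewrite opprB addrC subrK.
Qed.

Lemma integrable_hbox_dir i h a b : (forall k, a 0 k <= b 0 k) ->
  mu.-integrable (hbox a b) (EFin \o u) ->
  mu.-integrable (hbox (a + hv i h) (b + hv i h)) (EFin \o u).
Proof.
move=> ab iu; have [h0|h0] := leP 0 h; first exact: integrable_hbox_up.
have hK c : c + hv i h + hv i (- h) = c.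
  by rewrite /hv scaleNr addrK.
apply: (@integrable_hbox_down i (- h)); rewrite ?hK//.
  by move=> k; rewrite !rowDE lerD2r.
by rewrite oppr_ge0 ltW.
Qed.

Lemma integrable_hbox_translate t a b : (forall k, a 0 k <= b 0 k) ->
  mu.-integrable (hbox a b) (EFin \o u) ->
  mu.-integrable (hbox (a + t) (b + t)) (EFin \o u).
Proof.
move=> ab iu; rewrite (row_sum_delta t).
elim/big_ind: _ (a) (b) (ab) (iu) => [a' b' _|x y Hx Hy a' b' ab' iu'|i _ a' b' ab' iu'].
- by rewrite !addr0.
- rewrite !addrA; apply: (Hy _ _ _ (Hx _ _ ab' iu')).
  by move=> k; rewrite !rowDE lerD2r.
- exact: integrable_hbox_dir.
Qed.

Definition double_b i a b := b + hv i (b 0 i - a 0 i).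

Lemma double_bE i a b j : double_b i a b 0 j - a 0 j = (b 0 j - a 0 j) * (if j == i then 2 else 1).
Proof.
rewrite rowDE; case: eqP => [->|/eqP ji]; first by rewrite hv_i; ring.
by rewrite hv_j// addr0 mulr1.
Qed.

Lemma double_b_le i a b : (forall k, a 0 k <= b 0 k) -> forall k, a 0 k <= double_b i a b 0 k.
Proof.
move=> ab k; rewrite -subr_ge0 double_bE mulr_ge0 ?subr_ge0//.
by case: ifP.
Qed.

Lemma integrable_double i a b : (forall k, a 0 k <= b 0 k) ->
  mu.-integrable (hbox a b) (EFin \o u) ->
  mu.-integrable (hbox a (double_b i a b)) (EFin \o u).
Proof.
move=> ab iu; pose h := b 0 i - a 0 i.
have mh := measurable_leb_hbox.
have h0 : 0 <= h by rewrite subr_ge0.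
apply: (@integrableS _ _ _ mu (hbox a b `|` hbox (a + hv i h) (b + hv i h))).
- by apply: measurableU; exact: mh.
- exact: mh.
- move=> z H; have [zb|zb] := leP (z 0 i) (b 0 i); [left|right] => k; have := H k;
    rewrite !rowDE; have [->|ki] := eqVneq k i; rewrite ?hv_i ?hv_j// ?addr0// /h => /andP[z1 z2];
    apply/andP; split => //; lra.
- apply: integrable_setU; [exact: mh|exact: mh|exact: iu|exact: integrable_hbox_dir].
Qed.

Lemma integrable_double_iter s a b : (forall k, a 0 k <= b 0 k) ->
  mu.-integrable (hbox a b) (EFin \o u) ->
  exists b', [/\ (forall k, a 0 k <= b' 0 k), mu.-integrable (hbox a b') (EFin \o u) &
    forall j, b' 0 j - a 0 j = (b 0 j - a 0 j) * 2 ^+ count_mem j s].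
Proof.
move=> ab iu; elim: s => [|i s [b' [ab' iu' E]]] /=.
  by exists b; split => // j; rewrite expr0 mulr1.
exists (double_b i a b'); split; [exact: double_b_le|exact: integrable_double|].
move=> j; rewrite double_bE E -mulrA; congr (_ * _); rewrite (eq_sym i j).
by case: eqP => _; rewrite ?add1n ?add0n ?mulr1// exprSr.
Qed.

Lemma exists_small_box : exists (a : 'rV[R]_n) (e : R), 0 < e /\ box (Some (a, a + const_mx e)) `<=` Omega.
Proof.
have [z Oz] : exists z, Omega z.
  apply: contrapT => H.
  have sub : hbox 0 (const_mx 1) `<=` Gamma by move=> z _; apply: contrapT => Gz; apply: H; exists z.
  have := leb_hbox (0 : 'rV[R]_n) (const_mx 1).
  rewrite [LHS](leb_null_sub Gamma0 sub) /vol => -[] /esym.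
  under eq_bigr do rewrite !mxE subr0 (max_idPr ler01).
  by rewrite prodr_const expr1n => /eqP; rewrite oner_eq0.
have [||e e0 H] := @box_sub_open_enlarge R n Omega z z (closed_openC Gamma_closed).
- by move=> y H; suff -> : y = z by []; apply/rowP => i; apply/eqP; rewrite eq_sym eq_le; exact: H.
- by move=> i.
by exists z, e.
Qed.

(** Increments are integrable on every box. Hence integrability passes from one small box in the
    complement of Gamma to all its translates and, by doubling the sides, to boxes of any size. *)
Lemma integrable_hbox a b : mu.-integrable (hbox a b) (EFin \o u).
Proof.
have [a0 [e [e0 H]]] := exists_small_box.
pose b0 : 'rV[R]_n := a0 + const_mx e.
have ab0 k : a0 0 k <= b0 0 k by rewrite rowDE mxE lerDl ltW.
have i0 : mu.-integrable (hbox a0 b0) (EFin \o u) by exact: (integrable_hbox_in Gamma_closed lu).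
have [K HK] : exists K : nat, forall j, b 0 j - a 0 j <= e * 2 ^+ K.
  pose M := \sum_j `|b 0 j - a 0 j|.
  have M0 : 0 <= M by exact: sumr_ge0.
  exists (Num.bound (M / e)) => j.
  apply: (@le_trans _ _ M).
    apply: le_trans (ler_norm _) _; rewrite /M (bigD1 j)//= lerDl; exact: sumr_ge0.
  rewrite mulrC -ler_pdivrMr//.
  apply: ltW; apply: lt_le_trans (archi_boundP _) _; first by rewrite divr_ge0// ltW.
  by rewrite -natrX ler_nat ltnW// ltn_expl.
have [b1 [ab1 i1 E1]] := integrable_double_iter (all_dirs K) ab0 i0.
have i2 := integrable_hbox_translate (a - a0) ab1 i1.
apply: (@integrableS _ _ _ mu (hbox (a0 + (a - a0)) (b1 + (a - a0)))); last exact: i2.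
- exact: measurable_leb_hbox.
- exact: measurable_leb_hbox.
move=> z Hz k; have /andP[z1 z2] := Hz k; have := E1 k; have := HK k.
rewrite count_all_dirs /b0 rowDE !mxE [a0 0 k + e]addrC addrK.
by move: (e * 2 ^+ K) => X HX HE; apply/andP; split; lra.
Qed.

Let gint i a b := \int[mu]_(z in hbox a b) `|G z 0 i|.
Let gint_ge0 i a b : 0 <= gint i a b.
Proof. by apply: Rintegral_ge0. Qed.

(** Halving in the direction [i] itself gains a factor 1/2, the other directions are unaffected. The
    gain pays for the difference of the halves in [poincare_leaves]. *)
Lemma side_gradient_split i j a b : (forall k, a 0 k <= b 0 k) ->
  (lower_b a b j 0 i - a 0 i) * gint i a (lower_b a b j) +
  (b 0 i - upper_a a b j 0 i) * gint i (upper_a a b j) b =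
  (b 0 i - a 0 i) * gint i a b * (if i == j then 2^-1 else 1).
Proof.
move=> ab; rewrite [gint i a b](gradient_halves iG i j ab) -!/(gint _ _ _) !set_coordE.
case: eqP => [->|_]; last by rewrite mulr1 mulrDr.
by rewrite /mid; move: (gint _ _ _) (gint _ _ _) => x y; field.
Qed.

(** The upper half is the lower half translated by half of the side, so the increment estimate
    applies with [h] equal to the side of one half. *)
Lemma halves_difference_le (c : R) j a b : (forall k, a 0 k <= b 0 k) ->
  `|\int[mu]_(z in hbox a (lower_b a b j)) (u z - c) - \int[mu]_(z in hbox (upper_a a b j) b) (u z - c)| <=
  (b 0 j - a 0 j) * gint j a b / 2.
Proof.
move=> ab; set h := (b 0 j - a 0 j) / 2.
have h0 : 0 <= h by rewrite divr_ge0 ?subr_ge0.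
have ic x y : mu.-integrable (hbox x y) (EFin \o (fun=> c)).
  apply/integrableP; split; first by apply/measurable_EFinP; exact: measurable_cst.
  rewrite integral_cst; last exact: measurable_leb_hbox.
  by rewrite leb_hbox -EFinM ltry.
have iv x y : mu.-integrable (hbox x y) (EFin \o (fun z => u z - c)).
  exact: integrableRB (measurable_leb_hbox x y) (integrable_hbox x y) (ic x y).
have -> : upper_a a b j = a + hv j h.
  apply/rowP => k; rewrite rowDE set_coordE; case: eqP => [->|/eqP kj]; last by rewrite hv_j// addr0.
  by rewrite hv_i /mid /h; field.
have Eb : b = lower_b a b j + hv j h.
  apply/rowP => k; rewrite rowDE set_coordE; case: eqP => [->|/eqP kj]; last by rewrite hv_j// addr0.
  by rewrite hv_i /mid /h; field.
have loab := lower_le j ab.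
have -> : \int[mu]_(z in hbox (a + hv j h) b) (u z - c) =
   \int[mu]_(z in hbox a (lower_b a b j)) (u (z + hv j h) - c).
  rewrite [in LHS]Eb; apply: (Rint_hbox_shift (f := fun z => u z - c)).
  exact: integrableR_measurable (iv _ _).
rewrite distrC -RintegralB; [|exact: measurable_leb_hbox|exact: (integrable_hbox_shift (iv _ _))|exact: iv].
apply: le_trans (le_normr_Rintegral _ _) _.
- exact: measurable_leb_hbox.
- apply: integrableRB; [exact: measurable_leb_hbox|exact: (integrable_hbox_shift (iv _ _))|exact: iv].
have := shift_variation_le Gamma_closed Gamma0 bad0 lu wg iG j loab h0; rewrite -Eb.
have -> : lower_b a b j 0 j - a 0 j = h by rewrite set_coordE eqxx /mid /h; field.
have -> : (b 0 j - a 0 j) * gint j a b / 2 = h * gint j a b by rewrite /h mulrAC.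
have ii := integrable_norm (integrable_incr j loab h0).
rewrite -[X in (X <= _)%E](fineK (integrable_fin_num (measurable_leb_hbox _ _) ii)) lee_fin.
apply: le_trans; rewrite le_eqVlt; apply/orP; left; apply/eqP.
by congr fine; apply: eq_integral => z _ /=; rewrite opprB addrA subrK.
Qed.

(** For the integrals x and y over the halves, |x| + |y| <= |x + y| + |x - y|. The last term costs
    half of the summand of the split direction, and the other half is what the halves themselves
    use, so the total does not grow under halving. *)
Lemma poincare_leaves (c : R) s a b : (forall k, a 0 k <= b 0 k) ->
  \sum_(q <- leaves s a b) `|\int[mu]_(z in hbox q.1 q.2) (u z - c)| <=
  `|\int[mu]_(z in hbox a b) (u z - c)| + \sum_i (b 0 i - a 0 i) * gint i a b.
Proof.
elim: s a b => [|j s IH] a b ab /=.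
  rewrite big_seq1 lerDl; apply: sumr_ge0 => i _; rewrite mulr_ge0 ?subr_ge0//.
have ic x y : mu.-integrable (hbox x y) (EFin \o (fun=> c)).
  apply/integrableP; split; first by apply/measurable_EFinP; exact: measurable_cst.
  rewrite integral_cst; last exact: measurable_leb_hbox.
  by rewrite leb_hbox -EFinM ltry.
have iv : mu.-integrable (hbox a b) (EFin \o (fun z => u z - c)).
  exact: integrableRB (measurable_leb_hbox a b) (integrable_hbox a b) (ic a b).
rewrite big_cat /=.
apply: le_trans (lerD (IH _ _ (lower_le j ab)) (IH _ _ (upper_le j ab))) _.
have D := halves_difference_le c j ab.
rewrite (Rint_halves j ab iv) addrACA -big_split /=.
under eq_bigr do rewrite side_gradient_split//.
rewrite [X in _ + X](bigD1 j)//= [X in _ <= _ + X](bigD1 j)//= eqxx.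
under eq_bigr => i ij do rewrite (negbTE ij) mulr1.
move: D; set x := Rintegral _ _ _; set y := Rintegral _ _ _ => D.
have : `|x| + `|y| <= `|x + y| + `|x - y|.
  exact: norm_add_le.
move: D; set g := (b 0 j - a 0 j) * gint j a b; move: (\sum_(i < n | _) _) => S; lra.
Qed.

Lemma poincare_box (c : R) a b : (forall k, a 0 k <= b 0 k) ->
  \int[mu]_(z in hbox a b) `|u z - c| <=
  `|\int[mu]_(z in hbox a b) (u z - c)| + \sum_i (b 0 i - a 0 i) * \int[mu]_(z in hbox a b) `|G z 0 i|.
Proof.
move=> ab; have ic x y : mu.-integrable (hbox x y) (EFin \o (fun=> c)).
  apply/integrableP; split; first by apply/measurable_EFinP; exact: measurable_cst.
  rewrite integral_cst; last exact: measurable_leb_hbox.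
  by rewrite leb_hbox -EFinM ltry.
have iv := integrableRB (measurable_leb_hbox a b) (integrable_hbox a b) (ic a b).
by apply: (total_variation_le ab iv) => s; exact: poincare_leaves.
Qed.

End poincare.

(** * Weak gradients *)

Lemma integral_lin d (T : measurableType d) (R : realType) (mu : {measure set T -> \bar R})
    (D : set T) (c : R) (f g : T -> R) : measurable D ->
  mu.-integrable D (EFin \o f) -> mu.-integrable D (EFin \o g) ->
  (\int[mu]_(x in D) (c * f x + g x)%:E =
   c%:E * \int[mu]_(x in D) (f x)%:E + \int[mu]_(x in D) (g x)%:E)%E.
Proof.
move=> mD i1 i2.
under eq_integral do rewrite EFinD EFinM.
rewrite integralD//=; last by exact: (integrableRZ c mD i1).
by rewrite integralZl.
Qed.

Section gradient_unique.
Context {R : realType} {n : nat}.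
Local Notation L := (leb_space R n).
Local Notation mu := (leb R n).
Implicit Types (a b z : 'rV[R]_n) (i j : 'I_n) (f u v phi : 'rV[R]_n -> R) (U K Omega : set 'rV[R]_n).

Lemma ae_open U (P : 'rV[R]_n -> Prop) : open U ->
  (forall a b, (forall j, a 0 j <= b 0 j) -> box (Some (a, b)) `<=` U ->
     {ae mu, forall z, hbox a b z -> P z}) ->
  {ae mu, forall z, U z -> P z}.
Proof.
move=> oU H.
pose q (pk : 'rV[rat]_n * nat) : 'rV[R]_n := \row_i ratr (pk.1 0 i).
pose e (pk : 'rV[rat]_n * nat) : 'rV[R]_n := const_mx pk.2.+1%:R^-1.
have e0 pk i : 0 < e pk 0 i by rewrite mxE invr_gt0.
pose F k : set L := if unpickle k is Some pk then
  if `[< box (Some (q pk - e pk, q pk + e pk)) `<=` U >] then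
    ~` [set z | hbox (q pk - e pk) (q pk + e pk) z -> P z] else set0 else set0.
have F0 k : mu.-negligible (F k).
  rewrite /F; case: unpickle => [pk|]; last exact: negligible_set0.
  case: asboolP => sub; last exact: negligible_set0.
  apply: H => // j; have := e0 pk j; rewrite rowDE [leRHS]rowDE [(- e pk) 0 j]mxE; lra.
apply: negligibleS (negligible_bigcup F0) => z /= /not_implyP[Uz nP].
have /nbhs_ballP[r /= r0 rU] := open_nbhs_nbhs (conj oU Uz).
have [k ke] := exists_invSn_lt (divr_gt0 r0 (@ltr0Sn R 1)).
have Hi i : exists p : rat, `|z 0 i - ratr p| < k.+1%:R^-1 by exact: exists_rat_near.
have [f fP] := choice Hi.
exists (pickle (\row_i f i, k)) => //; rewrite /F pickleK.
set p := (\row_i f i, k).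
have lE i : (q p - e p) 0 i = ratr (f i) - k.+1%:R^-1 by rewrite rowDE !mxE.
have uE i : (q p + e p) 0 i = ratr (f i) + k.+1%:R^-1 by rewrite rowDE !mxE.
case: asboolP => [_ /=|]; last first.
  apply; move=> y By; apply: rU; split => // i j; rewrite (ord1 i) /ball/=.
  have : (q p - e p) 0 j <= y 0 j <= (q p + e p) 0 j := By j.
  have := fP j; rewrite lE uE; move: ke (z 0 j) (y 0 j) (ratr (f j)) => + x y' w.
  move: (k.+1%:R^-1) => s; rewrite !ltr_norml => ? /andP[? ?] /andP[? ?]; apply/andP; split; lra.
move=> Himp; apply: nP; apply: Himp => j; rewrite lE uE.
have := fP j; move: (k.+1%:R^-1) (ratr (f j)) => s w.
rewrite ltr_norml => /andP[? ?]; apply/andP; split; lra.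
Qed.

(** By [hbox_integral_eq0] the integrals over all boxes inside [Omega] vanish, hence so do all
    dyadic sums of absolute integrals and, by [total_variation_le], the L^1 norm on each box. *)
Lemma test_zero_ae Omega f : open Omega -> loc_integrable Omega f ->
  (forall phi, test_function Omega phi -> (\int[mu]_(z in Omega) (f z * phi z)%:E = 0)%E) ->
  {ae mu, forall z, Omega z -> f z = 0}.
Proof.
move=> oO lf f0; apply: ae_open => // a b ab abO.
have cf x y : box (Some (x, y)) `<=` box (Some (a, b)) -> mu.-integrable (hbox x y) (EFin \o f).
  move=> sub; apply: (@integrableS _ _ _ mu (box (Some (x, y)))); last first.
  - exact: (loc_integrable_compact oO lf (@compact_box R n _) (subset_trans sub abO)).
  - exact: hbox_sub_box.
  - exact: measurable_leb_hbox.
  - exact: measurable_leb_box.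
have iF := cf a b (@subset_refl _ _).
apply: (Rint_ae0 (measurable_leb_hbox a b) iF).
apply: (total_variation_le ab iF) => s.
suff -> : \sum_(q <- leaves s a b) `|\int[mu]_(z in hbox q.1 q.2) f z| = 0 by [].
have : forall a' b', (forall j, a' 0 j <= b' 0 j) -> box (Some (a', b')) `<=` Omega ->
    \sum_(q <- leaves s a' b') `|\int[mu]_(z in hbox q.1 q.2) f z| = 0; last exact.
elim: s => [|j s IH] a' b' ab' abO' /=.
  by rewrite big_seq1 (hbox_integral_eq0 oO lf f0)// normr0.
have mj := mid_bounds (ab' j).
rewrite big_cat /= !IH ?addr0//.
- exact: upper_le.
- move=> z H; apply: abO' => k; have /andP[z1 ->] := H k; rewrite andbT; apply: le_trans z1.
  by rewrite set_coordE; case: eqP => // ->; case/andP: mj.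
- exact: lower_le.
- move=> z H; apply: abO' => k; have /andP[-> /= z1] := H k; apply: le_trans z1 _.
  by rewrite set_coordE; case: eqP => // ->; case/andP: mj.
Qed.

Lemma partial_eq0_near i phi (V : set 'rV[R]_n) z : open V -> V z ->
  (forall x, V x -> phi x = 0) -> partial i phi z = 0.
Proof.
move=> oV Vz p0; rewrite /partial (@near_eq_derive _ _ _ _ (cst 0)) ?derive_cst//.
by near=> x; apply: p0; near: x; exact: open_nbhs_nbhs.
Unshelve. all: by end_near. Qed.

Lemma test_function_partial Omega phi i : test_function Omega phi -> test_function Omega (partial i phi).
Proof.
move=> [sp [K [cK KO p0]]]; split.
  by move=> s; have := sp (rcons s i); rewrite /= foldr_rcons.
exists K; split => // x Kx; apply: (@partial_eq0_near i phi (~` K)) => //.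
by apply: closed_openC; exact: compact_closed.
Qed.

Lemma test_function_continuous Omega phi : test_function Omega phi -> continuous phi.
Proof. by move=> [sp _]; have [] := sp [::]. Qed.

Lemma test_function_bounded Omega phi : test_function Omega phi -> exists C : R, forall x, `|phi x| <= C.
Proof.
move=> tp; have cp := test_function_continuous tp; have [_ [K [cK KO p0]]] := tp.
have : compact (phi @` K) by apply: continuous_compact => //; exact: continuous_subspaceT.
move=> /compact_bounded[M [_ HM]]; exists (Num.max 0 (M + 1)) => x; rewrite le_max.
have [Kx|nK] := pselect (K x); last by rewrite p0// normr0 lexx.
by rewrite (HM (M + 1)) ?orbT// ?ltrDl//; exists x.
Qed.

Lemma integrable_test Omega f phi : open Omega -> loc_integrable Omega f -> test_function Omega phi ->
  mu.-integrable Omega (EFin \o (fun z => f z * phi z)).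
Proof.
move=> oO lf tp; have cp := test_function_continuous tp; have [_ [K [cK KO p0]]] := tp.
have mK : measurable (K : set L) by exact: measurable_leb_compact.
have mp : measurable_fun (setT : set L) phi by exact: measurable_leb_continuous.
have [C HC] := test_function_bounded tp.
have ifK := loc_integrable_compact oO lf cK KO.
have iK : mu.-integrable K (EFin \o (fun z => f z * phi z)).
  by apply: (integrableR_mul mK ifK (measurable_funTS mp)) => x _; exact: HC.
apply/integrableP; split.
  apply/measurable_EFinP; apply: measurable_funM; first by case: lf.
  by apply: measurable_funTS; exact: mp.
rewrite (@integral_support _ _ _ mu Omega K)//.
  by have /integrableP[] := iK.
by move=> x _ nK; rewrite /= p0// mulr0 normr0.
Qed.

Lemma wgrad_unique Omega u (G G' : 'rV[R]_n -> 'rV[R]_n) : open Omega ->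
  is_wgrad Omega u G -> is_wgrad Omega u G' ->
  forall i, {ae mu, forall z, Omega z -> G z 0 i = G' z 0 i}.
Proof.
move=> oO wG wG' i; have [lG HG] := wG i; have [lG' HG'] := wG' i.
have mO : measurable (Omega : set L) by exact: measurable_leb_open.
have ld : loc_integrable Omega (fun z => G z 0 i - G' z 0 i).
  split; first by apply: measurable_funB; [case: lG|case: lG'].
  move=> K cK KO; have mK := measurable_leb_compact cK.
  have := integrableRB mK (loc_integrable_compact oO lG cK KO) (loc_integrable_compact oO lG' cK KO).
  by move=> /integrableP[].
have := test_zero_ae oO ld; case => [phi tp|N [mN N0 sub]].
  have i1 := integrable_test oO lG tp; have i2 := integrable_test oO lG' tp.
  under eq_integral do rewrite mulrBl EFinB.
  rewrite (integralB_EFin mO i1 i2).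
  have := HG _ tp; rewrite HG'// => /oppe_inj <-.
  by rewrite subee//; exact: (integrable_fin_num mO i2).
exists N; split => //; apply: subset_trans sub => z /= H1 H2; apply: H1 => Oz.
by apply/eqP; rewrite -subr_eq0; apply/eqP; exact: H2.
Qed.

Lemma loc_integrable_lin Omega (c : R) u v : open Omega -> loc_integrable Omega u ->
  loc_integrable Omega v -> loc_integrable Omega (fun z => c * u z + v z).
Proof.
move=> oO lu lv; split.
  apply: measurable_funD; last by case: lv.
  by apply: measurable_funM; [exact: measurable_cst|case: lu].
move=> K cK KO; have mK := measurable_leb_compact cK.
have := integrableRD mK (integrableRZ c mK (loc_integrable_compact oO lu cK KO))
  (loc_integrable_compact oO lv cK KO).
by move=> /integrableP[].
Qed.

Lemma is_wgrad_lin Omega (c : R) u v (G H : 'rV[R]_n -> 'rV[R]_n) : open Omega ->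
  loc_integrable Omega u -> loc_integrable Omega v ->
  is_wgrad Omega u G -> is_wgrad Omega v H ->
  is_wgrad Omega (fun z => c * u z + v z) (fun z => c *: G z + H z).
Proof.
move=> oO lu lv wG wH i; have [lG HG] := wG i; have [lH HH] := wH i.
have mO : measurable (Omega : set L) by exact: measurable_leb_open.
split; first by under eq_fun do rewrite !mxE; exact: loc_integrable_lin.
move=> phi tp; have tq := test_function_partial i tp.
have lin (f g psi : 'rV[R]_n -> R) : loc_integrable Omega f -> loc_integrable Omega g ->
    test_function Omega psi ->
    (\int[mu]_(z in Omega) ((c * f z + g z) * psi z)%:E =
     c%:E * (\int[mu]_(z in Omega) (f z * psi z)%:E) + \int[mu]_(z in Omega) (g z * psi z)%:E)%E.
  move=> lf lg tpsi.
  have i1 := integrable_test oO lf tpsi; have i2 := integrable_test oO lg tpsi.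
  rewrite -(integral_lin c mO i1 i2).
  by apply: eq_integral => z _; rewrite mulrDl -mulrA.
have E1 := integrable_fin_num mO (integrable_test oO lG tp).
have E2 := integrable_fin_num mO (integrable_test oO lH tp).
rewrite (lin _ _ _ lu lv tq) (HG _ tp) (HH _ tp).
under [in RHS]eq_integral do rewrite !mxE.
rewrite (lin _ _ _ lG lH tp); move: E1 E2.
rewrite /comp; case: (integral _ _ _) => [r||]; case: (integral _ _ _) => [r'||] // _ _.
have E : c * - r - r' = - (c * r + r') by ring.
exact: (congr1 EFin E).
Qed.

End gradient_unique.

(** * Tonelli theorem and Borel sets for Hausdorff measure *)

Section tonelli_on.
Context {d1 d2 : measure_display} {T1 : measurableType d1} {T2 : measurableType d2} {R : realType}.

(** Hausdorff measure of dimension d < n is not sigma-finite on the whole space but only on Gamma.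
    Finiteness is therefore asked for the traces on [D], and Tonelli's theorem is applied to
    restricted measures. *)
Definition sigma_finite_on d (T : measurableType d) (m : {measure set T -> \bar R}) (D : set T) :=
  exists F : (set T)^nat, (forall k, measurable (F k) /\ (m (F k `&` D) < +oo)%E) /\ \bigcup_k F k = setT.

(** Product measures are built on sigma-finite measures as a structure; this turns the property into
    that structure without changing the underlying function. *)
Lemma sigma_finite_pack d (T : measurableType d) (m : {measure set T -> \bar R}) :
  sigma_finite setT m -> exists m' : {sigma_finite_measure set T -> \bar R}, (m' : set T -> \bar R) = m.
Proof.
case: m => f [c1 c2] sf.
pose M := @Measure_isSigmaFinite.Axioms_ d T R f c1 c2 sf.
pose m' : {sigma_finite_measure set T -> \bar R} := HB.pack f c1 c2 M.
by exists m'.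
Qed.

Lemma sigma_finite_restr d (T : measurableType d) (m : {measure set T -> \bar R}) (D : set T) :
  measurable D -> sigma_finite_on m D ->
  exists m' : {sigma_finite_measure set T -> \bar R}, forall A, m' A = m (A `&` D).
Proof.
move=> mD [F [FP FT]].
have sf : sigma_finite setT (mrestr m mD).
  by exists F => // k; have [? ?] := FP k; split.
have [m' E] := sigma_finite_pack sf; exists m' => A.
by rewrite -[LHS]/((m' : set T -> \bar R) A) E.
Qed.

Variables (m1 : {measure set T1 -> \bar R}) (m2 : {measure set T2 -> \bar R}) (D1 : set T1) (D2 : set T2).
Hypotheses (mD1 : measurable D1) (mD2 : measurable D2).
Hypotheses (s1 : sigma_finite_on m1 D1) (s2 : sigma_finite_on m2 D2).
Variable f : T1 * T2 -> \bar R.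
Hypotheses (mf : measurable_fun (D1 `*` D2) f) (f0 : forall xy, (0 <= f xy)%E).
Local Open Scope ereal_scope.

Let f' := f \_ (D1 `*` D2).

Let mf' : measurable_fun setT f'.
Proof. by apply/(measurable_restrictT f) => //; exact: measurableX. Qed.

Let f'0 xy : 0 <= f' xy.
Proof. by rewrite /f' patchE; case: ifP. Qed.

Let f'E2 (m : {measure set T2 -> \bar R}) x : D1 x ->
  \int[m]_(y in D2) f (x, y) = \int[m]_y f' (x, y).
Proof.
move=> D1x; rewrite integral_mkcond; apply: eq_integral => y _.
rewrite /f' !patchE; case: ifP => yD; case: ifP => // H.
  by move/negP : H; rewrite inE => -[]; split => //; rewrite inE in yD.
by move: H; rewrite inE => -[_ /= D2y]; move: yD; rewrite (mem_set D2y).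
Qed.

Let f'E1 (m : {measure set T1 -> \bar R}) y : D2 y ->
  \int[m]_(x in D1) f (x, y) = \int[m]_x f' (x, y).
Proof.
move=> D2y; rewrite integral_mkcond; apply: eq_integral => x _.
rewrite /f' !patchE; case: ifP => yD; case: ifP => // H.
  by move/negP : H; rewrite inE => -[]; split => //; rewrite inE in yD.
by move: H; rewrite inE => -[/= D1x _]; move: yD; rewrite (mem_set D1x).
Qed.

Let f'out2 x y : ~ D2 y -> f' (x, y) = 0.
Proof. by move=> nD; rewrite /f' patchE; case: ifP => //; rewrite inE => -[]. Qed.

Let f'out1 x y : ~ D1 x -> f' (x, y) = 0.
Proof. by move=> nD; rewrite /f' patchE; case: ifP => //; rewrite inE => -[]. Qed.

Lemma measurable_integral_on : measurable_fun D1 (fun x => \int[m2]_(y in D2) f (x, y)).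
Proof.
have [m2' E2] := sigma_finite_restr mD2 s2.
apply: (eq_measurable_fun (fun x => \int[m2']_y f' (x, y))).
  move=> x; rewrite inE => D1x; rewrite -f'E2//; apply: eq_measure_integral => A mA AD.
  exact: etrans (E2 A) (congr1 m2 (setIidl AD)).
apply: (@measurable_funTS) => //.
exact: (@measurable_fun_fubini_tonelli_F _ _ _ _ _ m2' _ mf' f'0).
Qed.

Lemma measurable_integral_on2 : measurable_fun D2 (fun y => \int[m1]_(x in D1) f (x, y)).
Proof.
have [m1' E1] := sigma_finite_restr mD1 s1.
apply: (eq_measurable_fun (fun y => \int[m1']_x f' (x, y))).
  move=> y; rewrite inE => D2y; rewrite -f'E1//; apply: eq_measure_integral => A mA AD.
  exact: etrans (E1 A) (congr1 m1 (setIidl AD)).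
apply: (@measurable_funTS) => //.
exact: (@measurable_fun_fubini_tonelli_G _ _ _ _ _ m1' _ mf' f'0).
Qed.

Lemma tonelli_on : \int[m1]_(x in D1) \int[m2]_(y in D2) f (x, y) =
  \int[m2]_(y in D2) \int[m1]_(x in D1) f (x, y).
Proof.
have [m1' E1] := sigma_finite_restr mD1 s1.
have [m2' E2] := sigma_finite_restr mD2 s2.
have := @fubini_tonelli _ _ _ _ _ m1' m2' _ mf' f'0.
have -> : \int[m1']_x \int[m2']_y f' (x, y) = \int[m1]_(x in D1) \int[m2]_(y in D2) f (x, y).
  rewrite (@integral_support _ _ _ m1' setT D1)//; last first.
    by move=> x _ nD; rewrite integral0_eq// => y _; exact: f'out1.
  rewrite (@eq_measure_integral _ _ _ _ m1); last by move=> A mA AD; exact: etrans (E1 A) (congr1 m1 (setIidl AD)).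
  apply: eq_integral => x; rewrite inE => D1x; rewrite -f'E2//.
  by apply: eq_measure_integral => A mA AD; exact: etrans (E2 A) (congr1 m2 (setIidl AD)).
move=> ->.
rewrite (@integral_support _ _ _ m2' setT D2)//; last first.
  by move=> y _ nD; rewrite integral0_eq// => x _; exact: f'out2.
rewrite (@eq_measure_integral _ _ _ _ m2); last by move=> A mA AD; exact: etrans (E2 A) (congr1 m2 (setIidl AD)).
apply: eq_integral => y; rewrite inE => D2y; rewrite -f'E1//.
by apply: eq_measure_integral => A mA AD; exact: etrans (E1 A) (congr1 m1 (setIidl AD)).
Qed.

Lemma tonelli_le (C : R) (h : T2 -> \bar R) : (0 <= C)%R -> measurable_fun D2 h -> (forall y, 0 <= h y) ->
  (forall y, D2 y -> \int[m1]_(x in D1) f (x, y) <= C%:E * h y) ->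
  \int[m1]_(x in D1) \int[m2]_(y in D2) f (x, y) <= C%:E * \int[m2]_(y in D2) h y.
Proof.
move=> C0 mh h0 H; rewrite tonelli_on -ge0_integralZl//.
apply: ge0_le_integral => //.
- by move=> y _; apply: integral_ge0 => x _; exact: f0.
- exact: measurable_integral_on2.
- by apply: emeasurable_funM => //; exact: measurable_cst.
Qed.

End tonelli_on.

Section metric_outer.
Context {R : realType} {T : Type}.
Variables (mu : {outer_measure set T -> \bar R}) (f : T -> R).
Hypothesis sep : forall (A B : set T) (c e : R), 0 < e -> A `<=` [set x | f x <= c] ->
  B `<=` [set x | c + e <= f x] -> (mu A + mu B <= mu (A `|` B))%E.

(* Caratheodory's criterion: the slabs between the levels c + 1/(k+1) of equal parity are separated,
   hence the sum of their measures converges. *)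
Lemma caratheodory_halfspace (c : R) : mu.-caratheodory [set x | f x <= c].
Proof.
apply: le_caratheodory_measurable => X.
have [->|Xoo] := eqVneq (mu X) +oo%E; first by rewrite leey.
pose t (k : nat) : R := c + k.+1%:R^-1.
have tlt k : t k.+1 < t k by rewrite ltrD2l ltf_pV2 ?posrE// ltr_nat.
pose Y k := X `&` [set x | t k <= f x].
pose D k := X `&` [set x | t k.+1 <= f x < t k].
have fin (A : set T) : A `<=` X -> mu A \is a fin_num.
  move=> AX; rewrite ge0_fin_numE ?outer_measure_ge0//.
  by apply: le_lt_trans (le_outer_measure mu _ _ AX) _; rewrite ltey.
have YX k : Y k `<=` X by move=> x [].
have DX k : D k `<=` X by move=> x [].
pose S := [set x | f x <= c].
pose r k := fine (mu (Y k)); pose s k := fine (mu (D k)).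
have rE k : mu (Y k) = (r k)%:E by rewrite fineK// fin.
have sE k : mu (D k) = (s k)%:E by rewrite fineK// fin.
have SE : mu (X `&` S) = (fine (mu (X `&` S)))%:E by rewrite fineK// fin// => x [].
have XE : mu X = (fine (mu X))%:E by rewrite fineK// fin.
have CE : mu (X `&` ~` S) = (fine (mu (X `&` ~` S)))%:E by rewrite fineK// fin// => x [].
have rec k : s k.+1 + r k <= r k.+2.
  rewrite -lee_fin EFinD -rE -sE -rE addeC.
  have H : (mu (D k.+1) + mu (Y k) <= mu (D k.+1 `|` Y k))%E.
    apply: (@sep _ _ (t k.+1) (t k - t k.+1)).
    - by rewrite subr_gt0.
    - by move=> x [_ /= /andP[_ /ltW]].
    - by move=> x [_ /=]; rewrite addrC subrK.
  rewrite addeC; apply: le_trans H _; apply: le_outer_measure => x [[Xx /= /andP[? _]]|[Xx /= tx]]; split => //=.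
  by apply: ltW; apply: lt_le_trans tx; exact: lt_trans (tlt k).
have rS k : fine (mu (X `&` S)) + r k <= fine (mu X).
  rewrite -lee_fin EFinD -rE -SE -XE.
  apply: (@le_trans _ _ (mu ((X `&` S) `|` Y k))).
    apply: (@sep _ _ c k.+1%:R^-1); [by rewrite invr_gt0|by move=> x []|by move=> x []].
  by apply: le_outer_measure => x [[]|[]].
have r0 k : 0 <= r k by rewrite fine_ge0// outer_measure_ge0.
have s0 k : 0 <= s k by rewrite fine_ge0// outer_measure_ge0.
pose Phi := sup (range r).
have ub : has_ubound (range r) by exists (fine (mu X) - fine (mu (X `&` S))) => _ [k _ <-]; have := rS k; lra.
have rPhi k : r k <= Phi by apply: ub_le_sup => //; exists k.
have PhiS : fine (mu (X `&` S)) + Phi <= fine (mu X).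
  rewrite addrC -lerBrDr; apply: ge_sup; first by exists (r 0%N), 0%N.
  by move=> _ [k _ <-]; have := rS k; lra.
(* Summing [rec] telescopes with step two, which leaves boundary terms at two consecutive indices at
   each end. *)
have part m N : \sum_(k < N) s (m.+1 + k)%N <= r (m + N)%N + r (m + N).+1 - r m - r m.+1.
  elim: N => [|N IH]; first by rewrite big_ord0 addn0; lra.
  rewrite big_ord_recr /= addnS; have := rec (m + N)%N; rewrite -addSn; move: IH.
  set A := \sum_(_ < _) _; rewrite addSn; lra.
(* Points above the level [c] but below [t m.+1] lie in slabs of index at least m + 1. By [part] and
   the monotonicity of [r] these slabs have total measure at most 2 (Phi - r m), which is small for
   suitable [m]. *)
have cover m : (mu (X `&` ~` S) <= (r m.+1 + 2 * (Phi - r m))%:E)%E.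
  apply: (@le_trans _ _ (mu (Y m.+1) + mu (\bigcup_k D (m.+1 + k)%N))%E).
    apply: le_trans (outer_measureU2 mu _ _); apply: le_outer_measure => x [Xx /= /negP].
    rewrite -ltNge => cx; have [H|H] := leP (t m.+1) (f x); [by left|right].
    have [K tK] : exists K, t K <= f x.
      have fx0 : 0 < f x - c by rewrite subr_gt0.
      have [k Hk] := exists_invSn_lt fx0.
      by exists k; move: Hk; rewrite /t; move: (k.+1%:R^-1) => q; lra.
    have mK : (m.+1 < K)%N.
      rewrite ltnNge; apply/negP => Km; move: H; rewrite ltNge => /negP; apply.
      by apply: le_trans tK; rewrite lerD2l lef_pV2 ?posrE// ler_nat.
    have [k Hk] : exists k, t (m.+1 + k).+1 <= f x < t (m.+1 + k)%N.
      apply: contrapT => no.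
      have : forall j, f x < t (m.+1 + j)%N.
        elim=> [|j IH]; first by rewrite addn0.
        by rewrite ltNge; apply/negP => tj; apply: no; exists j; rewrite IH andbT -addnS.
      by move/(_ (K - m.+1)%N); rewrite subnKC ?(ltnW mK)// ltNge tK.
    by exists k => //; split.
  rewrite rE EFinD leeD2l//.
  apply: le_trans (outer_measure_sigma_subadditive mu _) _.
  apply: lime_le; first by apply: is_cvg_nneseries => *; exact: outer_measure_ge0.
  apply: nearW => N; rewrite (eq_bigr (fun k => (s (m.+1 + k)%N)%:E)); last by move=> k _; rewrite sE.
  rewrite sumEFin lee_fin big_mkord; apply: le_trans (part m N) _.
  have := rPhi (m + N)%N; have := rPhi (m + N).+1; have := r0 m.
  have : r m <= r m.+1.
    rewrite -lee_fin -!rE; apply: le_outer_measure => x [Xx /= tx]; split => //=.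
    exact: le_trans (ltW (tlt m)) tx.
  lra.
rewrite SE CE XE -EFinD lee_fin.
apply/ler_addgt0Pr => e e0.
have hs : has_sup (range r) by split => //; exists (r 0%N), 0%N.
have e2 : 0 < e / 2 by rewrite divr_gt0.
have [_ [m _ <-] Hm] := sup_adherent e2 hs.
have := cover m; rewrite CE lee_fin; have := rPhi m.+1; move: Hm; rewrite -/Phi; lra.
Qed.

End metric_outer.

Section hausdorff_borel.
Context {R : realType} {n : nat} (d : R).
Local Notation H := (haus_space R n d).
Local Open Scope ereal_scope.

Lemma haus_cost_ge0 (E : set 'rV[R]_n) : 0 <= haus_cost d E.
Proof. by rewrite /haus_cost; case: ifP => // _; exact: poweR_ge0. Qed.

Lemma haus_pre_mono (e e' : R) (A : set 'rV[R]_n) : (e <= e')%R -> haus_pre d e' A <= haus_pre d e A.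
Proof.
move=> ee; apply: ereal_inf_le_tmp => _ [s [Ps As] <-]; exists s => //; split => // k /=.
by apply: le_trans (Ps k) _; rewrite lee_fin.
Qed.

Lemma ediam_set0 : ediam (set0 : set 'rV[R]_n) = 0.
Proof. by rewrite /ediam setX0 image_set0 setU0; exact: ereal_sup1. Qed.

(** A piece of diameter at most [e] cannot meet both sets. Keeping the pieces that meet [A],
    respectively [B], and replacing the others by the empty set splits the cover into two covers
    without increasing the cost. *)
Lemma haus_pre_sep (A B : set 'rV[R]_n) (e : R) : (0 < e)%R ->
  (forall x y, A x -> B y -> e < enorm (x - y))%R ->
  haus_pre d e A + haus_pre d e B <= haus_pre d e (A `|` B).
Proof.
move=> e0 AB; apply: le_ereal_inf_tmp => _ [s [Ps Us] <-].
pose p (C : set 'rV[R]_n) k := if `[< exists x, C x /\ s k x >] then s k else set0.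
have pP (C : set 'rV[R]_n) : C `<=` A `|` B ->
    (forall k, ediam (p C k) <= e%:E) /\ C `<=` \bigcup_k p C k.
  move=> CAB; split => [k|x Cx].
    by rewrite /p; case: asboolP => _; [exact: Ps|rewrite ediam_set0 lee_fin ltW].
  by have [k _ skx] := Us _ (CAB _ Cx); exists k => //; rewrite /p asboolT//; exists x.
have le (C : set 'rV[R]_n) : C `<=` A `|` B -> haus_pre d e C <= \sum_(0 <= k <oo) haus_cost d (p C k).
  by move=> /pP[P1 P2]; apply: ereal_inf_lbound; exists (p C) => //; split.
apply: le_trans (leeD (le A _) (le B _)) _; [by move=> x; left|by move=> x; right|].
rewrite -nneseriesD; [|by move=> *; exact: haus_cost_ge0|by move=> *; exact: haus_cost_ge0].
apply: lee_nneseries => k *; first by rewrite adde_ge0 ?haus_cost_ge0.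
rewrite /p; case: asboolP => [[x [Ax sx]]|_]; last first.
  by rewrite {1}/haus_cost eqxx add0e; case: asboolP => // _; rewrite /haus_cost eqxx haus_cost_ge0.
case: asboolP => [[y [By sy]]|_]; last by rewrite {2}/haus_cost eqxx adde0.
have := Ps k; rewrite /= => /(le_trans (ediam_ge sx sy)); rewrite lee_fin => le1.
by have := AB _ _ Ax By; rewrite ltNge le1.
Qed.

Lemma haus_outer_sep (A B : set 'rV[R]_n) (e : R) : (0 < e)%R ->
  (forall x y, A x -> B y -> e < enorm (x - y))%R ->
  haus_outer d A + haus_outer d B <= haus_outer d (A `|` B).
Proof.
move=> e0 AB.
have pre0 e' (C : set 'rV[R]_n) : 0 <= haus_pre d e' C by apply: cover_outer_ge0 => E; exact: haus_cost_ge0.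
have up e' (C : set 'rV[R]_n) : (0 < e')%R -> haus_pre d e' C <= haus_outer d C.
  by move=> ?; apply: ereal_sup_ubound; exists e'.
have key e1 e2 : (0 < e1)%R -> (0 < e2)%R ->
    haus_pre d e1 A + haus_pre d e2 B <= haus_outer d (A `|` B).
  (* A scale below both [e1] and [e2] and below the separation, so that [haus_pre_sep] applies at
     this scale. *)
  move=> e10 e20; pose m := Num.min e (Num.min e1 e2).
  have m0 : (0 < m)%R by rewrite !lt_min e0 e10.
  apply: le_trans (up m _ m0).
  apply: le_trans (haus_pre_sep m0 _); last first.
    by move=> x y Ax By; apply: le_lt_trans (AB _ _ Ax By); rewrite ge_min lexx.
  by apply: leeD; apply: haus_pre_mono; rewrite !ge_min lexx ?orbT.
have h0 (C : set 'rV[R]_n) : 0 <= haus_outer d C by exact: le_trans (pre0 _ _) (up 1%R C ltr01).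
have [|Afin] := eqVneq (haus_outer d A) +oo.
  move=> Aoo; have -> : haus_outer d (A `|` B) = +oo; last by rewrite leey.
  apply/eqP; rewrite -leye_eq -Aoo; apply: ge_ereal_sup => _ [e' /= e'0 <-].
  by apply: le_trans (key _ 1%R e'0 ltr01); rewrite leeDl.
have [|Bfin] := eqVneq (haus_outer d B) +oo.
  move=> Boo; have -> : haus_outer d (A `|` B) = +oo; last by rewrite leey.
  apply/eqP; rewrite -leye_eq -Boo; apply: ge_ereal_sup => _ [e' /= e'0 <-].
  by apply: le_trans (key 1%R _ ltr01 e'0); rewrite leeDr.
have fA : haus_outer d A \is a fin_num by rewrite ge0_fin_numE// ltey.
have fB : haus_outer d B \is a fin_num by rewrite ge0_fin_numE// ltey.
apply/lee_addgt0Pr => x x0.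
have [_ [e1 e10 <-] H1] := ub_ereal_sup_adherent (divr_gt0 x0 (ltr0Sn R 1)) fA.
have [_ [e2 e20 <-] H2] := ub_ereal_sup_adherent (divr_gt0 x0 (ltr0Sn R 1)) fB.
apply: le_trans (leeD2r _ (key _ _ e10 e20)).
rewrite [x in leRHS]splitr EFinD addeACA; apply: leeD.
  by rewrite -leeBlDr//; exact: ltW.
by rewrite -leeBlDr//; exact: ltW.
Qed.

Lemma measurable_fun_halfspace d1 (T : measurableType d1) (f : T -> R) :
  (forall c, measurable [set x | (f x <= c)%R]) -> measurable_fun setT f.
Proof.
move=> mf; apply: (measurability _ (RGenCInfty.measurableE R)).
move=> _ [_ [a ->] <-]; rewrite setTI.
rewrite (_ : _ @^-1` _ = ~` \bigcup_k [set x | (f x <= a - k.+1%:R^-1)%R]).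
  by apply: measurableC; apply: bigcupT_measurable => k; exact: mf.
apply/seteqP; split => x /=; rewrite in_itv/= andbT.
  by move=> ax [k _ /=]; apply/negP; rewrite -ltNge ltrBlDr (le_lt_trans ax)// ltrDl.
move=> Hk; rewrite leNgt; apply/negP => xa; apply: Hk.
have ax : (0 < a - f x)%R by lra.
have [k] := exists_invSn_lt ax.
by exists k => //=; rewrite lerBrDr -lerBrDl ltW.
Qed.

Lemma measurable_haus_coord i : measurable_fun (setT : set H) (fun x : H => (x : 'rV[R]_n) 0%R i).
Proof.
apply: measurable_fun_halfspace => c.
apply: (@caratheodory_halfspace R 'rV[R]_n (@haus_outer R n d) (fun x => x 0%R i)).
move=> A B b e e0 Ab Bb; apply: (@haus_outer_sep A B (e / 2)); first by rewrite divr_gt0.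
move=> x y /Ab /= xb /Bb /= yb; apply: lt_le_trans (coord_le_enorm _ i).
rewrite !mxE distrC; apply: lt_le_trans (ler_norm _); lra.
Qed.

Lemma measurable_haus_closed (F : set 'rV[R]_n) : closed F -> measurable (F : set H).
Proof. exact: (measurable_coord_closed measurable_haus_coord). Qed.

Lemma measurable_haus_open (U : set 'rV[R]_n) : open U -> measurable (U : set H).
Proof. exact: (measurable_coord_open measurable_haus_coord). Qed.

Lemma measurable_haus_continuous (f : 'rV[R]_n -> R) : continuous f -> measurable_fun (setT : set H) f.
Proof. exact: (measurable_coord_continuous measurable_haus_coord). Qed.

End hausdorff_borel.

(** * Euclidean norm and distance to Gamma *)

(** The discriminant argument shared by the Cauchy-Schwarz inequalities for the Euclidean product,
    for semi-inner products and for energy forms. The degenerate case b = 0 is included because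
    those forms may vanish on nonzero functions. *)
Lemma cs_quadratic (R : realFieldType) (a b p : R) : 0 <= a -> 0 <= b ->
  (forall c, 0 <= a ^+ 2 + 2 * c * p + c ^+ 2 * b ^+ 2) -> `|p| <= a * b.
Proof.
move=> a0 b0 H.
have [b00|bN0] := eqVneq b 0.
  suff -> : p = 0 by rewrite normr0 mulr_ge0.
  apply/eqP; apply: contraT => pN0.
  have := H (- (a ^+ 2 + 1) / (2 * p)); rewrite b00 expr0n/= mulr0 addr0.
  have -> : a ^+ 2 + 2 * (- (a ^+ 2 + 1) / (2 * p)) * p = -1 by field.
  by lra.
have bp : 0 < b by rewrite lt_def bN0.
have : p ^+ 2 <= (a * b) ^+ 2.
  have := H (- p / b ^+ 2).
  have -> : a ^+ 2 + 2 * (- p / b ^+ 2) * p + (- p / b ^+ 2) ^+ 2 * b ^+ 2 = a ^+ 2 - p ^+ 2 / b ^+ 2 by field.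
  by rewrite subr_ge0 ler_pdivrMr ?exprn_gt0// exprMn.
by rewrite -real_normK ?num_real// ler_pXn2r// ?nnegrE ?mulr_ge0.
Qed.

Section euclidean.
Context {R : realType} {n : nat}.
Implicit Types (x y z v : 'rV[R]_n) (c : R).

Lemma dotpC x y : dotp x y = dotp y x.
Proof. by apply: eq_bigr => i _; rewrite mulrC. Qed.

Lemma dotpDl x y z : dotp (x + y) z = dotp x z + dotp y z.
Proof. by rewrite -big_split; apply: eq_bigr => i _; rewrite /= mxE mulrDl. Qed.

Lemma dotpZl c x z : dotp (c *: x) z = c * dotp x z.
Proof. by rewrite mulr_sumr; apply: eq_bigr => i _; rewrite !mxE mulrA. Qed.

Lemma dotpDr x y z : dotp z (x + y) = dotp z x + dotp z y.
Proof. by rewrite dotpC dotpDl !(dotpC z). Qed.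

Lemma dotpZr c x z : dotp z (c *: x) = c * dotp z x.
Proof. by rewrite dotpC dotpZl dotpC. Qed.

Lemma enorm_sqr x : enorm x ^+ 2 = dotp x x.
Proof. by rewrite sqr_sqrtr// dotp_ge0. Qed.

Lemma dotp_le x y : `|dotp x y| <= enorm x * enorm y.
Proof.
have a0 := enorm_ge0 x; have b0 := enorm_ge0 y.
have H c : 0 <= enorm x ^+ 2 + 2 * c * dotp x y + c ^+ 2 * enorm y ^+ 2.
  have := dotp_ge0 (x + c *: y).
  by rewrite dotpDl !dotpDr !dotpZl !dotpZr (dotpC y x) !enorm_sqr; lra.
exact: cs_quadratic.
Qed.

Lemma enormD x y : enorm (x + y) <= enorm x + enorm y.
Proof.
have s0 : 0 <= enorm x + enorm y by rewrite addr_ge0 ?enorm_ge0.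
rewrite -(@ler_pXn2r _ 2) ?nnegrE ?enorm_ge0// enorm_sqr dotpDl !dotpDr (dotpC y x) -!enorm_sqr.
have := le_trans (ler_norm _) (dotp_le x y); lra.
Qed.

Lemma enormB x y z : enorm (x - z) <= enorm (x - y) + enorm (y - z).
Proof. by have := enormD (x - y) (y - z); rewrite addrA subrK. Qed.

Lemma enorm_sub x y : enorm (x - y) = enorm (y - x).
Proof. by rewrite -enormN opprB. Qed.

Lemma enormZ c x : enorm (c *: x) = `|c| * enorm x.
Proof. by rewrite /enorm dotpZl dotpZr mulrA -expr2 sqrtrM ?sqr_ge0// sqrtr_sqr. Qed.

Lemma enorm0 : enorm (0 : 'rV[R]_n) = 0.
Proof. by rewrite -(scale0r (0 : 'rV[R]_n)) enormZ normr0 mul0r. Qed.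

Lemma enorm_eq0 x : enorm x = 0 -> x = 0.
Proof.
by move=> x0; apply/rowP => i; apply/eqP; rewrite mxE -normr_le0 -x0 coord_le_enorm.
Qed.

Lemma continuous_lipschitz (f : 'rV[R]_n -> R) :
  (forall x y, f x <= f y + enorm (x - y)) -> continuous f.
Proof.
(* The Euclidean norm is at most n times the sup norm of the library; the divisor n + 1 is nonzero
   for every n and makes the final inequality strict. *)
move=> fl x A /nbhs_ballP[e /= e0 eA]; apply/nbhs_ballP; exists (e / n.+1%:R) => /=.
  by rewrite divr_gt0.
move=> y [_ xy]; apply: eA; rewrite /ball/=.
have le1 : enorm (x - y) < e.
  apply: le_lt_trans (enorm_le_const (r := e / n.+1%:R) _) _.
    by move=> i; rewrite !mxE ltW//; exact: xy.
  by rewrite mulrCA gtr_pMr// ltr_pdivrMr// mul1r ltr_nat.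
have := fl x y; have := fl y x; rewrite (enorm_sub y x) => ? ?.
by rewrite ltr_norml; apply/andP; split; lra.
Qed.

Lemma continuous_enorm_sub z : continuous (fun x => enorm (x - z)).
Proof. by apply: continuous_lipschitz => x y; rewrite [leRHS]addrC; exact: enormB. Qed.

Lemma continuous_enorm : continuous (@enorm R n).
Proof. by apply: continuous_lipschitz => x y; have := enormB x y 0; rewrite !subr0 addrC. Qed.

Definition cube x c := hbox (x - const_mx c) (x + const_mx c).

Lemma cubeE x c z : cube x c z <-> forall i, x 0 i - c < z 0 i <= x 0 i + c.
Proof. by split => H i; have := H i; rewrite !mxE. Qed.

Lemma eball_sub_cube x c : eball x c `<=` cube x c.
Proof.
move=> z /= zx; apply/cubeE => i; have := le_lt_trans (coord_le_enorm _ i) zx.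
rewrite !mxE ltr_norml => /andP[? ?]; apply/andP; split; lra.
Qed.

Lemma cube_enorm x c z : cube x c z -> enorm (z - x) <= n%:R * c.
Proof.
move=> /cubeE H; apply: enorm_le_const => i; have /andP[? ?] := H i.
rewrite !mxE ler_norml; apply/andP; split; lra.
Qed.

Lemma cube_sub_eball x c : 0 < c -> cube x (c / n.+1%:R) `<=` eball x c.
Proof.
move=> c0 z /cube_enorm /= zx; apply: le_lt_trans zx _.
by rewrite mulrCA gtr_pMr// ltr_pdivrMr// mul1r ltr_nat.
Qed.

Lemma cube_le x c : 0 <= c -> forall i, (x - const_mx c) 0 i <= (x + const_mx c) 0 i.
Proof. by move=> c0 i; rewrite !mxE; lra. Qed.

Lemma vol_cube x c : 0 <= c -> vol (x - const_mx c) (x + const_mx c) = (2 * c) ^+ n.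
Proof.
move=> c0; rewrite /vol; under eq_bigr => i _.
  have -> : Num.max 0 ((x + const_mx c) 0 i - (x - const_mx c) 0 i) = 2 * c.
    by rewrite (max_idPr _) !mxE; lra.
  over.
by rewrite prodr_const card_ord.
Qed.

Lemma leb_cube x c : 0 <= c -> leb R n (cube x c) = ((2 * c) ^+ n)%:E.
Proof. by move=> c0; rewrite leb_hbox vol_cube. Qed.

Lemma measurable_leb_cube x c : measurable (cube x c : set (leb_space R n)).
Proof. exact: measurable_leb_hbox. Qed.

Lemma open_eball x c : open (eball x c).
Proof.
have -> : eball x c = (fun y => enorm (y - x)) @^-1` [set r : R | r < c] by [].
apply: open_comp; last exact: open_lt.
by move=> y _; exact: continuous_enorm_sub.
Qed.

(** Inscribed and circumscribed cubes determine the volume of the ball up to a constant factor,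
    which suffices for comparing means. *)
Lemma leb_eball x c : 0 < c ->
  exists2 V : R, leb R n (eball x c) = V%:E & (2 * (c / n.+1%:R)) ^+ n <= V <= (2 * c) ^+ n.
Proof.
move=> c0; have mB : measurable (eball x c : set (leb_space R n)) by apply: measurable_leb_open; exact: open_eball.
have le1 : (leb R n (eball x c) <= ((2 * c) ^+ n)%:E)%E.
  rewrite -(leb_cube x (ltW c0)); apply: le_measure; rewrite ?inE//; first exact: measurable_leb_cube.
  exact: eball_sub_cube.
have cn : 0 <= c / n.+1%:R by rewrite divr_ge0// ltW.
have le2 : (((2 * (c / n.+1%:R)) ^+ n)%:E <= leb R n (eball x c))%E.
  rewrite -(leb_cube x cn); apply: le_measure; rewrite ?inE//; first exact: measurable_leb_cube.
  exact: cube_sub_eball.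
have fin : leb R n (eball x c) \is a fin_num.
  by rewrite ge0_fin_numE// (le_lt_trans le1)// ltry.
exists (fine (leb R n (eball x c))); first by rewrite fineK.
by rewrite -!lee_fin fineK// le2.
Qed.

End euclidean.

Section distance.
Local Notation edist := Defs.edist.
Context {R : realType} {n : nat} (Gamma : set 'rV[R]_n).
Hypothesis Gamma_neq0 : Gamma !=set0.
Implicit Types (x y z : 'rV[R]_n).

Let lbG z : has_lbound [set enorm (z - y) | y in Gamma].
Proof. by exists 0 => _ [y _ <-]; exact: enorm_ge0. Qed.

Let neG z : [set enorm (z - y) | y in Gamma] !=set0.
Proof. by have [y Gy] := Gamma_neq0; exists (enorm (z - y)), y. Qed.

Lemma edist_le z y : Gamma y -> edist Gamma z <= enorm (z - y).
Proof. by move=> Gy; apply: ge_inf => //; exists y. Qed.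

Lemma edist_ge0 z : 0 <= edist Gamma z.
Proof. by apply: lb_le_inf => // _ [y _ <-]; exact: enorm_ge0. Qed.

Lemma edist_lip z x : edist Gamma z <= edist Gamma x + enorm (z - x).
Proof.
rewrite -lerBlDr; apply: lb_le_inf => // _ [y Gy <-].
rewrite lerBlDr addrC; exact: le_trans (edist_le z Gy) (enormB z x y).
Qed.

Lemma edist_near z c : edist Gamma z < c -> exists2 y, Gamma y & enorm (z - y) < c.
Proof.
rewrite -subr_gt0 => zc; have [_ [y Gy <-] H] := inf_adherent zc (conj (neG z) (lbG z)).
by exists y => //; apply: lt_le_trans H _; rewrite -/(edist Gamma z); lra.
Qed.

Lemma continuous_edist : continuous (edist Gamma).
Proof. exact: continuous_lipschitz edist_lip. Qed.

Hypothesis Gamma_closed : closed Gamma.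

Lemma edist_gt0 z : ~ Gamma z -> 0 < edist Gamma z.
Proof.
move=> nGz; have /nbhs_ballP[e /= e0 eO] := open_nbhs_nbhs (conj (closed_openC Gamma_closed) nGz).
apply: (lt_le_trans e0); apply: lb_le_inf => // _ [y Gy <-].
rewrite leNgt; apply/negP => H; apply: (eO y) Gy; split => // i j; rewrite (ord1 i) /ball/=.
by have := coord_le_enorm (z - y) j; rewrite !mxE => /le_lt_trans; apply.
Qed.

Lemma weight_gt0 (d : R) z : ~ Gamma z -> 0 < weight d Gamma z.
Proof. by move=> nGz; apply: powR_gt0; exact: edist_gt0. Qed.

Lemma weight_ge0 (d : R) z : 0 <= weight d Gamma z.
Proof. exact: powR_ge0. Qed.

Lemma weightV (d : R) z : (weight d Gamma z)^-1 = edist Gamma z `^ (n%:R - 1 - d).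
Proof. by rewrite -powRN; congr (_ `^ _); lra. Qed.

Lemma measurable_weight (d : R) : measurable_fun (setT : set (leb_space R n)) (weight d Gamma).
Proof.
have me : measurable_fun (setT : set (leb_space R n)) (edist Gamma).
  by apply: measurable_leb_continuous; exact: continuous_edist.
exact: measurableT_comp (measurable_powR (d + 1 - n%:R)) me.
Qed.

Lemma weightV_le (d r : R) x z : d <= n%:R - 1 -> Gamma x -> enorm (z - x) <= r ->
  (weight d Gamma z)^-1 <= r `^ (n%:R - 1 - d).
Proof.
move=> dn Gx zr; rewrite weightV; apply: ge0_ler_powR.
- by rewrite subr_ge0.
- by rewrite nnegrE edist_ge0.
- by rewrite nnegrE (le_trans (enorm_ge0 _) zr).
- exact: le_trans (edist_le z Gx) zr.
Qed.

End distance.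

(** * Potential estimates for means over balls *)

Section pointwise.
Context {R : realType} {n : nat}.
Variables (e F : 'rV[R]_n -> R).
Local Notation L := (leb_space R n).
Local Notation mu := (leb R n).
Implicit Types (x : 'rV[R]_n) (r s rho : R).
Hypothesis F0 : forall z, 0 <= F z.
Hypothesis iF : forall x r, mu.-integrable (cube x r) (EFin \o F).
Hypothesis ie : forall x r, mu.-integrable (cube x r) (EFin \o e).
Hypothesis osc : forall (c : R) x r, 0 <= r ->
  \int[mu]_(z in cube x r) `|e z - c| <=
  `|\int[mu]_(z in cube x r) (e z - c)| + 2 * n%:R * r * \int[mu]_(z in cube x r) F z.

(** The contribution of the scale r to the Riesz potential of order 1 of [F], with r^(1-n) written
    as a quotient. *)
Definition pot r x : R := r / r ^+ n * \int[mu]_(z in cube x r) F z.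
Definition mean x r : R := \int[mu]_(z in cube x r) e z / (2 * r) ^+ n.
Definition radius r (j : nat) : R := r / 4 ^+ j.
(** The factor 2 n comes from [osc]. The power comes from the smallest set compared with a cube of
    half side r: a ball of radius more than r / 4 contains a cube of side r / (2 (n + 1)). *)
Definition Kosc : R := 2 * n%:R * (2 * n.+1%:R) ^+ n.

Lemma Kosc_ge0 : 0 <= Kosc.
Proof. by rewrite !mulr_ge0// exprn_ge0// mulr_ge0. Qed.

Lemma pot_ge0 r x : 0 <= r -> 0 <= pot r x.
Proof.
move=> r0; rewrite mulr_ge0//; first by rewrite divr_ge0// exprn_ge0.
by apply: Rintegral_ge0.
Qed.

Lemma radius_gt0 r j : 0 < r -> 0 < radius r j.
Proof. by move=> r0; rewrite divr_gt0// exprn_gt0. Qed.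

Lemma radiusS r j : radius r j.+1 = radius r j / 4.
Proof. by rewrite /radius exprSr invfM mulrA. Qed.

Let icst (D : set L) c : measurable D -> (mu D < +oo)%E -> mu.-integrable D (EFin \o (fun=> c : R)).
Proof.
move=> mD Doo; apply/integrableP; split; first by apply/measurable_EFinP; exact: measurable_cst.
rewrite integral_cst// lte_mul_pinfty//.
Qed.

Let cube_fin x r : (mu (cube x r) < +oo)%E.
Proof. by rewrite leb_hbox ltry. Qed.

Let Rcst (D : set L) (c V : R) : measurable D -> mu D = V%:E -> \int[mu]_(z in D) c = c * V.
Proof. by move=> mD DV; rewrite /Rintegral integral_cst// DV. Qed.

Lemma mean_compare x r (D : set L) (V : R) : 0 < r -> measurable D -> D `<=` cube x r ->
  mu D = V%:E -> 0 < V ->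
  `|\int[mu]_(z in D) e z / V - mean x r| <= (2 * n%:R * r * \int[mu]_(z in cube x r) F z) / V.
Proof.
move=> r0 mD DQ DV V0; set m := mean x r.
have mQ := measurable_leb_cube x r.
have iD : mu.-integrable D (EFin \o e) by exact: integrableS mQ mD DQ (ie x r).
have Doo : (mu D < +oo)%E by rewrite DV ltry.
have ic := icst m mQ (cube_fin x r).
have iem := integrableRB mQ (ie x r) ic.
have -> : \int[mu]_(z in D) e z / V - m = \int[mu]_(z in D) (e z - m) / V.
  rewrite (RintegralB mD iD (icst m mD Doo)) (Rcst m mD DV).
  by field; rewrite gt_eqF.
rewrite normrM [X in _ * X]gtr0_norm ?invr_gt0// ler_pM2r ?invr_gt0//.
apply: le_trans (le_normr_Rintegral mD (integrableS mQ mD DQ iem)) _.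
apply: le_trans (Rint_le_subset mQ mD DQ (integrable_norm iem) (fun _ _ => normr_ge0 _)) _.
apply: le_trans (osc m x (ltW r0)) _.
(* The constant in the oscillation bound is the mean [m] over the cube, so that the first term of
   [osc] disappears. *)
have -> : \int[mu]_(z in cube x r) (e z - m) = 0.
  have mm : mu (cube x r) = ((2 * r) ^+ n)%:E by rewrite leb_cube// ltW.
  rewrite (RintegralB mQ (ie x r) ic) (Rcst m mQ mm) /m /mean divfK ?subrr//.
  by rewrite expf_neq0// mulf_neq0// gt_eqF.
by rewrite normr0 add0r.
Qed.

Lemma mean_compare_pot x r (D : set L) (V : R) : 0 < r -> measurable D -> D `<=` cube x r ->
  mu D = V%:E -> (r / (2 * n.+1%:R)) ^+ n <= V ->
  `|\int[mu]_(z in D) e z / V - mean x r| <= Kosc * pot r x.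
Proof.
move=> r0 mD DQ DV VK.
have W0 : 0 < (r / (2 * n.+1%:R)) ^+ n by rewrite exprn_gt0// divr_gt0// mulr_gt0.
have V0 := lt_le_trans W0 VK.
apply: le_trans (mean_compare r0 mD DQ DV V0) _.
have I0 : 0 <= \int[mu]_(z in cube x r) F z by apply: Rintegral_ge0.
apply: (@le_trans _ _ (2 * n%:R * r * \int[mu]_(z in cube x r) F z / (r / (2 * n.+1%:R)) ^+ n)).
  by rewrite ler_wpM2l ?lef_pV2// !mulr_ge0// ltW.
rewrite le_eqVlt; apply/orP; left; apply/eqP; rewrite /Kosc /pot expr_div_n.
have nz : (2 * n.+1%:R) ^+ n != 0 :> R by rewrite expf_neq0// mulf_neq0.
have rz : r ^+ n != 0 by rewrite expf_neq0// gt_eqF.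
move: (\int[mu]_(z in _) F z) ((2 * n.+1%:R) ^+ n) (r ^+ n) nz rz => I K1 K2 ? ?.
by field; apply/andP.
Qed.

Lemma mean_step x r : 0 < r -> `|mean x (r / 4) - mean x r| <= Kosc * pot r x.
Proof.
move=> r0; have r4 : 0 <= r / 4 by rewrite divr_ge0// ltW.
apply: mean_compare_pot => //; first exact: measurable_leb_cube.
- move=> z /cubeE H; apply/cubeE => i; have /andP[? ?] := H i; apply/andP; split; lra.
- by rewrite leb_cube.
- apply: lerXn2r; rewrite ?nnegrE ?mulr_ge0 ?invr_ge0 ?mulr_ge0 ?(ltW r0)//.
  rewrite ler_pdivrMr ?mulr_gt0//.
  have w1 : 1 <= n.+1%:R :> R by rewrite ler1n.
  have := ler_wpM2l (ltW r0) w1; move: (n.+1%:R) => w; lra.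
Qed.

Lemma mean_telescope x r J : 0 < r ->
  `|mean x (radius r J) - mean x r| <= Kosc * \sum_(j < J) pot (radius r j) x.
Proof.
move=> r0; elim: J => [|J IH].
  by rewrite big_ord0 mulr0 /radius expr0 divr1 subrr normr0.
rewrite big_ord_recr /= mulrDr radiusS.
have -> : mean x (radius r J / 4) - mean x r =
  (mean x (radius r J) - mean x r) + (mean x (radius r J / 4) - mean x (radius r J)) by lra.
by apply: le_trans (ler_normD _ _) _; rewrite lerD// mean_step// radius_gt0.
Qed.

Lemma radius_between r rho : 0 < rho -> rho <= r -> exists j, radius r j.+1 < rho <= radius r j.
Proof.
move=> rho0 rr; have r0 : 0 < r := lt_le_trans rho0 rr.
have [j] : exists j, radius r j < rho.
  pose j := Num.bound (r / rho).
  exists j; rewrite /radius ltr_pdivrMr ?exprn_gt0// mulrC -ltr_pdivrMr//.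
  apply: lt_le_trans (archi_boundP _) _; first by rewrite divr_ge0// ltW.
  by rewrite -natrX ler_nat ltnW// ltn_expl.
elim: j => [|j IH H]; first by rewrite /radius expr0 divr1 ltNge rr.
by have [/IH//|H2] := ltP (radius r j) rho; exists j; rewrite H.
Qed.

Definition bmean x rho : R := \int[mu]_(z in eball x rho) e z / fine (mu (eball x rho)).

Lemma integrable_eball x rho : mu.-integrable (eball x rho) (EFin \o e).
Proof.
apply: integrableS (ie x rho); [exact: measurable_leb_cube| |exact: eball_sub_cube].
by apply: measurable_leb_open; exact: open_eball.
Qed.

Lemma ball_meanE x rho : ball_mean e x rho = (bmean x rho)%:E.
Proof.
have mB : measurable (eball x rho : set L) by apply: measurable_leb_open; exact: open_eball.
rewrite /ball_mean /bmean mulrC EFinM; congr (_ * _)%E.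
by rewrite fineK//; exact: (integrable_fin_num mB (integrable_eball x rho)).
Qed.

Lemma bmean_mean x r rho j s : 0 < r -> radius r j.+1 < rho <= radius r j ->
  (forall J, \sum_(i < J) pot (radius r i) x <= s) -> `|bmean x rho - mean x r| <= Kosc * s.
Proof.
move=> r0 /andP[jrho rhoj] Hs.
have rho0 : 0 < rho := lt_trans (radius_gt0 _ r0) jrho.
have [V VE /andP[V1 V2]] := leb_eball x rho0.
have mB : measurable (eball x rho : set L) by apply: measurable_leb_open; exact: open_eball.
have H1 : `|bmean x rho - mean x (radius r j)| <= Kosc * pot (radius r j) x.
  rewrite /bmean VE; apply: mean_compare_pot => //; first exact: radius_gt0.
    apply: subset_trans (@eball_sub_cube _ _ x rho) _ => z /cubeE H.
    by apply/cubeE => i; have /andP[? ?] := H i; apply/andP; split; lra.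
  apply: le_trans V1; have q0 := radius_gt0 j r0; apply: lerXn2r.
  - by rewrite nnegrE ltW// divr_gt0// mulr_gt0.
  - by rewrite nnegrE ltW// mulr_gt0// divr_gt0.
  rewrite invfM !mulrA ler_wpM2r ?invr_ge0//.
  by move: jrho; rewrite radiusS; lra.
have -> : bmean x rho - mean x r =
   (bmean x rho - mean x (radius r j)) + (mean x (radius r j) - mean x r) by lra.
apply: le_trans (ler_normD _ _) _; apply: le_trans (lerD H1 (mean_telescope x j r0)) _.
by rewrite -mulrDr ler_wpM2l ?Kosc_ge0// addrC; have := Hs j.+1; rewrite big_ord_recr.
Qed.

Variable x : 'rV[R]_n.
Variables (r s : R).
Hypotheses (r0 : 0 < r) (Hs : forall J, \sum_(i < J) pot (radius r i) x <= s).
Hypothesis tr : ball_mean e x rho @[rho --> 0^'+] --> 0%:E.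

Let bmean_small (h : R) : 0 < h -> exists rho, 0 < rho <= r /\ `|bmean x rho| < h.
Proof.
move=> h0; have tr' : bmean x rho @[rho --> 0^'+] --> (0 : R).
  have : (bmean x rho)%:E @[rho --> 0^'+] --> 0%:E.
    by apply: cvg_trans tr; apply: near_eq_cvg; near=> q; rewrite /= ball_meanE.
  exact: fine_cvg.
have /cvgrPdist_lt/(_ h h0) H := tr'; near (0 : R)^'+ => q.
exists q; split; last by near: q; apply: filterS H => y; rewrite sub0r normrN.
by apply/andP; split => //; near: q; apply: nbhs_right_le.
Unshelve. all: by end_near. Qed.

(** Means over small balls are arbitrarily small because the trace vanishes at [x]; telescoping
    through the radii from there up to [r] leaves only the sum of the potentials. *)
Lemma mean_le : `|mean x r| <= Kosc * s.
Proof.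
apply/ler_addgt0Pr => h h0; have [rho [/andP[rho0 rhor] H]] := bmean_small h0.
have [j jrho] := radius_between rho0 rhor.
have B := bmean_mean r0 jrho Hs.
have -> : mean x r = bmean x rho - (bmean x rho - mean x r) by lra.
by apply: le_trans (ler_normB _ _) _; rewrite addrC lerD// ltW.
Qed.

Lemma ball_mean_le rho : 0 < rho <= r -> `|bmean x rho| <= 2 * Kosc * s.
Proof.
move=> /andP[rho0 rhor]; have [j jrho] := radius_between rho0 rhor.
have B := bmean_mean r0 jrho Hs; have M := mean_le.
have -> : bmean x rho = (bmean x rho - mean x r) + mean x r by lra.
apply: le_trans (ler_normD _ _) _; apply: le_trans (lerD B M) _; by rewrite -mulrA mulr_natl mulr2n.
Qed.

(** The oscillation bound with c = 0 leaves the mean, which [mean_le] controls, and a gradient term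
    that is the first summand of the potential. *)
Lemma cube_norm_le : \int[mu]_(z in cube x r) `|e z| <= ((2 * r) ^+ n * Kosc + 2 * n%:R * r ^+ n) * s.
Proof.
have H := osc 0 x (ltW r0); move: H.
under eq_Rintegral do rewrite subr0.
under [X in _ <= `|X| + _]eq_Rintegral do rewrite subr0.
move=> H; apply: (le_trans H); rewrite [leRHS]mulrDl; apply: lerD.
  have -> : \int[mu]_(z in cube x r) e z = (2 * r) ^+ n * mean x r.
    by rewrite /mean mulrC divfK// expf_neq0// mulf_neq0// gt_eqF.
  rewrite normrM ger0_norm ?exprn_ge0 ?mulr_ge0 ?(ltW r0)// -mulrA ler_wpM2l ?exprn_ge0 ?mulr_ge0 ?(ltW r0)//.
  exact: mean_le.
rewrite -!mulrA ler_wpM2l// ler_wpM2l//.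
have := Hs 1; rewrite big_ord1 /radius expr0 divr1 /pot => H1.
rewrite -ler_pdivrMl ?exprn_gt0// mulrCA mulrA; apply: le_trans H1.
by rewrite mulrAC.
Qed.

End pointwise.

Lemma integral_cst_indic d (T : measurableType d) (R : realType) (m : {measure set T -> \bar R})
    (A D : set T) (c : R) : measurable A -> measurable D -> 0 <= c ->
  (\int[m]_(x in D) (c * \1_A x)%:E = c%:E * m (A `&` D))%E.
Proof.
move=> mA mD c0; rewrite -integral_indic// -ge0_integralZl//.
by apply/measurable_EFinP; exact: measurable_indic.
Qed.

Lemma integral_affine_le d (T : measurableType d) (R : realType) (m : {measure set T -> \bar R})
    (D : set T) (f h : T -> \bar R) (k c V : R) : measurable D -> measurable_fun D f -> measurable_fun D h ->
  (forall x, (0 <= f x)%E) -> (forall x, (0 <= h x)%E) -> 0 <= k -> 0 <= c -> (m D <= V%:E)%E ->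
  (forall x, D x -> (f x <= k%:E * h x + c%:E)%E) ->
  (\int[m]_(x in D) f x <= k%:E * \int[m]_(x in D) h x + (c * V)%:E)%E.
Proof.
move=> mD mf mh f0 h0 k0 c0 DV fh.
have mk : measurable_fun D (fun x => (k%:E * h x)%E) by apply: emeasurable_funM => //; exact: measurable_cst.
apply: (@le_trans _ _ (\int[m]_(x in D) (k%:E * h x + c%:E))%E).
  apply: ge0_le_integral => //.
  by apply: emeasurable_funD => //; exact: measurable_cst.
have kh0 x : (0 <= k%:E * h x)%E by rewrite mule_ge0.
rewrite ge0_integralD//.
rewrite ge0_integralZl// integral_cst// leeD2l// EFinM.
exact: lee_wpmul2l.
Qed.

Lemma integral_series_le d (T : measurableType d) (R : realType) (m : {measure set T -> \bar R})
    (D : set T) (f : nat -> T -> \bar R) (c : nat -> R) (M : R) : measurable D ->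
  (forall j, measurable_fun D (f j)) -> (forall j x, (0 <= f j x)%E) ->
  (forall j, (\int[m]_(x in D) f j x <= (c j)%:E)%E) -> (forall J, \sum_(j < J) c j <= M) ->
  (\int[m]_(x in D) \sum_(0 <= j <oo) f j x <= M%:E)%E.
Proof.
move=> mD mf f0 fc cM; rewrite integral_nneseries//.
apply: lime_le; first by apply: is_cvg_nneseries => j *; exact: integral_ge0.
apply: nearW => J; apply: (@le_trans _ _ (\sum_(0 <= j < J) (c j)%:E)%E).
  by apply: lee_sum => j _.
by rewrite sumEFin lee_fin big_mkord.
Qed.

(** * Integrals of potentials over Gamma *)

Section hausdorff_balls.
Context {R : realType} {n : nat} (d C0 : R) (Gamma : set 'rV[R]_n).
Hypothesis d_bounds : 0 < d < n%:R - 1.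
Hypothesis C0_ge1 : 1 <= C0.
Hypothesis Gamma_closed : closed Gamma.
Hypothesis Gamma_AR : ahlfors_regular d C0 Gamma.
Local Notation L := (leb_space R n).
Local Notation mu := (leb R n).
Local Notation sigma := (haus n d).
Implicit Types (x y z : 'rV[R]_n) (r a b t rho : R) (h : 'rV[R]_n -> R).

Lemma haus_le (A B : set 'rV[R]_n) : A `<=` B -> (sigma A <= sigma B)%E.
Proof. by move=> AB; exact: (le_outer_measure (@haus_outer R n d)). Qed.

Definition Knear : R := C0 * (2 * n.+1%:R) `^ d.

Lemma Knear_ge0 : 0 <= Knear.
Proof. by rewrite mulr_ge0 ?powR_ge0// (le_trans ler01). Qed.

(** The centre [z] may lie off Gamma. Recentring at a point of [S] doubles the distance to at most 2
    n r, and the radius 2 (n + 1) r makes the inclusion in an open ball strict; hence the form of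
    [Knear]. *)
Lemma haus_near_le (S : set 'rV[R]_n) z r : 0 < r -> S `<=` Gamma ->
  (forall x, S x -> enorm (x - z) <= n%:R * r) -> (sigma S <= (Knear * r `^ d)%:E)%E.
Proof.
move=> r0 SG Sz; have [->|/set0P[y Sy]] := eqVneq S set0.
  by rewrite measure0 lee_fin mulr_ge0 ?powR_ge0// Knear_ge0.
have K0 : 0 < 2 * n.+1%:R * r :> R by rewrite !mulr_gt0.
have /andP[_ H] := Gamma_AR (SG _ Sy) K0; move: H.
rewrite powRM ?(ltW r0)// mulrA -/Knear => H.
apply: le_trans H; apply: haus_le => x Sx; split; first exact: SG.
apply: le_lt_trans (enormB x z y) _; apply: le_lt_trans (lerD (Sz x Sx) _) _.
  by rewrite enorm_sub; exact: Sz.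
rewrite -[n.+1%:R]natr1; move: (n%:R) => w; lra.
Qed.

Lemma measurable_Gamma_eball x rho : measurable (Gamma `&` eball x rho : set (haus_space R n d)).
Proof.
apply: measurableI; first exact: measurable_haus_closed.
by apply: measurable_haus_open; exact: open_eball.
Qed.

Lemma sigma_finite_on_leb (D : set L) : measurable D -> sigma_finite_on mu D.
Proof.
move=> mD; have [F FT FP] := @leb_sigma_finite R n.
exists F; split => // k; have [mF Foo] := FP k; split => //.
apply: le_lt_trans Foo; apply: le_measure; rewrite ?inE//; exact: measurableI.
Qed.

Lemma measurable_product_coord i : measurable_fun setT
  (fun p : haus_space R n d * L => ((p.2 : 'rV[R]_n) - (p.1 : 'rV[R]_n)) 0 i).
Proof.
rewrite (_ : (fun _ => _) = (fun p : haus_space R n d * L => (p.2 : 'rV[R]_n) 0 i - (p.1 : 'rV[R]_n) 0 i)); last first.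
  by apply/funext => p; rewrite !mxE.
apply: measurable_funB.
  exact: (measurableT_comp (measurable_leb_coord i) measurable_snd).
exact: (measurableT_comp (measurable_haus_coord i) measurable_fst).
Qed.

Lemma measurable_product_cube r :
  measurable [set p : haus_space R n d * L | cube (p.1 : 'rV[R]_n) r (p.2 : 'rV[R]_n)].
Proof.
rewrite (_ : [set p | _] = [set p : haus_space R n d * L | forall i, ((p.2 : 'rV[R]_n) - (p.1 : 'rV[R]_n)) 0 i \in `]-r, r]]).
  apply: (measurable_coord_rect measurable_product_coord (P := fun=> [set` `]-r, r]])) => i.
  exact: measurable_itv.
apply/seteqP; split => p /=.
  move=> /cubeE H i; rewrite in_itv/= !mxE; have /andP[? ?] := H i; apply/andP; split; lra.
move=> H; apply/cubeE => i; have := H i; rewrite in_itv/= !mxE => /andP[? ?]; apply/andP; split; lra.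
Qed.

Section near.
Variables (D1 : set (haus_space R n d)).
Hypotheses (mD1 : measurable D1) (D1G : D1 `<=` Gamma) (D1oo : (sigma D1 < +oo)%E).

Let sD1 : sigma_finite_on sigma D1.
Proof. by exists (fun=> setT); split => [k|]; [rewrite setTI|rewrite bigcup_const]. Qed.

Variables (D2 : set L) (h : 'rV[R]_n -> R) (r : R).
Hypotheses (mD2 : measurable D2) (mh : measurable_fun (setT : set L) h) (h0 : forall z, 0 <= h z) (r0 : 0 < r).

(** The cube enters as an indicator and not as the domain of integration, so that the integrand is
    jointly measurable on a fixed product and Tonelli's theorem applies. *)
Definition near_int x : \bar R := \int[mu]_(z in D2) (h z * \1_(cube x r) z)%:E.

Let f (p : haus_space R n d * L) : \bar R := (h p.2 * \1_(cube p.1 r) p.2)%:E.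

Let f0 p : (0 <= f p)%E.
Proof. by rewrite lee_fin mulr_ge0. Qed.

Let mf : measurable_fun (D1 `*` D2) f.
Proof.
apply/measurable_EFinP; apply: measurable_funTS; apply: measurable_funM.
  exact: (measurableT_comp mh measurable_snd).
rewrite (_ : (fun p => _) = \1_[set p : haus_space R n d * L | cube (p.1 : 'rV[R]_n) r (p.2 : 'rV[R]_n)]).
  exact: measurable_indic (measurable_product_cube r).
by apply/funext => p; rewrite !indicE; congr (_%:R); apply/idP/idP; rewrite !inE.
Qed.

Lemma measurable_near_int : measurable_fun D1 near_int.
Proof. exact: (measurable_integral_on mD1 mD2 (sigma_finite_on_leb mD2) mf f0). Qed.

(** By Tonelli's theorem, for fixed [z] it remains to measure the points x of [D1] with [z] in the
    cube about x, and [haus_near_le] bounds that set by a multiple of r^d. *)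
Lemma near_int_le : (\int[sigma]_(x in D1) near_int x <=
  (Knear * r `^ d)%:E * \int[mu]_(z in D2) (h z)%:E)%E.
Proof.
have C0' : 0 <= Knear * r `^ d by rewrite mulr_ge0 ?powR_ge0// Knear_ge0.
have mh' : measurable_fun D2 (EFin \o h) by apply/measurable_EFinP; exact: measurable_funTS mh.
have h0' z : (0 <= (EFin \o h) z)%E by rewrite lee_fin.
apply: (tonelli_le mD1 mD2 sD1 (sigma_finite_on_leb mD2) mf f0 C0' mh' h0') => z _.
pose A : set (haus_space R n d) := [set x | cube (x : 'rV[R]_n) r z].
have mA : measurable A.
  rewrite (_ : A = [set x : haus_space R n d | forall i, (x : 'rV[R]_n) 0 i \in `[z 0 i - r, z 0 i + r[]).
    apply: (measurable_coord_rect (@measurable_haus_coord R n d) (P := fun i => [set` `[z 0 i - r, z 0 i + r[])) => i.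
    exact: measurable_itv.
  apply/seteqP; split => x /=.
    move=> /cubeE H i; rewrite in_itv/=; have /andP[? ?] := H i; apply/andP; split; lra.
  move=> H; apply/cubeE => i; have := H i; rewrite in_itv/= => /andP[? ?]; apply/andP; split; lra.
have -> : (\int[sigma]_(x in D1) f (x, z) = (h z)%:E * sigma (A `&` D1))%E.
  rewrite -(integral_cst_indic sigma mA mD1 (h0 z)).
  apply: eq_integral => x _; rewrite /f; congr ((_ * _)%:E).
rewrite muleC; apply: lee_wpmul2r; first by rewrite lee_fin.
apply: (haus_near_le (z := z) r0); first by move=> x [_ /D1G].
by move=> x [/cube_enorm]; rewrite enorm_sub.
Qed.

End near.

Section potentials.
Hypothesis Gamma_neq0 : Gamma !=set0.
Hypothesis Gamma0 : leb_outer Gamma = 0%E.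
Variables (D1 : set (haus_space R n d)) (V : R).
Hypotheses (mD1 : measurable D1) (D1G : D1 `<=` Gamma) (D1V : (sigma D1 <= V%:E)%E).
Variables (F : 'rV[R]_n -> R).
Hypotheses (F0 : forall z, 0 <= F z) (mF : measurable_fun (setT : set L) F)
  (iF : forall x r, mu.-integrable (cube x r) (EFin \o F)).
Local Notation Omega := (~` Gamma : set L).

Let D1oo : (sigma D1 < +oo)%E.
Proof. by apply: le_lt_trans D1V _; rewrite ltry. Qed.

Let mO : measurable Omega.
Proof. by apply: measurable_leb_open; exact: closed_openC. Qed.

Let w := weight d Gamma.
Let h z := F z ^+ 2 * w z.

Let h0 z : 0 <= h z.
Proof. by rewrite mulr_ge0 ?sqr_ge0 ?weight_ge0. Qed.

Let mh : measurable_fun (setT : set L) h.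
Proof.
apply: measurable_funM; last exact: measurable_weight.
by apply: measurable_funX; exact: mF.
Qed.

Lemma potE r x : (pot F r x)%:E = ((r / r ^+ n)%:E * near_int setT F r x)%E.
Proof.
rewrite /pot EFinM; congr (_ * _)%E.
rewrite fineK; last by exact: (integrable_fin_num (measurable_leb_cube x r) (iF x r)).
rewrite /near_int (@integral_support _ _ _ mu setT (cube x r))//.
  by apply: eq_integral => z zx; rewrite indicE zx mulr1.
by move=> z _ nz; rewrite indicE memNset// mulr0.
Qed.

Lemma measurable_pot r : 0 <= r -> measurable_fun D1 (fun x => (pot F r x)%:E).
Proof.
move=> r0; under eq_fun do rewrite potE.
apply: emeasurable_funM; first exact: measurable_cst.
exact: (measurable_near_int mD1 r measurableT mF F0).
Qed.

(** Young's inequality with a free parameter [a]. It is linear in the weighted square, so it can be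
    integrated over Gamma before [a] is adapted to the scale, unlike the Cauchy-Schwarz inequality
    on each cube. *)
Lemma amgm_weight a f v : 0 < a -> 0 < v -> f <= a^-1 * (f ^+ 2 * v) + a * v^-1.
Proof.
move=> a0 v0; rewrite -subr_ge0.
have -> : a^-1 * (f ^+ 2 * v) + a * v^-1 - f = (a * v)^-1 * ((f * v - a / 2) ^+ 2 + 3 / 4 * a ^+ 2).
  by field; rewrite !gt_eqF.
apply: mulr_ge0; first by rewrite invr_ge0 mulr_ge0// ltW.
by rewrite addr_ge0 ?sqr_ge0// mulr_ge0// sqr_ge0.
Qed.

(** The cube is centred on Gamma, so that w^-1 = dist^(n-1-d) is at most (n r)^(n-1-d) on it; Gamma
    itself is removed from the cube as a null set. *)
Lemma cube_gradient_le x r a : Gamma x -> 0 < r -> 0 < a ->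
  (near_int setT F r x <= a^-1%:E * near_int Omega h r x +
     (a * (n%:R * r) `^ (n%:R - 1 - d) * (2 * r) ^+ n)%:E)%E.
Proof.
move=> Gx r0 a0; have /andP[_ dn] := d_bounds.
set Q := cube x r; pose Q' : set L := Q `\` Gamma.
have mQ := measurable_leb_cube x r.
have mG : measurable (Gamma : set L) by exact: leb_null_measurable.
have mQ' : measurable Q' by exact: measurableD.
have -> : near_int setT F r x = (\int[mu]_(z in Q') (F z)%:E)%E.
  rewrite /near_int (@integral_support _ _ _ mu setT Q)//; last first.
    by move=> z _ nz; rewrite indicE memNset// mulr0.
  have mFQ : measurable_fun (Q : set L) (fun z => (F z * \1_Q z)%:E).
    apply/measurable_EFinP; apply: measurable_funTS; apply: measurable_funM; first exact: mF.
    by apply: measurable_indic; exact: mQ.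
  have FQ0 z : Q z -> (0 <= (F z * \1_Q z)%:E)%E by rewrite lee_fin mulr_ge0.
  rewrite (@ge0_negligible_integral _ _ _ mu Q Gamma _ mG mQ mFQ FQ0 Gamma0).
  by apply: eq_integral => z; rewrite inE => -[Qz _]; rewrite indicE mem_set// mulr1.
have -> : near_int Omega h r x = (\int[mu]_(z in Q') (h z)%:E)%E.
  rewrite /near_int (@integral_support _ _ _ mu Omega Q')//; last 2 first.
  - by move=> z [].
  - by move=> z Oz nQ; rewrite indicE memNset ?mulr0// => Qz; apply: nQ.
  by apply: eq_integral => z; rewrite inE => -[Qz _]; rewrite indicE mem_set// mulr1.
apply: integral_affine_le.
- exact: mQ'.
- by apply/measurable_EFinP; exact: measurable_funTS mF.
- by apply/measurable_EFinP; exact: measurable_funTS mh.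
- by move=> z; rewrite lee_fin.
- by move=> z; rewrite lee_fin.
- by rewrite invr_ge0 ltW.
- by rewrite mulr_ge0 ?powR_ge0// ltW.
- rewrite -(leb_cube x (ltW r0)); apply: le_measure; rewrite ?inE//; by move=> z [].
- move=> z [Qz nGz]; rewrite -EFinM -EFinD lee_fin.
  apply: le_trans (amgm_weight (F z) a0 (weight_gt0 Gamma_neq0 Gamma_closed d nGz)) _.
  rewrite lerD2l ler_wpM2l ?(ltW a0)//.
  by apply: weightV_le Gx _ => //; [exact: ltW|exact: cube_enorm].
Qed.

Variable t : R.
Hypotheses (t0 : 0 < t) (energy : (\int[mu]_(z in Omega) (h z)%:E <= (t ^+ 2)%:E)%E).

Definition Kpot : R := n%:R `^ (n%:R - 1 - d) * 2 ^+ n * V.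

Lemma V_ge0 : 0 <= V.
Proof. by rewrite -lee_fin; apply: le_trans D1V; exact: measure_ge0. Qed.

Lemma Kpot_ge0 : 0 <= Kpot.
Proof. by rewrite !mulr_ge0 ?powR_ge0 ?exprn_ge0 ?V_ge0. Qed.

Lemma pot_integral_le r b : 0 < r -> 0 < b ->
  (\int[sigma]_(x in D1) (pot F r x)%:E <= (Knear * t ^+ 2 / b + Kpot * b * r)%:E)%E.
Proof.
move=> r0 b0; have /andP[dp dn] := d_bounds; set q := r / r ^+ n.
have q0 : 0 < q by rewrite divr_gt0 ?exprn_gt0.
have rd0 : 0 < r `^ d by exact: powR_gt0.
(* This choice cancels the powers of r: the factor r^d from Tonelli's theorem disappears from the
   first term, which becomes Knear t^2 / b, and the second term is proportional to b r. *)
pose a := b * q * r `^ d; have a0 : 0 < a by apply: mulr_gt0 => //; exact: mulr_gt0.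
pose c := q * (a * (n%:R * r) `^ (n%:R - 1 - d) * (2 * r) ^+ n).
have c0 : 0 <= c.
  apply: mulr_ge0; first exact: ltW.
  apply: mulr_ge0; last by rewrite exprn_ge0// mulr_ge0// ltW.
  by apply: mulr_ge0; [exact: ltW|exact: powR_ge0].
have qa0 : 0 <= q / a by rewrite divr_ge0 ?(ltW q0) ?(ltW a0).
apply: le_trans (@integral_affine_le _ _ _ sigma D1 (fun x => (pot F r x)%:E) (near_int Omega h r)
  (q / a) c V mD1 (measurable_pot (ltW r0)) _ _ _ qa0 c0 D1V _) _.
- exact: (measurable_near_int mD1 r mO mh h0).
- by move=> x; rewrite lee_fin; apply: pot_ge0 => //; exact: ltW.
- by move=> x; apply: integral_ge0 => z _; rewrite lee_fin mulr_ge0.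
- move=> x D1x; rewrite potE.
  apply: le_trans (lee_wpmul2l _ (cube_gradient_le (D1G D1x) r0 a0)) _; first by rewrite lee_fin ltW.
  by rewrite muleDr ?fin_num_adde_defl// muleA -!EFinM.
have H : (\int[sigma]_(x in D1) near_int Omega h r x <= (Knear * r `^ d * t ^+ 2)%:E)%E.
  apply: le_trans (near_int_le mD1 D1G D1oo mO mh h0 r0) _.
  by rewrite [leRHS]EFinM; apply: lee_wpmul2l => //; rewrite lee_fin mulr_ge0 ?powR_ge0// Knear_ge0.
apply: le_trans (leeD (lee_wpmul2l _ H) (lexx _)) _; first by rewrite lee_fin.
rewrite -EFinM -EFinD lee_fin le_eqVlt; apply/orP; left; apply/eqP.
have rz : r != 0 by rewrite gt_eqF.
have E : r `^ (n%:R - 1 - d) * (r * r `^ d) = r ^+ n.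
  rewrite -[X in _ * (X * _)]powRr1 ?(ltW r0)// -!powRD; last 2 first.
  - by rewrite rz implybT.
  - by rewrite rz implybT.
  by rewrite -powR_mulrn ?(ltW r0)//; congr (_ `^ _); lra.
have E2 : (n%:R * r) `^ (n%:R - 1 - d) = n%:R `^ (n%:R - 1 - d) * (r ^+ n / (r * r `^ d)).
  by rewrite powRM ?(ltW r0)// -E mulfK// mulf_neq0// gt_eqF.
rewrite /c /a /q /Kpot E2 exprMn; have rn : r ^+ n != 0 by rewrite expf_neq0.
have [bz rdz] : b != 0 /\ r `^ d != 0 by rewrite !gt_eqF.
move: (n%:R `^ _) (2 ^+ n) (r ^+ n) (r `^ d) rn rdz => A1 A2 A3 A4 ? ?.
by field; do ?(apply/andP; split).
Qed.

Definition potential (rad : R) x : \bar R := (\sum_(0 <= j <oo) (pot F (radius rad j) x)%:E)%E.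

Lemma measurable_potential rad : 0 < rad -> measurable_fun D1 (potential rad).
Proof.
move=> rad0; apply: ge0_emeasurable_sum => j *.
  by rewrite lee_fin pot_ge0// ltW// radius_gt0.
by apply: measurable_pot; rewrite ltW// radius_gt0.
Qed.

Lemma potential_integral_le rad : 0 < rad ->
  (\int[sigma]_(x in D1) potential rad x <= (2 * (Knear + Kpot * rad) * t)%:E)%E.
Proof.
move=> rad0; set K := Knear + Kpot * rad.
have K0 : 0 <= K by rewrite addr_ge0 ?Knear_ge0// mulr_ge0 ?Kpot_ge0// ltW.
apply: (integral_series_le (c := fun j => K * t / 2 ^+ j) mD1).
- by move=> j; apply: measurable_pot; rewrite ltW// radius_gt0.
- by move=> j x; rewrite lee_fin pot_ge0// ltW// radius_gt0.
(* With b = t 2^j and radius rad / 4^j both terms of [pot_integral_le] are multiples of t / 2^j. The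
   ratio 4 of the radii leaves this room for a geometric series. *)
- move=> j; have b0 : 0 < t * 2 ^+ j by rewrite mulr_gt0// exprn_gt0.
  apply: le_trans (pot_integral_le (radius_gt0 j rad0) b0) _.
  rewrite lee_fin le_eqVlt; apply/orP; left; apply/eqP; rewrite /radius /K.
  have -> : (4 : R) ^+ j = 2 ^+ j * 2 ^+ j by rewrite -exprMn; congr (_ ^+ _); lra.
  have : (2 : R) ^+ j != 0 by rewrite expf_neq0.
  move: (2 ^+ j) => p pz; have tz : t != 0 by rewrite gt_eqF.
  by field; rewrite pz.
move=> J; have -> : \sum_(j < J) K * t / 2 ^+ j = K * t * (2 - 2 / 2 ^+ J).
  elim: J => [|J IH]; first by rewrite big_ord0 expr0 divr1 subrr mulr0.
  rewrite big_ord_recr/= IH exprS; have : (2 : R) ^+ J != 0 by rewrite expf_neq0.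
  by move: (2 ^+ J) => p pz; field.
have : 0 <= K * t * (2 / 2 ^+ J) by rewrite !mulr_ge0 ?(ltW t0)// invr_ge0 exprn_ge0.
lra.
Qed.

End potentials.

End hausdorff_balls.

Lemma cst_integral_le d (T : measurableType d) (R : realType) (m : {measure set T -> \bar R})
    (D : set T) (g : T -> \bar R) (c K : R) : measurable D -> measurable_fun D g ->
  (forall x, (0 <= g x)%E) -> 0 <= K -> 0 <= c -> (forall x, D x -> (c%:E <= K%:E * g x)%E) ->
  (c%:E * m D <= K%:E * \int[m]_(x in D) g x)%E.
Proof.
move=> mD mg g0 K0 c0 H; rewrite -integral_cst// -ge0_integralZl//.
apply: ge0_le_integral => //.
by apply: emeasurable_funM => //; exact: measurable_cst.
Qed.

(** * Estimates for functions of finite energy *)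

Section sobolev.
Context {R : realType} {n : nat} (d C0 : R) (Gamma : set 'rV[R]_n).
Hypothesis n_ge2 : (2 <= n)%N.
Hypothesis d_bounds : 0 < d < n%:R - 1.
Hypothesis Gamma_neq0 : Gamma !=set0.
Hypothesis Gamma_closed : closed Gamma.
Hypothesis C0_ge1 : 1 <= C0.
Hypothesis Gamma_AR : ahlfors_regular d C0 Gamma.
Local Notation L := (leb_space R n).
Local Notation mu := (leb R n).
Local Notation sigma := (haus n d).
Local Notation Omega := (~` Gamma : set L).
Local Notation grad := (wgrad (~` Gamma)).
Local Notation w := (weight d Gamma).
Implicit Types (x y z a b : 'rV[R]_n) (r t rho : R) (u v e : 'rV[R]_n -> R) (i : 'I_n).

Lemma Gamma_null : leb_outer Gamma = 0%E.
Proof. by have [x Gx] := Gamma_neq0; exact: (leb_Gamma d_bounds Gamma_AR Gx). Qed.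

Lemma bad_lines_null i : leb_outer (bad_lines Gamma i) = 0%E.
Proof. by have [x Gx] := Gamma_neq0; exact: (leb_bad_lines d_bounds Gamma_AR Gx). Qed.

Lemma open_Omega : open (~` Gamma).
Proof. exact: closed_openC. Qed.

Lemma measurable_Omega : measurable Omega.
Proof. exact: measurable_leb_open open_Omega. Qed.

Definition gnorm u z : R := enorm (grad u z).

Lemma gnorm_ge0 u z : 0 <= gnorm u z.
Proof. exact: enorm_ge0. Qed.

Section gradient_of.
Variable u : 'rV[R]_n -> R.
Hypothesis Wu : in_W d Gamma u.

Let lu : loc_integrable (~` Gamma) u. Proof. by case: Wu. Qed.
Let wg : is_wgrad (~` Gamma) u (grad u). Proof. by case: Wu. Qed.

Lemma measurable_grad i : measurable_fun (setT : set L) (fun z => grad u z 0 i).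
Proof. by apply: (measurable_across Gamma_closed Gamma_null); case: (wg i). Qed.

Lemma measurable_W : measurable_fun (setT : set L) u.
Proof. exact: (measurable_across Gamma_closed Gamma_null). Qed.

Lemma measurable_gnorm : measurable_fun (setT : set L) (gnorm u).
Proof. exact: (measurable_coord_continuous measurable_grad continuous_enorm). Qed.

(** This is [cube_gradient_le] with a = t: as t^2 bounds the energy, both terms become multiples of
    t. *)
Lemma gnorm_cube_le y s t : Gamma y -> 0 < s -> 0 < t -> (W_energy d Gamma u <= (t ^+ 2)%:E)%E ->
  (\int[mu]_(z in cube y s) (gnorm u z)%:E <=
    ((1 + (n%:R * s) `^ (n%:R - 1 - d) * (2 * s) ^+ n) * t)%:E)%E.
Proof.
move=> Gy s0 t0 ut; have mO := measurable_Omega.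
have mh : measurable_fun (setT : set L) (fun z => gnorm u z ^+ 2 * w z).
  apply: measurable_funM; last exact: measurable_weight.
  by apply: measurable_funX; exact: measurable_gnorm.
have -> : (\int[mu]_(z in cube y s) (gnorm u z)%:E)%E = near_int setT (gnorm u) s y.
  rewrite /near_int [RHS](@integral_support _ _ _ mu setT (cube y s))//.
    by apply: eq_integral => z zs; rewrite indicE zs mulr1.
  by move=> z _ nz; rewrite indicE memNset// mulr0.
apply: le_trans (cube_gradient_le d_bounds Gamma_closed Gamma_neq0 Gamma_null
    (gnorm_ge0 u) measurable_gnorm Gy s0 t0) _.
set X := (n%:R * s) `^ _; set Y := (2 * s) ^+ n.
have -> : ((1 + X * Y) * t)%:E = (t%:E + (t * X * Y)%:E)%E by rewrite -EFinD; congr EFin; ring.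
apply: leeD => //.
have tz : t != 0 by rewrite gt_eqF.
have -> : t%:E = (t^-1%:E * (t ^+ 2)%:E)%E by rewrite -EFinM; congr EFin; field.
apply: lee_wpmul2l; first by rewrite lee_fin invr_ge0 ltW.
apply: le_trans ut; apply: ge0_le_integral; first exact: mO.
- move=> z _; rewrite lee_fin; apply: mulr_ge0; last by rewrite indicE.
  by apply: mulr_ge0; [exact: sqr_ge0|exact: weight_ge0].
- apply/measurable_EFinP; apply: measurable_funTS; apply: measurable_funM; first exact: mh.
  by apply: measurable_indic; exact: measurable_leb_cube.
- by apply/measurable_EFinP; exact: measurable_funTS mh.
- move=> z _; rewrite lee_fin ler_piMr// ?indicE ?lern1 ?leq_b1//.
  by rewrite mulr_ge0 ?sqr_ge0 ?weight_ge0.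
Qed.

Lemma integrable_gnorm_cube x r : mu.-integrable (cube x r) (EFin \o gnorm u).
Proof.
have [y Gy] := Gamma_neq0.
pose s := `|r| + enorm (x - y) + 1.
have s0 : 0 < s by rewrite ltr_wpDl// addr_ge0// enorm_ge0.
have [t [t0 ut]] : exists t : R, 0 < t /\ (W_energy d Gamma u <= (t ^+ 2)%:E)%E.
  have [_ _ fin] := Wu; have e0 : (0 <= W_energy d Gamma u)%E.
    by apply: integral_ge0 => z _; rewrite lee_fin mulr_ge0 ?sqr_ge0 ?weight_ge0.
  have fE : 0 <= fine (W_energy d Gamma u) by exact: fine_ge0.
  exists (fine (W_energy d Gamma u) + 1); split; first by rewrite ltr_wpDl.
  rewrite -[X in (X <= _)%E]fineK ?ge0_fin_numE// lee_fin.
  by move: fE; move: (fine _) => q q0; have := sqr_ge0 q; lra.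
have i1 : mu.-integrable (cube y s) (EFin \o gnorm u).
  apply/integrableP; split; first by apply/measurable_EFinP; exact: measurable_funTS measurable_gnorm.
  apply: le_lt_trans (ltry _); apply: le_trans (gnorm_cube_le Gy s0 t0 ut).
  rewrite le_eqVlt; apply/orP; left; apply/eqP; apply: eq_integral => z _.
  by rewrite /= ger0_norm ?gnorm_ge0.
apply: integrableS i1; [exact: measurable_leb_cube|exact: measurable_leb_cube|].
move=> z /cubeE H; apply/cubeE => i; have /andP[H1 H2] := H i.
have := coord_le_enorm (x - y) i; rewrite !mxE ler_norml => /andP[? ?].
have := ler_norm r; have := ler_norm (- r); rewrite normrN /s => ? ?.
by apply/andP; split; lra.
Qed.

Lemma hbox_sub_cube a b : exists r, hbox a b `<=` cube 0 r.
Proof.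
exists (\sum_j (`|a 0 j| + `|b 0 j|)) => z H; apply/cubeE => i; rewrite mxE sub0r add0r.
have : `|a 0 i| + `|b 0 i| <= \sum_j (`|a 0 j| + `|b 0 j|).
  by rewrite [leRHS](bigD1 i)//= lerDl; apply: sumr_ge0 => j _; rewrite addr_ge0.
have /andP[? ?] := H i; have := ler_norm (- a 0 i); have := ler_norm (b 0 i); rewrite normrN.
have := normr_ge0 (a 0 i); have := normr_ge0 (b 0 i).
move: (\sum_j _) => S ? ? ? ? ?; apply/andP; split; lra.
Qed.

Lemma integrable_grad a b i : mu.-integrable (hbox a b) (EFin \o (fun z => grad u z 0 i)).
Proof.
have [r sub] := hbox_sub_cube a b.
have i1 : mu.-integrable (hbox a b) (EFin \o gnorm u).
  apply: integrableS (integrable_gnorm_cube 0 r) => //; [exact: measurable_leb_cube|exact: measurable_leb_hbox].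
apply: (integrable_le (measurable_leb_hbox a b) _ i1).
  by apply: measurable_funTS; exact: measurable_grad.
by move=> z _; exact: coord_le_enorm.
Qed.

Lemma integrable_W a b : mu.-integrable (hbox a b) (EFin \o u).
Proof.
exact: (integrable_hbox Gamma_closed Gamma_null bad_lines_null lu wg integrable_grad).
Qed.

Lemma W_poincare (c : R) x r : 0 <= r ->
  \int[mu]_(z in cube x r) `|u z - c| <=
  `|\int[mu]_(z in cube x r) (u z - c)| + 2 * n%:R * r * \int[mu]_(z in cube x r) gnorm u z.
Proof.
move=> r0; apply: le_trans (poincare_box Gamma_closed Gamma_null bad_lines_null lu wg integrable_grad c (cube_le x r0)) _.
rewrite lerD2l; set I := \int[mu]_(z in cube x r) gnorm u z.
apply: (@le_trans _ _ (\sum_(i < n) 2 * r * I)).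
  apply: ler_sum => i _; rewrite !mxE.
  have -> : x 0 i + r - (x 0 i - r) = 2 * r by lra.
  rewrite ler_wpM2l ?mulr_ge0//; apply: le_Rintegral.
  - exact: measurable_leb_cube.
  - exact: integrable_norm (integrable_grad _ _ i).
  - exact: integrable_gnorm_cube.
  - by move=> z _; exact: coord_le_enorm.
by rewrite sumr_const card_ord -mulr_natl le_eqVlt; apply/orP; left; apply/eqP; ring.
Qed.

Lemma pot_partial_le x r s : 0 < r -> (potential (gnorm u) r x <= s%:E)%E ->
  forall J, \sum_(j < J) pot (gnorm u) (radius r j) x <= s.
Proof.
move=> r0 H J; rewrite -lee_fin -sumEFin; apply: le_trans H.
rewrite -(big_mkord xpredT (fun j => (pot (gnorm u) (radius r j) x)%:E)).
apply: nneseries_lim_ge => j *.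
by rewrite lee_fin pot_ge0 ?(ltW (radius_gt0 j r0))//; exact: gnorm_ge0.
Qed.

Lemma potential_ge0 r x : 0 < r -> (0 <= potential (gnorm u) r x)%E.
Proof.
move=> r0; apply: nneseries_ge0 => j _ _.
by rewrite lee_fin pot_ge0 ?(ltW (radius_gt0 j r0))//; exact: gnorm_ge0.
Qed.

Lemma W_ball_mean_le x r rho : 0 < rho <= r ->
  ball_mean u x q @[q --> 0^'+] --> 0%:E ->
  (`|bmean u x rho|%:E <= (2 * (@Kosc R n) + 1)%:E * potential (gnorm u) r x)%E.
Proof.
move=> /andP[rho0 rhor] tr; have r0 : 0 < r := lt_le_trans rho0 rhor.
(* The summand 1 makes the constant positive, so that the bound holds trivially where the potential
   is infinite. *)
have K0 : 0 < 2 * (@Kosc R n) + 1 :> R by rewrite ltr_wpDl// mulr_ge0// Kosc_ge0.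
have : (0 <= potential (gnorm u) r x)%E by exact: potential_ge0.
case E : (potential (gnorm u) r x) => [s||]// s0; last by rewrite gt0_muley ?lte_fin// leey.
have Hs := pot_partial_le r0 (_ : (potential (gnorm u) r x <= s%:E)%E).
rewrite lee_fin; apply: le_trans (ball_mean_le (gnorm_ge0 u) _ W_poincare r0 (Hs _) tr _) _.
- by move=> y q; exact: integrable_W.
- by rewrite E.
- by rewrite rho0.
by rewrite ler_wpM2r// lerDl.
Qed.

Lemma W_cube_norm_le x r : 0 < r ->
  ball_mean u x q @[q --> 0^'+] --> 0%:E ->
  ((\int[mu]_(z in cube x r) `|u z|)%:E <=
    ((2 * r) ^+ n * (@Kosc R n) + 2 * n%:R * r ^+ n + 1)%:E * potential (gnorm u) r x)%E.
Proof.
move=> r0 tr; set K := (2 * r) ^+ n * (@Kosc R n) + 2 * n%:R * r ^+ n.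
have K0 : 0 <= K.
  by apply: addr_ge0; rewrite mulr_ge0 ?Kosc_ge0 ?exprn_ge0 ?mulr_ge0 ?(ltW r0).
have K1 : 0 < K + 1 by rewrite ltr_wpDl.
have : (0 <= potential (gnorm u) r x)%E by exact: potential_ge0.
case E : (potential (gnorm u) r x) => [s||]// s0; last by rewrite gt0_muley ?lte_fin// leey.
have Hs := pot_partial_le r0 (_ : (potential (gnorm u) r x <= s%:E)%E).
rewrite lee_fin; apply: le_trans (cube_norm_le (gnorm_ge0 u) _ W_poincare r0 (Hs _) tr) _.
- by move=> y q; exact: integrable_W.
- by rewrite E.
by rewrite ler_wpM2r// lerDl.
Qed.

End gradient_of.

(** Every point of Gamma near [y] at which the trace vanishes bounds the same integral by the
    potential at that point. Averaging over Gamma in the unit ball about [y], of measure at least 1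
    / C0, replaces the potential by its integral over Gamma. A parameter t > 0 in place of the norm
    includes functions of zero energy. *)
Lemma W0_integral_bound x r : exists2 C : R, 0 <= C & forall e t, in_W0 d Gamma e -> 0 < t ->
  (W_energy d Gamma e <= (t ^+ 2)%:E)%E -> \int[mu]_(z in cube x r) `|e z| <= C * t.
Proof.
have [y Gy] := Gamma_neq0.
pose s := `|r| + enorm (x - y) + 1.
have s0 : 0 < s by rewrite ltr_wpDl// addr_ge0// enorm_ge0.
pose K := (2 * s) ^+ n * (@Kosc R n) + 2 * n%:R * s ^+ n + 1.
have K0 : 0 <= K.
  by rewrite addr_ge0// addr_ge0// mulr_ge0 ?Kosc_ge0 ?exprn_ge0 ?mulr_ge0 ?(ltW s0).
pose B : set (haus_space R n d) := Gamma `&` eball y 1.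
have mB : measurable B by exact: measurable_Gamma_eball.
have /andP[B1 B2] := Gamma_AR Gy (@ltr01 R).
rewrite powR1 mulr1 in B1; rewrite powR1 mulr1 in B2.
have C00 : 0 < C0 := lt_le_trans ltr01 C0_ge1.
have BV : 0 <= C0 by exact: ltW.
exists (C0 * (K * (2 * ((@Knear R n d C0) + (@Kpot R n d C0) * s)))).
  rewrite !mulr_ge0// addr_ge0 ?Knear_ge0// mulr_ge0 ?(ltW s0)//.
  by rewrite !mulr_ge0 ?powR_ge0 ?exprn_ge0.
move=> e t [We tre] t0 et.
have [N [mN N0 Nsub]] := tre.
(* Removing the null set where the trace fails to vanish keeps the lower bound on the measure and
   makes the pointwise estimate valid everywhere on [D1]. *)
pose D1 : set (haus_space R n d) := B `\` N.
have mD1 : measurable D1 by exact: measurableD.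
have D1G : D1 `<=` Gamma by move=> z [[]].
have D1V : (sigma D1 <= C0%:E)%E by apply: le_trans B2; apply: haus_le => z [].
have D1ge : (C0^-1%:E <= sigma D1)%E.
  apply: (le_trans B1).
  have -> : Gamma `&` eball y 1 = D1 `|` (B `&` N) by rewrite setUC setUIDK.
  apply: le_trans (outer_measureU2 (@haus_outer R n d) _ _) _.
  rewrite -[leRHS]adde0; apply: leeD; first exact: lexx.
  have := haus_le d (@subIsetr _ B N); rewrite N0; exact.
have trD z : D1 z -> ball_mean e z q @[q --> 0^'+] --> 0%:E.
  by move=> [[Gz _] nN]; apply: contrapT => H; apply: nN; apply: Nsub => /= H2; apply: H; exact: H2.
set I := \int[mu]_(z in cube x r) `|e z|.
have ptw z : D1 z -> (I%:E <= K%:E * potential (gnorm e) s z)%E.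
  move=> D1z; apply: le_trans (W_cube_norm_le We s0 (trD z D1z)).
  rewrite lee_fin; apply: Rint_le_subset; [exact: measurable_leb_cube|exact: measurable_leb_cube| | |].
  - move=> v /cubeE H; apply/cubeE => i; have /andP[H1 H2] := H i.
    have [[_ /= yz] _] := D1z; have := le_lt_trans (coord_le_enorm _ i) yz.
    have := coord_le_enorm (x - y) i; rewrite !mxE ler_norml ltr_norml => /andP[? ?] /andP[? ?].
    have := ler_norm r; have := ler_norm (- r); rewrite normrN /s => ? ?.
    by apply/andP; split; lra.
  - exact: integrable_norm (integrable_W We _ _).
  - by move=> v _; exact: normr_ge0.
have I0 : 0 <= I by apply: Rintegral_ge0.
have P := potential_integral_le d_bounds C0_ge1 Gamma_closed Gamma_AR Gamma_neq0 Gamma_null mD1 D1G D1V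
  (gnorm_ge0 e) (measurable_gnorm We) (integrable_gnorm_cube We) t0 et s0.
have mP := measurable_potential mD1 (gnorm_ge0 e) (measurable_gnorm We) (integrable_gnorm_cube We) s0.
have H : (I%:E * sigma D1 <= K%:E * \int[sigma]_(z in D1) potential (gnorm e) s z)%E.
  apply: (cst_integral_le sigma mD1 mP) => //.
  by move=> z; exact: potential_ge0.
have : (I%:E * C0^-1%:E <= (K * (2 * ((@Knear R n d C0) + (@Kpot R n d C0) * s) * t))%:E)%E.
  apply: le_trans (_ : (I%:E * sigma D1 <= _)%E); first by apply: lee_wpmul2l.
  by apply: le_trans H _; rewrite EFinM; exact: lee_wpmul2l.
by rewrite -EFinM lee_fin ler_pdivrMr// => /le_trans; apply; rewrite le_eqVlt; apply/orP; left; apply/eqP; ring.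
Qed.

End sobolev.

(** * Lax-Milgram theorem for semi-inner products *)

Section semi_hilbert.
Context {R : realType} {X : lmodType R}.
Variable P : X -> Prop.
Hypothesis P0 : P 0.
Hypothesis Plin : forall (a : R) u v, P u -> P v -> P (a *: u + v).
Implicit Types (u v w : X) (a s t : R).

(** The axioms hold only on the subspace [P] of a space of all functions, and definiteness is not
    asked for: functions that agree almost everywhere are not identified. *)
Record semi_inner (ip : X -> X -> R) : Prop := SemiInner {
  ip_lin : forall a u v w, P u -> P v -> P w -> ip (a *: u + v) w = a * ip u w + ip v w;
  ip_sym : forall u v, P u -> P v -> ip u v = ip v u;
  ip_ge0 : forall u, P u -> 0 <= ip u u }.

(** Squared increments of order 16^-k are what minimizing sequences provide, and geometric decay is
    what almost everywhere limits of values, gradients and means rely on. *)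
Definition fast_complete (ip : X -> X -> R) := forall (u : nat -> X) (K : R),
  (forall k, P (u k)) ->
  (forall k, ip (u k.+1 - u k) (u k.+1 - u k) <= K / 16 ^+ k) ->
  exists2 l, P l & ip (u k - l) (u k - l) @[k --> \oo] --> 0.

Lemma PB u v : P u -> P v -> P (u - v).
Proof. by move=> Pu Pv; rewrite addrC -scaleN1r; exact: Plin. Qed.

Lemma PD u v : P u -> P v -> P (u + v).
Proof. by move=> Pu Pv; rewrite -[u]scale1r; exact: Plin. Qed.

Lemma PZ a u : P u -> P (a *: u).
Proof. by move=> Pu; rewrite -[_ *: _]addr0; exact: Plin. Qed.

Section inner.
Variable ip : X -> X -> R.
Hypothesis H : semi_inner ip.

Lemma ipDl u v w : P u -> P v -> P w -> ip (u + v) w = ip u w + ip v w.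
Proof. by move=> Pu Pv Pw; rewrite -{1}[u]scale1r ip_lin// mul1r. Qed.

Lemma ip0 w : P w -> ip 0 w = 0.
Proof. by move=> Pw; have := ipDl P0 P0 Pw; rewrite addr0; lra. Qed.

Lemma ipZl a u w : P u -> P w -> ip (a *: u) w = a * ip u w.
Proof. by move=> Pu Pw; rewrite -[_ *: _]addr0 (ip_lin H)// ip0// addr0. Qed.

Lemma ipBl u v w : P u -> P v -> P w -> ip (u - v) w = ip u w - ip v w.
Proof. by move=> Pu Pv Pw; rewrite addrC -scaleN1r ip_lin// mulN1r addrC. Qed.

Lemma ipDr u v w : P u -> P v -> P w -> ip w (u + v) = ip w u + ip w v.
Proof. by move=> Pu Pv Pw; rewrite ip_sym ?ipDl ?(ip_sym H _ Pw)//; exact: PD. Qed.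

Lemma ipZr a u w : P u -> P w -> ip w (a *: u) = a * ip w u.
Proof. by move=> Pu Pw; rewrite ip_sym ?ipZl ?(ip_sym H _ Pw)//; exact: PZ. Qed.

Lemma ipBr u v w : P u -> P v -> P w -> ip w (u - v) = ip w u - ip w v.
Proof. by move=> Pu Pv Pw; rewrite ip_sym ?ipBl ?(ip_sym H _ Pw)//; exact: PB. Qed.

Definition inorm u := Num.sqrt (ip u u).

Lemma inorm_ge0 u : 0 <= inorm u. Proof. exact: sqrtr_ge0. Qed.

Lemma inorm_sqr u : P u -> inorm u ^+ 2 = ip u u.
Proof. by move=> Pu; rewrite sqr_sqrtr//; exact: (ip_ge0 H). Qed.

Lemma quadratic_ge0 (p q : R) : 0 <= q -> (forall s, 0 <= 2 * s * p + s ^+ 2 * q) -> p = 0.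
Proof.
move=> q0 h; apply/eqP; apply: contraT => pN0.
have q1 : 0 < q + 1 by lra.
have := h (- p / (q + 1)).
have -> : 2 * (- p / (q + 1)) * p + (- p / (q + 1)) ^+ 2 * q = - (p ^+ 2 * (q + 2)) / (q + 1) ^+ 2.
  by field; rewrite gt_eqF.
rewrite mulNr oppr_ge0 leNgt => /negP; case.
by rewrite divr_gt0 ?exprn_gt0// mulr_gt0 ?exprn_even_gt0//; lra.
Qed.

Lemma ip_le u v : P u -> P v -> `|ip u v| <= inorm u * inorm v.
Proof.
move=> Pu Pv; have E s : 0 <= ip u u + 2 * s * ip u v + s ^+ 2 * ip v v.
  have Psv := PZ s Pv; have Pw := PD Pu Psv.
  have := ip_ge0 H Pw; rewrite ipDl// !ipDr// !ipZl// !ipZr// (ip_sym H Pv Pu).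
  by congr (_ <= _); ring.
rewrite -!(inorm_sqr Pu) -!(inorm_sqr Pv) in E.
by apply: cs_quadratic => //; exact: inorm_ge0.
Qed.

Lemma inormD u v : P u -> P v -> inorm (u + v) <= inorm u + inorm v.
Proof.
move=> Pu Pv; have Puv := PD Pu Pv.
rewrite -(@ler_pXn2r _ 2) ?nnegrE ?addr_ge0 ?inorm_ge0// inorm_sqr//.
rewrite ipDl// !ipDr// (ip_sym H Pv Pu) -(inorm_sqr Pu) -(inorm_sqr Pv).
have := le_trans (ler_norm _) (ip_le Pu Pv); lra.
Qed.

Section riesz.
Hypothesis complete : fast_complete ip.
Variables (f : X -> R) (M : R).
Hypothesis f_lin : forall a u v, P u -> P v -> f (a *: u + v) = a * f u + f v.
Hypothesis f_bnd : forall v, P v -> `|f v| <= M * inorm v.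

Let J u := ip u u - 2 * f u.

Let J_lb u : P u -> - M ^+ 2 <= J u.
Proof.
move=> Pu; rewrite /J -inorm_sqr//; have := f_bnd Pu; have := ler_norm (f u).
have := sqr_ge0 (inorm u - M); move: (inorm u) (f u) `|f u| => x y z; lra.
Qed.

Let fD u v : P u -> P v -> f (u + v) = f u + f v.
Proof. by move=> Pu Pv; rewrite -{1}[u]scale1r f_lin// mul1r. Qed.

Let f0 : f 0 = 0.
Proof. by have := fD P0 P0; rewrite addr0; lra. Qed.

Let fZ a u : P u -> f (a *: u) = a * f u.
Proof. by move=> Pu; rewrite -[_ *: _]addr0 f_lin// f0 addr0. Qed.

(** The representing vector minimizes [J u] = |u|^2 - 2 f(u), which is bounded below because [f] is
    bounded. A minimizing sequence is fast Cauchy by the parallelogram identity, and the first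
    variation at the limit vanishes. *)
Lemma riesz : exists2 r, P r & forall v, P v -> ip r v = f v.
Proof.
pose E := [set J u | u in P].
have hE : has_inf E by split; [exists (J 0), 0|exists (- M ^+ 2) => _ [u Pu <-]; exact: J_lb].
pose m := inf E.
have Em u : P u -> m <= J u by move=> Pu; apply: ge_inf; [case: hE|exists u].
have e0 (k : nat) : 0 < (16 ^+ k : R)^-1 by rewrite invr_gt0 exprn_gt0.
have ex k : exists u, P u /\ J u <= m + (16 ^+ k)^-1.
  by have [_ [u Pu <-] Hu] := inf_adherent (e0 k) hE; exists u; split => //; exact: ltW.
have [u Pu] := choice ex.
have PuB k := (Pu k).1.
(* The midpoint competes in the infimum, so the parallelogram identity bounds the squared increment
   by 2 (16^-k + 16^-(k+1)), which is at most 4 / 16^k. *)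
have cauchy k : ip (u k.+1 - u k) (u k.+1 - u k) <= 4 / 16 ^+ k.
  have Pm : P (2^-1 *: (u k.+1 + u k)) by apply: PZ; exact: PD.
  have := Em _ Pm; have := (Pu k).2; have := (Pu k.+1).2.
  have Ps := PD (PuB k.+1) (PuB k).
  rewrite /J ipBl ?ipBr ?ipZl ?ipZr ?fZ ?fD ?ipDl ?ipDr//; try (by exact: PZ); try (by exact: PB).
  rewrite (ip_sym H (PuB k.+1) (PuB k)) exprS invfM.
  have := e0 k; move: (16 ^+ k)^-1 => q; lra.
have [r Pr cv] := complete PuB cauchy; exists r => // v Pv.
apply/eqP; rewrite -subr_eq0; apply/eqP; apply: (@quadratic_ge0 _ (ip v v)); first exact: (ip_ge0 H).
move=> s.
(* [u k + s v] competes in the infimum while [u k] exceeds it by at most 16^-k; the inequality is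
   rewritten around the limit [r], and the mixed term with [u k - r] tends to 0. *)
have key k : 0 <= (16 ^+ k)^-1 + 2 * s * ip (u k - r) v + (2 * s * (ip r v - f v) + s ^+ 2 * ip v v).
  have Psv := PZ s Pv; have Pus := PD (PuB k) Psv; have := Em _ Pus; have := (Pu k).2.
  rewrite /J (ipDl (PuB k) Psv Pus) !(ipDr (PuB k) Psv)// !(ipZl s Pv)// (ipZr s Pv)// (ipZr s Pv)//.
  rewrite fD// fZ// ipBl// (ip_sym H Pv (PuB k)); lra.
have c1 : (16 ^+ k : R)^-1 @[k --> \oo] --> (0 : R).
  under eq_fun do rewrite -exprVn; apply: cvg_expr.
  by rewrite ger0_norm ?invr_ge0// invf_lt1 ?ltr1n ?ltr0n.
have c2 : ip (u k - r) v @[k --> \oo] --> (0 : R).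
  have cn : inorm (u k - r) * inorm v @[k --> \oo] --> 0 * inorm v.
    apply: cvgM; last exact: cvg_cst.
    rewrite -[X in _ --> X]sqrtr0; apply: (cvg_comp _ _ cv); exact: sqrt_continuous.
  rewrite mul0r in cn; apply: norm_cvg0; apply: (squeeze_cvgr _ (cvg_cst 0) cn).
  by apply: nearW => k; rewrite normr_ge0 ip_le//; exact: PB.
have c3 : (16 ^+ k)^-1 + 2 * s * ip (u k - r) v + (2 * s * (ip r v - f v) + s ^+ 2 * ip v v) @[k --> \oo]
    --> 0 + 2 * s * 0 + (2 * s * (ip r v - f v) + s ^+ 2 * ip v v).
  have c4 : 2 * s * ip (u k - r) v @[k --> \oo] --> 2 * s * 0 by apply: cvgMr.
  exact: (cvgD (cvgD c1 c4) (cvg_cst _)).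
rewrite mulr0 !add0r in c3.
by apply: (cvgr_to_ge c3); exact: nearW.
Qed.

End riesz.

End inner.

Section lax_milgram.
Variables (ip b : X -> X -> R) (C c : R).
Hypothesis H : semi_inner ip.
Hypothesis complete : fast_complete ip.
Hypothesis b_linl : forall a u v w, P u -> P v -> P w -> b (a *: u + v) w = a * b u w + b v w.
Hypothesis b_linr : forall a u v w, P u -> P v -> P w -> b w (a *: u + v) = a * b w u + b w v.
Hypothesis b_bnd : forall u v, P u -> P v -> `|b u v| <= C * inorm ip u * inorm ip v.
Hypothesis C_ge0 : 0 <= C.
Hypothesis c0 : 0 < c.
Hypothesis b_coe : forall u, P u -> c * ip u u <= b u u.
Variables (f : X -> R) (M : R).
Hypothesis f_lin : forall a u v, P u -> P v -> f (a *: u + v) = a * f u + f v.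
Hypothesis f_bnd : forall v, P v -> `|f v| <= M * inorm ip v.

Let Sex u : exists s : X, P u -> P s /\ forall v, P v -> ip s v = b u v.
Proof.
have [Pu|nP] := pselect (P u); last by exists 0.
have [s Ps sv] := riesz H complete (fun a v w Pv Pw => b_linr a Pv Pw Pu) (fun v => @b_bnd u v Pu).
by exists s.
Qed.

(** Let <S u, v> = b(u, v). By boundedness and coercivity <S u, S v> is an equivalent semi-inner
    product, and the Riesz theorem for it represents v -> f(S v) by some u. Then S u - r is
    orthogonal to the range of S, where r represents f, and coercivity on S u - r itself shows that
    it has norm 0. *)
Lemma lax_milgram : exists2 u, P u & forall v, P v -> b u v = f v.
Proof.
(* [S] is a choice of representatives, linear only up to vectors of norm 0; its properties are read
   off from [ip (S u) v = b u v]. *)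
have [S SP] := choice Sex.
have PS u : P u -> P (S u) by move=> /SP[].
have Sb u v : P u -> P v -> ip (S u) v = b u v by move=> /SP[_ Hs] /Hs.
have [r Pr rf] := riesz H complete f_lin f_bnd.
have n0 u := inorm_ge0 ip u.
have S_le u : P u -> inorm ip (S u) <= C * inorm ip u.
  move=> Pu; have := b_bnd Pu (PS _ Pu); rewrite -(Sb _ _ Pu (PS _ Pu)) -(inorm_sqr H (PS _ Pu)).
  have := n0 (S u); have := n0 u; move: (inorm ip (S u)) (inorm ip u) => x y y0 x0.
  rewrite ger0_norm ?sqr_ge0// expr2.
  have [->|xN0] := eqVneq x 0; first by rewrite mulr_ge0.
  by rewrite ler_pM2r// lt_def xN0.
have S_ge u : P u -> c * inorm ip u <= inorm ip (S u).
  move=> Pu; have := b_coe Pu; rewrite -Sb// -(inorm_sqr H Pu) => h.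
  have := le_trans h (le_trans (ler_norm _) (ip_le H (PS _ Pu) Pu)).
  have := n0 (S u); have := n0 u; move: (inorm ip (S u)) (inorm ip u) => x y y0 x0.
  have [->|yN0] := eqVneq y 0; first by move=> _; rewrite mulr0.
  by rewrite expr2 mulrA ler_pM2r// lt_def yN0.
pose ip' u v := ip (S u) (S v).
have H' : semi_inner ip'.
  split => [a u v w Pu Pv Pw|u v Pu Pv|u Pu]; rewrite /ip'.
  - have Pa := Plin a Pu Pv; have PSw := PS _ Pw.
    by rewrite (Sb _ _ Pa PSw) (Sb _ _ Pu PSw) (Sb _ _ Pv PSw) b_linl.
  - by rewrite (ip_sym H)//; exact: PS.
  - by apply: (ip_ge0 H); exact: PS.
have in' u : inorm ip' u = inorm ip (S u) by [].
have complete' : fast_complete ip'.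
  move=> u K Pu uK.
  have cK k : ip (u k.+1 - u k) (u k.+1 - u k) <= (K / c ^+ 2) / 16 ^+ k.
    have Pd := PB (Pu k.+1) (Pu k); have := uK k; rewrite -!inorm_sqr// in'.
    move=> h; rewrite mulrAC ler_pdivlMr ?exprn_gt0//; apply: le_trans h.
    rewrite mulrC -exprMn; apply: lerXn2r; rewrite ?nnegrE ?n0// ?mulr_ge0 ?n0 ?(ltW c0)//.
    exact: S_ge.
  have [l Pl cl] := complete Pu cK; exists l => //.
  have cl2 : C ^+ 2 * ip (u k - l) (u k - l) @[k --> \oo] --> C ^+ 2 * 0 by apply: cvgMr.
  rewrite mulr0 in cl2; apply: (squeeze_cvgr _ (cvg_cst 0) cl2).
  apply: nearW => k; have Pd := PB (Pu k) Pl.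
  rewrite (ip_ge0 H')//= -!inorm_sqr// in' -exprMn.
  by apply: lerXn2r; rewrite ?nnegrE ?n0 ?S_le//; apply: le_trans (S_le _ Pd).
have g_lin a u v : P u -> P v -> f (S (a *: u + v)) = a * f (S u) + f (S v).
  move=> Pu Pv; have Pa := Plin a Pu Pv.
  rewrite -(rf _ (PS _ Pa)) -(rf _ (PS _ Pu)) -(rf _ (PS _ Pv)).
  rewrite !(ip_sym H Pr (PS _ _)) // (Sb _ _ Pa Pr) (Sb _ _ Pu Pr) (Sb _ _ Pv Pr).
  exact: b_linl.
have g_bnd v : P v -> `|f (S v)| <= M * inorm ip' v by move=> Pv; rewrite in'; apply: f_bnd; exact: PS.
have [u Pu Hu] := riesz H' complete' g_lin g_bnd.
have PSr := PB (PS _ Pu) Pr.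
have z0 : inorm ip (S u - r) = 0.
  have : c * ip (S u - r) (S u - r) <= 0.
    have PSd := PS _ PSr; apply: le_trans (b_coe PSr) _.
    rewrite -(Sb _ _ PSr PSr) (ipBr H (PS _ Pu) Pr PSd) (ip_sym H PSd (PS _ Pu)) (ip_sym H PSd Pr).
    by have := Hu _ PSr; rewrite /ip' => ->; rewrite (rf _ PSd) subrr.
  rewrite pmulr_rle0// -(inorm_sqr H PSr); have := n0 (S u - r); move: (inorm _ _) => x x0.
  by move=> h; apply/eqP; rewrite -[_ == 0](@expf_eq0 _ _ 2)//= eq_le h sqr_ge0.
exists u => // v Pv; rewrite -Sb// -rf//.
apply/eqP; rewrite -subr_eq0 -(ipBl H)//; last exact: PS.
by rewrite -normr_le0; apply: le_trans (ip_le H PSr Pv) _; rewrite z0 mul0r.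
Qed.

End lax_milgram.

End semi_hilbert.

(** * Energy forms on W *)

Section energy_forms.
Context {R : realType} {n : nat} (d C0 : R) (Gamma : set 'rV[R]_n).
Hypothesis d_bounds : 0 < d < n%:R - 1.
Hypothesis Gamma_neq0 : Gamma !=set0.
Hypothesis Gamma_closed : closed Gamma.
Hypothesis Gamma_AR : ahlfors_regular d C0 Gamma.
Local Notation L := (leb_space R n).
Local Notation mu := (leb R n).
Local Notation Omega := (~` Gamma : set L).
Local Notation grad := (wgrad (~` Gamma)).
Local Notation w := (weight d Gamma).
Local Notation V := ('rV[R]_n -> R).
Implicit Types (u v e : V) (a c : R) (z x : 'rV[R]_n) (i : 'I_n).

Let mO : measurable Omega. Proof. exact: measurable_Omega. Qed.
Let oO : open (~` Gamma). Proof. exact: open_Omega. Qed.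

(** [wgrad] picks some distributional gradient, so an explicit gradient agrees with it only off a
    null set. This is how explicit formulas reach the definitions of energy and form. *)
Lemma wgrad_eq u G : is_wgrad (~` Gamma) u G ->
  is_wgrad (~` Gamma) u (grad u) /\
  exists N : set L, [/\ measurable N, mu N = 0%E & forall z, Omega z -> ~ N z -> grad u z = G z].
Proof.
move=> wG; have wg : is_wgrad (~` Gamma) u (grad u).
  by apply: (xgetPex (cst 0) (P := [set G | is_wgrad (~` Gamma) u G])); exists G.
split => //; have : {ae mu, forall z, forall i, Omega z -> grad u z 0 i = G z 0 i}.
  by apply: filter_forall => i; exact: (wgrad_unique oO wg wG).
move=> [N [mN N0 sub]]; exists N; split => // z Oz nN; apply/rowP => i.
by apply: contrapT => H; apply: nN; apply: sub => /= H2; apply: H; exact: H2.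
Qed.

Lemma measurable_field_sqr (G : 'rV[R]_n -> 'rV[R]_n) :
  (forall i, measurable_fun Omega (fun z => G z 0 i)) ->
  measurable_fun Omega (fun z => enorm (G z) ^+ 2 * w z).
Proof.
move=> mG; apply: measurable_funM; last by apply: measurable_funTS; exact: measurable_weight.
have -> : (fun z => enorm (G z) ^+ 2) = (fun z => \sum_i G z 0 i * G z 0 i).
  by apply/funext => z; rewrite enorm_sqr.
by apply: measurable_sum => i; apply: measurable_funM; exact: mG.
Qed.

Lemma wgrad_measurable u G i : is_wgrad (~` Gamma) u G -> measurable_fun Omega (fun z => G z 0 i).
Proof. by move=> wG; case: (wG i) => -[]. Qed.

Lemma in_W_of_wgrad u G : loc_integrable (~` Gamma) u -> is_wgrad (~` Gamma) u G ->
  (\int[mu]_(z in Omega) (enorm (G z) ^+ 2 * w z)%:E < +oo)%E ->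
  in_W d Gamma u /\ W_energy d Gamma u = (\int[mu]_(z in Omega) (enorm (G z) ^+ 2 * w z)%:E)%E.
Proof.
move=> lu wG fin; have [wg [N [mN N0 EN]]] := wgrad_eq wG.
have E : W_energy d Gamma u = (\int[mu]_(z in Omega) (enorm (G z) ^+ 2 * w z)%:E)%E.
  have pos (H : 'rV[R]_n -> 'rV[R]_n) z : Omega z -> (0 <= (enorm (H z) ^+ 2 * w z)%:E)%E.
    by move=> _; rewrite lee_fin mulr_ge0 ?sqr_ge0 ?weight_ge0.
  have m1 : measurable_fun Omega (fun z => (enorm (grad u z) ^+ 2 * w z)%:E).
    by apply/measurable_EFinP; apply: measurable_field_sqr => i; exact: (wgrad_measurable i wg).
  have m2 : measurable_fun Omega (fun z => (enorm (G z) ^+ 2 * w z)%:E).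
    by apply/measurable_EFinP; apply: measurable_field_sqr => i; exact: (wgrad_measurable i wG).
  rewrite /W_energy (@ge0_negligible_integral _ _ _ mu Omega N _ mN mO m1 (pos _) N0).
  rewrite (@ge0_negligible_integral _ _ _ mu Omega N _ mN mO m2 (pos _) N0).
  by apply: eq_integral => z; rewrite inE => -[Oz nN]; rewrite EN.
by split => //; split => //; rewrite E.
Qed.

Definition energy_density u z : R := enorm (grad u z) ^+ 2 * w z.

Lemma energy_density_ge0 u z : 0 <= energy_density u z.
Proof. by rewrite mulr_ge0 ?sqr_ge0 ?weight_ge0. Qed.

Lemma integrable_energy u : in_W d Gamma u -> mu.-integrable Omega (EFin \o energy_density u).
Proof.
move=> [lu wg fin]; apply/integrableP; split.
  by apply/measurable_EFinP; apply: measurable_field_sqr => i; exact: (wgrad_measurable i wg).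
apply: le_lt_trans fin; rewrite le_eqVlt; apply/orP; left; apply/eqP; apply: eq_integral => z _.
by rewrite /= ger0_norm ?energy_density_ge0.
Qed.

Lemma in_W_lin a u v : in_W d Gamma u -> in_W d Gamma v -> in_W d Gamma (a *: u + v).
Proof.
move=> Wu Wv; have [lu wu _] := Wu; have [lv wv _] := Wv.
have wG := is_wgrad_lin a oO lu lv wu wv.
have [] := @in_W_of_wgrad (a *: u + v) _ (loc_integrable_lin a oO lu lv) wG; last by [].
have iD : mu.-integrable Omega (EFin \o (fun z => 2 * a ^+ 2 * energy_density u z + 2 * energy_density v z)).
  by apply: integrableRD => //; apply: integrableRZ => //; exact: integrable_energy.
apply: le_lt_trans (_ : (\int[mu]_(z in Omega) (2 * a ^+ 2 * energy_density u z + 2 * energy_density v z)%:E < +oo)%E).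
  apply: ge0_le_integral; first exact: mO.
  - by move=> z _; rewrite lee_fin mulr_ge0 ?sqr_ge0 ?weight_ge0.
  - by apply/measurable_EFinP; apply: measurable_field_sqr => i; exact: (wgrad_measurable i wG).
  - exact: measurable_int iD.
  - move=> z _; rewrite lee_fin /energy_density !(mulrA _ _ (w z)) -mulrDl ler_wpM2r ?weight_ge0//.
    have := enormD (a *: grad u z) (grad v z); rewrite enormZ.
    have := enorm_ge0 (a *: grad u z + grad v z).
    rewrite -(real_normK (num_real a)) -[2 * _ * _]mulrA -exprMn.
    have := enorm_ge0 (grad v z); have : 0 <= `|a| * enorm (grad u z) by rewrite mulr_ge0 ?enorm_ge0.
    move: (`|a| * enorm (grad u z)) (enorm (grad v z)) (enorm (_ + _)) => p q s p0 q0 s0 spq.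
    apply: le_trans (_ : (p + q) ^+ 2 <= _); first by apply: lerXn2r; rewrite ?nnegrE ?addr_ge0.
    have := sqr_ge0 (p - q); lra.
have /integrableP[_] := iD; apply: le_lt_trans; apply: le_integral => //.
- by apply: integrable_abse; exact: iD.
- by move=> z _; rewrite /= lee_fin ler_norm.
Qed.

Lemma grad_lin a u v : in_W d Gamma u -> in_W d Gamma v ->
  exists N : set L, [/\ measurable N, mu N = 0%E &
    forall z, Omega z -> ~ N z -> grad (a *: u + v) z = a *: grad u z + grad v z].
Proof.
move=> [lu wu _] [lv wv _]; have wG := is_wgrad_lin a oO lu lv wu wv.
exact: (wgrad_eq (u := a *: u + v) wG).2.
Qed.

Lemma in_W0_fun : in_W d Gamma 0 /\ W_energy d Gamma 0 = 0%E.
Proof.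
have l0 : loc_integrable (~` Gamma) (fun=> 0 : R).
  split; first exact: measurable_cst.
  by move=> K _ _; under eq_integral do rewrite abse0; rewrite integral0 ltry.
have w0 : is_wgrad (~` Gamma) (fun=> 0 : R) (fun=> 0).
  move=> i; split; first by rewrite (_ : (fun z => _) = fun=> 0)//; apply/funext => z; rewrite mxE.
  move=> phi _; under eq_integral do rewrite mul0r.
  under [in RHS]eq_integral do rewrite mxE mul0r.
  by rewrite !integral0 oppe0.
have e0 : (\int[mu]_(z in Omega) (enorm (0 : 'rV[R]_n) ^+ 2 * w z)%:E = 0)%E.
  by under eq_integral do rewrite enorm0 expr0n/= mul0r; rewrite integral0.
have [] := @in_W_of_wgrad 0 (fun=> 0) l0 w0; first by rewrite e0.
by move=> ? ->.
Qed.

Section form.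
Variables (A : 'rV[R]_n -> 'M[R]_n) (K : R).
Hypothesis mA : forall i j, measurable_fun Omega (fun z => A z i j).
Hypothesis K_ge0 : 0 <= K.
Hypothesis A_bnd : forall z, Omega z -> forall xi zeta : 'rV[R]_n,
  `|dotp (mxact (A z) xi) zeta| <= K * w z * enorm xi * enorm zeta.

Definition form_density u v z : R := dotp (mxact (A z) (grad u z)) (grad v z).
Definition eform u v : R := \int[mu]_(z in Omega) form_density u v z.

Lemma measurable_form_density u v : in_W d Gamma u -> in_W d Gamma v ->
  measurable_fun Omega (form_density u v).
Proof.
move=> [_ wu _] [_ wv _]; apply: measurable_sum => i.
apply: measurable_funM; last exact: (wgrad_measurable i wv).
rewrite (_ : (fun z => _) = (fun z => \sum_j grad u z 0 j * A z i j)); last first.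
  by apply/funext => z; rewrite mxE; apply: eq_bigr => j _; rewrite mxE.
by apply: measurable_sum => j; apply: measurable_funM; [exact: (wgrad_measurable j wu)|exact: mA].
Qed.

Lemma integrable_form_density u v : in_W d Gamma u -> in_W d Gamma v ->
  mu.-integrable Omega (EFin \o form_density u v).
Proof.
move=> Wu Wv; have iD : mu.-integrable Omega (EFin \o (fun z => K * energy_density u z + K * energy_density v z)).
  by apply: integrableRD => //; apply: integrableRZ => //; exact: integrable_energy.
apply: (integrable_le mO (measurable_form_density Wu Wv) iD) => z Oz.
apply: le_trans (A_bnd Oz _ _) _; rewrite /energy_density.
have := weight_ge0 Gamma d z; move: (w z) (enorm _) (enorm _) => q x y q0.
have H : 0 <= K * q * (x ^+ 2 + y ^+ 2 - x * y).
  by rewrite !mulr_ge0//; have := sqr_ge0 (x - y / 2); have := sqr_ge0 y; lra.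
by rewrite -subr_ge0; apply: le_trans H _; rewrite le_eqVlt; apply/orP; left; apply/eqP; ring.
Qed.

Lemma eform_linl a u v e : in_W d Gamma u -> in_W d Gamma v -> in_W d Gamma e ->
  eform (a *: u + v) e = a * eform u e + eform v e.
Proof.
move=> Wu Wv We; have [N [mN N0 EN]] := grad_lin a Wu Wv.
have Wuv := in_W_lin a Wu Wv.
have i1 := integrable_form_density Wu We; have i2 := integrable_form_density Wv We.
have i3 := integrableRZ a mO i1; have i4 := integrableRD mO i3 i2.
rewrite /eform (@Rint_ae_eq _ _ _ mu Omega N _ (fun z => a * form_density u e z + form_density v e z) mO mN N0
  (measurable_form_density Wuv We) (integrableR_measurable i4)).
  by rewrite (RintegralD mO i3 i2) (RintegralZl a mO i1).
by move=> z Oz nN; rewrite /form_density EN// /mxact mulmxDl -scalemxAl dotpDl dotpZl.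
Qed.

Lemma eform_linr a u v e : in_W d Gamma u -> in_W d Gamma v -> in_W d Gamma e ->
  eform e (a *: u + v) = a * eform e u + eform e v.
Proof.
move=> Wu Wv We; have [N [mN N0 EN]] := grad_lin a Wu Wv.
have Wuv := in_W_lin a Wu Wv.
have i1 := integrable_form_density We Wu; have i2 := integrable_form_density We Wv.
have i3 := integrableRZ a mO i1; have i4 := integrableRD mO i3 i2.
rewrite /eform (@Rint_ae_eq _ _ _ mu Omega N _ (fun z => a * form_density e u z + form_density e v z) mO mN N0
  (measurable_form_density We Wuv) (integrableR_measurable i4)).
  by rewrite (RintegralD mO i3 i2) (RintegralZl a mO i1).
by move=> z Oz nN; rewrite /form_density EN// dotpDr dotpZr.
Qed.

End form.

(** The inner product of W is the form of the matrix w Id, so that bilinearity and integrability are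
    shared with the form of [A]. *)
Definition wip u v : R := eform (fun z => (w z)%:M) u v.

Lemma mxact_scalar c (xi : 'rV[R]_n) : mxact c%:M xi = c *: xi.
Proof. by rewrite /mxact tr_scalar_mx mul_mx_scalar. Qed.

Lemma measurable_weight_mx i j : measurable_fun Omega (fun z => ((w z)%:M : 'M[R]_n) i j).
Proof.
under eq_fun do rewrite mxE; case: (i == j).
  by under eq_fun do rewrite mulr1n; apply: measurable_funTS; exact: measurable_weight.
by under eq_fun do rewrite mulr0n; exact: measurable_cst.
Qed.

Lemma weight_mx_bnd z : Omega z -> forall xi zeta : 'rV[R]_n,
  `|dotp (mxact (w z)%:M xi) zeta| <= 1 * w z * enorm xi * enorm zeta.
Proof.
move=> _ xi zeta; rewrite mxact_scalar dotpZl normrM ger0_norm ?weight_ge0// mul1r -mulrA.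
by rewrite ler_wpM2l ?weight_ge0// dotp_le.
Qed.

Lemma wip_energy u : in_W d Gamma u -> W_energy d Gamma u = (wip u u)%:E.
Proof.
move=> Wu; rewrite /wip /eform /Rintegral fineK.
  by apply: eq_integral => z _; rewrite /form_density mxact_scalar dotpZl -enorm_sqr mulrC.
exact: (integrable_fin_num mO (integrable_form_density measurable_weight_mx ler01 weight_mx_bnd Wu Wu)).
Qed.

Lemma wip_semi_inner : semi_inner (in_W d Gamma) wip.
Proof.
split.
- by move=> a u v e Wu Wv We; exact: (eform_linl measurable_weight_mx ler01 weight_mx_bnd).
- move=> u v Wu Wv; apply: eq_Rintegral => z _.
  by rewrite /form_density !mxact_scalar !dotpZl dotpC.
- move=> u Wu; apply: Rintegral_ge0 => z _.
  by rewrite /form_density mxact_scalar dotpZl -enorm_sqr mulr_ge0 ?sqr_ge0 ?weight_ge0.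
Qed.

Lemma W_normE u : W_norm d Gamma u = Num.sqrt (fine (W_energy d Gamma u)).
Proof. by []. Qed.

Lemma inorm_W u : in_W d Gamma u -> inorm wip u = W_norm d Gamma u.
Proof. by move=> Wu; rewrite /inorm W_normE wip_energy. Qed.

Lemma W_norm_ge0 u : 0 <= W_norm d Gamma u.
Proof. exact: sqrtr_ge0. Qed.

Section form_bound.
Variables (A : 'rV[R]_n -> 'M[R]_n) (K : R).
Hypothesis mA : forall i j, measurable_fun Omega (fun z => A z i j).
Hypothesis K_ge0 : 0 <= K.
Hypothesis A_bnd : forall z, Omega z -> forall xi zeta : 'rV[R]_n,
  `|dotp (mxact (A z) xi) zeta| <= K * w z * enorm xi * enorm zeta.

(** The integrand is at most K w |grad u| |grad v|. The integral of w (|grad u| + s |grad v|)^2 is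
    nonnegative for all s, which is the hypothesis of [cs_quadratic]. *)
Lemma eform_le u v : in_W d Gamma u -> in_W d Gamma v ->
  `|eform A u v| <= K * inorm wip u * inorm wip v.
Proof.
move=> Wu Wv; have Wi := wip_semi_inner.
pose g z := w z * enorm (grad u z) * enorm (grad v z).
have [_ wu _] := Wu; have [_ wv _] := Wv.
have iu := integrable_energy Wu; have iv := integrable_energy Wv.
have mn (G : 'rV[R]_n -> 'rV[R]_n) : (forall i, measurable_fun Omega (fun z => G z 0 i)) ->
    measurable_fun Omega (fun z => enorm (G z)).
  move=> mG; have -> : (fun z => enorm (G z)) = (fun z => Num.sqrt (\sum_i G z 0 i * G z 0 i)) by [].
  apply: (measurableT_comp (continuous_measurable_fun (@sqrt_continuous R))).
  by apply: measurable_sum => i; apply: measurable_funM; exact: mG.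
have mg : measurable_fun Omega g.
  apply: measurable_funM; last by apply: mn => i; exact: (wgrad_measurable i wv).
  apply: measurable_funM; first by apply: measurable_funTS; exact: measurable_weight.
  by apply: mn => i; exact: (wgrad_measurable i wu).
have ig : mu.-integrable Omega (EFin \o g).
  apply: (integrable_le mO mg (integrableRD mO iu iv)) => z _; rewrite /g /energy_density.
  have := weight_ge0 Gamma d z; have := enorm_ge0 (grad u z); have := enorm_ge0 (grad v z).
  move: (w z) (enorm _) (enorm _) => q y x x0 y0 q0; rewrite ger0_norm ?mulr_ge0//.
  rewrite -mulrDl [leRHS]mulrC -mulrA ler_wpM2l//; have := sqr_ge0 (x - y); have := sqr_ge0 x; have := sqr_ge0 y; lra.
have le1 : `|eform A u v| <= K * \int[mu]_(z in Omega) g z.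
  have i1 := integrable_form_density mA K_ge0 A_bnd Wu Wv.
  apply: le_trans (le_normr_Rintegral mO i1) _; rewrite -(RintegralZl K mO ig).
  apply: le_Rintegral => //; [exact: integrable_norm i1|exact: integrableRZ|].
  by move=> z Oz; apply: le_trans (A_bnd Oz _ _) _; rewrite /g !mulrA.
apply: le_trans le1 _; rewrite -mulrA ler_wpM2l//.
have nu := inorm_sqr Wi Wu; have nv := inorm_sqr Wi Wv.
have E e : in_W d Gamma e -> wip e e = \int[mu]_(z in Omega) energy_density e z.
  move=> We; apply: eq_Rintegral => z _.
  by rewrite /form_density mxact_scalar dotpZl -enorm_sqr mulrC.
have Eu := E _ Wu; have Ev := E _ Wv.
have Q s : 0 <= \int[mu]_(z in Omega) energy_density u z + (2 * s) * \int[mu]_(z in Omega) g z +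
    s ^+ 2 * \int[mu]_(z in Omega) energy_density v z.
  rewrite -(RintegralZl (2 * s) mO ig) -(RintegralZl (s ^+ 2) mO iv).
  have i2 := integrableRZ (2 * s) mO ig; have i3 := integrableRZ (s ^+ 2) mO iv.
  rewrite -(RintegralD mO iu i2) -(RintegralD mO (integrableRD mO iu i2) i3).
  apply: Rintegral_ge0 => z _; rewrite /energy_density /g.
  move: (w z) (weight_ge0 Gamma d z) (enorm (grad u z)) (enorm (grad v z)) => q q0 x y.
  have -> : x ^+ 2 * q + 2 * s * (q * x * y) + s ^+ 2 * (y ^+ 2 * q) = q * (x + s * y) ^+ 2 by ring.
  by rewrite mulr_ge0 ?sqr_ge0.
move: nu nv Eu Ev Q (inorm_ge0 wip u) (inorm_ge0 wip v).
move: (inorm wip u) (inorm wip v) (wip u u) (wip v v) (\int[mu]_(z in Omega) g z) => nu nv wu' wv' I.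
move: (\int[mu]_(z in Omega) energy_density u z) (\int[mu]_(z in Omega) energy_density v z) => Iu Iv.
move=> E1 E2 E3 E4 Q nu0 nv0; apply: le_trans (ler_norm _) _; apply: cs_quadratic => // s.
by rewrite E1 E2 E3 E4.
Qed.

End form_bound.

Lemma bmean_lin a u v x r : in_W d Gamma u -> in_W d Gamma v ->
  bmean (a *: u + v) x r = a * bmean u x r + bmean v x r.
Proof.
move=> Wu Wv.
have mB : measurable (eball x r : set L) by apply: measurable_leb_open; exact: open_eball.
have ib e : in_W d Gamma e -> mu.-integrable (eball x r) (EFin \o e).
  move=> We; apply: integrable_eball => y s.
  exact: (integrable_W d_bounds Gamma_neq0 Gamma_closed Gamma_AR We _ _).
have i1 := ib _ Wu; have i2 := ib _ Wv.
have E : \int[mu]_(z in eball x r) (a *: u + v) z =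
    a * \int[mu]_(z in eball x r) u z + \int[mu]_(z in eball x r) v z.
  by rewrite -(RintegralZl a mB i1) -(RintegralD mB (integrableRZ a mB i1) i2).
by rewrite /bmean E mulrDl mulrA.
Qed.

Lemma ball_mean_W u x r : in_W d Gamma u -> ball_mean u x r = (bmean u x r)%:E.
Proof.
move=> Wu; apply: ball_meanE => y s.
exact: (integrable_W d_bounds Gamma_neq0 Gamma_closed Gamma_AR Wu _ _).
Qed.

Lemma has_trace_lin a u v (g h : V) : in_W d Gamma u -> in_W d Gamma v ->
  has_trace d Gamma u g -> has_trace d Gamma v h -> has_trace d Gamma (a *: u + v) (a *: g + h).
Proof.
move=> Wu Wv; rewrite /has_trace; apply: (@filterS2 _ _ (ae_filter_ringOfSetsType (haus n d))) => x Hu Hv Gx.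
have Wuv := in_W_lin a Wu Wv.
have cv e l : in_W d Gamma e -> ball_mean e x r @[r --> 0^'+] --> l%:E -> bmean e x r @[r --> 0^'+] --> l.
  move=> We H; have : (bmean e x r)%:E @[r --> 0^'+] --> l%:E.
    by under eq_fun do rewrite -(ball_mean_W _ _ We).
  exact: fine_cvg.
under eq_fun do rewrite (ball_mean_W _ _ Wuv) bmean_lin//.
apply: cvg_EFin; first exact: nearW.
by apply: cvgD; [apply: cvgMr; exact: cv (Hu Gx)|exact: cv (Hv Gx)].
Qed.

Lemma in_W0_lin a u v : in_W0 d Gamma u -> in_W0 d Gamma v -> in_W0 d Gamma (a *: u + v).
Proof.
move=> [Wu tu] [Wv tv]; split; first exact: in_W_lin.
have := has_trace_lin a Wu Wv tu tv; congr has_trace.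
by apply/funext => z; rewrite /= /cst; have : a * 0 + 0 = 0 :> R by rewrite mulr0 addr0.
Qed.

Lemma in_W0_0 : in_W0 d Gamma 0.
Proof.
split; first exact: in_W0_fun.1.
apply/aeW => x Gx; rewrite (_ : (fun r => _) = cst 0%E); first exact: cvg_cst.
apply/funext => r; rewrite /ball_mean (_ : (\int[_]_(z in _) _)%E = 0%E) ?mule0//.
by apply: integral0_eq.
Qed.

End energy_forms.

(** * Completeness of the space of traceless functions *)

Section null_sets.
Context {d : measure_display} {T : measurableType d} {R : realType}.
Variable mu : {measure set T -> \bar R}.

Lemma null_setU2 (A B : set T) : measurable A -> measurable B -> mu A = 0%E -> mu B = 0%E ->
  measurable (A `|` B) /\ mu (A `|` B) = 0%E.
Proof.
move=> mA mB A0 B0; split; first exact: measurableU.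
by apply/negligibleP; [exact: measurableU|apply: negligibleU; exact/negligibleP].
Qed.

Lemma ge0_le_integral_null (D N : set T) (f g : T -> R) : measurable D -> measurable N -> mu N = 0%E ->
  measurable_fun D f -> measurable_fun D g -> (forall x, 0 <= f x) -> (forall x, 0 <= g x) ->
  (forall x, D x -> ~ N x -> f x <= g x) ->
  (\int[mu]_(x in D) (f x)%:E <= \int[mu]_(x in D) (g x)%:E)%E.
Proof.
move=> mD mN N0 mf mg f0 g0 fg.
have mf' : measurable_fun D (fun x => (f x)%:E) by exact/measurable_EFinP.
have pos (h : T -> R) : (forall x, 0 <= h x) -> forall x, D x -> (0 <= (h x)%:E)%E by move=> h0 x _; rewrite lee_fin.
rewrite (@ge0_negligible_integral _ _ _ mu D N _ mN mD mf' (pos _ f0) N0).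
have mg' : measurable_fun D (fun x => (g x)%:E) by exact/measurable_EFinP.
rewrite [leRHS](@ge0_negligible_integral _ _ _ mu D N _ mN mD mg' (pos _ g0) N0).
apply: ge0_le_integral.
- exact: measurableD.
- by move=> x _; rewrite lee_fin.
- by apply/measurable_EFinP; apply: measurable_funS mf => // x [].
- by apply/measurable_EFinP; apply: measurable_funS mg => // x [].
- by move=> x [Dx nN]; rewrite lee_fin; exact: fg.
Qed.

Lemma measurable_fun_dist (D : set T) (f g : T -> R) : measurable_fun D f -> measurable_fun D g ->
  measurable_fun D (fun x => `|f x - g x|).
Proof. by move=> mf mg; apply: measurableT_comp => //; exact: measurable_funB. Qed.

End null_sets.

(** * Fast Cauchy sequences in L^1 *)

Section fast_limits.
Context {d : measure_display} {T : measurableType d} {R : realType}.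
Variable mu : {measure set T -> \bar R}.

Lemma ae_lt_pinfty (D : set T) (f : T -> \bar R) : measurable D -> measurable_fun D f ->
  (forall x, (0 <= f x)%E) -> (\int[mu]_(x in D) f x < +oo)%E ->
  mu (D `&` [set x | f x = +oo%E]) = 0%E.
Proof.
move=> mD mf f0 fin.
have iF : mu.-integrable D f.
  apply/integrableP; split => //; apply: le_lt_trans fin.
  by apply: ge0_le_integral => //; [exact: measurableT_comp|move=> x _; rewrite gee0_abs].
have mN : measurable (D `&` [set x | f x = +oo%E]).
  exact: (mf mD [set +oo%E] (emeasurable_set1 _)).
apply/negligibleP => //.
apply: negligibleS (integrable_ae mD iF) => x [Dx foo] /= H.
by have := H Dx; rewrite foo.
Qed.

Variables (B : nat -> set T) (f : nat -> T -> R) (c : nat -> R).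
Hypotheses (mB : forall m, measurable (B m)) (BT : \bigcup_m B m = setT).
Hypotheses (mf : forall k, measurable_fun setT (f k)).
Hypothesis fast : forall m k, (\int[mu]_(x in B m) (`|f k.+1 x - f k x|)%:E <= (c m / 4 ^+ k)%:E)%E.

Let S x : \bar R := (\sum_(0 <= k <oo) (`|f k.+1 x - f k x|)%:E)%E.

Let mdf k : measurable_fun setT (fun x => `|f k.+1 x - f k x|).
Proof. by apply: measurableT_comp => //; apply: measurable_funB. Qed.

Let S0 x : (0 <= S x)%E.
Proof. by apply: nneseries_ge0 => k _ _; rewrite lee_fin. Qed.

Let mS : measurable_fun setT S.
Proof.
apply: ge0_emeasurable_sum => k *; first by rewrite lee_fin.
by apply/measurable_EFinP; exact: mdf.
Qed.

Let c_ge0 m : 0 <= c m.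
Proof.
have := fast m 0; rewrite expr0 divr1 => /(le_trans _) H.
by rewrite -lee_fin; apply: H; apply: integral_ge0 => x _; rewrite lee_fin.
Qed.

Lemma geometric_le (a : R) J : 0 <= a -> \sum_(j < J) a / 4 ^+ j <= 2 * a.
Proof.
move=> a0; have -> : \sum_(j < J) a / 4 ^+ j = a * (4 / 3) * (1 - 1 / 4 ^+ J).
  elim: J => [|J IH]; first by rewrite big_ord0 expr0 divr1 subrr mulr0.
  rewrite big_ord_recr/= IH exprS; have : (4 : R) ^+ J != 0 by rewrite expf_neq0.
  by move: (4 ^+ J) => p pz; field.
have : 0 <= a * (1 / 4 ^+ J) by rewrite mulr_ge0// divr_ge0// exprn_ge0.
by move: (1 / 4 ^+ J) => q; lra.
Qed.

Let N : set T := [set x | S x = +oo%E].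

Let mN : measurable N.
Proof. by rewrite -[N]setTI; exact: (mS measurableT (emeasurable_set1 _)). Qed.

Let N0 : mu N = 0%E.
Proof.
apply/negligibleP => //.
have -> : N = \bigcup_m (B m `&` N) by rewrite -setI_bigcupl BT setTI.
apply: negligible_bigcup => m; apply/negligibleP; first exact: measurableI.
apply: ae_lt_pinfty => //; first exact: measurable_funTS mS.
apply: (@le_lt_trans _ _ (2 * c m)%:E); last exact: ltry.
apply: (integral_series_le (c := fun k => c m / 4 ^+ k)) => //.
- by move=> k; apply/measurable_EFinP; exact: measurable_funTS (mdf k).
- by move=> J; exact: geometric_le.
Qed.

Let cvgf x : ~ N x -> cvgn (fun k => f k x).
Proof.
move=> nN; have Sfin : (S x < +oo)%E by rewrite ltey; apply/eqP.
have cs : cvgn (series (fun k => f k.+1 x - f k x)).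
  apply: normed_cvg; apply: nondecreasing_is_cvgn.
    by apply: nondecreasing_series => *; exact: normr_ge0.
  exists (fine (S x)) => _ [k _ <-].
  rewrite -lee_fin fineK ?ge0_fin_numE// /series/= -sumEFin.
  by apply: nneseries_lim_ge => j *; rewrite lee_fin.
have -> : (fun k => f k x) = (fun k => f 0%N x + series (fun k => f k.+1 x - f k x) k).
  apply/funext => k; rewrite /series/= telescope_sumr//; lra.
by apply: is_cvgD => //; exact: is_cvg_cst.
Qed.

(** The series of absolute increments has a finite integral on each [B m], so off a null set the
    sequence converges. Fatou's lemma gives the rate; the factor 2 bounds the sum 4/3 of the
    geometric series. *)
Lemma fast_limit : exists g : T -> R, exists N' : set T, [/\ measurable_fun setT g, measurable N', mu N' = 0%E,
  forall x, ~ N' x -> f k x @[k --> \oo] --> g x &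
  forall m k, (\int[mu]_(x in B m) (`|f k x - g x|)%:E <= (2 * c m / 4 ^+ k)%:E)%E].
Proof.
pose g x := if `[< N x >] then 0 else limn (fun k => f k x).
have cg x : ~ N x -> f k x @[k --> \oo] --> g x.
  by move=> nN; rewrite /g asboolF//; exact: cvgf.
have mg : measurable_fun setT g.
  apply: (@measurable_fun_cvg _ _ _ _ (fun k x => f k x * \1_(~` N) x)).
    move=> k; apply: measurable_funM => //; apply: measurable_indic; exact: measurableC.
  move=> x _; rewrite indicE; have [Nx|nN] := pselect (N x).
    rewrite memNset /=; last by move=> /(_ Nx).
    by under eq_fun do rewrite mulr0; rewrite /g asboolT//; exact: cvg_cst.
  by rewrite mem_set//; under eq_fun do rewrite mulr1; exact: cg.
exists g, N; split; [exact: mg|exact: mN|exact: N0|exact: cg|] => m k.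
have part j : (\int[mu]_(x in B m) (`|f k x - f (k + j)%N x|)%:E <= (\sum_(i < j) (c m / 4 ^+ k) / 4 ^+ i)%:E)%E.
  elim: j => [|j IH].
    rewrite big_ord0 integral0_eq// => x _; by rewrite addn0 subrr normr0.
  rewrite big_ord_recr/= EFinD.
  have mk i : measurable_fun (B m) (fun x => (`|f k x - f i x|)%:E).
    by apply/measurable_EFinP; apply: measurable_funTS; apply: measurableT_comp => //; apply: measurable_funB.
  apply: (@le_trans _ _ (\int[mu]_(x in B m) ((`|f k x - f (k + j)%N x|)%:E + (`|f (k + j).+1 x - f (k + j)%N x|)%:E))%E).
    apply: ge0_le_integral => //.
      by apply: emeasurable_funD => //; apply/measurable_EFinP; exact: measurable_funTS (mdf _).
    move=> x _; rewrite -EFinD lee_fin addnS.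
    have -> : f k x - f (k + j).+1 x = (f k x - f (k + j)%N x) - (f (k + j).+1 x - f (k + j)%N x) by lra.
    exact: ler_normB.
  rewrite ge0_integralD//; last by apply/measurable_EFinP; exact: measurable_funTS (mdf _).
  apply: leeD => //; apply: le_trans (fast _ _) _.
  by rewrite lee_fin exprD invfM mulrA.
apply: (@fatou_le _ _ _ mu (B m) N (fun j x => `|f k x - f (k + j)%N x|) (fun x => `|f k x - g x|) _ (mB m) mN N0).
- by move=> j; apply: measurable_funTS; apply: measurableT_comp => //; apply: measurable_funB.
- by apply: measurable_funTS; apply: measurableT_comp => //; apply: measurable_funB.
- by [].
- by [].
- move=> j; apply: le_trans (part j) _; rewrite lee_fin.
  by apply: le_trans (geometric_le _ _) _; [rewrite divr_ge0// exprn_ge0|rewrite mulrA].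
- move=> x _ nN; apply: cvg_norm; apply: cvgB; first exact: cvg_cst.
  have := cg x nN; rewrite -(cvg_shiftn k (fun j => f j x)) /=; under eq_fun do rewrite addnC; exact.
Qed.

End fast_limits.

Section test_limits.
Context {d : measure_display} {T : measurableType d} {R : realType}.
Variable mu : {measure set T -> \bar R}.
Variables (B D : set T) (f : nat -> T -> R) (g psi : T -> R) (c C : R).
Hypotheses (mB : measurable B) (mD : measurable D).
Hypotheses (fi : forall k, mu.-integrable B (EFin \o f k)) (mg : measurable_fun setT g).
Hypothesis fg : forall k, (\int[mu]_(x in B) (`|f k x - g x|)%:E <= (c / 4 ^+ k)%:E)%E.

Lemma limit_integrable : mu.-integrable B (EFin \o g).
Proof.
have mf0 : measurable_fun B (f 0%N) by exact: integrableR_measurable (fi 0).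
have i0 : mu.-integrable B (EFin \o (fun x => f 0%N x - g x)).
  apply/integrableP; split; first by apply/measurable_EFinP; apply: measurable_funB => //; exact: measurable_funTS.
  exact: le_lt_trans (fg 0) (ltry _).
have := integrableRB mB (fi 0) i0; congr (mu.-integrable _ (EFin \o _)).
by apply/funext => x; rewrite opprB addrC subrK.
Qed.

Hypotheses (mpsi : measurable_fun setT psi) (psiC : forall x, `|psi x| <= C).
Hypothesis psi0 : forall x, ~ B x -> psi x = 0.

(** The test function is bounded and vanishes off [B], so that convergence in L^1 on [B] controls
    the integrals over all of [D]. *)
Lemma limit_test : \int[mu]_(x in D) (f k x * psi x) @[k --> \oo] --> \int[mu]_(x in D) (g x * psi x).
Proof.
pose E := D `&` B; have mE : measurable E by exact: measurableI.
have EB : E `<=` B by move=> x [].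
have red h : \int[mu]_(x in D) (h x * psi x) = \int[mu]_(x in E) (h x * psi x).
  rewrite /Rintegral (@integral_support _ _ _ mu D E)//; first by move=> x [].
  by move=> x Dx nE; rewrite psi0 ?mulr0// => Bx; apply: nE.
have prod h : mu.-integrable B (EFin \o h) -> mu.-integrable E (EFin \o (fun x => h x * psi x)).
  move=> ih; apply: (integrableR_mul mE (integrableS mB mE EB ih) (measurable_funTS mpsi)).
  by move=> x _; exact: psiC.
have ig := limit_integrable.
have C0 : 0 <= C by exact: le_trans (normr_ge0 (psi point)) (psiC point).
apply: cvg_zero; apply: norm_cvg0.
have cc : C * (c / 4 ^+ k) @[k --> \oo] --> C * (c * 0).
  apply: cvgMr; apply: cvgMr; under eq_fun do rewrite -exprVn; apply: cvg_expr.
  by rewrite ger0_norm ?invr_ge0// invf_lt1 ?ltr1n ?ltr0n.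
rewrite !mulr0 in cc; apply: (squeeze_cvgr _ (cvg_cst 0) cc); apply: nearW => k.
rewrite normr_ge0/=.
change (`|\int[mu]_(x in D) (f k x * psi x) - \int[mu]_(x in D) (g x * psi x)| <= C * (c / 4 ^+ k)).
rewrite (red (f k)) (red g) -(RintegralB mE (prod _ (fi k)) (prod _ ig)).
apply: le_trans (le_normr_Rintegral mE (integrableRB mE (prod _ (fi k)) (prod _ ig))) _.
have iB := integrableRB mB (fi k) ig.
have iE := integrableS mB mE EB (integrable_norm iB).
apply: (@le_trans _ _ (\int[mu]_(x in E) (C * `|f k x - g x|))).
  apply: le_Rintegral => //.
  - exact: integrable_norm (integrableRB mE (prod _ (fi k)) (prod _ ig)).
  - exact: integrableRZ.
  - by move=> x _; rewrite /= -mulrBl normrM mulrC ler_wpM2r.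
rewrite (RintegralZl C mE iE) ler_wpM2l//.
apply: le_trans (Rint_le_subset mB mE EB (integrable_norm iB) (fun _ _ => normr_ge0 _)) _.
rewrite -lee_fin; apply: le_trans (fg k).
by rewrite fineK//; exact: (integrable_fin_num mB (integrable_norm iB)).
Qed.

End test_limits.

Lemma summable_tail (R : realType) (p : nat -> R) (s : R) : (forall k, 0 <= p k) ->
  (forall J, \sum_(i < J) p i <= s) -> exists eps : nat -> R, eps k @[k --> \oo] --> 0 /\
  forall k j, \sum_(i < j) p (k + i)%N <= eps k.
Proof.
move=> p0 ps; pose S J := \sum_(i < J) p i.
have nd : nondecreasing_seq S.
  by apply/nondecreasing_seqP => J; rewrite /S big_ord_recr/= lerDl.
have cS : cvgn S by apply: nondecreasing_is_cvgn => //; exists s => _ [J _ <-]; exact: ps.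
exists (fun k => limn S - S k); split.
  by rewrite -(subrr (limn S)); apply: cvgB => //; exact: cvg_cst.
move=> k j; have := nondecreasing_cvgn_le nd cS (k + j)%N.
by rewrite {1}/S big_split_ord /= -/(S k) lerBrDl.
Qed.

Lemma haus_null_measurable (R : realType) (n : nat) (d : R) (N : set 'rV[R]_n) : haus_outer d N = 0%E ->
  measurable (N : set (haus_space R n d)).
Proof.
move=> N0; apply: le_caratheodory_measurable => X.
have -> : (@haus_outer R n d : {outer_measure set 'rV[R]_n -> \bar R}) (X `&` N) = 0%E.
  apply/eqP; rewrite eq_le outer_measure_ge0 andbT -N0.
  by apply: le_outer_measure; exact: subIsetr.
by rewrite add0e; apply: le_outer_measure; exact: subIsetl.
Qed.

(** * Limits of fast Cauchy sequences in W_0 *)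

Section completeness.
Context {R : realType} {n : nat} (d C0 : R) (Gamma : set 'rV[R]_n).
Hypothesis d_bounds : 0 < d < n%:R - 1.
Hypothesis Gamma_neq0 : Gamma !=set0.
Hypothesis Gamma_closed : closed Gamma.
Hypothesis C0_ge1 : 1 <= C0.
Hypothesis Gamma_AR : ahlfors_regular d C0 Gamma.
Local Notation L := (leb_space R n).
Local Notation mu := (leb R n).
Local Notation sigma := (haus n d).
Local Notation Omega := (~` Gamma : set L).
Local Notation grad := (wgrad (~` Gamma)).
Local Notation w := (weight d Gamma).
Local Notation V := ('rV[R]_n -> R).
Local Notation wip := (wip d Gamma).
Implicit Types (v e : V) (a c : R) (z x y : 'rV[R]_n) (i : 'I_n) (k j m : nat).

Let mO : measurable Omega. Proof. exact: measurable_Omega. Qed.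
Let oO : open (~` Gamma). Proof. exact: open_Omega. Qed.
Let Gnull := Gamma_null d_bounds Gamma_neq0 Gamma_AR.
Let W0lin a u v := @in_W0_lin R n d C0 Gamma d_bounds Gamma_neq0 Gamma_closed Gamma_AR a u v.
Let Wlin := @in_W_lin R n d Gamma Gamma_neq0 Gamma_closed.

Variables (u : nat -> V) (M : R).
Hypothesis M0 : 0 < M.
Hypothesis W0u : forall k, in_W0 d Gamma (u k).
Hypothesis fast : forall k, wip (u k.+1 - u k) (u k.+1 - u k) <= (M / 4 ^+ k) ^+ 2.

Let t k : R := M / 4 ^+ k.
Let du k : V := u k.+1 - u k.

Let t0 k : 0 < t k.
Proof. by rewrite divr_gt0// exprn_gt0. Qed.

Let Wu k : in_W d Gamma (u k).
Proof. by case: (W0u k). Qed.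

Let W0B v e : in_W0 d Gamma v -> in_W0 d Gamma e -> in_W0 d Gamma (v - e).
Proof. exact: (@PB _ _ (in_W0 d Gamma) W0lin). Qed.

Let WB v e : in_W d Gamma v -> in_W d Gamma e -> in_W d Gamma (v - e).
Proof. exact: (@PB _ _ (in_W d Gamma) Wlin). Qed.

Let W0d k : in_W0 d Gamma (du k).
Proof. exact: W0B. Qed.

Let Wd k : in_W d Gamma (du k).
Proof. exact: WB. Qed.

Let Ed k : (W_energy d Gamma (du k) <= (t k ^+ 2)%:E)%E.
Proof. by rewrite (wip_energy Gamma_neq0 Gamma_closed (Wd k)) lee_fin; exact: fast. Qed.

Let y0 := projT1 (cid Gamma_neq0).
Let Gy0 : Gamma y0. Proof. exact: projT2 (cid Gamma_neq0). Qed.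

Let B m : set L := cube y0 m.+1%:R.
Let mB m : measurable (B m). Proof. exact: measurable_leb_cube. Qed.

Let BT : \bigcup_m B m = setT.
Proof.
apply/seteqP; split => // z _; exists (Num.bound (enorm (z - y0))) => //.
apply: eball_sub_cube => /=; apply: lt_le_trans (archi_boundP (enorm_ge0 _)) _.
by rewrite ler_nat.
Qed.

Let iu k m : mu.-integrable (B m) (EFin \o u k).
Proof. exact: (integrable_W d_bounds Gamma_neq0 Gamma_closed Gamma_AR (Wu k)). Qed.

(** [W0_integral_bound], applied to the increments, turns geometric decay of the norms into
    geometric decay in L^1 on every cube about a point of Gamma. *)
Lemma values_limit : exists l : V, exists c : nat -> R, measurable_fun (setT : set L) l /\
  forall m k, (\int[mu]_(x in B m) (`|u k x - l x|)%:E <= (2 * c m / 4 ^+ k)%:E)%E.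
Proof.
have [C CP] := choice (fun m => let: ex_intro2 C C_ge0 CP :=
  W0_integral_bound d_bounds Gamma_neq0 Gamma_closed C0_ge1 Gamma_AR y0 m.+1%:R in
  ex_intro (fun C => forall e s, in_W0 d Gamma e -> 0 < s -> (W_energy d Gamma e <= (s ^+ 2)%:E)%E ->
    \int[mu]_(z in cube y0 m.+1%:R) `|e z| <= C * s) C CP).
have [||l [N [ml mN N0 _ H]]] := @fast_limit _ _ _ mu B u (fun m => C m * M) mB BT.
- by move=> k; exact: (measurable_W d_bounds Gamma_neq0 Gamma_closed Gamma_AR (Wu k)).
- move=> m k; have H := CP m _ _ (W0d k) (t0 k) (Ed k).
  have id : mu.-integrable (B m) (EFin \o du k).
    exact: (integrable_W d_bounds Gamma_neq0 Gamma_closed Gamma_AR (Wd k)).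
  rewrite -mulrA -[leLHS](fineK (integrable_fin_num (mB m) (integrable_norm id))) lee_fin.
  exact: H.
by exists l, (fun m => C m * M).
Qed.

Let mgrad v i : in_W d Gamma v -> measurable_fun (setT : set L) (fun z => grad v z 0 i).
Proof. by move=> Wv; exact: (measurable_grad d_bounds Gamma_neq0 Gamma_closed Gamma_AR Wv). Qed.

Let gradB v e : in_W d Gamma v -> in_W d Gamma e ->
  exists N : set L, [/\ measurable N, mu N = 0%E &
    forall z, Omega z -> ~ N z -> grad (v - e) z = grad v z - grad e z].
Proof.
move=> Wv We; have [N [mN N0 H]] := grad_lin Gamma_closed (-1) We Wv.
exists N; split => // z Oz nN; have := H z Oz nN.
by rewrite scaleN1r addrC => ->; rewrite scaleN1r addrC.
Qed.

(** The cubes are centred on Gamma because [gnorm_cube_le] controls L^1 norms of gradients there.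
    The almost everywhere limit is kept along with the L^1 rate: the rate serves the distributional
    identity, the pointwise limit serves the energy. *)
Lemma gradients_limit i : exists (g : V) (N : set L) (c : nat -> R), [/\ measurable_fun (setT : set L) g,
  measurable N, mu N = 0%E, forall x, ~ N x -> grad (u k) x 0 i @[k --> \oo] --> g x &
  forall m k, (\int[mu]_(x in B m) (`|grad (u k) x 0 i - g x|)%:E <= (2 * c m / 4 ^+ k)%:E)%E].
Proof.
pose K m := 1 + (n%:R * m.+1%:R) `^ (n%:R - 1 - d) * (2 * m.+1%:R) ^+ n : R.
have [||g [N [mg mN N0 cv H]]] := @fast_limit _ _ _ mu B (fun k z => grad (u k) z 0 i) (fun m => K m * M) mB BT.
- by move=> k; exact: mgrad.
- move=> m k; have [N [mN N0 EN]] := gradB (Wu k.+1) (Wu k).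
  have mG : measurable (Gamma : set L) by exact: leb_null_measurable.
  have [mNG NG0] := null_setU2 mN mG N0 (Gnull : mu Gamma = 0%E).
  rewrite -mulrA; apply: le_trans (gnorm_cube_le d_bounds Gamma_neq0 Gamma_closed Gamma_AR (Wd k) Gy0 _ (t0 k) (Ed k)) => //.
  have mdf := measurable_funTS (D := B m) (measurable_fun_dist (mgrad i (Wu k.+1)) (mgrad i (Wu k))).
  have mgn := measurable_funTS (D := B m) (measurable_gnorm d_bounds Gamma_neq0 Gamma_closed Gamma_AR (Wd k)).
  apply: (ge0_le_integral_null (mB m) mNG NG0 mdf mgn).
  + by move=> z; exact: normr_ge0.
  + exact: gnorm_ge0.
  + move=> z _ nNG; rewrite /gnorm /du EN.
    * by have := coord_le_enorm (grad (u k.+1) z - grad (u k) z) i; rewrite !mxE.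
    * by move=> Gz; apply: nNG; right.
    * by move=> Nz; apply: nNG; left.
by exists g, N, (fun m => K m * M).
Qed.

Lemma compact_sub_cube (K : set 'rV[R]_n) : compact K -> exists m, K `<=` B m.
Proof.
move=> cK; have : compact ((fun z => enorm (z - y0)) @` K).
  by apply: continuous_compact => //; apply: continuous_subspaceT; exact: continuous_enorm_sub.
move=> /compact_bounded[C [_ HC]]; exists (Num.bound (`|C| + 1)) => z Kz.
apply: eball_sub_cube => /=; have := HC (`|C| + 1); rewrite (le_lt_trans (ler_norm C)) ?ltrDl//.
move=> /(_ isT (enorm (z - y0))) /(_ (ex_intro2 _ _ z Kz erefl)); rewrite /= (ger0_norm (enorm_ge0 _)) => h.
apply: (le_lt_trans h); apply: lt_le_trans (archi_boundP _) _; first by rewrite addr_ge0.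
by rewrite ler_nat.
Qed.

Lemma loc_integrable_cubes (f : V) : measurable_fun (setT : set L) f ->
  (forall m, mu.-integrable (B m) (EFin \o f)) -> loc_integrable (~` Gamma) f.
Proof.
move=> mf fi; split; first exact: measurable_funTS mf.
move=> K cK _; have [m KB] := compact_sub_cube cK.
by have /integrableP[] := integrableS (mB m) (measurable_leb_compact cK) KB (fi m).
Qed.

Lemma weak_limit : exists l : V, exists G : 'rV[R]_n -> 'rV[R]_n, [/\ measurable_fun (setT : set L) l,
  (exists c : nat -> R, forall m k, (\int[mu]_(x in B m) (`|u k x - l x|)%:E <= (2 * c m / 4 ^+ k)%:E)%E),
  loc_integrable (~` Gamma) l, is_wgrad (~` Gamma) l G &
  exists N : set L, [/\ measurable N, mu N = 0%E &
    forall x, ~ N x -> forall i, grad (u k) x 0 i @[k --> \oo] --> G x 0 i]].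
Proof.
have [l [c [ml Hl]]] := values_limit.
have [g Hg] := choice gradients_limit; have [N HN] := choice Hg; have [c' Hc] := choice HN.
pose G x : 'rV[R]_n := \row_i g i x.
have GE i : (fun z => G z 0 i) = g i by apply/funext => z; rewrite mxE.
have il m := limit_integrable (mB m) (fun k => iu k m) ml (Hl m).
have igk i k m : mu.-integrable (B m) (EFin \o (fun z => grad (u k) z 0 i)).
  exact: (integrable_grad d_bounds Gamma_neq0 Gamma_closed Gamma_AR (Wu k)).
have mg i : measurable_fun (setT : set L) (g i) by case: (Hc i).
have Hgi i : forall m k, (\int[mu]_(x in B m) (`|grad (u k) x 0 i - g i x|)%:E <= (2 * c' i m / 4 ^+ k)%:E)%E.
  by case: (Hc i).
have ig i m := limit_integrable (mB m) (fun k => igk i k m) (mg i) (Hgi i m).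
have ll : loc_integrable (~` Gamma) l by exact: loc_integrable_cubes.
have lg i : loc_integrable (~` Gamma) (g i) by exact: loc_integrable_cubes.
exists l, G; split; [exact: ml|by exists c|exact: ll| |].
  move=> i; rewrite GE; split; [exact: lg|move=> phi tp].
  have tq := test_function_partial i tp.
  have [_ [K [cK KO p0]]] := tp; have [m KB] := compact_sub_cube cK.
  have q0 x : ~ B m x -> partial i phi x = 0.
    move=> nB; apply: (@partial_eq0_near _ _ i phi (~` K)) => //.
      by apply: closed_openC; exact: compact_closed.
    by move=> Kx; apply: nB; exact: KB.
  have p0' x : ~ B m x -> phi x = 0 by move=> nB; apply: p0 => Kx; apply: nB; exact: KB.
  have mt psi : test_function (~` Gamma) psi -> measurable_fun (setT : set L) psi.
    by move=> /test_function_continuous; exact: measurable_leb_continuous.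
  have [Cp HCp] := test_function_bounded tp; have [Cq HCq] := test_function_bounded tq.
  have cv1 := limit_test (mB m) mO (fun k => iu k m) ml (Hl m) (mt _ tq) HCq q0.
  have cv2 := limit_test (mB m) mO (fun k => igk i k m) (mg i) (Hgi i m) (mt _ tp) HCp p0'.
  have E k : \int[mu]_(x in Omega) (u k x * partial i phi x) = - \int[mu]_(x in Omega) (grad (u k) x 0 i * phi x).
    have [_ wk _] := Wu k; have [_ Hk] := wk i; have := Hk _ tp => /(congr1 fine).
    by rewrite fineN.
  have cv3 : \int[mu]_(x in Omega) (u k x * partial i phi x) @[k --> \oo] --> - \int[mu]_(x in Omega) (g i x * phi x).
    by under eq_fun do rewrite E; exact: cvgN.
  have E13 : \int[mu]_(x in Omega) (l x * partial i phi x) = - \int[mu]_(x in Omega) (g i x * phi x).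
    by rewrite -(cvg_lim (@Rhausdorff R) cv1) -(cvg_lim (@Rhausdorff R) cv3).
  have := congr1 EFin E13; rewrite /Rintegral.
  rewrite EFinN fineK; last exact: (integrable_fin_num mO (integrable_test oO ll tq)).
  rewrite fineK; last exact: (integrable_fin_num mO (integrable_test oO (lg i) tp)).
  have -> : (fun z => (G z 0 i * phi z)%:E) = (fun z => (g i z * phi z)%:E) by apply/funext => z; rewrite mxE.
  exact.
have : {ae mu, forall x, forall i, grad (u k) x 0 i @[k --> \oo] --> G x 0 i}.
  apply: filter_forall => i; have [_ mN N0 cv _] := Hc i.
  exists (N i); split => // x /= H; apply: contrapT => nN; apply: H; rewrite mxE; exact: cv.
move=> [N' [mN' N0' sub]]; exists N'; split => // x nN'.
by apply: contrapT => H; apply: nN'; apply: sub.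
Qed.

Let W00 : in_W d Gamma 0. Proof. exact: (in_W0_fun d Gamma_neq0 Gamma_closed).1. Qed.

Let Wip := wip_semi_inner d Gamma_neq0 Gamma_closed.

Lemma inorm_tail k j : inorm wip (u (k + j)%N - u k) <= 2 * t k.
Proof.
apply: le_trans (_ : \sum_(i < j) t k / 4 ^+ i <= _); last by apply: geometric_le; exact: ltW.
elim: j => [|j IH].
  by rewrite big_ord0 addn0 subrr /inorm (ip0 W00 Wip W00) sqrtr0.
rewrite big_ord_recr/=.
have -> : u (k + j.+1)%N - u k = du (k + j)%N + (u (k + j)%N - u k) by rewrite addnS /du addrA subrK.
apply: le_trans (inormD W00 Wlin Wip (Wd _) (WB (Wu _) (Wu _))) _.
rewrite addrC; apply: lerD => //.
have H2 : inorm wip (du (k + j)%N) ^+ 2 <= (t k / 4 ^+ j) ^+ 2.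
  by rewrite (inorm_sqr Wip (Wd _)); apply: le_trans (fast _) _; rewrite /t exprD invfM mulrA.
move: H2; rewrite ler_pXn2r// nnegrE ?inorm_ge0// divr_ge0 ?exprn_ge0//; exact: ltW.
Qed.

Lemma energy_tail k j : (W_energy d Gamma (u (k + j)%N - u k)%R <= ((2 * t k) ^+ 2)%:E)%E.
Proof.
have Wkj := WB (Wu (k + j)%N) (Wu k).
rewrite (wip_energy Gamma_neq0 Gamma_closed Wkj) lee_fin -(inorm_sqr Wip Wkj).
have tk0 : 0 <= 2 * t k by rewrite mulr_ge0// ltW.
exact: (lerXn2r 2 (inorm_ge0 _ _ : _ \is Num.nneg) (tk0 : _ \is Num.nneg) (inorm_tail k j)).
Qed.

(** Lower semicontinuity: the energies of [u (k + j) - u k] are bounded in j, and Fatou's lemma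
    applies to the gradients, which converge almost everywhere. *)
Lemma limit_energy (l : V) (G : 'rV[R]_n -> 'rV[R]_n) (N : set L) k : loc_integrable (~` Gamma) l ->
  is_wgrad (~` Gamma) l G -> measurable N -> mu N = 0%E ->
  (forall x, ~ N x -> forall i, grad (u k) x 0 i @[k --> \oo] --> G x 0 i) ->
  in_W d Gamma (u k - l) /\ (W_energy d Gamma (u k - l)%R <= ((2 * t k) ^+ 2)%:E)%E.
Proof.
move=> ll wl mN N0 cv; have [lk wk _] := Wu k.
have wkl : is_wgrad (~` Gamma) (u k - l) (fun z => grad (u k) z - G z).
  have := is_wgrad_lin (-1) oO ll lk wl wk.
  have -> : (fun z => -1 * l z + u k z) = u k - l by apply/funext => z; rewrite mulN1r addrC.
  by under eq_fun do rewrite scaleN1r addrC.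
have lkl : loc_integrable (~` Gamma) (u k - l).
  have := loc_integrable_lin (-1) oO ll lk.
  by have -> : (fun z => -1 * l z + u k z) = u k - l by apply/funext => z; rewrite mulN1r addrC.
have mkl : measurable_fun Omega (fun z => enorm (grad (u k) z - G z) ^+ 2 * w z).
  by apply: (@measurable_field_sqr R n d Gamma Gamma_neq0 (fun z => grad (u k) z - G z)) => i; exact: (wgrad_measurable i wkl).
have mkj j : measurable_fun Omega (fun z => enorm (grad (u (k + j)%N) z - grad (u k) z) ^+ 2 * w z).
  apply: (@measurable_field_sqr R n d Gamma Gamma_neq0 (fun z => grad (u (k + j)%N) z - grad (u k) z)) => i; under eq_fun do rewrite !mxE.
  exact: (measurable_funB (measurable_funTS (D := Omega) (mgrad i (Wu (k + j)%N))) (measurable_funTS (D := Omega) (mgrad i (Wu k)))).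
have pos (H : 'rV[R]_n -> 'rV[R]_n) z : 0 <= enorm (H z) ^+ 2 * w z.
  by rewrite mulr_ge0 ?sqr_ge0 ?weight_ge0.
have le1 : (\int[mu]_(z in Omega) (enorm (grad (u k) z - G z) ^+ 2 * w z)%:E <= ((2 * t k) ^+ 2)%:E)%E.
  apply: (@fatou_le _ _ _ mu Omega N (fun j z => enorm (grad (u (k + j)%N) z - grad (u k) z) ^+ 2 * w z)
    (fun z => enorm (grad (u k) z - G z) ^+ 2 * w z) _ mO mN N0 mkj mkl).
  - exact: (fun j => pos (fun z => grad (u (k + j)%N) z - grad (u k) z)).
  - exact: (pos (fun z => grad (u k) z - G z)).
  - move=> j; apply: le_trans (energy_tail k j).
    have Wkj := WB (Wu (k + j)%N) (Wu k); have [_ wkj _] := Wkj.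
    have [N2 [mN2 N20 EN2]] := gradB (Wu (k + j)%N) (Wu k).
    apply: (ge0_le_integral_null mO mN2 N20 (mkj j)).
    + by apply: (@measurable_field_sqr R n d Gamma Gamma_neq0 (grad (u (k + j)%N - u k))) => i; exact: (wgrad_measurable i wkj).
    + exact: (pos (fun z => grad (u (k + j)%N) z - grad (u k) z)).
    + exact: (pos (grad (u (k + j)%N - u k))).
    + by move=> z Oz nN; rewrite EN2.
  - move=> z Oz nN; apply: cvgM; last exact: cvg_cst.
    rewrite enorm_sub enorm_sqr; under eq_fun do rewrite enorm_sqr.
    rewrite /dotp; apply: cvg_big => [|i _]; first exact: add_continuous.
    have H : (grad (u (k + j)%N) z - grad (u k) z) 0 i @[j --> \oo] --> (G z - grad (u k) z) 0 i.
      rewrite !mxE; under eq_fun do rewrite !mxE.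
      apply: cvgB; last exact: cvg_cst.
      have := cv z nN i; rewrite -(cvg_shiftn k (fun j => grad (u j) z 0 i)) /=.
      by under eq_fun do rewrite addnC.
    exact: cvgM.
have [W1 E1] := in_W_of_wgrad Gamma_neq0 Gamma_closed lkl wkl (le_lt_trans le1 (ltry _)).
by split => //; rewrite E1.
Qed.

Let pk k x := potential (gnorm Gamma (du k)) 1 x.

(** The integral of the k-th potential over a bounded part of Gamma is at most a multiple of M /
    4^k, so the sum over k has a finite integral. *)
Lemma potentials_finite m :
  sigma ((Gamma `&` eball y0 m.+1%:R) `&` [set x | (\sum_(0 <= k <oo) pk k x = +oo)%E]) = 0%E.
Proof.
set D := (Gamma `&` _ : set (haus_space R n d)).
have mD : measurable D by exact: measurable_Gamma_eball.
have DG : D `<=` Gamma by move=> x [].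
have m0 : 0 < m.+1%:R :> R by rewrite ltr0n.
have DV : (sigma D <= (C0 * m.+1%:R `^ d)%:E)%E by have /andP[] := Gamma_AR Gy0 m0.
have mg k := measurable_gnorm d_bounds Gamma_neq0 Gamma_closed Gamma_AR (Wd k).
have ig k := integrable_gnorm_cube d_bounds Gamma_neq0 Gamma_closed Gamma_AR (Wd k).
have mp k : measurable_fun D (pk k).
  exact: (measurable_potential mD (@gnorm_ge0 R n Gamma (du k)) (mg k) (ig k) ltr01).
have p0 k x : (0 <= pk k x)%E by exact: potential_ge0.
set K := 2 * ((@Knear R n d C0) + (@Kpot R n d (C0 * m.+1%:R `^ d)) * 1).
have pI k : (\int[sigma]_(x in D) pk k x <= (K * t k)%:E)%E.
  exact: (potential_integral_le d_bounds C0_ge1 Gamma_closed Gamma_AR Gamma_neq0 (Gnull : leb_outer Gamma = 0%E) mD DG DV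
    (@gnorm_ge0 R n Gamma (du k)) (mg k) (ig k) (t0 k) (Ed k) ltr01).
have K0 : 0 <= K.
  have : (0%:E <= (K * t 0)%:E)%E by apply: le_trans (pI 0); apply: integral_ge0 => x _; exact: p0.
  by rewrite lee_fin pmulr_lge0.
apply: (ae_lt_pinfty mD).
- by apply: ge0_emeasurable_sum => k *; [exact: p0|exact: mp].
- by move=> x; apply: nneseries_ge0 => k _ _; exact: p0.
- apply: le_lt_trans (ltry (2 * (K * M))).
  apply: (integral_series_le (c := fun k => K * t k) mD mp p0 pI) => J.
  have := geometric_le J (mulr_ge0 K0 (ltW M0)).
  by under eq_bigr do rewrite -mulrA.
Qed.

Lemma bmean_cvg (l : V) (c : nat -> R) x r : measurable_fun (setT : set L) l ->
  (forall m k, (\int[mu]_(x in B m) (`|u k x - l x|)%:E <= (2 * c m / 4 ^+ k)%:E)%E) ->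
  bmean (u k) x r @[k --> \oo] --> bmean l x r.
Proof.
move=> ml Hl; set D := (eball x r : set L).
have mD : measurable D by apply: measurable_leb_open; exact: open_eball.
have [m Dm] : exists m, D `<=` B m.
  exists (Num.bound (`|r| + enorm (x - y0))) => z /= Dz; apply: eball_sub_cube => /=.
  suff : enorm (z - y0) < `|r| + enorm (x - y0) + 1.
    rewrite /eball /= => H; apply: lt_le_trans H _.
    by rewrite -natr1 lerD2r; apply: ltW; apply: archi_boundP; rewrite addr_ge0 ?enorm_ge0.
  have -> : z - y0 = (z - x) + (x - y0) by rewrite addrA subrK.
  apply: le_lt_trans (enormD _ _) _; have := ler_norm r; have : enorm (z - x) < r by exact: Dz.
  by move=> ? ?; lra.
have mpsi : measurable_fun (setT : set L) (\1_D : V) by exact: measurable_indic.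
have psiC z : `|(\1_D z : R)| <= 1 by rewrite indicE; case: (_ \in _); rewrite ?normr1 ?normr0.
have psi0 z : ~ B m z -> (\1_D z : R) = 0 by move=> nB; rewrite indicE memNset// => /Dm.
have cv := limit_test (mB m) mD (fun k => iu k m) ml (Hl m) mpsi psiC psi0.
have E v : \int[mu]_(z in D) (v z * \1_D z) = \int[mu]_(z in D) v z.
  by apply: eq_Rintegral => z zD; rewrite indicE zD mulr1.
rewrite /bmean; apply: cvgM; last exact: cvg_cst.
by move: cv; rewrite E; under eq_fun do rewrite E.
Qed.

(** The tails of the summable potentials at [x] bound the difference between the means of [l] and of
    [u k] uniformly in radii r <= 1. This uniformity permits exchanging the limits r -> 0 and k ->
    oo. *)
Lemma limit_trace_at (l : V) (c : nat -> R) x : measurable_fun (setT : set L) l -> in_W d Gamma l ->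
  (forall m k, (\int[mu]_(x in B m) (`|u k x - l x|)%:E <= (2 * c m / 4 ^+ k)%:E)%E) ->
  (forall k, ball_mean (u k) x r @[r --> 0^'+] --> 0%E) ->
  (forall k, ball_mean (du k) x r @[r --> 0^'+] --> 0%E) ->
  (\sum_(0 <= k <oo) pk k x < +oo)%E ->
  ball_mean l x r @[r --> 0^'+] --> 0%E.
Proof.
move=> ml Wl Hl tu td fin.
have p0 k : (0 <= pk k x)%E by exact: potential_ge0.
have S0 : (0 <= \sum_(0 <= k <oo) pk k x)%E by apply: nneseries_ge0 => k _ _; exact: p0.
have Sf : (\sum_(0 <= k <oo) pk k x)%E \is a fin_num by rewrite ge0_fin_numE.
set s := fine (\sum_(0 <= k <oo) pk k x)%E.
have psum J : (\sum_(0 <= k < J) pk k x <= s%:E)%E.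
  by rewrite /s fineK//; apply: nneseries_lim_ge => k _ _; exact: p0.
have pf k : pk k x \is a fin_num.
  rewrite ge0_fin_numE//; apply: le_lt_trans (ltry s); apply: le_trans (psum k.+1).
  by rewrite big_nat_recr//= leeDr// sume_ge0.
pose p k := fine (pk k x).
have pE k : pk k x = (p k)%:E by rewrite /p fineK.
have pp k : 0 <= p k by exact: fine_ge0.
have ps J : \sum_(i < J) p i <= s.
  rewrite -lee_fin -sumEFin; apply: le_trans (psum J); rewrite big_mkord.
  by apply: lee_sum => i _; rewrite pE.
have [eps [eps0 epsP]] := summable_tail pp ps.
pose Kc : R := 2 * (@Kosc R n) + 1.
have bd k r : 0 < r <= 1 -> `|bmean (du k) x r| <= Kc * p k.
  move=> r01; have := W_ball_mean_le d_bounds Gamma_neq0 Gamma_closed Gamma_AR (Wd k) r01 (td k).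
  by rewrite -[potential _ _ _]/(pk k x) pE -EFinM lee_fin.
have bj k r j : 0 < r <= 1 -> `|bmean (u (k + j)%N) x r - bmean (u k) x r| <= Kc * \sum_(i < j) p (k + i)%N.
  move=> r01; elim: j => [|j IH].
    by rewrite addn0 subrr normr0 big_ord0 mulr0.
  rewrite big_ord_recr mulrDr /=.
  have -> : bmean (u (k + j.+1)%N) x r = bmean (du (k + j)%N) x r + bmean (u (k + j)%N) x r.
    have := bmean_lin d_bounds Gamma_neq0 Gamma_closed Gamma_AR 1 x r (Wd (k + j)%N) (Wu (k + j)%N).
    by rewrite scale1r mul1r /du subrK addnS.
  rewrite -addrA addrC; apply: le_trans (ler_normD _ _) _; apply: lerD; [exact: IH|exact: bd].
have Kc0 : 0 < Kc by rewrite /Kc ltr_wpDl// mulr_ge0// Kosc_ge0.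
have bl k r : 0 < r <= 1 -> `|bmean l x r - bmean (u k) x r| <= Kc * eps k.
  move=> r01; have cv := bmean_cvg (x := x) (r := r) ml Hl.
  have cv2 : `|bmean (u (k + j)%N) x r - bmean (u k) x r| @[j --> \oo] --> `|bmean l x r - bmean (u k) x r|.
    apply: cvg_norm; apply: cvgB; last exact: cvg_cst.
    by move: cv; rewrite -(cvg_shiftn k (fun j => bmean (u j) x r)) /=; under eq_fun do rewrite addnC.
  apply: (cvgr_to_le cv2); apply: nearW => j; apply: le_trans (bj k r j r01) _.
  exact: (ler_wpM2l (ltW Kc0) (epsP k j)).
have E v r : in_W d Gamma v -> ball_mean v x r = (bmean v x r)%:E.
  by move=> Wv; exact: (ball_mean_W d_bounds Gamma_neq0 Gamma_closed Gamma_AR x r Wv).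
under eq_fun do rewrite (E _ _ Wl).
apply: cvg_EFin; first exact: nearW.
have cvu k : bmean (u k) x r @[r --> 0^'+] --> (0 : R).
  have : (bmean (u k) x r)%:E @[r --> 0^'+] --> 0%:E.
    by have := tu k; under eq_fun do rewrite (E _ _ (Wu k)).
  exact: fine_cvg.
rewrite /comp /=; apply/cvgrPdist_lt => e e0.
have [k ek] : exists k, Kc * eps k < e / 2.
  have : \forall k \near \oo, eps k < e / 2 / Kc.
    by apply: (cvgr_lt _ eps0); rewrite divr_gt0// divr_gt0.
  by move=> [k _ /(_ k (leqnn k))] H; exists k; rewrite mulrC -ltr_pdivlMr.
near=> r; rewrite sub0r normrN.
have -> : bmean l x r = (bmean l x r - bmean (u k) x r) + bmean (u k) x r by rewrite subrK.
apply: le_lt_trans (ler_normD _ _) _; rewrite [ltRHS](splitr e); apply: ler_ltD.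
  apply: le_trans (bl k r _) (ltW ek); apply/andP; split; near: r; first exact: nbhs_right_gt.
  exact: nbhs_right_le.
near: r; have := cvu k => /cvgrPdist_lt /(_ (e / 2)); rewrite divr_gt0// => /(_ isT).
by apply: filterS => r; rewrite sub0r normrN.
Unshelve. all: by end_near. Qed.

Lemma fast_limit_W0 : exists2 l : V, in_W0 d Gamma l & wip (u k - l) (u k - l) @[k --> \oo] --> 0.
Proof.
have [l [G [ml [c Hl] ll wl [N [mN N0 cv]]]]] := weak_limit.
have H k := limit_energy k ll wl mN N0 cv.
have Wl : in_W d Gamma l.
  have -> : l = u 0%N - (u 0%N - l) by rewrite opprB addrC subrK.
  exact: WB (Wu 0) (H 0%N).1.
exists l.
  split; first exact: Wl.
  have tr : {ae sigma, forall x, forall k, Gamma x -> ball_mean (u k) x r @[r --> 0^'+] --> 0%E}.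
    by apply: ae_foralln => k; case: (W0u k).
  have td : {ae sigma, forall x, forall k, Gamma x -> ball_mean (du k) x r @[r --> 0^'+] --> 0%E}.
    by apply: ae_foralln => k; case: (W0d k).
  have tp : {ae sigma, forall x, forall m,
      ~ ((Gamma `&` eball y0 m.+1%:R) `&` [set x | (\sum_(0 <= k <oo) pk k x = +oo)%E]) x}.
    apply: ae_foralln => m; have P := potentials_finite m.
    exists ((Gamma `&` eball y0 m.+1%:R) `&` [set x | (\sum_(0 <= k <oo) pk k x = +oo)%E]); split.
    + exact: (haus_null_measurable P).
    + exact: P.
    + by move=> x /= /contrapT.
  rewrite /has_trace.
  apply: (@filterS3 _ _ (ae_filter_ringOfSetsType sigma) _ _ _ _ _ tr td tp) => x Hu Hd Hp Gx.
  apply: (limit_trace_at ml Wl Hl) => [k|k|]; [exact: Hu|exact: Hd|].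
  rewrite ltey; apply/eqP => oo.
  apply: (Hp (Num.bound (enorm (x - y0)))); split; last exact: oo.
  split; first exact: Gx.
  by apply: lt_le_trans (archi_boundP (enorm_ge0 _)) _; rewrite ler_nat.
have t2 : (2 * t k) ^+ 2 @[k --> \oo] --> (0 : R).
  have -> : (fun k => (2 * t k) ^+ 2) = (fun k => (2 * M) ^+ 2 * (16^-1) ^+ k).
    apply/funext => k; rewrite /t mulrA expr_div_n mulrC -exprAC mulrC; congr (_ * _).
    by rewrite exprVn; congr (_ ^+ _ )^-1; rewrite expr2 -natrM.
  rewrite -[0](mulr0 ((2 * M) ^+ 2)); apply: cvgM; first exact: cvg_cst.
  apply: cvg_expr; rewrite ger0_norm ?invr_ge0// invf_lt1// ltr1n.
  by [].
apply: (squeeze_cvgr _ (cvg_cst 0) t2); apply: nearW => k.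
have [Wk Ek] := H k; rewrite (wip_energy Gamma_neq0 Gamma_closed Wk) lee_fin in Ek.
by rewrite Ek andbT; case: Wip => _ _; apply.
Qed.

End completeness.

Lemma W0_complete (R : realType) (n : nat) (d C0 : R) (Gamma : set 'rV[R]_n) :
  0 < d < n%:R - 1 -> Gamma !=set0 -> closed Gamma -> 1 <= C0 -> ahlfors_regular d C0 Gamma ->
  fast_complete (in_W0 d Gamma) (wip d Gamma).
Proof.
move=> db G0 Gc C1 AR u K W0u fast.
(* With M = |K| + 1 one has K <= M^2, which puts the decay K / 16^k in the form (M / 4^k)^2. *)
have M0 : 0 < `|K| + 1 by rewrite ltr_pwDr.
apply: (fast_limit_W0 db G0 Gc C1 AR M0 W0u) => k.
apply: le_trans (fast k) _; rewrite expr_div_n -exprM mulnC exprM.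
have -> : 4 ^+ 2 = 16 :> R by rewrite expr2 -natrM.
rewrite ler_pM2r ?invr_gt0 ?exprn_gt0//; have := ler_norm K; have := normr_ge0 K; nra.
Qed.

(** * Weak gradients from difference quotients *)

Section bounded_integrable.
Context {d : measure_display} {T : measurableType d} {R : realType}.
Variable mu : {measure set T -> \bar R}.

Lemma bounded_integrable (D : set T) (f : T -> R) (C : R) : measurable D -> (mu D < +oo)%E ->
  measurable_fun D f -> (forall x, D x -> `|f x| <= C) -> mu.-integrable D (EFin \o f).
Proof.
move=> mD Doo mf fC; apply: (measurable_bounded_integrable mD Doo mf).
exists C; split; first exact: num_real.
by move=> M CM x Dx; apply: le_trans (fC x Dx) (ltW CM).
Qed.

Lemma integrable_extend (D : set T) (f : T -> R) : measurable_fun setT f ->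
  (forall x, ~ D x -> f x = 0) -> mu.-integrable D (EFin \o f) -> mu.-integrable setT (EFin \o f).
Proof.
move=> mf f0 /integrableP[_ fi]; apply/integrableP; split; first exact/measurable_EFinP.
by rewrite (@integral_support _ _ _ mu setT D)// => x _ nD; rewrite /= f0// normr0.
Qed.

End bounded_integrable.

Section directional.
Context {R : realType} {n : nat}.
Local Notation V := ('rV[R]_n -> R).
Implicit Types (f : V) (i : 'I_n) (z : 'rV[R]_n) (s t h C : R).

Lemma is_derive_line f i z s : derivable f (z + hv i s) (delta_mx 0 i) ->
  is_derive s (1 : R) (fun t : R => f (z + hv i t)) (partial i f (z + hv i s)).
Proof.
move=> df.
have E : (fun h : R => h^-1 *: (f (z + hv i (h *: (1 : R) + s)) - f (z + hv i s))) =
         (fun h : R => h^-1 *: (f (h *: delta_mx 0 i + (z + hv i s)) - f (z + hv i s))).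
  apply/funext => h; congr (_ *: (f _ - _)).
  by rewrite /hv scalerDl [h *: 1]mulr1 addrCA.
split; first by rewrite /derivable E.
by rewrite /derive E.
Qed.

Lemma line_mvt f i z h C : 0 <= h ->
  (forall t, 0 <= t <= h -> derivable f (z + hv i t) (delta_mx 0 i)) ->
  (forall t, 0 <= t <= h -> `|partial i f (z + hv i t)| <= C) -> `|f (z + hv i h) - f z| <= C * h.
Proof.
move=> h0 df bf; pose g t := f (z + hv i t).
have dg t : 0 <= t <= h -> is_derive t (1 : R) g (partial i f (z + hv i t)).
  by move=> th; apply: is_derive_line; exact: df.
have cg : {within `[0, h], continuous g}.
  apply: derivable_within_continuous => t; rewrite in_itv /= => th.
  by have [] := dg t th.
have [||t th E] := @MVT_segment R g (fun t => partial i f (z + hv i t)) 0 h h0.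
- by move=> t; rewrite in_itv /= => /andP[t0 th]; apply: dg; rewrite !ltW.
- exact: cg.
have -> : f z = g 0 by rewrite /g /hv scale0r addr0.
rewrite -[f _]/(g h) E subr0 normrM (ger0_norm h0); apply: ler_wpM2r => //; apply: bf.
by move: th; rewrite in_itv.
Qed.

Lemma partial_quotient f i z (h : nat -> R) : derivable f z (delta_mx 0 i) -> (forall j, h j != 0) ->
  h j @[j --> \oo] --> (0 : R) ->
  (f (z + hv i (h j)) - f z) / h j @[j --> \oo] --> partial i f z.
Proof.
move=> df hn h0.
have hcv : h @ \oo --> (0 : R)^'.
  move=> A A0; have := h0 _ A0; rewrite /nbhs /= => H.
  near=> j; have : h j != 0 -> A (h j) by near: j; exact: H.
  exact.
have := cvg_comp _ _ hcv df; rewrite -/(partial i f z).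
suff -> : (fun t : R => t^-1 *: (f (t *: delta_mx 0 i + z) - f z)) \o h =
  (fun j => (f (z + hv i (h j)) - f z) / h j) by [].
by apply/funext => j; rewrite /= [_ *: _]mulrC [_ + z]addrC.
Unshelve. all: by end_near. Qed.

End directional.

Section integration_by_parts.
Context {R : realType} {n : nat}.
Local Notation L := (leb_space R n).
Local Notation mu := (leb R n).
Local Notation V := ('rV[R]_n -> R).

Lemma measurable_shift (v : V) (a : 'rV[R]_n) : measurable_fun (setT : set L) v ->
  measurable_fun (setT : set L) (fun z => v (z + a)).
Proof. by move=> mv; exact: (measurableT_comp mv (measurable_leb_shift a)). Qed.

Lemma integrable_shift (v : V) (a : 'rV[R]_n) : mu.-integrable (setT : set L) (EFin \o v) ->
  mu.-integrable (setT : set L) (EFin \o (fun z => v (z + a))).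
Proof.
move=> iv; have mv := integrableR_measurable iv.
apply/integrableP; split; first by apply/measurable_EFinP; exact: measurable_shift.
have /integrableP[_] := iv.
rewrite (leb_integral_shift a measurableT); first exact.
exact: (measurable_int _ (integrable_abse iv)).
Qed.

Lemma Rintegral_shift (v : V) (a : 'rV[R]_n) : measurable_fun (setT : set L) v ->
  \int[mu]_z v z = \int[mu]_z v (z + a).
Proof.
by move=> /measurable_EFinP mv; rewrite /Rintegral (leb_integral_shift a measurableT mv).
Qed.

(** Translation invariance moves the shift from [phi] to [v]: the discrete form of integration by
    parts. *)
Lemma summation_by_parts (v phi : V) (a : 'rV[R]_n) C : mu.-integrable (setT : set L) (EFin \o v) ->
  measurable_fun (setT : set L) phi -> (forall z, `|phi z| <= C) ->
  \int[mu]_z (v z * (phi z - phi (z - a))) = - \int[mu]_z ((v (z + a) - v z) * phi z).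
Proof.
move=> iv mp pC.
have mpa := measurable_shift (- a) mp.
have ivp : mu.-integrable (setT : set L) (EFin \o (fun z => v z * phi z)).
  by apply: (integrableR_mul measurableT iv mp) => z _; exact: pC.
have ivpa : mu.-integrable (setT : set L) (EFin \o (fun z => v z * phi (z - a))).
  by apply: (integrableR_mul measurableT iv mpa) => z _; exact: pC.
have iva : mu.-integrable (setT : set L) (EFin \o (fun z => v (z + a) * phi z)).
  by apply: (integrableR_mul measurableT (integrable_shift a iv) mp) => z _; exact: pC.
have E : \int[mu]_z (v z * phi (z - a)) = \int[mu]_z (v (z + a) * phi z).
  rewrite (Rintegral_shift a (integrableR_measurable ivpa)).
  by apply: eq_Rintegral => z _; rewrite addrK.
under eq_Rintegral do rewrite mulrBr.
under [in RHS]eq_Rintegral do rewrite mulrBl.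
by rewrite (RintegralB measurableT ivp ivpa) (RintegralB measurableT iva ivp) opprB E.
Qed.

End integration_by_parts.

Lemma leb_le (R : realType) (n : nat) (A B : set 'rV[R]_n) : A `<=` B -> (leb R n A <= leb R n B)%E.
Proof. exact: le_outer_measure. Qed.

Section quotients.
Context {R : realType} {n : nat} (Gamma : set 'rV[R]_n).
Hypothesis Gamma_neq0 : Gamma !=set0.
Hypothesis Gamma_closed : closed Gamma.
Hypothesis Gamma_null : leb_outer Gamma = 0%E.
Local Notation L := (leb_space R n).
Local Notation mu := (leb R n).
Local Notation Omega := (~` Gamma : set L).
Local Notation V := ('rV[R]_n -> R).
Local Notation edist := (Defs.edist Gamma).
Implicit Types (z y : 'rV[R]_n) (rho M t c : R).

Let oO : open (~` Gamma). Proof. exact: open_Omega. Qed.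
Let mO : measurable Omega. Proof. exact: measurable_Omega. Qed.

(** Shells exhaust the complement of Gamma, and a shift of length at most rho maps a shell at
    distance 2 rho into one at distance rho. Local bounds are therefore stated on shells instead of
    compact sets. *)
Definition shell rho M : set 'rV[R]_n := [set z | rho <= edist z /\ enorm z <= M].

Lemma measurable_shell rho M : measurable (shell rho M : set L).
Proof.
have -> : shell rho M = [set z | rho <= edist z] `&` [set z | enorm z <= M] by [].
apply: measurableI; apply: measurable_leb_closed.
- by apply: (@preimage_closed _ _ edist [set t | rho <= t]) => [z _|]; [exact: continuous_edist|exact: closed_ge].
- by apply: (@preimage_closed _ _ (@enorm R n) [set t | t <= M]) => [z _|]; [exact: continuous_enorm|exact: closed_le].
Qed.

Lemma shell_Omega rho M : 0 < rho -> shell rho M `<=` ~` Gamma.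
Proof.
move=> r0 z [rz _] Gz; have := edist_le z Gz; rewrite subrr enorm0 => h.
by have := lt_le_trans r0 (le_trans rz h); rewrite ltxx.
Qed.

Lemma leb_shell rho M : (mu (shell rho M) < +oo)%E.
Proof.
have sub : shell rho M `<=` cube (0 : 'rV[R]_n) (`|M| + 1).
  move=> z [_ zM]; apply: eball_sub_cube; rewrite /eball /= subr0.
  by apply: le_lt_trans zM _; apply: le_lt_trans (ler_norm M) _; rewrite ltrDl.
have H : (mu (cube (0 : 'rV[R]_n) (`|M| + 1)) < +oo)%E by rewrite leb_cube ?ltry// addr_ge0.
apply: le_lt_trans H; exact: leb_le.
Qed.

Lemma compact_sub_shell (K : set 'rV[R]_n) : compact K -> K `<=` ~` Gamma ->
  exists rho M, 0 < rho /\ K `<=` shell rho M.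
Proof.
move=> cK KO; have [e e0 He] := compact_sub_open_ball cK oO KO.
have : compact ((@enorm R n) @` K).
  by apply: continuous_compact => //; apply: continuous_subspaceT; exact: continuous_enorm.
move=> /compact_bounded[C [_ HC]]; exists e, (`|C| + 1); split => // z Kz; split.
  rewrite leNgt; apply/negP => /(edist_near Gamma_neq0)[y Gy zy].
  apply: (He z Kz y) Gy; split => // i j; rewrite (ord1 i) /ball/=.
  by have := le_lt_trans (coord_le_enorm (z - y) j) zy; rewrite !mxE.
have := HC (`|C| + 1); rewrite (le_lt_trans (ler_norm C)) ?ltrDl//.
by move=> /(_ isT (enorm z)) /(_ (ex_intro2 _ _ z Kz erefl)) /=; exact: le_trans (ler_norm _).
Qed.

Lemma loc_integrable_shell (f : V) : measurable_fun Omega f ->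
  (forall rho M, 0 < rho -> exists C, forall z, shell rho M z -> `|f z| <= C) ->
  loc_integrable (~` Gamma) f.
Proof.
move=> mf bf; split => // K cK KO; have [rho [M [r0 KS]]] := compact_sub_shell cK KO.
have [C HC] := bf rho M r0; have mK := measurable_leb_compact cK.
have Koo : (mu K < +oo)%E.
  apply: le_lt_trans (leb_shell rho M); exact: leb_le.
have fC z : K z -> `|f z| <= C by move=> Kz; exact: HC (KS _ Kz).
by have /integrableP[] := bounded_integrable mK Koo (measurable_funS mO KO mf) fC.
Qed.

Lemma enorm_hv i t : 0 <= t -> enorm (hv i t : 'rV[R]_n) = t.
Proof.
move=> t0; rewrite /hv enormZ (ger0_norm t0) -[RHS]mulr1; congr (_ * _).
rewrite /enorm /dotp (bigD1 i)//= big1 ?addr0; last first.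
  by move=> j ji; rewrite !mxE (negbTE ji) andbF mulr0.
by rewrite !mxE !eqxx mulr1 sqrtr1.
Qed.

Lemma shell_hv i rho M z t : 0 <= t <= rho -> shell (2 * rho) M z -> shell rho (M + rho) (z + hv i t).
Proof.
move=> /andP[t0 tr] [rz zM]; split.
  have := edist_lip Gamma_neq0 z (z + hv i t); rewrite opprD addrA subrr sub0r.
  by rewrite -[- _]sub0r enorm_sub subr0 enorm_hv// => h; lra.
by have := enormD z (hv i t); rewrite enorm_hv// => h; lra.
Qed.

Variables (i : 'I_n) (u G : V).
Hypothesis mu_u : measurable_fun Omega u.
Hypothesis bu : forall rho M, 0 < rho -> exists C, forall z, shell rho M z -> `|u z| <= C.
Hypothesis qb : forall rho M, 0 < rho -> exists C, forall z t, shell (2 * rho) M z -> 0 < t <= rho ->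
  `|u (z + hv i t) - u z| <= C * t.
Hypothesis qc : forall (h : nat -> R) z, (forall j, 0 < h j) -> h j @[j --> \oo] --> (0 : R) -> ~ Gamma z ->
  (u (z + hv i (h j)) - u z) / h j @[j --> \oo] --> G z.

Let step (rho : R) j : R := rho / j.+1%:R.

Let step_gt0 rho j : 0 < rho -> 0 < step rho j.
Proof. by move=> r0; rewrite divr_gt0. Qed.

Let step_le rho j : 0 < rho -> step rho j <= rho.
Proof. by move=> r0; rewrite ler_pdivrMr// ler_peMr ?(ltW r0)// ler1n. Qed.

Let step_cvg rho : step rho j @[j --> \oo] --> (0 : R).
Proof. by rewrite -[0](mulr0 rho); apply: cvgM; [exact: cvg_cst|exact: cvg_harmonic]. Qed.

Let muT : measurable_fun (setT : set L) u.
Proof. by apply: (measurable_fun_null_setC mO _ mu_u); rewrite setCK. Qed.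

Lemma quotient_limit_measurable : measurable_fun Omega G.
Proof.
apply: (@measurable_fun_cvg _ _ _ Omega (fun j z => (u (z + hv i (step 1 j)) - u z) / step 1 j)).
  move=> j; apply: measurable_funM; last exact: measurable_cst.
  apply: measurable_funB; last exact: mu_u.
  by apply: measurable_funTS; exact: measurable_shift.
by move=> z Oz; apply: (qc _ _ Oz) => [j|]; [exact: step_gt0|exact: step_cvg].
Qed.

Lemma quotient_limit_bounded rho M : 0 < rho -> exists C, forall z, shell rho M z -> `|G z| <= C.
Proof.
move=> r0; have r20 : 0 < rho / 2 by rewrite divr_gt0.
have [C HC] := qb M r20; exists C => z Sz.
have cv := qc (fun j => step_gt0 j r20) (step_cvg (rho / 2)) (shell_Omega r0 Sz).
apply: (cvgr_to_le (cvg_norm cv)); apply: nearW => j /=.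
rewrite normrM normfV (gtr0_norm (step_gt0 j r20)) ler_pdivrMr ?step_gt0//.
by apply: HC; [rewrite mulrC divfK|rewrite step_gt0//= step_le].
Qed.

(** Discrete integration by parts for a truncation of [u], followed by dominated convergence on both
    sides: the mean value theorem dominates the quotients of [phi], and the Lipschitz bound [qb]
    those of [u] on the support of [phi]. *)
Lemma wgrad_of_quotients : loc_integrable (~` Gamma) u /\ loc_integrable (~` Gamma) G /\
  forall phi, test_function (~` Gamma) phi ->
  (\int[mu]_(z in Omega) (u z * partial i phi z)%:E = - \int[mu]_(z in Omega) (G z * phi z)%:E)%E.
Proof.
have lu : loc_integrable (~` Gamma) u by exact: loc_integrable_shell.
have lG : loc_integrable (~` Gamma) G.
  by apply: loc_integrable_shell; [exact: quotient_limit_measurable|exact: quotient_limit_bounded].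
split; [exact: lu|split; [exact: lG|move=> phi tp]].
have tq := test_function_partial i tp.
have [sp [K [cK KO p0]]] := tp.
have [rho' [M [r'0 KS']]] := compact_sub_shell cK KO.
pose rho := rho' / 2; have r0 : 0 < rho by rewrite divr_gt0.
have KS : K `<=` shell (2 * rho) M by rewrite /rho mulrC divfK.
pose D : set L := shell rho (M + rho); have mD : measurable D by exact: measurable_shell.
have mK : measurable (K : set L) by exact: measurable_leb_compact.
have KD : K `<=` D by move=> z /KS[a b]; split; lra.
have [Cu HCu] := bu (M + rho) r0.
have [Cp HCp] := test_function_bounded tp; have [Cq HCq] := test_function_bounded tq.
have [Cb HCb] := qb M r0.
have mp : measurable_fun (setT : set L) phi by apply: measurable_leb_continuous; exact: test_function_continuous tp.
(* The truncation makes [v] integrable on the whole space. It is invisible on [K], since shifts of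
   points of [K] by at most rho stay in [D]. *)
pose v z : R := u z * \1_D z.
have vE z : D z -> v z = u z by move=> Dz; rewrite /v indicE mem_set// mulr1.
have mv : measurable_fun (setT : set L) v by apply: measurable_funM; [exact: muT|exact: measurable_indic].
have iv : mu.-integrable (setT : set L) (EFin \o v).
  apply: (integrable_extend (D := D) mv).
    by move=> z nD; rewrite /v indicE memNset// mulr0.
  apply: (bounded_integrable (C := Cu) mD (leb_shell _ _) (measurable_funTS mv)) => z Dz.
  by rewrite vE//; exact: HCu.
pose h j := step rho j; have h0 j : 0 < h j by exact: step_gt0.
have hc : h j @[j --> \oo] --> (0 : R) by exact: step_cvg.
have by_parts j : \int[mu]_z (v z * ((phi z - phi (z - hv i (h j))) / h j)) =
    - \int[mu]_z (((v (z + hv i (h j)) - v z) / h j) * phi z).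
  have mph : measurable_fun (setT : set L) (fun z => phi z / h j).
    by apply: measurable_funM; [exact: mp|exact: measurable_cst].
  have bph z : `|phi z / h j| <= Cp / h j.
    by rewrite normrM normfV (gtr0_norm (h0 j)) ler_pM2r ?invr_gt0//; exact: HCp.
  have := summation_by_parts (hv i (h j)) iv mph bph.
  under eq_Rintegral do rewrite -mulrBl.
  by under [in RHS]eq_Rintegral do rewrite [phi _ / _]mulrC mulrA.
have dphi z : derivable phi z (delta_mx 0 i) by exact: (sp [::]).2.
have cv1 : \int[mu]_z (v z * ((phi z - phi (z - hv i (h j))) / h j)) @[j --> \oo] -->
    \int[mu]_z (v z * partial i phi z).
  have ig : mu.-integrable (setT : set L) (EFin \o (fun z => Cq * `|v z|)).
    by apply: integrableRZ; [exact: measurableT|exact: integrable_norm iv].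
  have [|||_ //] := @dct_eventually _ _ _ mu setT
    (fun j z => v z * ((phi z - phi (z - hv i (h j))) / h j)) (fun z => v z * partial i phi z) _ measurableT _ ig.
  - move=> j; apply: measurable_funM; first exact: mv.
    apply: measurable_funM; last exact: measurable_cst.
    by apply: measurable_funB; [exact: mp|exact: measurable_shift].
  - move=> j z _; rewrite normrM mulrC; apply: ler_wpM2r; first exact: normr_ge0.
    rewrite normrM normfV (gtr0_norm (h0 j)) ler_pdivrMr//.
    have := @line_mvt R n phi i (z - hv i (h j)) (h j) Cq (ltW (h0 j)).
    by rewrite subrK; apply.
  - move=> z _; apply: cvgM; first exact: cvg_cst.
    have := @partial_quotient R n phi i z (fun j => - h j) (dphi z).
    have -> : (fun j => (phi (z + hv i (- h j)) - phi z) / - h j) =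
        (fun j => (phi z - phi (z - hv i (h j))) / h j).
      by apply/funext => j; rewrite /hv scaleNr invrN mulrN -mulNr opprB.
    apply; first by move=> j; rewrite oppr_eq0 gt_eqF.
    by rewrite -[0]oppr0; exact: cvgN.
have K1 : mu.-integrable (setT : set L) (EFin \o (fun z => Cb * Cp * \1_K z)).
  have Koo : (mu K < +oo)%E.
    apply: le_lt_trans (leb_shell rho (M + rho)); exact: leb_le.
  have mK1 : measurable_fun (setT : set L) (\1_K : V) by exact: measurable_indic.
  have i1 : mu.-integrable (setT : set L) (EFin \o (\1_K : V)).
    have o0 (z : L) : ~ K z -> (\1_K : V) z = 0 by move=> nK; rewrite indicE memNset.
    have o1 (z : L) : K z -> `|(\1_K : V) z| <= 1 by move=> Kz; rewrite indicE mem_set// normr1.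
    exact: (integrable_extend mK1 o0 (bounded_integrable mK Koo (measurable_funTS mK1) o1)).
  exact: (integrableRZ (Cb * Cp) measurableT i1).
have vq z j : K z -> v (z + hv i (h j)) - v z = u (z + hv i (h j)) - u z.
  move=> Kz; rewrite !vE//; first exact: KD.
  by apply: shell_hv; [rewrite (ltW (h0 j))/= step_le|exact: KS].
have cv2 : \int[mu]_z (((v (z + hv i (h j)) - v z) / h j) * phi z) @[j --> \oo] --> \int[mu]_z (G z * phi z).
  have [|||_ //] := @dct_eventually _ _ _ mu setT
    (fun j z => ((v (z + hv i (h j)) - v z) / h j) * phi z) (fun z => G z * phi z) _ measurableT _ K1.
  - move=> j; apply: measurable_funM; last exact: mp.
    apply: measurable_funM; last exact: measurable_cst.
    by apply: measurable_funB; [exact: measurable_shift|exact: mv].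
  - move=> j z _; rewrite indicE; have [Kz|nK] := pselect (K z); last first.
      by rewrite memNset// p0// mulr0 normr0 mulr0.
    rewrite mem_set// mulr1 normrM vq//; apply: ler_pM; [exact: normr_ge0|exact: normr_ge0| |exact: HCp].
    rewrite normrM normfV (gtr0_norm (h0 j)) ler_pdivrMr//.
    by apply: HCb; [exact: KS|rewrite h0/= step_le].
  - move=> z _; have [Kz|nK] := pselect (K z); last first.
      by rewrite p0// mulr0; under eq_fun do rewrite mulr0; exact: cvg_cst.
    apply: cvgM; last exact: cvg_cst.
    by under eq_fun do rewrite vq//; apply: (qc h0 hc); exact: KO.
have E : \int[mu]_z (v z * partial i phi z) = - \int[mu]_z (G z * phi z).
  rewrite -(cvg_lim (@Rhausdorff R) cv1); under eq_fun do rewrite by_parts.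
  by rewrite (cvg_lim (@Rhausdorff R) (cvgN cv2)).
have onOmega (f psi : V) : (forall z, ~ K z -> psi z = 0) ->
    (\int[mu]_z (f z * psi z)%:E = \int[mu]_(z in Omega) (f z * psi z)%:E)%E.
  by move=> psi0; apply: integral_support => // z _ nO; rewrite psi0 ?mulr0// => /KO.
have q0 z : ~ K z -> partial i phi z = 0.
  move=> nK; apply: (@partial_eq0_near _ _ i phi (~` K)) => //.
  by apply: closed_openC; exact: compact_closed.
have := congr1 EFin E; rewrite /Rintegral (onOmega v _ q0) (onOmega G _ p0).
have -> : (\int[mu]_(z in Omega) (v z * partial i phi z)%:E = \int[mu]_(z in Omega) (u z * partial i phi z)%:E)%E.
  apply: eq_integral => z _; have [Kz|nK] := pselect (K z); last by rewrite q0// !mulr0.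
  by rewrite vE//; exact: KD.
rewrite EFinN fineK; last exact: (integrable_fin_num mO (integrable_test oO lu tq)).
by rewrite fineK; last exact: (integrable_fin_num mO (integrable_test oO lG tp)).
Qed.

End quotients.

(** * The extension operator *)

Section scales.
Context {d : measure_display} {T : measurableType d} {R : realType}.
Variables (mu : {measure set T -> \bar R}) (D : set T).
Hypothesis mD : measurable D.

Lemma dyadic_integral_le (f : T -> R) (A : nat -> set T) (c : nat -> R) (K q : R) :
  measurable_fun D f -> (forall x, 0 <= f x) -> (forall k, measurable (A k)) -> (forall k, 0 <= c k) ->
  (forall x, D x -> exists k, A k x /\ f x <= c k) ->
  (forall k, ((c k)%:E * mu (A k `&` D) <= (K * q ^+ k)%:E)%E) -> 0 <= K -> 0 <= q < 1 ->
  (\int[mu]_(x in D) (f x)%:E <= (K / (1 - q))%:E)%E.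
Proof.
move=> mf f0 mA c0 fA cA K0 /andP[q0 q1].
have s0 x k : (0 <= (c k * \1_(A k) x)%:E)%E by rewrite lee_fin mulr_ge0.
have ms k : measurable_fun D (fun x => (c k * \1_(A k) x)%:E).
  by apply/measurable_EFinP; apply: measurable_funM; [exact: measurable_cst|exact: measurable_indic].
apply: le_trans (_ : (\int[mu]_(x in D) \sum_(0 <= k <oo) (c k * \1_(A k) x)%:E <= _)%E).
  apply: ge0_le_integral => //.
  - by move=> x _; rewrite lee_fin.
  - exact/measurable_EFinP.
  - by apply: ge0_emeasurable_sum => k *.
  - move=> x Dx; have [k [Ak fk]] := fA x Dx.
    apply: le_trans (_ : ((c k * \1_(A k) x)%:E <= _)%E).
      by rewrite indicE mem_set// mulr1 lee_fin.
    apply: le_trans (nneseries_lim_ge k.+1 _); last by move=> *; exact: s0.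
    by rewrite big_nat_recr//= leeDr// sume_ge0.
apply: (integral_series_le (c := fun k => K * q ^+ k) mD ms) => [j x|j|J]; first exact: s0.
  by rewrite (integral_cst_indic mu (mA j) mD (c0 j)).
rewrite -mulr_sumr; apply: ler_wpM2l => //.
have q1' : 0 < 1 - q by rewrite subr_gt0.
rewrite -[leRHS]mul1r ler_pdivlMr// mulr_suml.
have -> : \sum_(i < J) q ^+ i * (1 - q) = 1 - q ^+ J.
  elim: J => [|J IH]; first by rewrite big_ord0 expr0 subrr.
  by rewrite big_ord_recr/= IH exprSr; ring.
by rewrite gerBl exprn_ge0.
Qed.

Lemma powR_expr (b s : R) k : 0 <= b -> (b ^+ k) `^ s = (b `^ s) ^+ k.
Proof.
move=> b0; elim: k => [|k IH]; first by rewrite !expr0 powR1.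
by rewrite !exprS powRM ?exprn_ge0// IH.
Qed.

Lemma powR2_lt1 (p : R) : p < 0 -> 2 `^ p < 1.
Proof.
move=> p0; rewrite -[p]opprK powRN invf_lt1 ?powR_gt0//.
have := @gt0_ltr_powR R (- p); rewrite oppr_gt0 => /(_ p0 1 2); rewrite powR1.
by apply; rewrite ?nnegrE// ltr1n.
Qed.

Variables (f rad : T -> R) (K c s a rho : R).
Hypothesis mf : measurable_fun D f.
Hypothesis f0 : forall x, 0 <= f x.
Hypothesis mrad : measurable_fun setT rad.
Hypotheses (K0 : 0 <= K) (c0 : 0 <= c) (rho0 : 0 < rho).
Hypothesis growth : forall t : R, (0 < t)%R -> (mu (D `&` [set x | (rad x < t)%R]) <= (K * t `^ s)%:E)%E.

(** One argument for b = 2 and b = 1/2, with scales going outwards or inwards. On the k-th scale the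
    integrand is at most c (t_k / 2)^(-a) on a set of measure at most K t_k^s, and b^(s-a) < 1 is
    the convergence of the resulting geometric series. *)
Lemma scale_integral_le (b : R) : 0 < b -> b `^ (s - a) < 1 ->
  (forall x, D x -> exists k, rad x < rho * b ^+ k /\ f x <= c * (rho * b ^+ k / 2) `^ (- a)) ->
  (\int[mu]_(x in D) (f x)%:E <= (c * K * 2 `^ a / (1 - b `^ (s - a)) * rho `^ (s - a))%:E)%E.
Proof.
move=> b0 q1 H; pose t k := rho * b ^+ k.
have t0 k : 0 < t k by rewrite mulr_gt0// exprn_gt0.
rewrite (_ : c * K * 2 `^ a / (1 - b `^ (s - a)) * rho `^ (s - a) = (c * K * 2 `^ a * rho `^ (s - a)) / (1 - b `^ (s - a))); last by ring.
apply: (@dyadic_integral_le f (fun k => [set x | rad x < t k]) (fun k => c * (t k / 2) `^ (- a))) => //.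
- move=> k; have -> : [set x | rad x < t k] = setT `&` rad @^-1` `]-oo, t k[%classic.
    by apply/seteqP; split => x /=; [rewrite in_itv|case=> _; rewrite in_itv].
  by apply: mrad; [exact: measurableT|exact: measurable_itv].
- by move=> k; rewrite mulr_ge0// powR_ge0.
- move=> k; rewrite setIC.
  apply: le_trans (_ : ((c * (t k / 2) `^ (- a))%:E * (K * t k `^ s)%:E <= _)%E).
    by apply: lee_wpmul2l; [rewrite lee_fin mulr_ge0// powR_ge0|exact: growth].
  rewrite -EFinM lee_fin /t le_eqVlt; apply/orP; left; apply/eqP.
  have r0 := ltW rho0; have bk : 0 <= b ^+ k by rewrite exprn_ge0// ltW.
  rewrite -[rho * b ^+ k / 2]/(t k / 2) (_ : (t k / 2) `^ (- a) = t k `^ (- a) * 2 `^ a); last first.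
    by rewrite powRM ?invr_ge0 ?(ltW (t0 k))// -powR_inv1// -powRrM mulN1r opprK.
  have -> : c * (t k `^ (- a) * 2 `^ a) * (K * t k `^ s) = c * K * 2 `^ a * (t k `^ (- a) * t k `^ s) by ring.
  rewrite -powRD; last by apply/implyP => _; rewrite gt_eqF.
  by rewrite [- a + s]addrC /t powRM// powR_expr ?(ltW b0)// mulrA.
- by rewrite !mulr_ge0// powR_ge0.
- by rewrite powR_ge0.
Qed.

Lemma powR_anti (x y p : R) : 0 < x -> x <= y -> 0 <= p -> y `^ (- p) <= x `^ (- p).
Proof.
move=> x0 xy p0; rewrite !powRN lef_pV2 ?posrE ?powR_gt0 ?(lt_le_trans x0)//.
by apply: ge0_ler_powR; rewrite ?nnegrE ?(le_trans _ xy) ?(ltW x0).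
Qed.

Lemma far_integral_le : 0 <= a -> s < a -> (forall x, D x -> f x <= c * (Num.max (rad x) rho) `^ (- a)) ->
  (\int[mu]_(x in D) (f x)%:E <= (c * K * 2 `^ a / (1 - 2 `^ (s - a)) * rho `^ (s - a))%:E)%E.
Proof.
move=> a0 sa fb; apply: scale_integral_le => //.
  by apply: powR2_lt1; rewrite subr_lt0.
move=> x Dx; have ex : exists k, rad x < rho * 2 ^+ k.
  exists (Num.bound (`|rad x| / rho)); rewrite mulrC -ltr_pdivrMr//.
  apply: le_lt_trans (_ : `|rad x| / rho < _); first by rewrite ler_pM2r ?invr_gt0// ler_norm.
  apply: lt_le_trans (archi_boundP _) _; first by rewrite divr_ge0// ltW.
  by rewrite -natrX ler_nat ltnW// ltn_expl.
(* For the least such k > 0 the previous scale does not contain x, hence rad x is at least half of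
   the k-th scale; for k = 0 the maximum is at least rho. *)
case: (ex_minnP ex) => k kx kmin; exists k; split; first exact: kx.
apply: le_trans (fb x Dx) _; apply: ler_wpM2l => //; apply: powR_anti => //.
  by rewrite divr_gt0// mulr_gt0// exprn_gt0.
rewrite le_max; case: k kx kmin => [|k] kx kmin.
  by apply/orP; right; rewrite expr0 mulr1 ler_pdivrMr// ler_peMr ?(ltW rho0)// ler1n.
apply/orP; left; rewrite exprSr mulrA mulfK// leNgt; apply/negP => /kmin.
by rewrite ltnn.
Qed.

Lemma near_integral_le : 0 <= a -> a < s -> (forall x, D x -> 0 < rad x < rho) ->
  (forall x, D x -> f x <= c * rad x `^ (- a)) ->
  (\int[mu]_(x in D) (f x)%:E <= (c * K * 2 `^ a / (1 - 2^-1 `^ (s - a)) * rho `^ (s - a))%:E)%E.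
Proof.
move=> a0 sa rD fb; apply: scale_integral_le => //.
  by rewrite -powR_inv1// -powRrM; apply: powR2_lt1; lra.
move=> x Dx; have /andP[r0 r1] := rD x Dx.
have ex : exists k, rho * 2^-1 ^+ k.+1 <= rad x.
  exists (Num.bound (rho / rad x)); rewrite exprVn ler_pdivrMr ?exprn_gt0// mulrC -ler_pdivrMr//.
  apply: le_trans (ltW (archi_boundP _)) _; first by rewrite divr_ge0// ltW.
  by rewrite -natrX ler_nat ltnW// (leq_trans (ltn_expl _ (ltnSn 1)))// leq_exp2l.
case: (ex_minnP ex) => k kx kmin; exists k; split.
  case: k kx kmin => [|k] kx kmin; first by rewrite expr0 mulr1.
  by rewrite ltNge; apply/negP => /kmin; rewrite ltnn.
apply: le_trans (fb x Dx) _; apply: ler_wpM2l => //; apply: powR_anti => //.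
  by rewrite divr_gt0// mulr_gt0// exprn_gt0.
by move: kx; rewrite exprSr mulrA.
Qed.

End scales.

(** * The kernel |z - y|^(-M) *)

Section kernel.
Context {R : realType} {n : nat}.
Variable M : R.
Hypothesis M0 : 0 < M.
Implicit Types (x y z : 'rV[R]_n) (c r t rho B : R) (i : 'I_n).

Definition kern z y : R := enorm (z - y) `^ (- M).

Lemma kern_ge0 z y : 0 <= kern z y.
Proof. exact: powR_ge0. Qed.

Lemma kern_le c z z' y : 0 < c -> 0 < enorm (z' - y) -> enorm (z' - y) <= c * enorm (z - y) ->
  kern z y <= c `^ M * kern z' y.
Proof.
move=> c0 p0 le; rewrite /kern.
have p1 : 0 < enorm (z - y) by rewrite -(pmulr_rgt0 _ c0); exact: lt_le_trans le.
have := powR_anti p0 le (ltW M0); rewrite powRM ?(ltW c0) ?enorm_ge0//.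
by rewrite [c `^ _]powRN mulrC ler_pdivrMr ?powR_gt0// mulrC.
Qed.

Lemma enorm_powR x p : enorm x `^ p = dotp x x `^ (p / 2).
Proof. by rewrite /enorm -powR12_sqrt ?dotp_ge0// -powRrM mulrC. Qed.

Lemma dotp_delta x i : dotp x (delta_mx 0 i) = x 0 i.
Proof.
rewrite /dotp (bigD1 i)//= big1 ?addr0; last first.
  by move=> j ji; rewrite !mxE (negbTE ji) andbF mulr0.
by rewrite !mxE !eqxx mulr1.
Qed.

Lemma dotp_line x i t : dotp (t *: delta_mx 0 i + x) (t *: delta_mx 0 i + x) =
  dotp x x + 2 * x 0 i * t + t ^+ 2.
Proof.
rewrite dotpDl !dotpDr !dotpZl !dotpZr (dotpC _ x) !dotp_delta !mxE !eqxx.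
by rewrite /= mulr1; ring.
Qed.

(** Along a coordinate line the squared distance is a quadratic polynomial, so the kernel is a power
    with exponent -M / 2 of a polynomial that is positive at the point. *)
Lemma kern_derive i z y : 0 < enorm (z - y) -> derivable (kern ^~ y) z (delta_mx 0 i) /\
  partial i (kern ^~ y) z = - M * (z - y) 0 i * enorm (z - y) `^ (- M - 2).
Proof.
move=> p0; set x := z - y.
pose q (t : R) : R := dotp x x + (2 * x 0 i) * t + t ^+ 2.
pose g := (fun t : R => t `^ (- M / 2)) \o q.
have q0 : q 0 = enorm x ^+ 2 by rewrite /q mulr0 expr0n/= !addr0 enorm_sqr.
have dq : is_derive (0 : R) (1 : R) q (2 * x 0 i).
  have H := is_deriveD (is_deriveD (is_derive_cst (dotp x x) (0 : R) (1 : R))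
    (is_deriveZ (2 * x 0 i) (is_derive_id (0 : R) (1 : R)))) (is_deriveM (is_derive_id (0 : R) (1 : R)) (is_derive_id (0 : R) (1 : R))).
  have -> : q = cst (dotp x x) + (2 * x 0 i) \*: id + id * id by apply/funext => t; rewrite /q expr2.
  apply: is_derive_eq H _.
  by rewrite /= add0r !scale0r addr0 [_ *: 1]mulr1 addr0.
have dg : is_derive (0 : R) (1 : R) g (- M / 2 * (enorm x ^+ 2) `^ (- M / 2 - 1) * (2 * x 0 i)).
  apply: is_derive1_comp; rewrite q0; apply: is_derive1_powR; exact: exprn_gt0.
have E : (fun h : R => h^-1 *: (kern (h *: delta_mx 0 i + z) y - kern z y)) =
         (fun h : R => h^-1 *: (g (h *: (1 : R) + 0) - g 0)).
  have kE t : kern (t *: delta_mx 0 i + z) y = g t.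
    by rewrite /kern enorm_powR /g /= /q -addrA dotp_line.
  apply/funext => h; rewrite kE addr0 [h *: 1]mulr1; congr (_ *: (_ - _)).
  by rewrite -(kE 0) scale0r add0r.
have [dg1 dg2] := dg; split; first by rewrite /derivable E.
rewrite /partial /derive E -/(derive g 0 1) dg2.
have -> : (enorm x ^+ 2) `^ (- M / 2 - 1) = enorm x `^ (- M - 2).
  rewrite -powR_mulrn ?enorm_ge0// -powRrM; congr (_ `^ _); lra.
by field.
Qed.

Lemma kern_partial_le i z y rho : 0 < rho -> rho <= enorm (z - y) ->
  `|partial i (kern ^~ y) z| <= M / rho * kern z y.
Proof.
move=> r0 rp; have p0 := lt_le_trans r0 rp.
have [_ ->] := kern_derive i p0; rewrite !normrM normrN (gtr0_norm M0) -!mulrA.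
apply: ler_wpM2l; first exact: ltW.
rewrite (ger0_norm (powR_ge0 _ _)) powRD; last by apply/implyP => _; rewrite gt_eqF.
rewrite /kern mulrA mulrC mulrA mulrC [leRHS]mulrC; apply: ler_wpM2l; first exact: powR_ge0.
rewrite powRN powR_mulrn ?enorm_ge0//.
apply: le_trans (_ : (enorm (z - y) ^+ 2)^-1 * enorm (z - y) <= _).
  by apply: ler_wpM2l; [rewrite invr_ge0 sqr_ge0|exact: coord_le_enorm].
by rewrite expr2 invfM -mulrA mulVf ?gt_eqF// mulr1 lef_pV2.
Qed.

Lemma kern_lip i z y t rho B : 0 < rho -> 0 <= t ->
  (forall s, 0 <= s <= t -> rho <= enorm (z + hv i s - y) /\ kern (z + hv i s) y <= B) ->
  `|kern (z + hv i t) y - kern z y| <= M / rho * B * t.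
Proof.
move=> r0 t0 H; apply: (@line_mvt R n (kern ^~ y) i z t _ t0) => s st; have [a b] := H s st.
- by have [] := kern_derive i (lt_le_trans r0 a).
- apply: le_trans (kern_partial_le i r0 a) _; apply: ler_wpM2l => //.
  by rewrite divr_ge0// ltW.
Qed.

Lemma measurable_enorm_comp d (X : measurableType d) (D : set X) (Z : X -> 'rV[R]_n) :
  (forall i, measurable_fun D (fun p => Z p 0 i)) -> measurable_fun D (fun p => enorm (Z p)).
Proof.
move=> mZ; have -> : (fun p => enorm (Z p)) = (fun p => (\sum_i Z p 0 i * Z p 0 i) `^ (2^-1)).
  by apply/funext => p; rewrite powR12_sqrt// dotp_ge0.
apply: (measurableT_comp (measurable_powR _)).
by apply: measurable_sum => i; apply: measurable_funM; exact: mZ.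
Qed.

Lemma measurable_kern_comp d (X : measurableType d) (D : set X) (Z Y : X -> 'rV[R]_n) :
  (forall i, measurable_fun D (fun p => Z p 0 i)) -> (forall i, measurable_fun D (fun p => Y p 0 i)) ->
  measurable_fun D (fun p => kern (Z p) (Y p)).
Proof.
move=> mZ mY; apply: (measurableT_comp (measurable_powR _)); apply: measurable_enorm_comp => i.
by under eq_fun do rewrite !mxE; apply: measurable_funB; [exact: mZ|exact: mY].
Qed.

End kernel.

Section integral_estimates.
Context {dd : measure_display} {T : measurableType dd} {R : realType}.
Variables (mu : {measure set T -> \bar R}) (D : set T).
Hypothesis mD : measurable D.
Implicit Types f g : T -> R.

Lemma Rint_norm_le f g : mu.-integrable D (EFin \o f) -> mu.-integrable D (EFin \o g) ->
  (forall x, D x -> `|f x| <= g x) -> `|\int[mu]_(x in D) f x| <= \int[mu]_(x in D) g x.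
Proof.
move=> iF iG fg; apply: le_trans (le_normr_Rintegral mD iF) _.
by apply: le_Rintegral => //; exact: (integrable_norm iF).
Qed.

Lemma integrable_of_bound f (c : \bar R) : measurable_fun D f -> (forall x, 0 <= f x) ->
  (\int[mu]_(x in D) (f x)%:E <= c)%E -> (c < +oo)%E -> mu.-integrable D (EFin \o f).
Proof.
move=> mf f0 le lt; apply/integrableP; split; first exact/measurable_EFinP.
apply: le_lt_trans lt; apply: le_trans le; rewrite le_eqVlt; apply/orP; left; apply/eqP.
by apply: eq_integral => x _; rewrite /= ger0_norm.
Qed.

Lemma Rint_ge_subset f (A : set T) (c : R) : mu.-integrable D (EFin \o f) -> (forall x, 0 <= f x) ->
  measurable A -> A `<=` D -> 0 <= c -> (forall x, A x -> c <= f x) ->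
  (c%:E * mu A <= (\int[mu]_(x in D) f x)%:E)%E.
Proof.
move=> iF f0 mA AD c0 cf; apply: (@le_trans _ _ (\int[mu]_(x in A) (f x)%:E)%E).
  rewrite -integral_cst//; apply: ge0_le_integral => //.
  by apply/measurable_EFinP; exact: measurable_funS (integrableR_measurable iF).
rewrite /Rintegral fineK; last exact: integrable_fin_num.
apply: ge0_subset_integral => //; first by apply/measurable_EFinP; exact: integrableR_measurable iF.
by move=> x _; rewrite lee_fin.
Qed.

Lemma Rint_quotient f g (t : R) : mu.-integrable D (EFin \o f) -> mu.-integrable D (EFin \o g) ->
  (\int[mu]_(x in D) f x - \int[mu]_(x in D) g x) / t = \int[mu]_(x in D) ((f x - g x) / t).
Proof.
move=> iF iG; rewrite -RintegralB// RintegralZr//; exact: integrableRB.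
Qed.

End integral_estimates.

Lemma abs_mul_le (R : realDomainType) (a x y c : R) : 0 <= x -> 0 <= y -> x <= c * y ->
  `|a * x| <= c * `|a * y|.
Proof.
by move=> x0 y0 le; rewrite !normrM (ger0_norm x0) (ger0_norm y0) mulrCA; apply: ler_wpM2l.
Qed.

(** * Potentials of the kernel on Gamma *)

Section kernel_potential.
Context {R : realType} {n : nat} (d C0 : R) (Gamma : set 'rV[R]_n).
Hypothesis d_bounds : 0 < d < n%:R - 1.
Hypothesis Gamma_neq0 : Gamma !=set0.
Hypothesis Gamma_closed : closed Gamma.
Hypothesis C0_ge1 : 1 <= C0.
Hypothesis Gamma_AR : ahlfors_regular d C0 Gamma.
Local Notation L := (leb_space R n).
Local Notation H := (haus_space R n d).
Local Notation mu := (leb R n).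
Local Notation sigma := (haus n d).
Local Notation Omega := (~` Gamma : set L).
Local Notation G := (Gamma : set H).
Local Notation V := ('rV[R]_n -> R).
Local Notation edist := (Defs.edist Gamma).
Implicit Types (z y : 'rV[R]_n) (rho B t c : R) (i : 'I_n) (h : V).

(* With this exponent the energy of the extension is bounded below by an integral of
   max(|z - x|, |z - y|)^(-M) over z, and M exceeds both d and n. *)
Definition kexp : R := d + 1 + n%:R.
Local Notation M := kexp.
Local Notation k := (kern M).

Lemma kexp_gt0 : 0 < M.
Proof. by rewrite /kexp; have /andP[d0 _] := d_bounds; have : 0 <= n%:R :> R by []; lra. Qed.
Let M0 := kexp_gt0.

Let dM : d < M.
Proof. by rewrite /kexp; have : 0 <= n%:R :> R by []; lra. Qed.

Let mO : measurable Omega. Proof. exact: measurable_Omega. Qed.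

Lemma measurable_Gamma : measurable G.
Proof. exact: measurable_haus_closed. Qed.
Let mG := measurable_Gamma.

Lemma sigma_finite_on_Gamma : sigma_finite_on sigma G.
Proof.
have [y0 Gy0] := Gamma_neq0; exists (fun j => eball y0 j.+1%:R); split.
  move=> j; split; first by apply: measurable_haus_open; exact: open_eball.
  have j0 : 0 < j.+1%:R :> R by rewrite ltr0n.
  by rewrite setIC; have /andP[_ h] := Gamma_AR Gy0 j0; apply: le_lt_trans h (ltry _).
apply/seteqP; split => // z _; exists (Num.bound (enorm (z - y0))) => //=.
by rewrite /eball/=; apply: lt_le_trans (archi_boundP (enorm_ge0 _)) _; rewrite ler_nat.
Qed.

Lemma measurable_kern z : measurable_fun (setT : set H) (k z).
Proof.
apply: (@measurable_kern_comp R n M _ _ setT (fun=> z) (fun y : H => y : 'rV[R]_n)) => i; first exact: measurable_cst.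
exact: measurable_haus_coord.
Qed.

Lemma Omega_dist z y : ~ Gamma z -> Gamma y -> 0 < enorm (z - y).
Proof. by move=> nz Gy; apply: lt_le_trans (edist_gt0 Gamma_neq0 Gamma_closed nz) (edist_le z Gy). Qed.

Lemma nearest_Gamma z : ~ Gamma z -> exists2 y, Gamma y & enorm (z - y) < 2 * edist z.
Proof.
move=> nz; have e0 := edist_gt0 Gamma_neq0 Gamma_closed nz.
by apply: (edist_near Gamma_neq0); rewrite ltr_pMl// ltr1n.
Qed.

(** For an almost nearest point [y1] of Gamma, |y - y1| <= |z - y| + 2 dist(z) <= 3 |z - y|. This
    bounds the kernel by 3^M max(|y - y1|, dist(z))^(-M), whose dyadic sum converges because d <
    M. *)
Lemma integrable_kern z : ~ Gamma z -> sigma.-integrable G (EFin \o k z).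
Proof.
move=> nz; have e0 := edist_gt0 Gamma_neq0 Gamma_closed nz.
have [y1 Gy1 zy1] := nearest_Gamma nz.
have mk : measurable_fun G (k z) by apply: measurable_funTS; exact: measurable_kern.
have mr : measurable_fun (setT : set H) (fun y => enorm (y - y1)).
  by apply: measurable_haus_continuous; exact: continuous_enorm_sub.
have C00 : 0 <= C0 by exact: le_trans C0_ge1.
have growth t : 0 < t -> (sigma (G `&` [set y | (enorm (y - y1) < t)%R]) <= (C0 * t `^ d)%:E)%E.
  by move=> t0; have /andP[_] := Gamma_AR Gy1 t0.
have far : forall y, Gamma y -> k z y <= 3 `^ M * Num.max (enorm (y - y1)) (edist z) `^ (- M); last first.
  have le := @far_integral_le _ _ _ sigma G mG (k z) (fun y => enorm (y - y1)) C0 (3 `^ M) d M (edist z) mk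
    (fun y => kern_ge0 M z y) mr C00 (powR_ge0 _ _) e0 growth (ltW M0) dM far.
  exact: (@integrable_of_bound _ _ _ sigma G (k z) _ mk (kern_ge0 M z) le (ltry _)).
move=> y Gy.
have zy := edist_le z Gy; have := enormB y z y1; rewrite (enorm_sub y z) => tri.
have m0 : 0 < Num.max (enorm (y - y1)) (edist z) by rewrite lt_max e0 orbT.
have m3 : Num.max (enorm (y - y1)) (edist z) <= 3 * enorm (z - y) by rewrite ge_max; apply/andP; split; lra.
have := powR_anti m0 m3 (ltW M0); rewrite powRM ?enorm_ge0// [3 `^ (- _)]powRN.
by rewrite ler_pdivrMl ?powR_gt0.
Qed.

Definition den z : R := \int[sigma]_(y in G) k z y.

Definition den_cst : R := C0^-1 * 3 `^ (- M).

Lemma den_cst_gt0 : 0 < den_cst.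
Proof. by rewrite mulr_gt0 ?powR_gt0// invr_gt0 (lt_le_trans ltr01). Qed.

(** All points of Gamma in the ball of radius dist(z) about an almost nearest point lie within 3
    dist(z) of [z], and lower regularity bounds their measure from below. *)
Lemma den_ge z : ~ Gamma z -> den_cst * edist z `^ (d - M) <= den z.
Proof.
move=> nz; have e0 := edist_gt0 Gamma_neq0 Gamma_closed nz.
have [y1 Gy1 zy1] := nearest_Gamma nz.
have ik := integrable_kern nz.
set A := (Gamma `&` eball y1 (edist z) : set H).
have mA : measurable A by exact: measurable_Gamma_eball.
have AG : A `<=` G by move=> y [].
have /andP[lo _] := Gamma_AR Gy1 e0.
have p0 : 0 <= (3 * edist z) `^ (- M) by exact: powR_ge0.
have near y : A y -> (3 * edist z) `^ (- M) <= k z y.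
  move=> [Gy yy]; apply: powR_anti (ltW M0); first exact: Omega_dist.
  have yy' : enorm (y - y1) < edist z by exact: yy.
  by have := enormB z y1 y; rewrite (enorm_sub y1 y); lra.
have le1 := Rint_ge_subset mG ik (fun y => kern_ge0 M z y) mA AG p0 near.
rewrite -lee_fin; apply: le_trans le1.
apply: le_trans (_ : (((3 * edist z) `^ (- M))%:E * (C0^-1 * edist z `^ d)%:E <= _)%E); last first.
  by apply: lee_wpmul2l; [rewrite lee_fin|exact: lo].
rewrite -EFinM lee_fin powRM ?(ltW e0)// /den_cst powRD; last by apply/implyP => _; rewrite gt_eqF.
by rewrite le_eqVlt; apply/orP; left; apply/eqP; ring.
Qed.

Lemma den_gt0 z : ~ Gamma z -> 0 < den z.
Proof.
move=> nz; apply: lt_le_trans (den_ge nz).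
by rewrite mulr_gt0 ?den_cst_gt0// powR_gt0// edist_gt0.
Qed.

Variable z0 : 'rV[R]_n.
Hypothesis nz0 : ~ Gamma z0.

(** For [z] in a shell the ratio of |z - y| and |z0 - y| is bounded above and below uniformly over y
    in Gamma. Integrability at the single point [z0] therefore dominates all potentials and their
    derivatives on the shell. *)
Lemma kern_shell_le rho B : 0 < rho -> exists2 c, 0 <= c &
  forall z y, shell Gamma rho B z -> Gamma y -> k z y <= c * k z0 y /\ k z0 y <= c * k z y.
Proof.
move=> r0; have e0 := edist_gt0 Gamma_neq0 Gamma_closed nz0.
pose S : R := enorm z0 + `|B|; have S0 : 0 <= S by rewrite addr_ge0 ?enorm_ge0.
pose a : R := 1 + S / rho + S / edist z0.
have a0 : 0 < a by rewrite /a -addrA ltr_wpDr// addr_ge0// divr_ge0// ltW.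
exists (a `^ M); first exact: powR_ge0.
move=> z y [rz zB] Gy.
have zz0 : enorm (z - z0) <= S.
  have := enormB z 0 z0; rewrite subr0 sub0r -[enorm (- z0)]/(enorm (- z0)) -sub0r enorm_sub subr0.
  by have := ler_norm B; rewrite /S; lra.
have p1 := le_trans rz (edist_le z Gy); have p2 := edist_le z0 Gy.
have pos1 := lt_le_trans r0 p1; have pos2 := lt_le_trans e0 p2.
have s1 : S <= S / rho * enorm (z - y).
  by rewrite -mulrA ler_peMr// mulrC ler_pdivlMr// mul1r.
have s2 : S <= S / edist z0 * enorm (z0 - y).
  by rewrite -mulrA ler_peMr// mulrC ler_pdivlMr// mul1r.
have sn1 : 0 <= S / rho by rewrite divr_ge0// ltW.
have sn2 : 0 <= S / edist z0 by rewrite divr_ge0// ltW.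
have q1 : 0 <= S / edist z0 * enorm (z - y) by rewrite mulr_ge0 ?enorm_ge0.
have q2 : 0 <= S / rho * enorm (z0 - y) by rewrite mulr_ge0 ?enorm_ge0.
split; apply: kern_le => //.
- by have := enormB z0 z y; rewrite (enorm_sub z0 z) /a; lra.
- by have := enormB z z0 y; rewrite /a; lra.
Qed.

Section weighted.
Variable h : V.
Hypothesis mh : measurable_fun (setT : set H) h.
Hypothesis ih0 : sigma.-integrable G (EFin \o (fun y => h y * k z0 y)).

Definition kpot z : R := \int[sigma]_(y in G) (h y * k z y).
Definition dkpot i z : R := \int[sigma]_(y in G) (h y * partial i (k ^~ y) z).

Let mhk z : measurable_fun G (fun y => h y * k z y).
Proof. by apply: measurable_funM; apply: measurable_funTS; [exact: mh|exact: measurable_kern]. Qed.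

Let iabs : sigma.-integrable G (EFin \o (fun y => `|h y * k z0 y|)).
Proof. exact: (integrable_norm ih0). Qed.

Let I0 := \int[sigma]_(y in G) `|h y * k z0 y|.

Let weighted_le c z y : k z y <= c * k z0 y -> `|h y * k z y| <= c * `|h y * k z0 y|.
Proof.
exact: (abs_mul_le (h y) (kern_ge0 M z y) (kern_ge0 M z0 y)).
Qed.

Lemma integrable_weighted z : ~ Gamma z -> sigma.-integrable G (EFin \o (fun y => h y * k z y)).
Proof.
move=> nz; have e0 := edist_gt0 Gamma_neq0 Gamma_closed nz.
have [c c0 Hc] := kern_shell_le (enorm z) e0.
apply: (integrable_le mG (mhk z) (integrableRZ c mG iabs)) => y Gy.
have [|le _] := Hc z y _ Gy; first by split.
exact: weighted_le.
Qed.

Lemma kpot_bounded rho B : 0 < rho -> exists C, forall z, shell Gamma rho B z -> `|kpot z| <= C.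
Proof.
move=> r0; have [c c0 Hc] := kern_shell_le B r0; exists (c * I0) => z Sz.
have nz := shell_Omega r0 Sz; have iz := integrable_weighted nz.
rewrite /I0 -(RintegralZl _ mG iabs).
apply: (Rint_norm_le mG iz (integrableRZ c mG iabs)) => y Gy.
by have [le _] := Hc z y Sz Gy; exact: weighted_le.
Qed.

Let kern_diff_le i rho B : 0 < rho -> exists2 c, 0 <= c & forall z t y, shell Gamma (2 * rho) B z ->
  0 < t <= rho -> Gamma y -> `|k (z + hv i t) y - k z y| <= c * k z0 y * t.
Proof.
move=> r0; have [c c0 Hc] := kern_shell_le (B + rho) r0.
exists (M / rho * c); first by rewrite mulr_ge0// divr_ge0// ltW.
move=> z t y Sz /andP[t0 tr] Gy; rewrite -[_ * c * _]mulrA.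
apply: kern_lip => //; first exact: ltW.
move=> s /andP[s0 st]; have Ss : shell Gamma rho (B + rho) (z + hv i s).
  by apply: shell_hv => //; rewrite s0 (le_trans st).
split; last by have [] := Hc _ _ Ss Gy.
by case: Ss => a _; apply: le_trans a (edist_le _ Gy).
Qed.

Lemma kpot_lip i rho B : 0 < rho -> exists C, forall z t, shell Gamma (2 * rho) B z -> 0 < t <= rho ->
  `|kpot (z + hv i t) - kpot z| <= C * t.
Proof.
move=> r0; have [c c0 Hc] := kern_diff_le i B r0; exists (c * I0) => z t Sz tr.
have r20 : 0 < 2 * rho by rewrite mulr_gt0.
have nz := shell_Omega r20 Sz; have iz := integrable_weighted nz.
have nzt : ~ Gamma (z + hv i t).
  have /andP[t0 t1] := tr; apply: (shell_Omega r0 (M := B + rho)); apply: shell_hv => //.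
  by rewrite (ltW t0).
have izt := integrable_weighted nzt.
rewrite /kpot -(RintegralB mG izt iz) /I0 mulrAC -(RintegralZl _ mG iabs).
apply: (Rint_norm_le mG (integrableRB mG izt iz) (integrableRZ (c * t) mG iabs)) => y Gy.
rewrite -mulrBr !normrM [`|k z0 y|]ger0_norm ?kern_ge0// mulrCA.
by apply: ler_wpM2l => //; rewrite mulrAC; exact: Hc.
Qed.

(** The difference quotients of the kernel are at most c k(z0, y), so dominated convergence applies
    under the integral. The first j0 terms are dropped to keep the shifted points in a shell. *)
Lemma kpot_quotient i (s : nat -> R) z : (forall j, 0 < s j) -> s j @[j --> \oo] --> (0 : R) -> ~ Gamma z ->
  (kpot (z + hv i (s j)) - kpot z) / s j @[j --> \oo] --> dkpot i z.
Proof.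
move=> s0 sc nz; have e0 := edist_gt0 Gamma_neq0 Gamma_closed nz.
pose rho := edist z / 2; have r0 : 0 < rho by rewrite divr_gt0.
have Sz : shell Gamma (2 * rho) (enorm z) z by split; rewrite // /rho mulrC divfK.
have [c c0 Hc] := kern_diff_le i (enorm z) r0.
have [j0 _ Hj] : \forall j \near \oo, s j <= rho by apply: (cvgr_le _ sc).
have iz := integrable_weighted nz.
have sj j : 0 < s (j + j0)%N <= rho by rewrite s0; apply: Hj; rewrite /= leq_addl.
have nzt j : ~ Gamma (z + hv i (s (j + j0)%N)).
  have /andP[t0 t1] := sj j; apply: (shell_Omega r0 (M := enorm z + rho)).
  by apply: (shell_hv Gamma_neq0 i _ Sz); rewrite (ltW t0).
rewrite -(cvg_shiftn j0) /=.
have E j : (kpot (z + hv i (s (j + j0)%N)) - kpot z) / s (j + j0)%N =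
    \int[sigma]_(y in G) (h y * ((k (z + hv i (s (j + j0)%N)) y - k z y) / s (j + j0)%N)).
  rewrite /kpot (Rint_quotient mG _ (integrable_weighted (nzt j)) iz).
  by apply: eq_Rintegral => y _; rewrite -mulrBr mulrA.
under eq_fun do rewrite E.
have mk y := measurable_kern y.
have [|||_ //] := @dct_eventually _ _ _ sigma G
  (fun j y => h y * ((k (z + hv i (s (j + j0)%N)) y - k z y) / s (j + j0)%N))
  (fun y => h y * partial i (k ^~ y) z) _ mG _ (integrableRZ c mG iabs).
- move=> j; apply: measurable_funTS; apply: measurable_funM; first exact: mh.
  by apply: measurable_funM; [apply: measurable_funB; exact: mk|exact: measurable_cst].
- move=> j y Gy; have /andP[t0 t1] := sj j.
  rewrite !normrM (ger0_norm (kern_ge0 _ _ _)) normfV (gtr0_norm t0) [leRHS]mulrCA.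
  by apply: ler_wpM2l => //; rewrite ler_pdivrMr//; apply: Hc => //; exact: sj.
- move=> y Gy; apply: cvgM; first exact: cvg_cst.
  apply: (@partial_quotient R n (k ^~ y) i z (fun j => s (j + j0)%N)).
  + by have [] := kern_derive M i (Omega_dist nz Gy).
  + by move=> j; rewrite gt_eqF.
  + by have := sc; rewrite -(cvg_shiftn j0).
Qed.

Lemma measurable_kpot : measurable_fun Omega kpot.
Proof.
pose f (p : L * H) : \bar R := (h p.2 * k p.1 p.2)%:E.
have mf : measurable_fun (Omega `*` G) f.
  apply: measurable_funTS; apply/measurable_EFinP; apply: measurable_funM.
    exact: (measurableT_comp mh measurable_snd).
  apply: (@measurable_kern_comp R n M _ _ setT (fun p : L * H => p.1 : 'rV[R]_n) (fun p : L * H => p.2 : 'rV[R]_n)) => i.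
  - exact: (measurableT_comp (measurable_leb_coord i) measurable_fst).
  - exact: (measurableT_comp (measurable_haus_coord i) measurable_snd).
have mp := measurable_integral_on mO mG sigma_finite_on_Gamma (measurable_funepos mf) (fun _ => funepos_ge0 _ _).
have mn := measurable_integral_on mO mG sigma_finite_on_Gamma (measurable_funeneg mf) (fun _ => funeneg_ge0 _ _).
rewrite /kpot /Rintegral; apply: (measurableT_comp (f := fine)); first exact: fine_measurable.
have -> : (fun z => \int[sigma]_(y in G) (h y * k z y)%:E)%E =
  (fun z => \int[sigma]_(y in G) (f^\+ (z, y)) - \int[sigma]_(y in G) (f^\- (z, y)))%E.
  apply/funext => z; rewrite integralE; congr (_ - _)%E; apply: eq_integral => y _; by rewrite ?funeposE ?funenegE.
by apply: emeasurable_funB.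
Qed.

End weighted.
End kernel_potential.

(** * Quotient rule for difference quotients *)

Section quotient_rule.
Context {R : realType} {n : nat} (Gamma : set 'rV[R]_n).
Hypothesis Gamma_neq0 : Gamma !=set0.
Hypothesis Gamma_closed : closed Gamma.
Local Notation L := (leb_space R n).
Local Notation Omega := (~` Gamma : set L).
Local Notation V := ('rV[R]_n -> R).
Local Notation edist := (Defs.edist Gamma).
Implicit Types (z : 'rV[R]_n) (rho B t : R).

Definition shell_bounded (f : V) := forall rho B, 0 < rho -> exists C, forall z, shell Gamma rho B z -> `|f z| <= C.
Definition shell_lip (i : 'I_n) (f : V) := forall rho B, 0 < rho -> exists C, forall z t,
  shell Gamma (2 * rho) B z -> 0 < t <= rho -> `|f (z + hv i t) - f z| <= C * t.
Definition has_quotient (i : 'I_n) (f G : V) := forall (s : nat -> R) z, (forall j, 0 < s j) ->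
  s j @[j --> \oo] --> (0 : R) -> ~ Gamma z -> (f (z + hv i (s j)) - f z) / s j @[j --> \oo] --> G z.

Variables (N D : V).
Hypothesis D0 : forall z, ~ Gamma z -> 0 < D z.
Hypothesis D1 : shell_bounded (fun z => (D z)^-1).
Hypothesis bN : shell_bounded N.

Lemma shell_bounded_div : shell_bounded (fun z => N z / D z).
Proof.
move=> rho B r0; have [C HC] := bN B r0; have [C' HC'] := D1 B r0.
by exists (C * C') => z Sz; rewrite normrM; apply: ler_pM => //; [exact: HC|exact: HC'].
Qed.

Lemma shell_lip_div i : shell_lip i N -> shell_lip i D -> shell_lip i (fun z => N z / D z).
Proof.
move=> lN lD rho B r0; have r20 : 0 < 2 * rho by rewrite mulr_gt0.
have [c1 H1] := lN rho B r0; have [c2 H2] := lD rho B r0.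
have [c3 H3] := bN B r20; have [c4 H4] := D1 B r20; have [c5 H5] := D1 (B + rho) r0.
exists (c1 * c5 + c3 * c2 * (c4 * c5)) => z t Sz tr.
have Szt : shell Gamma rho (B + rho) (z + hv i t).
  by have /andP[t0 t1] := tr; apply: (shell_hv Gamma_neq0 i _ Sz); rewrite (ltW t0).
have Dz := D0 (shell_Omega r20 Sz); have Dzt := D0 (shell_Omega r0 Szt).
have -> : N (z + hv i t) / D (z + hv i t) - N z / D z =
    (N (z + hv i t) - N z) * (D (z + hv i t))^-1
    - N z * (D (z + hv i t) - D z) * ((D z)^-1 * (D (z + hv i t))^-1).
  by field; rewrite !gt_eqF.
apply: le_trans (ler_normB _ _) _; rewrite [leRHS]mulrDl; apply: lerD.
  by rewrite normrM mulrAC; apply: ler_pM => //; [exact: H1|exact: H5].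
have e1 : `|N z * (D (z + hv i t) - D z)| <= c3 * (c2 * t).
  by rewrite normrM; apply: ler_pM; [exact: normr_ge0|exact: normr_ge0|exact: H3|exact: H2].
have e2 : `|(D z)^-1 * (D (z + hv i t))^-1| <= c4 * c5.
  by rewrite normrM; apply: ler_pM; [exact: normr_ge0|exact: normr_ge0|exact: H4|exact: H5].
rewrite normrM; have -> : c3 * c2 * (c4 * c5) * t = c3 * (c2 * t) * (c4 * c5) by ring.
exact: (ler_pM (normr_ge0 _) (normr_ge0 _) e1 e2).
Qed.

Lemma has_quotient_div i N' D' : has_quotient i N N' -> has_quotient i D D' ->
  has_quotient i (fun z => N z / D z) (fun z => (N' z * D z - N z * D' z) / D z ^+ 2).
Proof.
move=> hN hD s z s0 sc nz; have e0 := edist_gt0 Gamma_neq0 Gamma_closed nz.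
have cN := hN s z s0 sc nz; have cD := hD s z s0 sc nz.
have cDs : D (z + hv i (s j)) @[j --> \oo] --> D z.
  have -> : (fun j => D (z + hv i (s j))) = (fun j => D z + s j * ((D (z + hv i (s j)) - D z) / s j)).
    by apply/funext => j; rewrite [s j * _]mulrC divfK ?gt_eqF//; ring.
  rewrite -[X in _ --> X]addr0 -[X in _ --> _ + X](mul0r (D' z)).
  by apply: cvgD; [exact: cvg_cst|apply: cvgM].
have lim : ((N (z + hv i (s j)) - N z) / s j * D z - N z * ((D (z + hv i (s j)) - D z) / s j)) *
    (D z * D (z + hv i (s j)))^-1 @[j --> \oo] --> (N' z * D z - N z * D' z) / D z ^+ 2.
  apply: cvgM.
    by apply: cvgB; apply: cvgM => //; exact: cvg_cst.
  rewrite expr2; apply: cvgV; first by rewrite mulf_neq0// gt_eqF// D0.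
  by apply: cvgM => //; exact: cvg_cst.
apply: cvg_trans lim; apply: near_eq_cvg.
have [j0 _ Hj] : \forall j \near \oo, s j < edist z by apply: (cvgr_lt _ sc).
exists j0 => // j /Hj sj.
have nzt : ~ Gamma (z + hv i (s j)).
  move=> /(edist_le z); rewrite opprD addrA subrr sub0r -[- _]sub0r enorm_sub subr0 enorm_hv ?(ltW (s0 j))//.
  by rewrite leNgt sj.
have Dz := D0 nz; have Dzt := D0 nzt.
by field; rewrite !gt_eqF.
Qed.

End quotient_rule.

Section cauchy_schwarz.
Context {dd : measure_display} {T : measurableType dd} {R : realType}.
Variables (mu : {measure set T -> \bar R}) (D : set T).
Hypothesis mD : measurable D.

(** The inequality 2 l |f| <= l^2 + f^2 is integrated against k with l = A / K. An infinite
    right-hand side is allowed, so square integrability need not be known beforehand. *)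
Lemma weighted_cauchy_schwarz (f k : T -> R) (A K : R) : measurable_fun D f -> (forall x, 0 <= k x) ->
  mu.-integrable D (EFin \o k) -> mu.-integrable D (EFin \o (fun x => `|f x| * k x)) ->
  K = \int[mu]_(x in D) k x -> A = \int[mu]_(x in D) (`|f x| * k x) -> 0 < K ->
  ((A ^+ 2 / K)%:E <= \int[mu]_(x in D) (f x ^+ 2 * k x)%:E)%E.
Proof.
move=> mf k0 ik ifk KE AE K0.
have mk := integrableR_measurable ik.
have f20 x : 0 <= f x ^+ 2 * k x by rewrite mulr_ge0// sqr_ge0.
have mf2 : measurable_fun D (fun x => f x ^+ 2 * k x).
  by apply: measurable_funM => //; exact: measurable_funX.
have [->|fin] := eqVneq (\int[mu]_(x in D) (f x ^+ 2 * k x)%:E)%E +oo%E; first by rewrite leey.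
have i2 : mu.-integrable D (EFin \o (fun x => f x ^+ 2 * k x)).
  by apply: (integrable_of_bound mf2 f20 (lexx _)); rewrite ltey.
rewrite -[leRHS]fineK; last exact: (integrable_fin_num mD i2).
rewrite lee_fin -[fine _]/(\int[mu]_(x in D) (f x ^+ 2 * k x)).
set Q := \int[mu]_(x in D) (f x ^+ 2 * k x).
pose l := A / K.
have : 2 * l * A <= l ^+ 2 * K + Q.
  rewrite {1}AE KE -(RintegralZl _ mD ifk) -(RintegralZl _ mD ik) -RintegralD//; last exact: integrableRZ.
  apply: le_Rintegral => //; [exact: integrableRZ|apply: integrableRD => //; exact: integrableRZ|].
  move=> x Dx; rewrite mulrA -mulrDl; apply: ler_wpM2r => //.
  by have := sqr_ge0 (l - `|f x|); rewrite -[f x ^+ 2]real_normK ?num_real//; lra.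
have -> : 2 * l * A = 2 * (A ^+ 2 / K) by rewrite /l; field; rewrite gt_eqF.
have -> : l ^+ 2 * K = A ^+ 2 / K by rewrite /l; field; rewrite gt_eqF.
by lra.
Qed.

End cauchy_schwarz.

Section averages.
Context {dd : measure_display} {T : measurableType dd} {R : realType}.
Variables (mu : {measure set T -> \bar R}) (D : set T).
Hypothesis mD : measurable D.

Lemma average_le (k : T -> R) (F : T -> \bar R) (c : R) : 0 <= c -> mu.-integrable D (EFin \o k) ->
  (forall x, 0 <= k x) -> measurable_fun D F -> (forall x, D x -> ((c * k x)%:E <= F x)%E) ->
  ((c * \int[mu]_(x in D) k x)%:E <= \int[mu]_(x in D) F x)%E.
Proof.
move=> c0 ik k0 mF kF; have ick := integrableRZ c mD ik.
rewrite -(RintegralZl c mD ik) /Rintegral fineK; last exact: (integrable_fin_num mD ick).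
apply: ge0_le_integral => //.
- by move=> x _; rewrite lee_fin mulr_ge0.
- by apply/measurable_EFinP; exact: integrableR_measurable ick.
Qed.

Lemma scaled_bound (f : T -> R) (a b c : R) : measurable_fun D f -> (forall x, 0 <= f x) -> 0 <= c ->
  (a%:E <= b%:E * \int[mu]_(x in D) (f x)%:E)%E ->
  ((a * c)%:E <= b%:E * \int[mu]_(x in D) (f x * c)%:E)%E.
Proof.
move=> mf f0 c0 le; have -> : (\int[mu]_(x in D) (f x * c)%:E = \int[mu]_(x in D) (f x)%:E * c%:E)%E.
  rewrite -ge0_integralZr//; first exact/measurable_EFinP.
  by move=> x _; rewrite lee_fin.
by rewrite muleA EFinM; apply: lee_wpmul2r => //; rewrite lee_fin.
Qed.

End averages.

Lemma inv_norm_le (R : realFieldType) (a b c : R) : 0 < a -> 0 < b -> b <= c * a -> `|a^-1| <= c / b.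
Proof.
by move=> a0 b0 le; rewrite normfV (gtr0_norm a0) ler_pdivlMr// mulrC ler_pdivrMr.
Qed.

(** * The extension and its gradient *)

Section extension.
Context {R : realType} {n : nat} (d C0 : R) (Gamma : set 'rV[R]_n).
Hypothesis d_bounds : 0 < d < n%:R - 1.
Hypothesis Gamma_neq0 : Gamma !=set0.
Hypothesis Gamma_closed : closed Gamma.
Hypothesis C0_ge1 : 1 <= C0.
Hypothesis Gamma_AR : ahlfors_regular d C0 Gamma.
Local Notation L := (leb_space R n).
Local Notation H := (haus_space R n d).
Local Notation mu := (leb R n).
Local Notation sigma := (haus n d).
Local Notation Omega := (~` Gamma : set L).
Local Notation G := (Gamma : set H).
Local Notation V := ('rV[R]_n -> R).
Local Notation edist := (Defs.edist Gamma).
Local Notation M := (@kexp R n d).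
Local Notation k := (kern M).
Local Notation kpot := (kpot d Gamma).
Local Notation dkpot := (dkpot d Gamma).
Local Notation D := (kpot (cst 1)).
Implicit Types (z y x : 'rV[R]_n) (rho B t c : R) (i : 'I_n) (h : V).

Let mO : measurable Omega. Proof. exact: measurable_Omega. Qed.
Let mG : measurable G. Proof. exact: measurable_Gamma. Qed.
Let M0 : 0 < M. Proof. exact: (kexp_gt0 d_bounds). Qed.
Let Gnull := Gamma_null d_bounds Gamma_neq0 Gamma_AR.

Variables (z0 : 'rV[R]_n) (g : V).
Hypothesis nz0 : ~ Gamma z0.
Hypothesis mg : measurable_fun (setT : set H) g.
Hypothesis ig0 : sigma.-integrable G (EFin \o (fun y => g y * k z0 y)).

Let m1 : measurable_fun (setT : set H) (cst 1 : V). Proof. exact: measurable_cst. Qed.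

Let i10 : sigma.-integrable G (EFin \o (fun y => (cst 1 : V) y * k z0 y)).
Proof.
have := integrable_kern d_bounds Gamma_neq0 Gamma_closed C0_ge1 Gamma_AR nz0.
by under [X in _ -> sigma.-integrable _ (EFin \o X)]eq_fun do rewrite mul1r.
Qed.

Lemma den_kpot z : D z = den d Gamma z.
Proof. by apply: eq_Rintegral => y _; rewrite /= mul1r. Qed.

Lemma kpot1_gt0 z : ~ Gamma z -> 0 < D z.
Proof. by move=> nz; rewrite den_kpot; exact: (den_gt0 d_bounds Gamma_neq0 Gamma_closed C0_ge1 Gamma_AR nz). Qed.

Lemma kpot1_ge z : ~ Gamma z -> @den_cst R n d C0 * edist z `^ (d - M) <= D z.
Proof. by move=> nz; rewrite den_kpot; exact: (den_ge d_bounds Gamma_neq0 Gamma_closed C0_ge1 Gamma_AR nz). Qed.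

Let ik z : ~ Gamma z -> sigma.-integrable G (EFin \o k z).
Proof. exact: (integrable_kern d_bounds Gamma_neq0 Gamma_closed C0_ge1 Gamma_AR). Qed.

Lemma kpot1_shell : shell_bounded Gamma (fun z => (D z)^-1).
Proof.
move=> rho B r0; have [c c0 Hc] := kern_shell_le d_bounds Gamma_neq0 Gamma_closed nz0 B r0.
exists (c / D z0) => z Sz; have nz := shell_Omega r0 Sz.
have Dz := kpot1_gt0 nz; have Dz0 := kpot1_gt0 nz0.
apply: (inv_norm_le Dz Dz0); rewrite !den_kpot /den.
rewrite -(RintegralZl c mG (ik nz)); apply: le_trans (ler_norm _) _.
apply: (Rint_norm_le mG (ik nz0) (integrableRZ c mG (ik nz))) => y Gy.
by rewrite ger0_norm ?kern_ge0//; have [_] := Hc z y Sz Gy.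
Qed.

Definition ext z : R := kpot g z / D z.
Definition dext i z : R := (dkpot g i z * D z - kpot g z * dkpot (cst 1) i z) / D z ^+ 2.

Lemma measurable_ext : measurable_fun Omega ext.
Proof.
apply: measurable_funM.
  exact: (measurable_kpot Gamma_neq0 Gamma_closed Gamma_AR mg).
have -> : (fun z => (D z)^-1) = (fun z => D z `^ (-1)).
  apply/funext => z; rewrite powR_inv1//; apply: Rintegral_ge0 => y _.
  by rewrite /= mul1r kern_ge0.
apply: (measurableT_comp (measurable_powR _)).
exact: (measurable_kpot Gamma_neq0 Gamma_closed Gamma_AR m1).
Qed.

Lemma ext_wgrad : loc_integrable (~` Gamma) ext /\ is_wgrad (~` Gamma) ext (fun z => \row_i dext i z).
Proof.
have bg := kpot_bounded d_bounds Gamma_neq0 Gamma_closed nz0 mg ig0.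
have main i := @wgrad_of_quotients R n Gamma Gamma_neq0 Gamma_closed Gnull i ext (dext i) measurable_ext
  (shell_bounded_div kpot1_shell bg)
  (shell_lip_div Gamma_neq0 kpot1_gt0 kpot1_shell bg
    (kpot_lip d_bounds Gamma_neq0 Gamma_closed nz0 mg ig0 i) (kpot_lip d_bounds Gamma_neq0 Gamma_closed nz0 m1 i10 i))
  (has_quotient_div Gamma_neq0 Gamma_closed kpot1_gt0
    (@kpot_quotient R n d Gamma d_bounds Gamma_neq0 Gamma_closed z0 nz0 g mg ig0 i)
    (@kpot_quotient R n d Gamma d_bounds Gamma_neq0 Gamma_closed z0 nz0 (cst 1) m1 i10 i)).
have n0 : (0 < n)%N.
  by have /andP[d0 d1] := d_bounds; case: (posnP n) d1 => // ->; move=> d1; lra.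
split; first by have [] := main (Ordinal n0).
move=> i; have [_ [li Hi]] := main i.
have -> : (fun z => (\row_i dext i z) 0 i) = dext i by apply/funext => z; rewrite mxE.
split; first exact: li.
move=> phi tp; rewrite (Hi phi tp); congr (- _)%E; apply: eq_integral => z _.
by rewrite mxE.
Qed.

Lemma measurable_dkern i z : ~ Gamma z -> measurable_fun G (fun y => partial i (k ^~ y) z).
Proof.
move=> nz; apply: (eq_measurable_fun (fun y : H => - M * (z - (y : 'rV[R]_n)) 0 i * enorm (z - (y : 'rV[R]_n)) `^ (- M - 2) : R)).
  move=> y; rewrite inE => Gy.
  by have [_ ->] := kern_derive M i (Omega_dist Gamma_neq0 Gamma_closed nz Gy).
apply: measurable_funTS; apply: measurable_funM.
  apply: measurable_funM; first exact: measurable_cst.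
  under eq_fun do rewrite !mxE; apply: measurable_funB; first exact: measurable_cst.
  exact: measurable_haus_coord.
apply: (measurableT_comp (measurable_powR _)).
apply: (@measurable_enorm_comp R n _ _ setT (fun y : H => z - (y : 'rV[R]_n))) => j.
under eq_fun do rewrite !mxE; apply: measurable_funB; first exact: measurable_cst.
exact: measurable_haus_coord.
Qed.

Section weighted_gradient.
Variable h : V.
Hypothesis mh : measurable_fun (setT : set H) h.
Hypothesis ih0 : sigma.-integrable G (EFin \o (fun y => h y * k z0 y)).

Let ih z : ~ Gamma z -> sigma.-integrable G (EFin \o (fun y => h y * k z y)).
Proof. exact: (integrable_weighted d_bounds Gamma_neq0 Gamma_closed nz0 mh ih0). Qed.

Lemma dweighted_le i z y : ~ Gamma z -> Gamma y ->
  `|h y * partial i (k ^~ y) z| <= M / edist z * `|h y * k z y|.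
Proof.
move=> nz Gy; have e0 := edist_gt0 Gamma_neq0 Gamma_closed nz.
rewrite [`|h y * k z y|]normrM (ger0_norm (kern_ge0 _ _ _)) normrM mulrCA; apply: ler_wpM2l => //.
exact: (kern_partial_le M0 i e0 (edist_le z Gy)).
Qed.

Lemma integrable_dweighted i z : ~ Gamma z ->
  sigma.-integrable G (EFin \o (fun y => h y * partial i (k ^~ y) z)).
Proof.
move=> nz; have iN : sigma.-integrable G (EFin \o (fun y => `|h y * k z y|)) by exact: (integrable_norm (ih nz)).
have mhp : measurable_fun G (fun y => h y * partial i (k ^~ y) z).
  by apply: measurable_funM; [exact: measurable_funTS|exact: measurable_dkern].
by apply: (integrable_le mG mhp (integrableRZ (M / edist z) mG iN)) => y Gy; exact: dweighted_le.
Qed.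

Lemma dkpot_le i z : ~ Gamma z ->
  `|dkpot h i z| <= M / edist z * \int[sigma]_(y in G) `|h y * k z y|.
Proof.
move=> nz; have iN : sigma.-integrable G (EFin \o (fun y => `|h y * k z y|)) by exact: (integrable_norm (ih nz)).
rewrite -(RintegralZl _ mG iN).
by apply: (Rint_norm_le mG (integrable_dweighted i nz) (integrableRZ _ mG iN)) => y Gy; exact: dweighted_le.
Qed.

Lemma kpot_abs_le z : ~ Gamma z -> `|kpot h z| <= \int[sigma]_(y in G) `|h y * k z y|.
Proof.
move=> nz; have iN : sigma.-integrable G (EFin \o (fun y => `|h y * k z y|)) by exact: (integrable_norm (ih nz)).
exact: (Rint_norm_le mG (ih nz) iN).
Qed.

End weighted_gradient.

Lemma integrable_sub_cst c : sigma.-integrable G (EFin \o (fun y => (g y - c) * k z0 y)).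
Proof.
have := integrableRB mG ig0 (integrableRZ c mG (ik nz0)).
by under [X in _ -> sigma.-integrable _ (EFin \o X)]eq_fun do rewrite mulrBl.
Qed.

Let mgc c : measurable_fun (setT : set H) (fun y => g y - c).
Proof. by apply: measurable_funB; [exact: mg|exact: measurable_cst]. Qed.

Let iw z : ~ Gamma z -> sigma.-integrable G (EFin \o (fun y => g y * k z y)).
Proof. exact: (integrable_weighted d_bounds Gamma_neq0 Gamma_closed nz0 mg ig0). Qed.

Let i1 z : ~ Gamma z -> sigma.-integrable G (EFin \o (fun y => (cst 1 : V) y * k z y)).
Proof. exact: (integrable_weighted d_bounds Gamma_neq0 Gamma_closed nz0 m1 i10). Qed.

Lemma kpot_sub_cst c z : ~ Gamma z -> kpot (fun y => g y - c) z = kpot g z - c * D z.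
Proof.
move=> nz; rewrite -(RintegralZl c mG (i1 nz)) -(RintegralB mG (iw nz) (integrableRZ c mG (i1 nz))).
by apply: eq_Rintegral => y _; rewrite mulrBl mul1r.
Qed.

Lemma dkpot_sub_cst c i z : ~ Gamma z -> dkpot (fun y => g y - c) i z = dkpot g i z - c * dkpot (cst 1) i z.
Proof.
move=> nz; have j1 := integrable_dweighted m1 i10 i nz; have jg := integrable_dweighted mg ig0 i nz.
rewrite -(RintegralZl c mG j1) -(RintegralB mG jg (integrableRZ c mG j1)).
by apply: eq_Rintegral => y _; rewrite mulrBl mul1r.
Qed.

(* Subtracting a constant from [g] does not change the gradient. *)
Lemma dext_le c i z : ~ Gamma z ->
  `|dext i z| <= 2 * M / edist z * (\int[sigma]_(y in G) `|(g y - c) * k z y| / D z).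
Proof.
move=> nz; have Dz := kpot1_gt0 nz; have e0 := edist_gt0 Gamma_neq0 Gamma_closed nz.
set A := \int[sigma]_(y in G) _.
have a1 := dkpot_le (mgc c) (integrable_sub_cst c) i nz; have a2 := kpot_abs_le (mgc c) (integrable_sub_cst c) nz.
have a3 := dkpot_le m1 i10 i nz; rewrite -/A in a1 a2.
have E1 : \int[sigma]_(y in G) `|(cst 1 : V) y * k z y| = D z.
  by apply: eq_Rintegral => y _; rewrite /= mul1r ger0_norm ?kern_ge0.
rewrite E1 in a3.
have -> : dext i z = dkpot (fun y => g y - c) i z / D z
    - kpot (fun y => g y - c) z * (dkpot (cst 1) i z / D z ^+ 2).
  by rewrite /dext kpot_sub_cst// dkpot_sub_cst//; field; rewrite gt_eqF.
have P0 : 0 <= M / edist z by rewrite divr_ge0 ?ltW.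
apply: le_trans (ler_normB _ _) _.
have -> : 2 * M / edist z * (A / D z) = M / edist z * A / D z + A * (M / edist z * D z / D z ^+ 2).
  by field; rewrite !gt_eqF.
apply: lerD.
  by rewrite normrM normfV (gtr0_norm Dz) ler_pM2r ?invr_gt0.
rewrite !normrM normfV (gtr0_norm (exprn_gt0 2 Dz)).
apply: ler_pM => //; first by rewrite mulr_ge0// invr_ge0 exprn_ge0// ltW.
by rewrite ler_pM2r// invr_gt0 exprn_gt0.
Qed.

Lemma deviation_le c z : ~ Gamma z ->
  (((\int[sigma]_(y in G) `|(g y - c) * k z y|) ^+ 2 / D z)%:E <= \int[sigma]_(y in G) ((g y - c) ^+ 2 * k z y)%:E)%E.
Proof.
move=> nz; have Dz := kpot1_gt0 nz.
set A := \int[sigma]_(y in G) `|(g y - c) * k z y|.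
have AE : A = \int[sigma]_(y in G) (`|g y - c| * k z y).
  by apply: eq_Rintegral => y _; rewrite normrM (ger0_norm (kern_ge0 _ _ _)).
have iabs : sigma.-integrable G (EFin \o (fun y => `|g y - c| * k z y)).
  have := integrable_norm (integrable_weighted d_bounds Gamma_neq0 Gamma_closed nz0 (mgc c) (integrable_sub_cst c) nz).
  by under [X in _ -> sigma.-integrable _ (EFin \o X)]eq_fun do rewrite -[X in _ * X](ger0_norm (kern_ge0 _ _ _)) -normrM.
exact: (weighted_cauchy_schwarz mG (measurable_funTS (mgc c)) (kern_ge0 M z) (ik nz) iabs (den_kpot z) AE Dz).
Qed.

Definition gap x y z : R := (g y - g x) ^+ 2 * k z y * k z x.

Lemma dext_sqr_le c i z : ~ Gamma z ->
  ((dext i z ^+ 2 * D z)%:E <= ((2 * M / edist z) ^+ 2)%:E * \int[sigma]_(y in G) ((g y - c) ^+ 2 * k z y)%:E)%E.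
Proof.
move=> nz; have Dz := kpot1_gt0 nz; have e0 := edist_gt0 Gamma_neq0 Gamma_closed nz.
set A := \int[sigma]_(y in G) `|(g y - c) * k z y|.
have cs := deviation_le c nz; rewrite -/A in cs.
apply: le_trans (_ : (((2 * M / edist z) ^+ 2)%:E * (A ^+ 2 / D z)%:E <= _)%E); last first.
  by apply: lee_wpmul2l; [rewrite lee_fin sqr_ge0|exact: cs].
rewrite -EFinM lee_fin; have := dext_le c i nz; rewrite -/A => le.
have -> : (2 * M / edist z) ^+ 2 * (A ^+ 2 / D z) = (2 * M / edist z * (A / D z)) ^+ 2 * D z.
  by field; rewrite !gt_eqF.
rewrite ler_pM2r// -real_normK ?num_real//.
by apply: lerXn2r; rewrite ?nnegrE// (le_trans _ le).
Qed.

Lemma measurable_gap_comp dX (X : measurableType dX) (S : set X) (x y : X -> H) (z : X -> 'rV[R]_n) :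
  measurable_fun S x -> measurable_fun S y -> (forall i, measurable_fun S (fun p => z p 0 i)) ->
  measurable_fun S (fun p => gap (x p) (y p) (z p)).
Proof.
move=> mx my mz.
have cx i : measurable_fun S (fun p => (x p : 'rV[R]_n) 0 i) by exact: (measurableT_comp (measurable_haus_coord i) mx).
have cy i : measurable_fun S (fun p => (y p : 'rV[R]_n) 0 i) by exact: (measurableT_comp (measurable_haus_coord i) my).
apply: measurable_funM; last exact: measurable_kern_comp.
apply: measurable_funM; last exact: measurable_kern_comp.
apply: measurable_funX; apply: measurable_funB; first exact: (measurableT_comp mg my).
exact: (measurableT_comp mg mx).
Qed.

Lemma gap_ge0 x y z : 0 <= gap x y z.
Proof. by apply: mulr_ge0 (kern_ge0 _ _ _); apply: mulr_ge0 (kern_ge0 _ _ _); exact: sqr_ge0. Qed.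

(** The bound [dext_sqr_le] holds with c = g(x) for every x in Gamma; multiplied by k(z, x) and
    integrated over x it becomes a double integral of differences of g, and the left-hand side gains
    another factor D. *)
Lemma dext_gap_le i z : ~ Gamma z ->
  ((dext i z ^+ 2 * D z ^+ 2)%:E <=
    ((2 * M / edist z) ^+ 2)%:E * \int[sigma]_(x in G) \int[sigma]_(y in G) (gap x y z)%:E)%E.
Proof.
move=> nz; have Dz := kpot1_gt0 nz.
have c0 : 0 <= dext i z ^+ 2 * D z by rewrite mulr_ge0 ?sqr_ge0// ltW.
have mI : measurable_fun G (fun x => (\int[sigma]_(y in G) (gap x y z)%:E)%E).
  have sG := sigma_finite_on_Gamma Gamma_neq0 Gamma_AR.
  apply: (@measurable_integral_on _ _ H H R sigma G G mG mG sG (fun p : H * H => (gap p.1 p.2 z)%:E)).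
    apply/measurable_EFinP; apply: measurable_gap_comp; [exact: measurable_funTS measurable_fst|exact: measurable_funTS measurable_snd|].
    by move=> j; exact: measurable_cst.
  by move=> p; rewrite lee_fin gap_ge0.
have mF : measurable_fun G (fun x => (((2 * M / edist z) ^+ 2)%:E * \int[sigma]_(y in G) (gap x y z)%:E)%E).
  by apply: emeasurable_funM; [exact: measurable_cst|exact: mI].
rewrite -ge0_integralZl; [|exact: mG|exact: mI| |by rewrite lee_fin sqr_ge0]; last first.
  by move=> x _; apply: integral_ge0 => y _; rewrite lee_fin gap_ge0.
rewrite expr2 mulrA {2}den_kpot; apply: (average_le mG c0 (ik nz) (kern_ge0 M z) mF) => x Gx.
apply: scaled_bound; [exact: mG| | |exact: kern_ge0|exact: dext_sqr_le].
- apply: measurable_funTS; apply: measurable_funM; last exact: measurable_kern.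
  by apply: measurable_funX; exact: mgc.
- by move=> y; rewrite mulr_ge0 ?sqr_ge0 ?kern_ge0.
Qed.

End extension.

(** * Triple integrals *)

Section tonelli3.
Context {d1 d2 : measure_display} {T1 : measurableType d1} {T2 : measurableType d2} {R : realType}.
Variables (m1 : {measure set T1 -> \bar R}) (m2 : {measure set T2 -> \bar R}).
Variables (D1 : set T1) (D2 : set T2).
Hypotheses (mD1 : measurable D1) (mD2 : measurable D2).
Hypotheses (s1 : sigma_finite_on m1 D1) (s2 : sigma_finite_on m2 D2).
Local Open Scope ereal_scope.

(** Tonelli's theorem is applied twice: it exchanges the integrals over z and x, and then, for each
    x, those over z and y, until the integral over z is innermost. *)
Lemma tonelli3_le (f : T1 -> T2 -> T2 -> \bar R) (h : T2 -> T2 -> \bar R) (C : R) :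
  measurable_fun ((D1 `*` D2) `*` D2) (fun p => f p.1.1 p.1.2 p.2) ->
  (forall x, D2 x -> measurable_fun (D1 `*` D2) (fun p => f p.1 x p.2)) ->
  measurable_fun (D2 `*` D2) (fun p => h p.1 p.2) ->
  (forall z x y, 0 <= f z x y) -> (forall x y, 0 <= h x y) -> (0 <= C)%R ->
  (forall x y, D2 x -> D2 y -> \int[m1]_(z in D1) f z x y <= C%:E * h x y) ->
  measurable_fun D1 (fun z => \int[m2]_(x in D2) \int[m2]_(y in D2) f z x y) /\
  \int[m1]_(z in D1) \int[m2]_(x in D2) \int[m2]_(y in D2) f z x y <=
    C%:E * \int[m2]_(x in D2) \int[m2]_(y in D2) h x y.
Proof.
move=> mf mfx mh f0 h0 C0 H.
have mF := measurable_integral_on (measurableX mD1 mD2) mD2 s2 mf (fun _ => f0 _ _ _).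
have F0 (p : T1 * T2) : 0 <= \int[m2]_(y in D2) f p.1 p.2 y by apply: integral_ge0 => y _.
split; first exact: (measurable_integral_on mD1 mD2 s2 mF F0).
apply: (tonelli_le mD1 mD2 s1 s2 mF F0 C0 (measurable_integral_on mD2 mD2 s2 mh (fun _ => h0 _ _))) => [x|x Dx].
  by apply: integral_ge0 => y _.
apply: (@tonelli_le _ _ _ _ _ _ _ _ _ mD1 mD2 s1 s2 (fun p => f p.1 x p.2)) => //; first exact: mfx.
  have := measurable_integral_on mD2 mD2 s2 mh (fun _ => h0 _ _) => _.
  have mpair : measurable_fun D2 (fun y : T2 => (x, y)) by apply: measurable_funTS; exact: pair1_measurable.
  apply: (measurable_comp _ _ mh mpair); first exact: measurableX.
  by move=> _ [y Dy <-]; split.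
by move=> y Dy; exact: H.
Qed.

Lemma integral_le_scaled (f : T1 -> R) (F : T1 -> \bar R) (K : R) : measurable_fun D1 f -> (forall x, (0 <= f x)%R) ->
  measurable_fun D1 F -> (forall x, 0 <= F x) -> (0 <= K)%R -> (forall x, D1 x -> (f x)%:E <= K%:E * F x) ->
  \int[m1]_(x in D1) (f x)%:E <= K%:E * \int[m1]_(x in D1) F x.
Proof.
move=> mf f0 mF F0 K0 fF; rewrite -ge0_integralZl//.
apply: ge0_le_integral => //.
- by move=> x _; rewrite lee_fin.
- exact/measurable_EFinP.
- by apply: emeasurable_funM => //; exact: measurable_cst.
Qed.

Lemma integral2_scale (f : T2 -> T2 -> R) (c : R) : measurable_fun (D2 `*` D2) (fun p => (f p.1 p.2)%:E) ->
  (forall x, D2 x -> measurable_fun D2 (f x)) -> (forall x y, (0 <= f x y)%R) -> (0 <= c)%R ->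
  \int[m2]_(x in D2) \int[m2]_(y in D2) (c * f x y)%:E = c%:E * \int[m2]_(x in D2) \int[m2]_(y in D2) (f x y)%:E.
Proof.
move=> mf mfx f0 c0.
have mI := measurable_integral_on mD2 mD2 s2 mf (fun p => f0 p.1 p.2).
rewrite -ge0_integralZl//; last by move=> x _; apply: integral_ge0 => y _; rewrite lee_fin.
apply: eq_integral => x; rewrite inE => Dx; rewrite -ge0_integralZl//.
- exact/measurable_EFinP/mfx.
- by move=> y _; rewrite lee_fin.
Qed.

End tonelli3.

(** * Energy of the extension *)

Section extension_energy.
Context {R : realType} {n : nat} (d C0 : R) (Gamma : set 'rV[R]_n).
Hypothesis d_bounds : 0 < d < n%:R - 1.
Hypothesis Gamma_neq0 : Gamma !=set0.
Hypothesis Gamma_closed : closed Gamma.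
Hypothesis C0_ge1 : 1 <= C0.
Hypothesis Gamma_AR : ahlfors_regular d C0 Gamma.
Local Notation L := (leb_space R n).
Local Notation H := (haus_space R n d).
Local Notation mu := (leb R n).
Local Notation sigma := (haus n d).
Local Notation Omega := (~` Gamma : set L).
Local Notation G := (Gamma : set H).
Local Notation V := ('rV[R]_n -> R).
Local Notation edist := (Defs.edist Gamma).
Local Notation w := (weight d Gamma).
Local Notation M := (@kexp R n d).
Local Notation k := (kern M).
Local Notation kpot := (kpot d Gamma).
Local Notation D := (kpot (cst 1)).
Implicit Types (z y x : 'rV[R]_n) (t c r : R) (i : 'I_n).

Let mO : measurable Omega. Proof. exact: measurable_Omega. Qed.
Let mG : measurable G. Proof. exact: measurable_Gamma. Qed.
Let M0 : 0 < M. Proof. exact: (kexp_gt0 d_bounds). Qed.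
Let sG : sigma_finite_on sigma G. Proof. exact: (sigma_finite_on_Gamma Gamma_neq0 Gamma_AR). Qed.
Let sO : sigma_finite_on mu Omega. Proof. exact: sigma_finite_on_leb. Qed.

Lemma leb_ball_growth (S : set L) x t : 0 < t -> (mu (S `&` [set z : L | (enorm ((z : 'rV[R]_n) - x) < t)%R]) <= (2 ^+ n * t `^ n%:R)%:E)%E.
Proof.
move=> t0; have [v E /andP[_ v2]] := leb_eball x t0.
apply: le_trans (leb_le (B := eball x t) _) _; first by move=> z [].
by rewrite E lee_fin powR_mulrn ?(ltW t0)// -exprMn; exact: v2.
Qed.

Lemma measurable_leb_dist x : measurable_fun (setT : set L) (fun z : L => enorm ((z : 'rV[R]_n) - x)).
Proof. by apply: measurable_leb_continuous; exact: continuous_enorm_sub. Qed.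

Lemma measurable_leb_kern y : measurable_fun (setT : set L) (fun z : L => k (z : 'rV[R]_n) y).
Proof.
apply: (@measurable_kern_comp R n M _ _ setT (fun z : L => z : 'rV[R]_n) (fun=> y)) => i; last exact: measurable_cst.
exact: measurable_leb_coord.
Qed.

(** The kernel at the nearer of x and y absorbs dist(z)^M. The distance to the farther one is at
    least |z - x| and, by the triangle inequality, at least |x - y| / 2. *)
Lemma kern_pair_le x y z : ~ Gamma z -> Gamma x -> Gamma y ->
  edist z `^ M * (k z x * k z y) <= Num.max (enorm (z - x)) (enorm (x - y) / 2) `^ (- M).
Proof.
move=> nz Gx Gy; have e0 := edist_gt0 Gamma_neq0 Gamma_closed nz.
have ex := edist_le z Gx; have ey := edist_le z Gy.
have x0 := lt_le_trans e0 ex; have y0 := lt_le_trans e0 ey.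
have tri := enormB x z y; rewrite (enorm_sub x z) in tri.
have one p : edist z <= p -> edist z `^ M * p `^ (- M) <= 1.
  move=> ep; have p0 := lt_le_trans e0 ep; rewrite powRN ler_pdivrMr ?powR_gt0// mul1r.
  exact: (ge0_ler_powR (ltW M0) (ltW e0 : _ \is Num.nneg) (ltW p0 : _ \is Num.nneg) ep).
have max0 : 0 < Num.max (enorm (z - x)) (enorm (x - y) / 2) by rewrite lt_max x0.
have [le|gt] := leP (enorm (z - x)) (enorm (z - y)).
- rewrite mulrA; apply: le_trans (_ : k z y <= _).
    by rewrite -[leRHS]mul1r; apply: ler_wpM2r (kern_ge0 _ _ _) _ _ _; exact: one.
  by apply: powR_anti (ltW M0) => //; rewrite ge_max le/=; lra.
- rewrite mulrCA mulrC; apply: le_trans (_ : k z x <= _).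
    by rewrite -[leRHS]mul1r; apply: ler_wpM2r (kern_ge0 _ _ _) _ _ _; exact: one.
  by apply: powR_anti (ltW M0) => //; rewrite ge_max lexx/=; lra.
Qed.

Definition pair_cst : R := 2 ^+ n * 2 `^ M / (1 - 2 `^ (n%:R - M)) * 2 `^ (d + 1).

Lemma pair_cst_ge0 : 0 <= pair_cst.
Proof.
have nM : n%:R - M < 0 by rewrite /kexp; have /andP[d0 _] := d_bounds; lra.
by rewrite mulr_ge0 ?powR_ge0// divr_ge0 ?mulr_ge0 ?powR_ge0// subr_ge0 ltW// powR2_lt1.
Qed.

Lemma measurable_H_density (h : V) : measurable_fun (setT : set H) h -> measurable_fun (G `*` G)
  (fun p : H * H => (`|h p.1 - h p.2| ^+ 2 / enorm ((p.1 : 'rV[R]_n) - p.2) `^ (d + 1))%:E).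
Proof.
move=> mh; apply: measurable_funTS; apply/measurable_EFinP; apply: measurable_funM.
  apply: measurable_funX; apply: (measurableT_comp (@normr_measurable R setT)).
  by apply: measurable_funB; [exact: (measurableT_comp mh measurable_fst)|exact: (measurableT_comp mh measurable_snd)].
have -> : (fun p : H * H => (enorm ((p.1 : 'rV[R]_n) - p.2) `^ (d + 1))^-1) =
    (fun p : H * H => enorm ((p.1 : 'rV[R]_n) - p.2) `^ (- (d + 1))).
  by apply/funext => p; rewrite powRN.
apply: (measurableT_comp (measurable_powR _)).
apply: (@measurable_enorm_comp R n _ _ setT (fun p : H * H => (p.1 : 'rV[R]_n) - (p.2 : 'rV[R]_n))) => j.
under eq_fun do rewrite !mxE; apply: measurable_funB.
  exact: (measurableT_comp (measurable_haus_coord j) measurable_fst).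
exact: (measurableT_comp (measurable_haus_coord j) measurable_snd).
Qed.

(** [far_integral_le] in dimension n with the radius |x - y| / 2. Since n - M = -(d + 1), the result
    is exactly the kernel of [H_energy]. *)
Lemma pair_integral_le x y : Gamma x -> Gamma y -> x != y ->
  (\int[mu]_(z in Omega) (edist z `^ M * (k z x * k z y))%:E <= (pair_cst / enorm (x - y) `^ (d + 1))%:E)%E.
Proof.
move=> Gx Gy xy; have /andP[d0 _] := d_bounds.
have r0 : 0 < enorm (x - y).
  rewrite lt_def enorm_ge0 andbT; apply/eqP => /enorm_eq0/eqP; rewrite subr_eq0; exact/negP.
have r20 : 0 < enorm (x - y) / 2 by rewrite divr_gt0.
have nM : n%:R < M by rewrite /kexp; lra.
have mf : measurable_fun Omega (fun z : L => edist z `^ M * (k z x * k z y)).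
  apply: measurable_funTS; apply: measurable_funM.
    apply: (measurableT_comp (measurable_powR _)); apply: measurable_leb_continuous.
    exact: continuous_edist.
  by apply: measurable_funM; exact: measurable_leb_kern.
have f0 z : 0 <= edist z `^ M * (k z x * k z y).
  by apply: mulr_ge0 (powR_ge0 _ _) _; apply: mulr_ge0; exact: kern_ge0.
have c2 : 0 <= 2 ^+ n :> R by rewrite exprn_ge0.
have := @far_integral_le _ _ _ mu Omega mO (fun z : L => edist z `^ M * (k z x * k z y))
  (fun z : L => enorm ((z : 'rV[R]_n) - x)) (2 ^+ n) 1 n%:R M (enorm (x - y) / 2) mf f0
  (measurable_leb_dist x) c2 ler01 r20 (@leb_ball_growth Omega x) (ltW M0) nM.
move=> H; apply: le_trans (H _) _; first by move=> z Oz; rewrite mul1r; exact: kern_pair_le.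
rewrite lee_fin mul1r /pair_cst -!mulrA le_eqVlt; apply/orP; left; apply/eqP.
do 3 congr (_ * _).
have -> : n%:R - M = - (d + 1) by rewrite /kexp; lra.
rewrite powRM ?enorm_ge0 ?invr_ge0// -[2^-1]powR_inv1// -powRrM mulN1r opprK powRN mulrC.
by [].
Qed.

Variables (z0 : 'rV[R]_n) (g : V).
Hypothesis nz0 : ~ Gamma z0.
Hypothesis mg : measurable_fun (setT : set H) g.
Hypothesis ig0 : sigma.-integrable G (EFin \o (fun y => g y * k z0 y)).

Let Gnull := Gamma_null d_bounds Gamma_neq0 Gamma_AR.

Definition energy_cst : R := n%:R * (2 * M) ^+ 2 / (@den_cst R n d C0) ^+ 2.

Lemma energy_cst_ge0 : 0 <= energy_cst.
Proof. by rewrite divr_ge0 ?sqr_ge0// mulr_ge0// sqr_ge0. Qed.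

Local Notation gap := (gap d g).
Local Notation dext := (dext d Gamma g).
Local Notation dfield := (fun z => \row_i dext i z : 'rV[R]_n).

(** The bounds [dext_gap_le] are summed over the coordinates and divided by D^2, for which the lower
    bound of D by a multiple of dist^(d-M) is used. *)
Lemma dfield_le z : ~ Gamma z ->
  ((enorm (dfield z) ^+ 2 * w z)%:E <=
    energy_cst%:E * \int[sigma]_(x in G) \int[sigma]_(y in G) (edist z `^ M * gap x y z)%:E)%E.
Proof.
move=> nz; have e0 := edist_gt0 Gamma_neq0 Gamma_closed nz.
have Dz := kpot1_gt0 d_bounds Gamma_neq0 Gamma_closed C0_ge1 Gamma_AR nz.
have Dge := kpot1_ge d_bounds Gamma_neq0 Gamma_closed C0_ge1 Gamma_AR nz.
have mgap2 : measurable_fun (G `*` G) (fun p : H * H => (gap p.1 p.2 z)%:E).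
  apply/measurable_EFinP; apply: (measurable_gap_comp mg); [exact: measurable_funTS measurable_fst|exact: measurable_funTS measurable_snd|].
  by move=> j; exact: measurable_cst.
have mgap1 x : G x -> measurable_fun G (fun y => gap x y z).
  move=> _; apply: (measurable_gap_comp mg); [exact: measurable_cst|exact: measurable_id|].
  by move=> j; exact: measurable_cst.
rewrite (integral2_scale mG sG mgap2 mgap1 (fun x y => gap_ge0 d g x y z) (powR_ge0 _ _)).
set T := (\int[sigma]_(x in G) _)%E.
have T0 : (0 <= T)%E by apply: integral_ge0 => x _; apply: integral_ge0 => y _; rewrite lee_fin; exact: gap_ge0.
have term i : ((dext i z ^+ 2 * D z ^+ 2)%:E <= ((2 * M / edist z) ^+ 2)%:E * T)%E.
  exact: (dext_gap_le d_bounds Gamma_neq0 Gamma_closed C0_ge1 Gamma_AR nz0 mg ig0 i nz).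
have sum_le : ((enorm (dfield z) ^+ 2 * D z ^+ 2)%:E <= (n%:R * (2 * M / edist z) ^+ 2)%:E * T)%E.
  have -> : enorm (dfield z) ^+ 2 * D z ^+ 2 = \sum_(i < n) dext i z ^+ 2 * D z ^+ 2.
    by rewrite enorm_sqr /dotp mulr_suml; apply: eq_bigr => i _; rewrite !mxE expr2.
  rewrite -sumEFin; apply: le_trans (_ : (\sum_(i < n) (((2 * M / edist z) ^+ 2)%:E * T) <= _)%E).
    by apply: lee_sum => i _; exact: term.
  rewrite (eq_bigr (fun=> (((2 * M / edist z) ^+ 2)%:E * T)%E))// big_const card_ord iter_addr_0.
  by rewrite [(n%:R * _)%:E]EFinM -muleA mule_natl.
pose P := w z / D z ^+ 2; have P0 : 0 <= P by rewrite divr_ge0 ?sqr_ge0 ?weight_ge0.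
have -> : enorm (dfield z) ^+ 2 * w z = P * (enorm (dfield z) ^+ 2 * D z ^+ 2).
  by rewrite /P; field; rewrite gt_eqF.
rewrite EFinM; apply: le_trans (_ : (P%:E * ((n%:R * (2 * M / edist z) ^+ 2)%:E * T) <= _)%E).
  by apply: lee_wpmul2l; [rewrite lee_fin|exact: sum_le].
rewrite !muleA; apply: lee_wpmul2r => //; rewrite -!EFinM lee_fin.
have c0 : 0 < @den_cst R n d C0 by exact: (@den_cst_gt0 R n d C0 C0_ge1).
have lo0 : 0 < @den_cst R n d C0 * edist z `^ (d - M) by rewrite mulr_gt0// powR_gt0.
have P1 : P <= w z / (@den_cst R n d C0 * edist z `^ (d - M)) ^+ 2.
  rewrite /P; apply: ler_wpM2l; first exact: weight_ge0.
  have l2 := lerXn2r 2 (ltW lo0 : _ \is Num.nneg) (ltW Dz : _ \is Num.nneg) Dge.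
  by rewrite lef_pV2 ?posrE ?exprn_gt0.
apply: le_trans (ler_wpM2r _ P1) _; first by rewrite mulr_ge0// sqr_ge0.
rewrite le_eqVlt; apply/orP; left; apply/eqP.
(* The exponents add up as (d + 1 - n) - 2 (d - M) - 2 = 2 M - (d + 1 + n) = M. *)
have pe : w z / (edist z `^ (d - M)) ^+ 2 / edist z ^+ 2 = edist z `^ M.
  rewrite -!powR_mulrn ?powR_ge0 ?(ltW e0)// -!powRrM -!powRN /weight -!powRD; try by apply/implyP => _; rewrite gt_eqF.
  by congr (_ `^ _); rewrite /kexp; lra.
rewrite -pe /energy_cst; field.
by rewrite !gt_eqF// powR_gt0.
Qed.

Lemma ext_energy_le : (H_energy d Gamma g < +oo)%E -> in_W d Gamma (ext d Gamma g) /\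
  (W_energy d Gamma (ext d Gamma g) <= (energy_cst * pair_cst)%:E * H_energy d Gamma g)%E.
Proof.
rewrite ltey => fin.
have [lu wu] := ext_wgrad d_bounds Gamma_neq0 Gamma_closed C0_ge1 Gamma_AR nz0 mg ig0.
have mdf : measurable_fun Omega (fun z => enorm (dfield z) ^+ 2 * w z).
  by apply: (@measurable_field_sqr R n d Gamma Gamma_neq0 dfield) => i; exact: (wgrad_measurable i wu).
have med : measurable_fun (setT : set L) (fun z : L => edist z `^ M).
  apply: (measurableT_comp (measurable_powR _)); apply: measurable_leb_continuous.
  exact: continuous_edist.
pose f (z : L) (x y : H) : \bar R := (edist z `^ M * gap x y z)%:E.
pose h (x y : H) : \bar R := (`|g x - g y| ^+ 2 / enorm ((x : 'rV[R]_n) - y) `^ (d + 1))%:E.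
have mf3 : measurable_fun ((Omega `*` G) `*` G) (fun p : (L * H) * H => f p.1.1 p.1.2 p.2).
  apply: measurable_funTS; apply/measurable_EFinP; apply: measurable_funM.
    exact: (measurableT_comp (measurableT_comp med measurable_fst) measurable_fst).
  apply: (measurable_gap_comp mg); [exact: (measurableT_comp measurable_snd measurable_fst)|exact: measurable_snd|].
  by move=> j; exact: (measurableT_comp (measurableT_comp (measurable_leb_coord j) measurable_fst) measurable_fst).
have mf2 x : G x -> measurable_fun (Omega `*` G) (fun p : L * H => f p.1 x p.2).
  move=> _; apply: measurable_funTS; apply/measurable_EFinP; apply: measurable_funM.
    exact: (measurableT_comp med measurable_fst).
  apply: (measurable_gap_comp mg); [exact: measurable_cst|exact: measurable_snd|].
  by move=> j; exact: (measurableT_comp (measurable_leb_coord j) measurable_fst).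
have mh := measurable_H_density mg : measurable_fun (G `*` G) (fun p : H * H => h p.1 p.2).
have f0 z x y : (0 <= f z x y)%E.
  by rewrite lee_fin; apply: mulr_ge0 (powR_ge0 _ _) _; exact: gap_ge0.
have h0 x y : (0 <= h x y)%E by rewrite lee_fin divr_ge0 ?sqr_ge0 ?powR_ge0.
have inner x y : G x -> G y -> (\int[mu]_(z in Omega) f z x y <= pair_cst%:E * h x y)%E.
  (* On the diagonal, which [pair_integral_le] excludes, the gap vanishes identically. *)
  move=> Gx Gy; have [<-|xy] := eqVneq x y.
    rewrite integral0_eq; first by rewrite mule_ge0// lee_fin pair_cst_ge0.
    by move=> z _; rewrite /f /gap subrr expr0n/= !mul0r mulr0.
  have shuffle (e a b c : R) : e * (a * b * c) = a * (e * (c * b)) by ring.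
  have fE z : f z x y = (((g y - g x) ^+ 2)%:E * (edist z `^ M * (k z x * k z y))%:E)%E.
    exact: (congr1 EFin (shuffle _ _ _ _)).
  under eq_integral do rewrite fE.
  have mk2 : measurable_fun Omega (fun z : L => (edist z `^ M * (k z x * k z y))%:E).
    apply: measurable_funTS; apply/measurable_EFinP; apply: measurable_funM; first exact: med.
    by apply: measurable_funM; exact: measurable_leb_kern.
  rewrite ge0_integralZl; [|exact: mO|exact: mk2| |by rewrite lee_fin sqr_ge0]; last first.
    by move=> z _; rewrite lee_fin; apply: mulr_ge0 (powR_ge0 _ _) _; apply: mulr_ge0; exact: kern_ge0.
  apply: le_trans (_ : (((g y - g x) ^+ 2)%:E * (pair_cst / enorm (x - y) `^ (d + 1))%:E <= _)%E).
    by apply: lee_wpmul2l; [rewrite lee_fin sqr_ge0|exact: pair_integral_le].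
  rewrite -!EFinM lee_fin real_normK ?num_real// -sqrrN opprB mulrCA.
  by [].
have [mT le3] := tonelli3_le mO mG sO sG mf3 mf2 mh f0 h0 pair_cst_ge0 inner.
have le : (\int[mu]_(z in Omega) (enorm (dfield z) ^+ 2 * w z)%:E <=
    (energy_cst * pair_cst)%:E * H_energy d Gamma g)%E.
  rewrite EFinM -muleA.
  apply: le_trans (_ : (energy_cst%:E * \int[mu]_(z in Omega) \int[sigma]_(x in G) \int[sigma]_(y in G) f z x y <= _)%E).
    have p0 z : 0 <= enorm (dfield z) ^+ 2 * w z by rewrite mulr_ge0 ?sqr_ge0 ?weight_ge0.
    have F0 z : (0 <= \int[sigma]_(x in G) \int[sigma]_(y in G) f z x y)%E.
      by apply: integral_ge0 => x _; apply: integral_ge0 => y _; exact: f0.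
    have fF z : Omega z -> ((enorm (dfield z) ^+ 2 * w z)%:E <=
        energy_cst%:E * \int[sigma]_(x in G) \int[sigma]_(y in G) f z x y)%E by exact: dfield_le.
    have := @integral_le_scaled _ _ _ mu Omega mO _ _ energy_cst mdf p0 mT F0 energy_cst_ge0 fF.
    exact.
  by apply: lee_wpmul2l; [rewrite lee_fin energy_cst_ge0|exact: le3].
have H0 : (0 <= H_energy d Gamma g)%E by apply: integral_ge0 => x _; apply: integral_ge0 => y _; exact: h0.
have lt : (\int[mu]_(z in Omega) (enorm (dfield z) ^+ 2 * w z)%:E < +oo)%E.
  apply: le_lt_trans le _; have := fin; rewrite -(fineK (x := H_energy d Gamma g)); last by rewrite ge0_fin_numE// ltey.
  by rewrite -EFinM ltry.
by have [Wu E] := in_W_of_wgrad Gamma_neq0 Gamma_closed lu wu lt; split => //; rewrite E.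
Qed.

End extension_energy.

(** * Means and mean squares *)

Section mean_deviation.
Context {dd : measure_display} {T : measurableType dd} {R : realType}.
Variables (mu : {measure set T -> \bar R}) (D : set T).
Hypothesis mD : measurable D.

(** Young's inequality |v - c| <= (lam + (v - c)^2 / lam) / 2, averaged over [D]; the parameter
    [lam] is left free to be adapted to the size of the ball. *)
Lemma mean_deviation_le (v : T -> R) (c m lam Q : R) : 0 < lam -> 0 < m -> mu D = m%:E ->
  mu.-integrable D (EFin \o v) -> (\int[mu]_(x in D) ((v x - c) ^+ 2)%:E <= Q%:E)%E ->
  `|\int[mu]_(x in D) v x / m - c| <= (lam + Q / (lam * m)) / 2.
Proof.
move=> l0 m0 mDm iv le; have mv := integrableR_measurable iv.
have Doo : (mu D < +oo)%E by rewrite mDm ltry.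
have icst a : mu.-integrable D (EFin \o (cst a : T -> R)).
  by apply: (bounded_integrable (C := `|a|) mD Doo); [exact: measurable_cst|].
have cstE a : \int[mu]_(x in D) (cst a : T -> R) x = a * m.
  by transitivity (fine (\int[mu]_(x in D) a%:E)); [by []|rewrite integral_cst// mDm -EFinM].
have mdev : measurable_fun D (fun x => v x - c) by apply: measurable_funB => //; exact: measurable_cst.
have i2 : mu.-integrable D (EFin \o (fun x => (v x - c) ^+ 2)).
  apply: (@integrable_of_bound _ _ _ mu D (fun x => (v x - c) ^+ 2) Q%:E _ _ le (ltry _)); first exact: measurable_funX.
  by move=> x; exact: sqr_ge0.
have ib := integrableRB mD iv (icst c).
have ig := integrableRD mD (icst (lam / 2)) (integrableRZ (2 * lam)^-1 mD i2).
have H : `|\int[mu]_(x in D) (v x - cst c x)| <= \int[mu]_(x in D) (cst (lam / 2) x + (2 * lam)^-1 * (v x - c) ^+ 2).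
  apply: (Rint_norm_le mD ib ig) => x _ /=.
  rewrite -[(v x - c) ^+ 2]real_normK ?num_real//; set a := `|_|.
  rewrite -subr_ge0; have -> : lam / 2 + (2 * lam)^-1 * a ^+ 2 - a = (2 * lam)^-1 * (a - lam) ^+ 2.
    by field; rewrite gt_eqF.
  by rewrite mulr_ge0 ?sqr_ge0// invr_ge0 mulr_ge0// ltW.
rewrite (RintegralB mD iv (icst c)) cstE in H.
rewrite (RintegralD mD (icst (lam / 2)) (integrableRZ (2 * lam)^-1 mD i2)) cstE (RintegralZl _ mD i2) in H.
have Q2 : \int[mu]_(x in D) (v x - c) ^+ 2 <= Q.
  by rewrite -lee_fin /Rintegral fineK//; exact: (integrable_fin_num mD i2).
have -> : \int[mu]_(x in D) v x / m - c = (\int[mu]_(x in D) v x - c * m) / m.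
  by rewrite mulrBl mulfK// gt_eqF.
rewrite normrM normfV (gtr0_norm m0) ler_pdivrMr//; apply: le_trans H _.
have -> : (lam + Q / (lam * m)) / 2 * m = lam / 2 * m + (2 * lam)^-1 * Q by field; rewrite !gt_eqF.
by rewrite lerD2l; apply: ler_wpM2l => //; rewrite invr_ge0 mulr_ge0// ltW.
Qed.

Lemma integral_le_cst (f : T -> R) (c m : R) : measurable_fun D f -> (forall x, 0 <= f x) -> 0 <= c ->
  (forall x, D x -> f x <= c) -> (mu D <= m%:E)%E -> (\int[mu]_(x in D) (f x)%:E <= (c * m)%:E)%E.
Proof.
move=> mf f0 c0 fc Dm; apply: (@le_trans _ _ (\int[mu]_(x in D) c%:E)%E).
  apply: ge0_le_integral => //.
  - by move=> x _; rewrite lee_fin.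
  exact/measurable_EFinP.
by rewrite integral_cst// EFinM; apply: lee_wpmul2l => //; rewrite lee_fin.
Qed.

Lemma integral_split (A : set T) (f : T -> R) : measurable A -> measurable_fun D f -> (forall x, 0 <= f x) ->
  (\int[mu]_(x in D) (f x)%:E = \int[mu]_(x in D `&` A) (f x)%:E + \int[mu]_(x in D `\` A) (f x)%:E)%E.
Proof.
move=> mA mf f0; rewrite -ge0_integral_setU//.
- by rewrite setUIDK.
- exact: measurableI.
- exact: measurableD.
- by rewrite setUIDK; exact/measurable_EFinP.
- by move=> x _; rewrite lee_fin.
- by apply/disj_setPRL => x [_ nA] [].
Qed.

End mean_deviation.

(** * Mean-square trace of the extension *)

Section extension_trace.
Context {R : realType} {n : nat} (d C0 : R) (Gamma : set 'rV[R]_n).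
Hypothesis d_bounds : 0 < d < n%:R - 1.
Hypothesis Gamma_neq0 : Gamma !=set0.
Hypothesis Gamma_closed : closed Gamma.
Hypothesis C0_ge1 : 1 <= C0.
Hypothesis Gamma_AR : ahlfors_regular d C0 Gamma.
Local Notation L := (leb_space R n).
Local Notation H := (haus_space R n d).
Local Notation mu := (leb R n).
Local Notation sigma := (haus n d).
Local Notation Omega := (~` Gamma : set L).
Local Notation G := (Gamma : set H).
Local Notation V := ('rV[R]_n -> R).
Local Notation edist := (Defs.edist Gamma).
Local Notation M := (@kexp R n d).
Local Notation k := (kern M).
Local Notation kpot := (kpot d Gamma).
Local Notation D := (kpot (cst 1)).
Implicit Types (z y x : 'rV[R]_n) (t c r : R) (i : 'I_n).

Let mO : measurable Omega. Proof. exact: measurable_Omega. Qed.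
Let mG : measurable G. Proof. exact: measurable_Gamma. Qed.
Let M0 : 0 < M. Proof. exact: (kexp_gt0 d_bounds). Qed.
Let sG : sigma_finite_on sigma G. Proof. exact: (sigma_finite_on_Gamma Gamma_neq0 Gamma_AR). Qed.

Definition near_cst : R := 2 ^+ n * 2 `^ d / (1 - 2^-1 `^ (n%:R - d)).
Definition trace_cst : R := (2 ^+ n + near_cst) * 2 `^ (d + 1).

Let nd0 : 0 < n%:R - d. Proof. by have /andP[d0 d1] := d_bounds; lra. Qed.

Lemma near_cst_ge0 : 0 <= near_cst.
Proof.
have h : 2^-1 `^ (n%:R - d) < 1 :> R by rewrite -powR_inv1// -powRrM; apply: powR2_lt1; have := nd0; lra.
by rewrite divr_ge0 ?mulr_ge0 ?powR_ge0// subr_ge0 ltW.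
Qed.

Lemma trace_cst_ge0 : 0 <= trace_cst.
Proof. by rewrite mulr_ge0 ?powR_ge0// addr_ge0 ?near_cst_ge0. Qed.

Lemma measurable_edist_powR p : measurable_fun (setT : set L) (fun z : L => edist z `^ p).
Proof.
apply: (measurableT_comp (measurable_powR _)); apply: measurable_leb_continuous.
exact: continuous_edist.
Qed.

(** The ball is split by the ball of radius |x - y| / 2 about y. Outside the latter, one factor
    dist(z) <= |z - x| < r yields a power of r and the rest is at most |z - y|^(-(d+1)); inside, the
    integrand is at most |z - y|^(-d), which is integrable because d < n. *)
Lemma trace_kernel_le x y r : 0 < r -> Gamma x -> Gamma y -> x != y ->
  (\int[mu]_(z in Omega `&` eball x r) (edist z `^ (M - d) * k z y)%:E <=
    (trace_cst * (r ^+ n * r) / enorm (x - y) `^ (d + 1))%:E)%E.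
Proof.
move=> r0 Gx Gy xy; have /andP[d0 d1] := d_bounds.
have R0 : 0 < enorm (x - y).
  rewrite lt_def enorm_ge0 andbT; apply/eqP => /enorm_eq0/eqP; rewrite subr_eq0; exact/negP.
set q := enorm (x - y) / 2; have q0 : 0 < q by rewrite divr_gt0.
set S := (Omega `&` eball x r : set L).
have mB : measurable (eball x r : set L) by apply: measurable_leb_open; exact: open_eball.
have mS : measurable S by exact: measurableI.
set A := (eball y q : set L).
have mA : measurable A by apply: measurable_leb_open; exact: open_eball.
pose f (z : L) : R := edist z `^ (M - d) * k z y.
have f0 z : 0 <= f z by apply: mulr_ge0 (powR_ge0 _ _) (kern_ge0 _ _ _).
have mfT : measurable_fun (setT : set L) f.
  by apply: measurable_funM; [exact: measurable_edist_powR|exact: measurable_leb_kern].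
have Md : 0 <= M - d by rewrite /kexp; have : 0 <= n%:R :> R by []; lra.
have fb z : ~ Gamma z -> f z <= enorm (z - y) `^ (- d).
  move=> nz; have e0 := edist_gt0 Gamma_neq0 Gamma_closed nz; have ey := edist_le z Gy.
  have y0 := lt_le_trans e0 ey.
  apply: le_trans (_ : enorm (z - y) `^ (M - d) * k z y <= _).
    apply: ler_wpM2r (kern_ge0 _ _ _) _ _ _.
    exact: (ge0_ler_powR Md (ltW e0 : _ \is Num.nneg) (ltW y0 : _ \is Num.nneg) ey).
  rewrite /kern -powRD; last by apply/implyP => _; rewrite gt_eqF.
  by rewrite le_eqVlt; apply/orP; left; apply/eqP; congr (_ `^ _); lra.
have ffar z : ~ Gamma z -> enorm (z - x) < r -> q <= enorm (z - y) -> f z <= r * q `^ (- (d + 1)).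
  move=> nz zx qz; have e0 := edist_gt0 Gamma_neq0 Gamma_closed nz; have ey := edist_le z Gy.
  have ex := edist_le z Gx; have y0 := lt_le_trans e0 ey.
  have -> : f z = edist z * (edist z `^ n%:R * k z y).
    rewrite mulrA /f; congr (_ * _); rewrite -{2}[edist z]powRr1 ?(ltW e0)// -powRD; last first.
      by apply/implyP => _; rewrite gt_eqF.
    by congr (_ `^ _); rewrite /kexp; lra.
  have r1 : edist z <= r by apply: le_trans ex (ltW zx).
  apply: ler_pM; [exact: ltW|by apply: mulr_ge0 (powR_ge0 _ _) (kern_ge0 _ _ _)|exact: r1|].
  apply: le_trans (_ : enorm (z - y) `^ n%:R * k z y <= _).
    apply: ler_wpM2r (kern_ge0 _ _ _) _ _ _.
    exact: (ge0_ler_powR (ler0n _ _) (ltW e0 : _ \is Num.nneg) (ltW y0 : _ \is Num.nneg) ey).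
  rewrite /kern -powRD; last by apply/implyP => _; rewrite gt_eqF.
  have -> : n%:R - M = - (d + 1) by rewrite /kexp; lra.
  by apply: (powR_anti q0 qz); lra.
have qE : q `^ (- (d + 1)) = 2 `^ (d + 1) / enorm (x - y) `^ (d + 1).
  by rewrite /q powRM ?enorm_ge0 ?invr_ge0// -[2^-1]powR_inv1// -powRrM mulN1r opprK powRN mulrC.
have leS : (mu S <= ((2 * r) ^+ n)%:E)%E.
  have [v E /andP[_ v2]] := leb_eball x r0.
  by apply: le_trans (leb_le (B := eball x r) _) _; [by move=> z []|rewrite E lee_fin].
have far : (\int[mu]_(z in S `\` A) (f z)%:E <= (r * q `^ (- (d + 1)) * (2 * r) ^+ n)%:E)%E.
  apply: (integral_le_cst (measurableD mS mA) (measurable_funTS mfT) f0).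
  - by rewrite mulr_ge0 ?powR_ge0 ?ltW.
  - move=> z [[nz zx] nA]; apply: ffar => //.
    by rewrite leNgt; apply/negP => h; apply: nA.
  - by apply: le_trans leS; apply: leb_le => z [].
have near : (\int[mu]_(z in S `&` A) (f z)%:E <= (near_cst * (r ^+ n * r) * q `^ (- (d + 1)))%:E)%E.
  (* If r <= q the two balls are disjoint, as the sum of their radii is at most |x - y|. Otherwise
     q^(n+1) <= r^(n+1) converts the local bound into the required power of r. *)
  have [rq|qr] := leP r q.
    have -> : S `&` A = set0.
      apply/seteqP; split => // z [[_ zx] zy].
      have zx' : enorm (z - x) < r by exact: zx.
      have zy' : enorm (z - y) < q by exact: zy.
      have := enormB x z y; rewrite (enorm_sub x z) => tri.
      have : q + q = enorm (x - y) by rewrite /q -splitr.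
      by lra.
    rewrite integral_set0 lee_fin; apply: mulr_ge0 (powR_ge0 _ _); apply: mulr_ge0; first exact: near_cst_ge0.
    by rewrite mulr_ge0 ?exprn_ge0 ?ltW.
  have c2 : 0 <= 2 ^+ n :> R by rewrite exprn_ge0.
  have dn : d < n%:R by lra.
  have := @near_integral_le _ _ _ mu (S `&` A) (measurableI _ _ mS mA) f
    (fun z : L => enorm ((z : 'rV[R]_n) - y)) (2 ^+ n) 1 n%:R d q (measurable_funTS mfT) f0
    (measurable_leb_dist y) c2 ler01 q0 (@leb_ball_growth R n (S `&` A) y) (ltW d0) dn.
  move=> H; apply: le_trans (H _ _) _.
  - move=> z [[nz _] zA]; apply/andP; split; last exact: zA.
    exact: (Omega_dist Gamma_neq0 Gamma_closed nz Gy).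
  - by move=> z [[nz _] _]; rewrite mul1r; exact: fb.
  rewrite lee_fin mul1r -/near_cst -mulrA; apply: ler_wpM2l near_cst_ge0 _ _ _.
  have -> : q `^ (n%:R - d) = (q ^+ n * q) * q `^ (- (d + 1)).
    rewrite -exprSr -powR_mulrn ?(ltW q0)// -powRD; last by apply/implyP => _; rewrite gt_eqF.
    by congr (_ `^ _); rewrite -natr1; lra.
  apply: ler_wpM2r (powR_ge0 _ _) _ _ _; rewrite -!exprSr.
  exact: (lerXn2r n.+1 (ltW q0 : _ \is Num.nneg) (ltW r0 : _ \is Num.nneg) (ltW qr)).
rewrite (integral_split mu mS mA (measurable_funTS mfT) f0).
apply: le_trans (leeD near far) _; rewrite -EFinD lee_fin.
have -> : trace_cst * (r ^+ n * r) / enorm (x - y) `^ (d + 1) = (2 ^+ n + near_cst) * (r ^+ n * r) * q `^ (- (d + 1)).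
  by rewrite qE /trace_cst; ring.
by rewrite exprMn le_eqVlt; apply/orP; left; apply/eqP; ring.
Qed.

Variables (z0 : 'rV[R]_n) (g : V).
Hypothesis nz0 : ~ Gamma z0.
Hypothesis mg : measurable_fun (setT : set H) g.
Hypothesis ig0 : sigma.-integrable G (EFin \o (fun y => g y * k z0 y)).
Local Notation ext := (ext d Gamma g).

Let c0 : 0 < @den_cst R n d C0. Proof. exact: (@den_cst_gt0 R n d C0 C0_ge1). Qed.

(** The weighted Cauchy-Schwarz inequality bounds the squared deviation by a weighted mean square
    divided by D, and the lower bound of D makes the kernel explicit. *)
Lemma ext_deviation_le c z : ~ Gamma z ->
  (((ext z - c) ^+ 2)%:E <= ((@den_cst R n d C0)^-1)%:E *
    \int[sigma]_(y in G) (edist z `^ (M - d) * ((g y - c) ^+ 2 * k z y))%:E)%E.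
Proof.
move=> nz; have e0 := edist_gt0 Gamma_neq0 Gamma_closed nz.
have Dz := kpot1_gt0 d_bounds Gamma_neq0 Gamma_closed C0_ge1 Gamma_AR nz.
have Dge := kpot1_ge d_bounds Gamma_neq0 Gamma_closed C0_ge1 Gamma_AR nz.
have mgc : measurable_fun (setT : set H) (fun y => g y - c).
  by apply: measurable_funB; [exact: mg|exact: measurable_cst].
have igc := integrable_sub_cst d_bounds Gamma_neq0 Gamma_closed C0_ge1 Gamma_AR nz0 ig0 c.
have cs := deviation_le d_bounds Gamma_neq0 Gamma_closed C0_ge1 Gamma_AR nz0 mg ig0 c nz.
have kle := kpot_abs_le d_bounds Gamma_neq0 Gamma_closed nz0 mgc igc nz.
have kE := kpot_sub_cst d_bounds Gamma_neq0 Gamma_closed C0_ge1 Gamma_AR nz0 mg ig0 c nz.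
set A := \int[sigma]_(y in G) _ in cs kle.
set Q := (\int[sigma]_(y in G) _)%E in cs.
have mQ : measurable_fun G (fun y => ((g y - c) ^+ 2 * k z y)%:E).
  apply: measurable_funTS; apply/measurable_EFinP; apply: measurable_funM; last exact: measurable_kern.
  exact: measurable_funX.
have pQ y : G y -> (0 <= ((g y - c) ^+ 2 * k z y)%:E)%E.
  by move=> _; rewrite lee_fin mulr_ge0 ?sqr_ge0 ?kern_ge0.
have Q0 : (0 <= Q)%E by apply: integral_ge0.
under eq_integral do rewrite EFinM.
rewrite (ge0_integralZl sigma mG mQ pQ) ?lee_fin ?powR_ge0// -/Q muleA -EFinM.
have Dinv : (D z)^-1 <= (@den_cst R n d C0)^-1 * edist z `^ (M - d).
  have lo0 : 0 < @den_cst R n d C0 * edist z `^ (d - M) by rewrite mulr_gt0// powR_gt0.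
  have -> : (@den_cst R n d C0)^-1 * edist z `^ (M - d) = (@den_cst R n d C0 * edist z `^ (d - M))^-1.
    by rewrite [RHS]invfM -[(edist z `^ (d - M))^-1]powRN opprB.
  by rewrite lef_pV2.
apply: le_trans (_ : (((D z)^-1)%:E * Q <= _)%E); last by apply: lee_wpmul2r => //; rewrite lee_fin.
apply: le_trans (_ : (((D z)^-1)%:E * (A ^+ 2 / D z)%:E <= _)%E); last first.
  by apply: lee_wpmul2l => //; rewrite lee_fin invr_ge0 ltW.
rewrite -EFinM lee_fin.
have -> : ext z - c = kpot (fun y => g y - c) z / D z.
  by rewrite kE mulrBl mulfK ?gt_eqF.
have -> : (D z)^-1 * (A ^+ 2 / D z) = (A / D z) ^+ 2 by field; rewrite gt_eqF.
rewrite -[leLHS]real_normK ?num_real//; apply: lerXn2r; rewrite ?nnegrE//.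
  by rewrite divr_ge0 ?(ltW Dz)// (le_trans _ kle).
by rewrite normrM normfV (gtr0_norm Dz) ler_pM2r// invr_gt0.
Qed.

(** Tonelli's theorem reduces the integral to [trace_kernel_le] for each y. The bound is of order
    r^(n+1), one power of r better than the volume of the ball, and this gain produces the trace. *)
Lemma ext_mean_square_le x r (F : R) : 0 < r -> Gamma x ->
  (\int[sigma]_(y in G) (`|g x - g y| ^+ 2 / enorm ((x : 'rV[R]_n) - y) `^ (d + 1))%:E <= F%:E)%E ->
  (\int[mu]_(z in Omega `&` eball x r) ((ext z - g x) ^+ 2)%:E <=
    ((@den_cst R n d C0)^-1 * (trace_cst * (r ^+ n * r) * F))%:E)%E.
Proof.
move=> r0 Gx leF.
have mB : measurable (eball x r : set L) by apply: measurable_leb_open; exact: open_eball.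
set S := (Omega `&` eball x r : set L); have mS : measurable S by exact: measurableI.
pose f (p : L * H) : \bar R := (edist p.1 `^ (M - d) * ((g p.2 - g x) ^+ 2 * k p.1 p.2))%:E.
pose h (y : H) : \bar R := (`|g x - g y| ^+ 2 / enorm ((x : 'rV[R]_n) - y) `^ (d + 1))%:E.
have f0 p : (0 <= f p)%E.
  by rewrite lee_fin; apply: mulr_ge0 (powR_ge0 _ _) _; apply: mulr_ge0 (sqr_ge0 _) (kern_ge0 _ _ _).
have h0 y : (0 <= h y)%E by rewrite lee_fin divr_ge0 ?sqr_ge0 ?powR_ge0.
have mf : measurable_fun (S `*` G) f.
  apply: measurable_funTS; apply/measurable_EFinP; apply: measurable_funM.
    exact: (measurableT_comp (measurable_edist_powR (M - d)) measurable_fst).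
  apply: measurable_funM.
    apply: measurable_funX; apply: measurable_funB; last exact: measurable_cst.
    exact: (measurableT_comp mg measurable_snd).
  apply: (@measurable_kern_comp R n M _ _ setT (fun p : L * H => p.1 : 'rV[R]_n) (fun p : L * H => p.2 : 'rV[R]_n)) => i.
  - exact: (measurableT_comp (measurable_leb_coord i) measurable_fst).
  - exact: (measurableT_comp (measurable_haus_coord i) measurable_snd).
have mh : measurable_fun G h.
  have mpair : measurable_fun G (fun y : H => (x, y) : H * H) by apply: measurable_funTS; exact: pair1_measurable.
  apply: (measurable_comp _ _ (measurable_H_density mg) mpair); first exact: measurableX.
  by move=> _ [y Gy <-]; split.
have sS : sigma_finite_on mu S by exact: sigma_finite_on_leb.
have K0 : 0 <= trace_cst * (r ^+ n * r) by rewrite mulr_ge0 ?trace_cst_ge0// mulr_ge0 ?exprn_ge0 ?ltW.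
have inner y : G y -> (\int[mu]_(z in S) f (z, y) <= (trace_cst * (r ^+ n * r))%:E * h y)%E.
  move=> Gy; have [<-|xy] := eqVneq x y.
    rewrite integral0_eq; first by rewrite mule_ge0// lee_fin.
    by move=> z _; rewrite /f /= subrr expr0n/= mul0r mulr0.
  have fE (z : L) : f (z, y) = (((g y - g x) ^+ 2)%:E * (edist z `^ (M - d) * k z y)%:E)%E.
    exact: (congr1 EFin (mulrCA _ _ _)).
  under eq_integral do rewrite fE.
  have mk2 : measurable_fun S (fun z : L => (edist z `^ (M - d) * k z y)%:E).
    apply: measurable_funTS; apply/measurable_EFinP; apply: measurable_funM; last exact: measurable_leb_kern.
    exact: measurable_edist_powR.
  rewrite ge0_integralZl; [|exact: mS|exact: mk2| |by rewrite lee_fin sqr_ge0]; last first.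
    by move=> z _; rewrite lee_fin; apply: mulr_ge0 (powR_ge0 _ _) (kern_ge0 _ _ _).
  apply: le_trans (_ : (((g y - g x) ^+ 2)%:E * (trace_cst * (r ^+ n * r) / enorm (x - y) `^ (d + 1))%:E <= _)%E).
    by apply: lee_wpmul2l; [rewrite lee_fin sqr_ge0|exact: trace_kernel_le].
  by rewrite -!EFinM lee_fin real_normK ?num_real// -[leRHS]mulrCA -sqrrN opprB.
have ton := tonelli_le mS mG sS sG mf f0 K0 mh h0 inner.
have mI := measurable_integral_on mS mG sG mf f0.
have mv : measurable_fun S (fun z => (ext z - g x) ^+ 2).
  apply: measurable_funX; apply: measurable_funB; last exact: measurable_cst.
  apply: (measurable_funS mO); first by move=> z [].
  exact: (measurable_ext Gamma_neq0 Gamma_closed Gamma_AR mg).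
have v0 z : 0 <= (ext z - g x) ^+ 2 by exact: sqr_ge0.
have I0 z : (0 <= \int[sigma]_(y in G) f (z, y))%E by apply: integral_ge0 => y _; exact: f0.
have ci : 0 <= (@den_cst R n d C0)^-1 by rewrite invr_ge0 ltW.
have dev z : S z -> (((ext z - g x) ^+ 2)%:E <= ((@den_cst R n d C0)^-1)%:E * \int[sigma]_(y in G) f (z, y))%E.
  by move=> [nz _]; exact: ext_deviation_le.
apply: le_trans (@integral_le_scaled _ _ _ mu S mS _ _ _ mv v0 mI I0 ci dev) _.
rewrite [leRHS]EFinM; apply: lee_wpmul2l; first by rewrite lee_fin.
apply: le_trans ton _; rewrite [leRHS]EFinM; apply: lee_wpmul2l; first by rewrite lee_fin.
exact: leF.
Qed.

End extension_trace.

Lemma amgm_scaled (R : realFieldType) (t k s : R) : 0 <= t -> 0 <= k -> 0 < s ->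
  t * k <= t ^+ 2 / s + s * k * k.
Proof.
move=> t0 k0 s0; rewrite -(ler_pM2r s0).
have -> : (t ^+ 2 / s + s * k * k) * s = t ^+ 2 + (s * k) ^+ 2 by field; rewrite gt_eqF.
by have := sqr_ge0 (t - s * k); have := mulr_ge0 t0 (mulr_ge0 (ltW s0) k0); lra.
Qed.

(** * Extension of data of finite energy *)

Section extension_operator.
Context {R : realType} {n : nat} (d C0 : R) (Gamma : set 'rV[R]_n).
Hypothesis d_bounds : 0 < d < n%:R - 1.
Hypothesis Gamma_neq0 : Gamma !=set0.
Hypothesis Gamma_closed : closed Gamma.
Hypothesis C0_ge1 : 1 <= C0.
Hypothesis Gamma_AR : ahlfors_regular d C0 Gamma.
Local Notation L := (leb_space R n).
Local Notation H := (haus_space R n d).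
Local Notation mu := (leb R n).
Local Notation sigma := (haus n d).
Local Notation Omega := (~` Gamma : set L).
Local Notation G := (Gamma : set H).
Local Notation V := ('rV[R]_n -> R).
Local Notation edist := (Defs.edist Gamma).
Local Notation M := (@kexp R n d).
Local Notation k := (kern M).
Local Notation ext := (ext d Gamma).
Implicit Types (z y x : 'rV[R]_n) (t c r : R) (i : 'I_n) (g : V).

Let mO : measurable Omega. Proof. exact: measurable_Omega. Qed.
Let mG : measurable G. Proof. exact: measurable_Gamma. Qed.
Let sG : sigma_finite_on sigma G. Proof. exact: (sigma_finite_on_Gamma Gamma_neq0 Gamma_AR). Qed.
Let Gnull := Gamma_null d_bounds Gamma_neq0 Gamma_AR.
Let c0 : 0 < @den_cst R n d C0. Proof. exact: (@den_cst_gt0 R n d C0 C0_ge1). Qed.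

Definition H_density g x y : \bar R := (`|g x - g y| ^+ 2 / enorm (x - y) `^ (d + 1))%:E.

Lemma H_density_ge0 g x y : (0 <= H_density g x y)%E.
Proof. by rewrite lee_fin divr_ge0 ?sqr_ge0 ?powR_ge0. Qed.

(** The mean-square bound of order r^(n+1) on a ball of volume comparable with r^n, inserted in
    [mean_deviation_le] with lam = sqrt r, makes the deviation of the mean from g(x) of order sqrt
    r. *)
Lemma ext_trace_at z0 g x (F : R) : ~ Gamma z0 -> measurable_fun (setT : set H) g ->
  sigma.-integrable G (EFin \o (fun y => g y * k z0 y)) -> in_W d Gamma (ext g) -> Gamma x ->
  (\int[sigma]_(y in G) H_density g x y <= F%:E)%E ->
  ball_mean (ext g) x r @[r --> 0^'+] --> (g x)%:E.
Proof.
move=> nz0 mg ig0 We Gx leF.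
have F0 : 0 <= F.
  by rewrite -lee_fin; apply: le_trans leF; apply: integral_ge0 => y _; exact: H_density_ge0.
set u := ext g in We *.
have tc0 : 0 <= @trace_cst R n d by exact: (@trace_cst_ge0 R n d d_bounds).
have ci0 : 0 <= (@den_cst R n d C0)^-1 by rewrite invr_ge0 ltW.
pose K := (@den_cst R n d C0)^-1 * @trace_cst R n d * F / (2 / n.+1%:R) ^+ n.
have K0 : 0 <= K.
  apply: divr_ge0; last by rewrite exprn_ge0// divr_ge0.
  by apply: mulr_ge0 F0; exact: mulr_ge0.
have mu_u : measurable_fun (setT : set L) u.
  apply: (measurable_fun_null_setC mO); first by rewrite setCK.
  exact: (measurable_ext Gamma_neq0 Gamma_closed Gamma_AR mg).
have dev r : 0 < r -> `|bmean u x r - g x| <= (1 + K) * Num.sqrt r.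
  move=> r0; have s0 : 0 < Num.sqrt r by rewrite sqrtr_gt0.
  have [v E /andP[v1 _]] := leb_eball x r0.
  have cr0 : 0 < (2 / n.+1%:R) ^+ n * r ^+ n :> R by rewrite mulr_gt0 ?exprn_gt0 ?divr_gt0.
  have v1' : (2 / n.+1%:R) ^+ n * r ^+ n <= v by rewrite -exprMn mulrAC -mulrA.
  have v0 : 0 < v := lt_le_trans cr0 v1'.
  set B := (eball x r : set L).
  have mB : measurable B by apply: measurable_leb_open; exact: open_eball.
  have iB : mu.-integrable B (EFin \o u).
    apply: integrable_eball => // a b.
    exact: (integrable_W d_bounds Gamma_neq0 Gamma_closed Gamma_AR We).
  have msq : measurable_fun (setT : set L) (fun z => (u z - g x) ^+ 2).
    by apply: measurable_funX; apply: measurable_funB; [exact: mu_u|exact: measurable_cst].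
  pose Q := (@den_cst R n d C0)^-1 * (@trace_cst R n d * (r ^+ n * r) * F).
  have le : (\int[mu]_(z in B) ((u z - g x) ^+ 2)%:E <= Q%:E)%E.
    apply: le_trans (ext_mean_square_le d_bounds Gamma_neq0 Gamma_closed C0_ge1 Gamma_AR nz0 mg ig0 r0 Gx leF).
    have sq0 z : 0 <= (u z - g x) ^+ 2 by exact: sqr_ge0.
    rewrite (integral_split mu mB mO (measurable_funTS msq) sq0) setIC.
    have -> : (\int[mu]_(z in B `\` Omega) ((u z - g x) ^+ 2)%:E = 0)%E; last by rewrite adde0.
    apply: (@null_set_integral _ _ _ mu).
    - exact: measurableD.
    - by apply/measurable_EFinP; exact: measurable_funTS.
    - apply: (@leb_null_sub R n _ Gamma) => // z [_ nn].
      by apply: contrapT.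
  have := mean_deviation_le mB s0 v0 E iB le.
  rewrite -[v]/(fine v%:E) -E => H1; apply: le_trans H1 _; rewrite E /=.
  have Qv : Q / (Num.sqrt r * v) <= K * Num.sqrt r.
    apply: (@le_trans _ _ (Q / (Num.sqrt r * ((2 / n.+1%:R) ^+ n * r ^+ n)))).
      have inv_le (p q : R) : 0 < p -> p <= q -> q^-1 <= p^-1.
        by move=> p0 pq; rewrite lef_pV2 ?posrE// (lt_le_trans p0).
      apply: ler_wpM2l; last by apply: inv_le; [rewrite mulr_gt0|rewrite ler_pM2l].
      apply: mulr_ge0 ci0 _; apply: mulr_ge0 F0; apply: mulr_ge0 tc0 _.
      by rewrite mulr_ge0 ?exprn_ge0 ?(ltW r0).
    rewrite le_eqVlt; apply/orP; left; apply/eqP; rewrite /Q /K.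
    have {2}-> : r = Num.sqrt r ^+ 2 by rewrite sqr_sqrtr// ltW.
    by field; rewrite !gt_eqF ?exprn_gt0// ltr0n.
  have ks : 0 <= K * Num.sqrt r by exact: mulr_ge0 K0 (ltW s0).
  by lra.
under eq_fun do rewrite (ball_mean_W d_bounds Gamma_neq0 Gamma_closed Gamma_AR _ _ We).
apply: cvg_EFin; first exact: nearW.
rewrite /comp /=; apply/cvgrPdist_lt => e e0.
have K1 : 0 < 1 + K by rewrite ltr_pwDl.
have e1 : 0 < e / (1 + K) by rewrite divr_gt0.
have e2 : 0 < (e / (1 + K)) ^+ 2 by exact: exprn_gt0.
near=> r.
have r0 : 0 < r by near: r; exact: nbhs_right_gt.
rewrite distrC; apply: le_lt_trans (dev r r0) _.
rewrite mulrC -ltr_pdivlMr//.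
rewrite -(ltr_pXn2r (n := 2)) ?nnegrE ?sqrtr_ge0 ?(ltW e1)// sqr_sqrtr ?(ltW r0)//.
Unshelve. all: by end_near. Qed.

Lemma Omega_neq0 : exists z0, ~ Gamma z0.
Proof.
apply/not_existsP => H1; have [y0 _] := Gamma_neq0.
have sub : cube y0 1 `<=` Gamma by move=> z _; apply: contrapT; exact: H1.
have := leb_null_sub Gnull sub; rewrite -[leb_outer _]/(mu (cube y0 1)) leb_cube//.
by move=> /eqP; rewrite eqe; apply/negP; rewrite gt_eqF// exprn_gt0.
Qed.

(** One point x0 with a finite inner integral suffices: |g| is at most |g(x0) - g| + |g(x0)|, and
    Young's inequality with s = |x0 - y|^(d+1) bounds |g(x0) - g| k by the density of [H_energy]
    plus s k^2, where s k is bounded. *)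
Lemma integrable_kern_of_density z0 g x0 : ~ Gamma z0 -> measurable_fun (setT : set H) g -> Gamma x0 ->
  (\int[sigma]_(y in G) H_density g x0 y < +oo)%E ->
  sigma.-integrable G (EFin \o (fun y => g y * k z0 y)).
Proof.
move=> nz0 mg Gx0 fin; have e0 := edist_gt0 Gamma_neq0 Gamma_closed nz0.
have ik := integrable_kern d_bounds Gamma_neq0 Gamma_closed C0_ge1 Gamma_AR nz0.
pose q y : R := `|g x0 - g y| ^+ 2 / enorm (x0 - y) `^ (d + 1).
have q0 y : 0 <= q y by rewrite divr_ge0 ?sqr_ge0 ?powR_ge0.
have mq : measurable_fun G q.
  apply/measurable_EFinP; have mpair : measurable_fun G (fun y : H => (x0, y) : H * H).
    by apply: measurable_funTS; exact: pair1_measurable.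
  apply: (measurable_comp _ _ (measurable_H_density mg) mpair); first exact: measurableX.
  by move=> _ [y Gy <-]; split.
have iq := @integrable_of_bound _ _ _ sigma G q _ mq q0 (lexx _) fin.
have md : 0 < d + 1 by have /andP[? _] := d_bounds; lra.
pose a : R := 1 + enorm (x0 - z0) / edist z0.
have a0 : 0 < a by rewrite ltr_pwDl// divr_ge0 ?enorm_ge0// ltW.
pose b : R := a `^ (d + 1) * edist z0 `^ (- n%:R).
have dom := integrableRD mG (integrableRD mG iq (integrableRZ b mG ik)) (integrableRZ `|g x0| mG ik).
have mgk : measurable_fun G (fun y => g y * k z0 y).
  by apply: measurable_funTS; apply: measurable_funM; [exact: mg|exact: measurable_kern].
apply: (integrable_le mG mgk dom) => y Gy; have ey := edist_le z0 Gy; have p0 := lt_le_trans e0 ey.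
have k0 := kern_ge0 M z0 y; rewrite normrM (ger0_norm k0).
have tri : `|g y| <= `|g x0 - g y| + `|g x0|.
  by have := ler_normB (g x0) (g x0 - g y); rewrite opprB addrC subrK addrC.
apply: le_trans (ler_wpM2r k0 tri) _; rewrite mulrDl lerD2r.
have [<-|xy] := eqVneq x0 y.
  by rewrite subrr normr0 mul0r addr_ge0 ?q0// mulr_ge0 ?kern_ge0// mulr_ge0 ?powR_ge0.
have r0 : 0 < enorm (x0 - y).
  rewrite lt_def enorm_ge0 andbT; apply/eqP => /enorm_eq0/eqP; rewrite subr_eq0; exact/negP.
set s := enorm (x0 - y) `^ (d + 1); have s0 : 0 < s by exact: powR_gt0.
(* On Gamma |x0 - y| is at most a |z0 - y|, and d + 1 - M = -n leaves a power of |z0 - y| >=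
   dist(z0) with negative exponent. *)
have sk : s * k z0 y <= b.
  have le1 : enorm (x0 - y) <= a * enorm (z0 - y).
    have := enormB x0 z0 y; rewrite /a mulrDl mul1r => h; apply: le_trans h _; rewrite addrC lerD2l.
    by rewrite -mulrA ler_peMr ?enorm_ge0// mulrC ler_pdivlMr// mul1r.
  have le2 : s <= a `^ (d + 1) * enorm (z0 - y) `^ (d + 1).
    rewrite -powRM ?(ltW a0) ?enorm_ge0//; apply: ge0_ler_powR; rewrite ?nnegrE ?enorm_ge0 ?(ltW md)//.
    by rewrite mulr_ge0 ?(ltW a0) ?enorm_ge0.
  apply: le_trans (ler_wpM2r k0 le2) _; rewrite -mulrA; apply: ler_wpM2l (powR_ge0 _ _) _ _ _.
  rewrite /kern -powRD; last by apply/implyP => _; rewrite gt_eqF.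
  have -> : d + 1 - M = - n%:R by rewrite /kexp; lra.
  exact: powR_anti.
apply: le_trans (amgm_scaled (normr_ge0 _) k0 s0) _.
by rewrite lerD2l; exact: (ler_wpM2r k0 sk).
Qed.

Definition ext_cst : R := @energy_cst R n d C0 * @pair_cst R n d.

Lemma ext_cst_ge0 : 0 <= ext_cst.
Proof. by rewrite mulr_ge0 ?energy_cst_ge0// (pair_cst_ge0 d_bounds). Qed.

Lemma extension_exists g : in_H d Gamma g -> exists u, [/\ in_W d Gamma u, has_trace d Gamma u g &
  (W_energy d Gamma u <= ext_cst%:E * H_energy d Gamma g)%E].
Proof.
(* [g] is measurable on Gamma only; its extension by 0 is measurable on the whole space and has the
   same energy. *)
move=> [mgG Hfin]; pose g' : V := patch (fun=> 0) Gamma g.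
have g'E x : Gamma x -> g' x = g x by move=> Gx; rewrite /g' patchE mem_set.
have mg : measurable_fun (setT : set H) g'.
  by apply/(@measurable_restrict _ _ H _ G setT g mG measurableT); rewrite setTI.
have HE : H_energy d Gamma g' = H_energy d Gamma g.
  apply: eq_integral => x; rewrite inE => Gx; apply: eq_integral => y; rewrite inE => Gy.
  by rewrite !g'E.
have mI : measurable_fun G (fun x => \int[sigma]_(y in G) H_density g' x y)%E.
  exact: (measurable_integral_on mG mG sG (measurable_H_density mg) (fun p => H_density_ge0 g' p.1 p.2)).
have I0 x : (0 <= \int[sigma]_(y in G) H_density g' x y)%E.
  by apply: integral_ge0 => y _; exact: H_density_ge0.
have fin : (\int[sigma]_(x in G) \int[sigma]_(y in G) H_density g' x y < +oo)%E.
  by rewrite -[X in (X < _)%E]/(H_energy d Gamma g') HE.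
have N0 := ae_lt_pinfty mG mI I0 fin; set N := (X in sigma X = _) in N0.
have [z0 nz0] := Omega_neq0; have [y0 Gy0] := Gamma_neq0.
(* Lower regularity gives Gamma positive measure, so it cannot be contained in the null set where
   the inner integral is infinite. *)
have [x0 [Gx0 nN]] : exists x0, Gamma x0 /\ ~ N x0.
  apply: contrapT => no; have sub : Gamma `&` eball y0 1 `<=` N.
    by move=> x [Gx _]; apply: contrapT => nN; apply: no; exists x.
  have /andP[lo _] := Gamma_AR Gy0 ltr01.
  have := le_trans lo (haus_le d sub); rewrite N0 powR1 mulr1 lee_fin leNgt invr_gt0.
  by rewrite (lt_le_trans ltr01 C0_ge1).
have finx x : Gamma x -> ~ N x -> (\int[sigma]_(y in G) H_density g' x y < +oo)%E.
  by move=> Gx nNx; rewrite ltey; apply/eqP => oo; apply: nNx; split.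
have ig := integrable_kern_of_density nz0 mg Gx0 (finx x0 Gx0 nN).
have fin' : (H_energy d Gamma g' < +oo)%E by rewrite HE.
have [We le] := ext_energy_le d_bounds Gamma_neq0 Gamma_closed C0_ge1 Gamma_AR nz0 mg ig fin'.
exists (ext g'); split; [exact: We| |by rewrite -HE].
exists N; split; [exact: (haus_null_measurable N0)|exact: N0|].
move=> x H1; apply: contrapT => nNx; apply: H1 => Gx; rewrite -(g'E x Gx).
have fx := finx x Gx nNx; have fxf : (\int[sigma]_(y in G) H_density g' x y)%E \is a fin_num.
  by rewrite ge0_fin_numE.
by apply: (@ext_trace_at z0 g' x (fine (\int[sigma]_(y in G) H_density g' x y)%E)) => //; rewrite fineK.
Qed.

End extension_operator.

(** * The boundary value problem *)

Lemma quadratic_bound (R : realFieldType) (x D E C : R) : 0 <= x -> 0 <= D -> 0 <= E -> 0 < C ->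
  C^-1 * x ^+ 2 <= D * x + C * E * x -> x <= C * (D + C * E).
Proof.
move=> x0 D0 E0 C0 H; have [->|xn] := eqVneq x 0.
  by rewrite mulr_ge0 ?(ltW C0)// addr_ge0// mulr_ge0// ltW.
have xp : 0 < x by rewrite lt_def xn.
by move: H; rewrite -mulrDl expr2 mulrA ler_pM2r// ler_pdivrMl.
Qed.

Section boundary_value_problem.
Context {R : realType} {n : nat} (d C0 C1 : R) (Gamma : set 'rV[R]_n) (A : 'rV[R]_n -> 'M[R]_n).
Hypothesis d_bounds : 0 < d < n%:R - 1.
Hypothesis Gamma_neq0 : Gamma !=set0.
Hypothesis Gamma_closed : closed Gamma.
Hypothesis C0_ge1 : 1 <= C0.
Hypothesis Gamma_AR : ahlfors_regular d C0 Gamma.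
Hypothesis A_meas : forall i j : 'I_n,
  measurable_fun (~` Gamma : set (leb_space R n)) (fun z => A z i j).
Hypothesis C1_ge1 : 1 <= C1.
Hypothesis A_elliptic : elliptic d C1 Gamma A.
Local Notation L := (leb_space R n).
Local Notation mu := (leb R n).
Local Notation Omega := (~` Gamma : set L).
Local Notation V := ('rV[R]_n -> R).
Local Notation W := (in_W d Gamma).
Local Notation W0 := (in_W0 d Gamma).
Local Notation ip := (wip d Gamma).
Local Notation b := (eform Gamma A).
Local Notation nrm := (inorm ip).
Implicit Types (u v e g : V) (a : R) (f : V -> R).

Let mO : measurable Omega. Proof. exact: measurable_Omega. Qed.
Let C1_ge0 : 0 <= C1. Proof. exact: le_trans C1_ge1. Qed.
Let C1_gt0 : 0 < C1. Proof. exact: lt_le_trans C1_ge1. Qed.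

Let A_bnd z : Omega z -> forall xi zeta : 'rV[R]_n,
  `|dotp (mxact (A z) xi) zeta| <= C1 * weight d Gamma z * enorm xi * enorm zeta.
Proof. by move=> /A_elliptic[]. Qed.

Let W00 : W 0 := (in_W0_fun d Gamma_neq0 Gamma_closed).1.
Let Wlin := @in_W_lin R n d Gamma Gamma_neq0 Gamma_closed.
Let W0lin := @in_W0_lin R n d C0 Gamma d_bounds Gamma_neq0 Gamma_closed Gamma_AR.
Let Wip := wip_semi_inner d Gamma_neq0 Gamma_closed.
Let b_linl := @eform_linl R n d Gamma Gamma_neq0 Gamma_closed A C1 A_meas C1_ge0 A_bnd.
Let b_linr := @eform_linr R n d Gamma Gamma_neq0 Gamma_closed A C1 A_meas C1_ge0 A_bnd.
Let b_le := @eform_le R n d Gamma Gamma_neq0 Gamma_closed A C1 A_meas C1_ge0 A_bnd.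
Let b_int := @integrable_form_density R n d Gamma Gamma_neq0 Gamma_closed A C1 A_meas C1_ge0 A_bnd.
Let normE u : W u -> nrm u = W_norm d Gamma u := @inorm_W R n d Gamma Gamma_neq0 Gamma_closed u.

Let W0W u : W0 u -> W u. Proof. by case. Qed.

Lemma eform_coercive u : W u -> C1^-1 * ip u u <= b u u.
Proof.
move=> Wu; have iE := integrable_energy Gamma_neq0 Wu.
have -> : ip u u = \int[mu]_(z in Omega) energy_density d Gamma u z.
  exact: (esym (congr1 fine (wip_energy Gamma_neq0 Gamma_closed Wu))).
rewrite -(RintegralZl _ mO iE); apply: le_trans (ler_norm _) _.
apply: (Rint_norm_le mO (integrableRZ _ mO iE) (b_int Wu Wu)) => z Oz.
have [_ H] := A_elliptic Oz.
rewrite ger0_norm; last by rewrite mulr_ge0 ?invr_ge0// mulr_ge0 ?sqr_ge0 ?weight_ge0.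
by have := H (wgrad (~` Gamma) u z); rewrite /energy_density /form_density -mulrA [weight _ _ _ * _]mulrC.
Qed.

Lemma weak_solution_eform u f : W u -> weak_solution d Gamma A u f <-> forall v, W0 v -> b u v = f v.
Proof.
move=> Wu; have E v : W0 v -> (\int[mu]_(z in Omega) (form_density Gamma A u v z)%:E = (b u v)%:E)%E.
  by move=> /W0W Wv; rewrite /eform /Rintegral fineK//; exact: (integrable_fin_num mO (b_int Wu Wv)).
split=> H v W0v; have := H v W0v; rewrite -?E//; last by move=> <-; exact: E.
by rewrite -[X in (X = _ -> _)%E]/(\int[mu]_(z in Omega) (form_density Gamma A u v z)%:E)%E E// => -[].
Qed.

Section dual.
Variable f : V -> R.
Hypothesis Wf : in_Wdual d Gamma f.

Let f_lin a u v : W0 u -> W0 v -> f (a *: u + v) = a * f u + f v.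
Proof. by move=> W0u W0v; exact: Wf.1. Qed.

Let f0 : f 0 = 0.
Proof.
have W000 := in_W0_0 d Gamma_neq0 Gamma_closed.
by have := f_lin 1 W000 W000; rewrite scaler0 addr0 mul1r; lra.
Qed.

Let fZ a u : W0 u -> f (a *: u) = a * f u.
Proof.
move=> W0u; have := f_lin a W0u (in_W0_0 d Gamma_neq0 Gamma_closed).
by rewrite f0 !addr0.
Qed.

Let sphere_le v : W0 v -> W_norm d Gamma v = 1 -> f v <= Wdual_norm d Gamma f.
Proof.
move=> W0v v1; have [_ [M HM]] := Wf.
apply: ub_le_sup; last by exists v.
by exists M => _ [phi [W0p p1] <-]; apply: le_trans (ler_norm _) _; have := HM phi W0p; rewrite p1 mulr1.
Qed.

Let normZ a u : W u -> W_norm d Gamma (a *: u) = `|a| * W_norm d Gamma u.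
Proof.
move=> Wu; have Wau : W (a *: u) := PZ W00 Wlin a Wu.
rewrite -(normE Wu) -(normE Wau) /inorm (ipZl W00 Wip a Wu Wau) (ipZr W00 Wlin Wip a Wu Wu) mulrA -expr2 sqrtrM ?sqr_ge0//.
by rewrite sqrtr_sqr.
Qed.

Let sphere_abs v : W0 v -> W_norm d Gamma v = 1 -> `|f v| <= Wdual_norm d Gamma f.
Proof.
move=> W0v v1; rewrite ler_norml lerNl; apply/andP; split; last exact: sphere_le.
have W0nv : W0 (-1 *: v) by exact: (PZ (in_W0_0 d Gamma_neq0 Gamma_closed) W0lin).
have -> : - f v = f (-1 *: v) by rewrite (fZ (-1) W0v) mulN1r.
by apply: (sphere_le W0nv); rewrite (normZ (-1) (W0W W0v)) normrN1 mul1r.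
Qed.

Lemma Wdual_norm_ge0 : 0 <= Wdual_norm d Gamma f.
Proof.
have [[phi [W0p p1]]|no] := pselect (exists phi, W0 phi /\ W_norm d Gamma phi = 1).
  exact: le_trans (normr_ge0 _) (sphere_abs W0p p1).
(* If no element of W_0 has norm 1, the supremum is taken over the empty set and has the default
   value 0. *)
rewrite /Wdual_norm; have -> : [set phi | W0 phi /\ W_norm d Gamma phi = 1] = set0.
  by apply/seteqP; split => // phi H; apply: no; exists phi.
by rewrite image_set0 sup0.
Qed.

(** Homogeneity reduces to the unit sphere. Elements of norm 0 cannot be normalized; on them
    boundedness of the functional gives the value 0. *)
Lemma Wdual_norm_le v : W0 v -> `|f v| <= Wdual_norm d Gamma f * W_norm d Gamma v.
Proof.
move=> W0v; have Wv := W0W W0v; have [v0|v0] := leP (W_norm d Gamma v) 0.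
  have v00 : W_norm d Gamma v = 0 by apply/eqP; rewrite eq_le v0 W_norm_ge0.
  by have [_ [M HM]] := Wf; have := HM v W0v; rewrite v00 !mulr0.
set t := W_norm d Gamma v in v0 *.
have ti : 0 <= t^-1 by rewrite invr_ge0 ltW.
have W0s : W0 (t^-1 *: v) by exact: (PZ (in_W0_0 d Gamma_neq0 Gamma_closed) W0lin).
have s1 : W_norm d Gamma (t^-1 *: v) = 1.
  by rewrite (normZ t^-1 Wv) -/t (ger0_norm ti) mulVf// gt_eqF.
have := sphere_abs W0s s1; rewrite (fZ t^-1 W0v) normrM (ger0_norm ti).
by rewrite mulrC ler_pdivrMr.
Qed.

End dual.

Lemma existence f g : in_Wdual d Gamma f -> in_H d Gamma g -> exists u, is_solution d Gamma A f g u.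
Proof.
move=> Wf Hg; have [E [WE trE _]] := extension_exists d_bounds Gamma_neq0 Gamma_closed C0_ge1 Gamma_AR Hg.
have W000 := in_W0_0 d Gamma_neq0 Gamma_closed.
have ip0W0 : semi_inner W0 ip.
  have [l s p] := Wip; split=> [a u v w hu hv hw|u v hu hv|u hu].
  - by apply: l; exact: W0W.
  - by apply: s; exact: W0W.
  - by apply: p; exact: W0W.
have F_lin a u v : W0 u -> W0 v -> f (a *: u + v) - b E (a *: u + v) = a * (f u - b E u) + (f v - b E v).
  move=> W0u W0v; rewrite (b_linr a (W0W W0u) (W0W W0v) WE).
  have -> : f (a *: u + v) = a * f u + f v by exact: (Wf.1 a u v W0u W0v).
  have shuffle (x p q r t : R) : x * p + q - (x * r + t) = x * (p - r) + (q - t) by ring.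
  exact: shuffle.
have F_bnd v : W0 v -> `|f v - b E v| <= (Wdual_norm d Gamma f + C1 * nrm E) * nrm v.
  move=> W0v; have Wv := W0W W0v; apply: le_trans (ler_normB _ _) _; rewrite mulrDl; apply: lerD.
    by rewrite (normE Wv); exact: (Wdual_norm_le Wf W0v).
  exact: (b_le WE Wv).
have b_l a u v w : W0 u -> W0 v -> W0 w -> b (a *: u + v) w = a * b u w + b v w.
  by move=> hu hv hw; apply: b_linl; exact: W0W.
have b_r a u v w : W0 u -> W0 v -> W0 w -> b w (a *: u + v) = a * b w u + b w v.
  by move=> hu hv hw; apply: b_linr; exact: W0W.
have b_b u v : W0 u -> W0 v -> `|b u v| <= C1 * nrm u * nrm v.
  by move=> hu hv; apply: b_le; exact: W0W.
have c0 : 0 < C1^-1 by rewrite invr_gt0.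
have coe u : W0 u -> C1^-1 * ip u u <= b u u by move=> hu; apply: eform_coercive; exact: W0W.
have [v W0v Hv] := lax_milgram W000 W0lin ip0W0 (W0_complete d_bounds Gamma_neq0 Gamma_closed C0_ge1 Gamma_AR)
  b_l b_r b_b C1_ge0 c0 coe F_lin F_bnd.
have Wv := W0W W0v; have Wu : W (1 *: E + v) by exact: Wlin.
exists (1 *: E + v); split; first exact: Wu.
  by apply/(weak_solution_eform f Wu) => e W0e; rewrite (b_linl 1 WE Wv (W0W W0e)) mul1r (Hv e W0e) addrC subrK.
have := has_trace_lin d_bounds Gamma_neq0 Gamma_closed Gamma_AR 1 WE Wv trE W0v.2.
by have -> : 1 *: g + cst 0 = g :> V by apply/funext => z; rewrite /= scale1r addr0.
Qed.

Lemma difference_W0 u v g : W u -> W v -> has_trace d Gamma u g -> has_trace d Gamma v g -> W0 (-1 *: u + v).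
Proof.
move=> Wu Wv tu tv; split; first exact: Wlin.
have := has_trace_lin d_bounds Gamma_neq0 Gamma_closed Gamma_AR (-1) Wu Wv tu tv.
by have -> : -1 *: g + g = cst 0 :> V by rewrite scaleN1r addNr.
Qed.

(** The difference lies in W_0 and, tested against itself, has energy 0 by coercivity.
    [W0_integral_bound] is then available with every t > 0 and makes its L^1 norm on each cube
    vanish. *)
Lemma uniqueness f g u u' : is_solution d Gamma A f g u -> is_solution d Gamma A f g u' ->
  {ae mu, forall z : 'rV[R]_n, (~` Gamma) z -> u' z = u z}.
Proof.
move=> [Wu su tu] [Wu' su' tu']; set e : V := -1 *: u + u'.
have W0e : W0 e by exact: difference_W0 tu tu'.
have We := W0W W0e.
have bee : b e e = 0.
  have s1 := (weak_solution_eform f Wu).1 su; have s2 := (weak_solution_eform f Wu').1 su'.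
  by rewrite {1}/e (b_linl (-1) Wu Wu' We) (s1 e W0e) (s2 e W0e) mulN1r addNr.
have e0 : W_energy d Gamma e = 0%E.
  rewrite (wip_energy Gamma_neq0 Gamma_closed We); congr EFin; apply/eqP; rewrite eq_le.
  have [_ _ p] := Wip; rewrite p// andbT.
  by have := eform_coercive We; rewrite bee pmulr_rle0// invr_gt0.
have [y0 _] := Gamma_neq0.
have ae_cube (m : nat) : {ae mu, forall z : L, cube y0 m.+1%:R z -> e z = 0}.
  have mc : measurable (cube y0 m.+1%:R : set L) by exact: measurable_leb_cube.
  have ie : mu.-integrable (cube y0 m.+1%:R : set L) (EFin \o e).
    exact: (integrable_W d_bounds Gamma_neq0 Gamma_closed Gamma_AR We).
  apply: (Rint_ae0 mc ie).
  have [C C_ge0 HC] := W0_integral_bound d_bounds Gamma_neq0 Gamma_closed C0_ge1 Gamma_AR y0 m.+1%:R.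
  apply/ler_addgt0Pl => eps eps0; rewrite addr0.
  (* This t gives C t <= eps; the summand 1 covers the case C = 0. *)
  have t0 : 0 < eps / (C + 1) by rewrite divr_gt0// ltr_pwDr.
  apply: le_trans (HC e _ W0e t0 _) _; first by rewrite e0 lee_fin sqr_ge0.
  by rewrite mulrCA ler_piMr ?(ltW eps0)// ler_pdivrMr ?mul1r ?lerDl// ltr_pwDr.
have := ae_foralln ae_cube; apply: filterS => z H _.
have zc : cube y0 (Num.bound (enorm (z - y0))).+1%:R z.
  apply: eball_sub_cube; rewrite /eball/=; apply: lt_le_trans (archi_boundP (enorm_ge0 _)) _.
  by rewrite ler_nat.
have : - 1 * u z + u' z = 0 by exact: (H _ zc).
by move=> h; lra.
Qed.

(** [E] is any element of W with the same trace, so that u - E lies in W_0 and is an admissible test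
    function. Coercivity bounds its norm by C1 times the dual norm of f plus C1^2 times the norm of
    [E]. *)
Lemma energy_estimate f g u E : in_Wdual d Gamma f -> is_solution d Gamma A f g u -> W E ->
  has_trace d Gamma E g ->
  W_norm d Gamma u <= C1 * Wdual_norm d Gamma f + (C1 ^+ 2 + 1) * W_norm d Gamma E.
Proof.
move=> Wf [Wu su tu] WE tE; set v : V := -1 *: E + u.
have W0v : W0 v by exact: difference_W0 tE tu.
have Wv := W0W W0v; have vn := inorm_ge0 ip v; have En := inorm_ge0 ip E.
have Dn := Wdual_norm_ge0 Wf.
have bv : b v v = f v - b E v.
  by rewrite {1}/v (b_linl (-1) WE Wu Wv) ((weak_solution_eform f Wu).1 su v W0v) mulN1r addrC.
have coe := eform_coercive Wv; rewrite bv -(inorm_sqr Wip Wv) in coe.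
have f1 := Wdual_norm_le Wf W0v; rewrite -(normE Wv) in f1.
have f2 := b_le WE Wv.
have key : nrm v <= C1 * (Wdual_norm d Gamma f + C1 * nrm E).
  apply: (quadratic_bound vn Dn En C1_gt0).
  by apply: le_trans coe _; apply: le_trans (ler_norm _) _; apply: le_trans (ler_normB _ _) _; exact: lerD.
have -> : W_norm d Gamma u = nrm (v + E).
  by rewrite -(normE Wu); congr inorm; rewrite /v scaleN1r addrAC addNr add0r.
rewrite -(normE WE); apply: le_trans (inormD W00 Wlin Wip Wv WE) _.
by rewrite [(C1 ^+ 2 + 1) * _]mulrDl mul1r addrA lerD2r; apply: le_trans key _; rewrite mulrDr mulrA -expr2.
Qed.

(** The extension of g has norm at most sqrt K times the norm of g in H, where K depends on n, d and
    C0 only. Used as [E] in the energy estimate, it yields a constant that depends on the matrix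
    only through C1. *)
Lemma stability : exists C : R, 0 < C /\ forall f g u, in_Wdual d Gamma f -> in_H d Gamma g ->
  is_solution d Gamma A f g u -> W_norm d Gamma u <= C * (H_norm d Gamma g + Wdual_norm d Gamma f).
Proof.
pose K : R := @ext_cst R n d C0; have K0 : 0 <= K by exact: (@ext_cst_ge0 R n d C0 d_bounds).
pose s := (C1 ^+ 2 + 1) * Num.sqrt K.
have s0 : 0 <= s by rewrite mulr_ge0 ?sqrtr_ge0// addr_ge0 ?sqr_ge0.
exists (C1 + s); split; first by rewrite ltr_wpDr.
move=> f g u Wf Hg su.
have [E [WE tE le]] := extension_exists d_bounds Gamma_neq0 Gamma_closed C0_ge1 Gamma_AR Hg.
have Hn : 0 <= H_norm d Gamma g by exact: sqrtr_ge0.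
have Dn := Wdual_norm_ge0 Wf.
have NE : W_norm d Gamma E <= Num.sqrt K * H_norm d Gamma g.
  have H0 : (0 <= H_energy d Gamma g)%E.
    by apply: integral_ge0 => x _; apply: integral_ge0 => y _; exact: H_density_ge0.
  have Hf : H_energy d Gamma g \is a fin_num by rewrite ge0_fin_numE//; case: Hg.
  rewrite /W_norm /H_norm -sqrtrM//; apply: ler_wsqrtr.
  rewrite -lee_fin EFinM (fineK Hf) fineK//.
  by rewrite (wip_energy Gamma_neq0 Gamma_closed WE).
apply: le_trans (energy_estimate Wf su WE tE) _.
have e1 : (C1 ^+ 2 + 1) * W_norm d Gamma E <= s * H_norm d Gamma g.
  by rewrite -mulrA; apply: ler_wpM2l => //; rewrite addr_ge0 ?sqr_ge0.
have e2 : 0 <= C1 * H_norm d Gamma g by rewrite mulr_ge0.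
have e3 : 0 <= s * Wdual_norm d Gamma f by rewrite mulr_ge0.
by rewrite mulrDr !mulrDl; lra.
Qed.

End boundary_value_problem.

Unset Implicit Arguments.

Theorem lemma9p1 (R : realType) (n : nat) (n_ge2 : (2 <= n)%N)
    (d : R) (d_bounds : 0 < d < n%:R - 1)
    (Gamma : set 'rV[R]_n) (Gamma_neq0 : Gamma !=set0)
    (Gamma_closed : closed Gamma)
    (C0 : R) (C0_ge1 : 1 <= C0) (Gamma_AR : ahlfors_regular d C0 Gamma)
    (A : 'rV[R]_n -> 'M[R]_n)
    (A_meas : forall i j : 'I_n,
       measurable_fun (~` Gamma : set (leb_space R n)) (fun z => A z i j))
    (C1 : R) (C1_ge1 : 1 <= C1) (A_elliptic : elliptic d C1 Gamma A) :
  (forall (f : ('rV[R]_n -> R) -> R) (g : 'rV[R]_n -> R),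
     in_Wdual d Gamma f -> in_H d Gamma g ->
     exists u : 'rV[R]_n -> R, is_solution d Gamma A f g u /\
       forall u' : 'rV[R]_n -> R, is_solution d Gamma A f g u' ->
         {ae leb R n, forall z : 'rV[R]_n, (~` Gamma) z -> u' z = u z}) /\
  (exists C : R, 0 < C /\
     forall (f : ('rV[R]_n -> R) -> R) (g u : 'rV[R]_n -> R),
       in_Wdual d Gamma f -> in_H d Gamma g -> is_solution d Gamma A f g u ->
       W_norm d Gamma u <= C * (H_norm d Gamma g + Wdual_norm d Gamma f)).
Proof.
split; last exact: (stability d_bounds Gamma_neq0 Gamma_closed C0_ge1 Gamma_AR A_meas C1_ge1 A_elliptic).
move=> f g Wf Hg.
have [u su] := existence d_bounds Gamma_neq0 Gamma_closed C0_ge1 Gamma_AR A_meas C1_ge1 A_elliptic Wf Hg.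
exists u; split; first exact: su.
move=> u' su'.
exact: (uniqueness d_bounds Gamma_neq0 Gamma_closed C0_ge1 Gamma_AR A_meas C1_ge1 A_elliptic su su').
Qed.
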